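(* Let $m>1$ be an integer, let $c_1<c_2$ be real analytic functions on $\mathbb{R}$ such that the $c_1<c_2$-zero-set $(c_1,c_2,D_{c_1,c_2},X_{m,c_1,c_2})$ is of SAB-at-Infinity-in-Top, and suppose that there are $a_1,a_2\in\mathbb{R}$ such that $c_1(x)$ and $c_2(x)$ both converge to $a_1$ as $x\to-\infty$ and both converge to $a_2$ as $x\to+\infty$. Write $\pi:=\pi_{m+1,1}|_{X_{m,c_1,c_2}}$, $p_{\pm}:=(0,\dots,0,\pm1)\in S^m$, and let $f=f_{S^m,(c_1,c_2,D_{c_1,c_2},X_{m,c_1,c_2})}:S^m\to\mathbb{R}$ be the canonical compactification of $\pi$. Suppose that $\mathrm{GDNF}(R_{\pi},q_{\pi}(S(\pi)),\bar{\pi})$ is isomorphic to one of the following: (i) a $1$-dimensional connected cell complex with exactly one vertex and exactly one edge, whose closure is homeomorphic to $\{t\in\mathbb{R}\mid t\ge0\}$; (ii) a $1$-dimensional connected cell complex with exactly three vertices and exactly two edges, whose closures are homeomorphic to $D^1$ and which are both oriented as edges departing from one vertex; (iii) a $1$-dimensional connected cell complex with exactly three vertices and exactly two edges, whose closures are homeomorphic to $D^1$ and which are both oriented as edges entering one vertex; (iv) a $1$-dimensional connected cell complex with exactly three vertices and exactly two edges, whose closures are homeomorphic to $D^1$ and which are oriented as an edge departing from one vertex and an edge entering that same vertex, respectively. Then $$\mathrm{GDNF}\Big(R_f,\ q_f\big(S(f|_{S^m-\{p_+,p_-\}})\big)\cup q_f(\{p_+,p_-\}),\ \bar f\Big)$$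 is isomorphic to $\mathrm{GDNF}(R_{\pi},q_{\pi}(S(\pi)),\bar{\pi})$.
   Context: **Reeb spaces.** For a continuous function $c:X\to\mathbb{R}$ on a topological space, $x_1\sim_c x_2$ iff $x_1,x_2$ lie in the same connected component of a level set $c^{-1}(y)$. The Reeb space is the quotient space $R_c:=X/{\sim_c}$, $q_c:X\to R_c$ is the quotient map, and $\bar c:R_c\to\mathbb{R}$ is the unique continuous function with $c=\bar c\circ q_c$. For a smooth function $c$ on a smooth manifold, $S(c)$ is the set of its critical points. $\pi_{k,k_1}:\mathbb{R}^k\to\mathbb{R}^{k_1}$ is the projection to the first $k_1$ coordinates. $D^j$ is the closed unit disk in $\mathbb{R}^j$ and $S^{j-1}$ its boundary sphere; $D^0$ is a point, $S^{-1}=\emptyset$. **Zero-sets.** For real analytic $c_1<c_2$ on $\mathbb{R}$ and an integer $m>1$, put $D_{c_1,c_2}:=\{(x_1,x_2)\in\mathbb{R}^2\mid c_1(x_2)<x_1<c_2(x_2)\}$ and $$X_{m,c_1,c_2}:=\Big\{(x_1,x_2,(y_j)_{j=1}^{m-1})\in\overline{D_{c_1,c_2}}\times\mathbb{R}^{m-1}\ \Big|\ (x_1-c_1(x_2))(c_2(x_2)-x_1)-\sum_{j=1}^{m-1}y_j^2=0\Big\}\subset\mathbb{R}^{m+1},$$ an $m$-dimensional smooth submanifold of $\mathbb{R}^{m+1}$ without boundary. The quadruple $(c_1,c_2,D_{c_1,c_2},X_{m,c_1,c_2})$ is called the $c_1<c_2$-zero-set. It is of *SAB-at-Infinity-in-Top*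 if, at each of the two infinities (as $x\to-\infty$, and as $x\to+\infty$), one of the following holds (possibly a different one at each infinity): $c_1(x)$ and $c_2(x)$ converge to the same real number; both diverge to $-\infty$; both diverge to $+\infty$. In that case $(R_\pi,q_\pi(S(\pi)),\bar\pi)$, with $\pi=\pi_{m+1,1}|_{X_{m,c_1,c_2}}$, is a pre-digraph in the sense below. **Canonical compactification.** Suppose $c_1,c_2$ both converge to $a_1\in\mathbb{R}$ at $-\infty$ and both converge to $a_2\in\mathbb{R}$ at $+\infty$. There is a diffeomorphism $\phi:S^m-\{p_+,p_-\}\to X_{m,c_1,c_2}$, where $p_\pm=(0,\dots,0,\pm1)$, chosen so that the $x_2$-coordinate of $\phi(p)$ tends to $-\infty$ as $p\to p_-$ and to $+\infty$ as $p\to p_+$. The function $f=f_{S^m,(c_1,c_2,D_{c_1,c_2},X_{m,c_1,c_2})}:S^m\to\mathbb{R}$ is defined by $f=\pi_{m+1,1}|_{X_{m,c_1,c_2}}\circ\phi$ on $S^m-\{p_+,p_-\}$, $f(p_-)=a_1$, $f(p_+)=a_2$. It is continuous, smooth outside $\{p_+,p_-\}$, and $(R_f,q_f(S(f|_{S^m-\{p_+,p_-\}}))\cup q_f(\{p_+,p_-\}),\bar f)$ is a pre-digraph. **Cell complexes and graphs.** A cell complex is a Hausdorff space $X$ decomposed as a disjoint union of cells, each the image of a homeomorphism from $D^j-S^{j-1}$ onto a subset of $X$, such that for each $j$-cell $e$ the set $\overline{e}-e$ is a union of cells of dimension smaller than $j$. Here all cell complexes have dimension $0$ or $1$; $0$-cells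 are vertices, $1$-cells are edges. A graph is a locally finite CW complex of dimension $0$ or $1$ in which the closure of each edge is homeomorphic to $D^1$. **Pre-digraphs.** A pre-digraph is a triplet $(G_0,S_{G_0},c_{G_0})$ of a Hausdorff space $G_0$, a subset $S_{G_0}\subset G_0$ and a continuous function $c_{G_0}:G_0\to\mathbb{R}$ such that: $G_0-S_{G_0}$ is homeomorphic to a disjoint union $\bigsqcup_{e\in E_{G_0,S_{G_0}}}e$ of copies of $D^1-S^0$ (each homeomorphic to $\mathbb{R}$), and decomposing $G_0$ into these copies (the edges) and the points of $S_{G_0}$ makes $G_0$ a $0$- or $1$-dimensional cell complex whose set of $0$-cells is $S_{G_0}$; and $c_{G_0}$ is injective on each of these copies. A point $s\in G_0$ is NF (non-finite) if $s$ has no neighborhood in $G_0$ which is homeomorphic to a graph and contains no point of $S_{G_0}-\{s\}$. $\mathrm{NF}(G_0,S_{G_0})$ is the set of all NF points. **GDNF.** Write $N:=\mathrm{NF}(G_0,S_{G_0})$. On the set of connected components of $G_0-N$ let $\sim$ be the equivalence relation generated by the following rule: $C_1\sim C_2$ if there are non-empty families of edges $\{e_{1,j}\}_{j\in J_1},\{e_{2,j}\}_{j\in J_2}\subset E_{G_0,S_{G_0}}$ with $\bigsqcup_{j\in J_1}e_{1,j}\subset C_1$, $\bigsqcup_{j\in J_2}e_{2,j}\subset C_2$, and a point $s\in N$ lying in the closures in $G_0$ of both unions, such that either the restrictions of $c_{G_0}$ to both closures are maximal at $s$, or the restrictions of $c_{G_0}$ to both closures are minimal at $s$. The graph diagram $\mathrm{GDNF}(G_0,S_{G_0},c_{G_0})$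 is the $0$- or $1$-dimensional cell complex with oriented edges defined as follows. Its vertices are the equivalence classes $[C]$ of connected components of $G_0-N$. Its edges are the elements $s\in N$. The edge $s$ departs from the vertex $V$ iff there are $C\in V$ and a non-empty family of edges $\{e_j\}_{j\in J}\subset E_{G_0,S_{G_0}}$ contained in $C$ such that $s\in\overline{\bigsqcup_j e_j}$ and $c_{G_0}|_{\overline{\bigsqcup_j e_j}}$ is maximal at $s$; it enters the vertex $V$ iff the same holds with ''minimal'' in place of ''maximal''. (An edge may have only a departing or only an entering vertex; the corresponding other end is then open.) Two such oriented complexes are isomorphic if there are bijections of vertices and of edges preserving the relations ''departs from'' and ''enters''. *)

(* Defs.v *)
(* MathComp-Analysis, over an arbitrary [R : realType]. *)
From Stdlib Require Import Relation_Operators.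
From HB Require Import structures.
From mathcomp Require Import all_boot all_order all_algebra.
From mathcomp Require Import all_classical all_reals all_analysis.

Set Implicit Arguments.
Unset Strict Implicit.
Unset Printing Implicit Defensive.

Import Order.TTheory GRing.Theory Num.Theory.
Import numFieldNormedType.Exports.

Local Open Scope quotient_scope.
Local Open Scope classical_set_scope.
Local Open Scope ring_scope.

Section Topology.

Definition homeomorphic (T U : topologicalType) : Prop :=
  exists (f : T -> U) (g : U -> T),
    [/\ continuous f, continuous g, cancel f g & cancel g f].

Definition subsp (T : topologicalType) (A : set T) : topologicalType :=
  set_type A.

End Topology.

Section ReebSpace.
Variables (R : realType) (T : topologicalType) (c : T -> R).

Definition reeb_rel (x1 x2 : T) : Prop :=
  exists y : R, c x1 = y /\ connected_component (c @^-1` [set y]) x1 x2.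

Let reeb_relb : rel T := fun x1 x2 => `[< reeb_rel x1 x2 >].

Let reeb_relb_refl : reflexive reeb_relb.
Proof.
by move=> x; apply/asboolP; exists (c x); split=> //;
  exact: connected_component_refl.
Qed.

Let reeb_rel_sym x y : reeb_rel x y -> reeb_rel y x.
Proof.
move=> [t [cx xy]]; exists t; split; last exact: connected_component_sym.
exact: (connected_component_sub xy).
Qed.

Let reeb_relb_sym : symmetric reeb_relb.
Proof. by move=> x y; apply/asboolP/asboolP; exact: reeb_rel_sym. Qed.

Let reeb_relb_trans : transitive reeb_relb.
Proof.
move=> y x z /asboolP[t [cx xy]] /asboolP[t' [cy yz]]; apply/asboolP.
exists t; split=> //; apply: (connected_component_trans xy).
by have <- : t' = t by rewrite -cy; exact: (connected_component_sub xy).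
Qed.

Definition reeb_equiv : equiv_rel T :=
  EquivRel reeb_relb reeb_relb_refl reeb_relb_sym reeb_relb_trans.

Definition reeb_space : topologicalType :=
  quotient_topology {eq_quot reeb_equiv}.

Definition reeb_map (x : T) : reeb_space :=
  \pi_{eq_quot reeb_equiv} x.

Definition reeb_bar (r : reeb_space) : R :=
  c (repr (r : {eq_quot reeb_equiv})).

Lemma reeb_mapP (x y : T) : reeb_map x = reeb_map y <-> reeb_rel x y.
Proof.
split=> [/eqmodP/asboolP //|h].
by apply/eqmodP/asboolP.
Qed.

Lemma reeb_map_surj (r : reeb_space) : exists x, reeb_map x = r.
Proof. by exists (repr (r : {eq_quot reeb_equiv})); exact: reprK. Qed.

Lemma reeb_barE (x : T) : reeb_bar (reeb_map x) = c x.
Proof.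
have [t [<- /connected_component_sub /=]] :
  reeb_rel x (repr (reeb_map x : {eq_quot reeb_equiv})) => //.
by apply/reeb_mapP; rewrite /reeb_map reprK.
Qed.

End ReebSpace.

Section Graphs.
Variable R : realType.

Let open_disk : set R := `]-1, 1[%classic.
Let closed_disk : set R := `[-1, 1]%classic.

(* [V] is the set of vertices and [E] the set of open edges of a CW structure. *)
Definition graph_structure (T : topologicalType) (V : set T) (E : set (set T))
    : Prop :=
  [/\ (forall e, E e -> homeomorphic (subsp e) (subsp open_disk)),
      [/\ (forall e, E e -> e `&` V = set0),
          trivIset E id &
          V `|` \bigcup_(e in E) e = setT],
      (forall e, E e -> closure e `\` e `<=` V),
      (* CW conditions: characteristic maps, closure-finiteness and the weak
         topology *)
      [/\ (forall e, E e -> exists h : R -> T,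
            [/\ {within closed_disk, continuous h}, set_inj open_disk h,
                h @` open_disk = e, V (h (-1)) & V (h 1)]),
          (forall e, E e -> finite_set (closure e `\` e)) &
          (forall A : set T,
            (forall e, E e -> closed (A `&` closure e)) -> closed A)] &
      (forall x : T, exists2 U, nbhs x U &
         finite_set (V `&` U) /\ finite_set [set e | E e /\ e `&` U !=set0])
      /\ (forall e, E e -> homeomorphic (subsp (closure e)) (subsp closed_disk))].

Definition is_graph (T : topologicalType) : Prop :=
  hausdorff_space T /\ exists V E, @graph_structure T V E.

(* A presentation of [~` S] as a disjoint union of copies of ]-1, 1[: the
   members of [E] are open in [~` S], so that [~` S] carries the sum topology. *)
Definition edge_decomposition (G : topologicalType) (S : set G)
    (E : set (set G)) : Prop :=
  [/\ (forall e, E e -> homeomorphic (subsp e) (subsp open_disk)),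
      (forall e, E e -> exists2 O, open O & e = O `&` ~` S),
      trivIset E id &
      \bigcup_(e in E) e = ~` S].

Definition pre_digraph (G : topologicalType) (S : set G) (c : G -> R)
    (E : set (set G)) : Prop :=
  [/\ hausdorff_space G, continuous c, edge_decomposition S E,
      (forall e, E e -> closure e `\` e `<=` S) &
      (forall e, E e -> set_inj e c)].

End Graphs.

Section GDNF.
Variables (R : realType) (G : topologicalType) (S : set G) (c : G -> R).

(* The summands of a disjoint union of intervals are its connected components,
   so the edges of a pre-digraph are determined by [G] and [S]; see
   [pre_digraph_edges] below. *)
Definition edges : set (set G) :=
  [set connected_component (~` S) x | x in ~` S].

Definition NF : set G :=
  [set s | ~ exists U : set G,
     [/\ nbhs s U, U `&` (S `\ s) = set0 &
         exists Gamma : topologicalType,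
           is_graph R Gamma /\ homeomorphic (subsp U) Gamma]].

Definition NF_components : set (set G) :=
  [set connected_component (~` NF) x | x in ~` NF].

Definition edges_max_at (C : set G) (s : G) : Prop :=
  exists J : set (set G),
    [/\ J !=set0, J `<=` edges, \bigcup_(e in J) e `<=` C,
        closure (\bigcup_(e in J) e) s &
        forall x, closure (\bigcup_(e in J) e) x -> c x <= c s].

Definition edges_min_at (C : set G) (s : G) : Prop :=
  exists J : set (set G),
    [/\ J !=set0, J `<=` edges, \bigcup_(e in J) e `<=` C,
        closure (\bigcup_(e in J) e) s &
        forall x, closure (\bigcup_(e in J) e) x -> c s <= c x].

Definition gdnf_step (C1 C2 : set G) : Prop :=
  [/\ NF_components C1, NF_components C2 &
      exists2 s, NF s &
        (edges_max_at C1 s /\ edges_max_at C2 s) \/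
        (edges_min_at C1 s /\ edges_min_at C2 s)].

Definition gdnf_class (C : set G) : set (set G) :=
  [set C' | NF_components C' /\ clos_refl_sym_trans (set G) gdnf_step C C'].

End GDNF.

(* A complex of dimension at most 1 with oriented edges, up to isomorphism; an
   end of an edge at which it is attached to no vertex is open. *)
Record diagram := Diagram {
  vertex : Type;
  edge : Type;
  departs : edge -> vertex -> Prop;
  enters : edge -> vertex -> Prop }.

Definition diagram_iso (D1 D2 : diagram) : Prop :=
  exists (fv : vertex D1 -> vertex D2) (fe : edge D1 -> edge D2),
    [/\ bijective fv, bijective fe,
        (forall e v, departs e v <-> departs (fe e) (fv v)) &
        (forall e v, enters e v <-> enters (fe e) (fv v))].

Definition GDNF (R : realType) (G : topologicalType) (S : set G) (c : G -> R)
    : diagram :=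
  @Diagram
    (set_type [set gdnf_class S c C | C in NF_components R S])
    (set_type (NF R S))
    (fun s V => exists2 C, \val V C & edges_max_at S c C (\val s))
    (fun s V => exists2 C, \val V C & edges_min_at S c C (\val s)).

Section Shapes.
Variable D : diagram.

Definition incident (x y : vertex D + edge D) : Prop :=
  match x, y with
  | inl v, inr e => departs e v \/ enters e v
  | _, _ => False
  end.

Definition diagram_connected : Prop :=
  forall x y, clos_refl_sym_trans (vertex D + edge D)%type incident x y.

(* The closure of [e] is homeomorphic to D^1: both ends are attached, to
   distinct vertices (a loop would have closure S^1). *)
Definition closure_arc (e : edge D) : Prop :=
  exists v w, [/\ v <> w, (forall u, departs e u <-> u = v) &
                  (forall u, enters e u <-> u = w)].

(* The closure of [e] is homeomorphic to [0, +oo[: exactly one end is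
   attached. *)
Definition closure_ray (e : edge D) : Prop :=
  exists v,
    ((forall u, departs e u <-> u = v) /\ (forall u, ~ enters e u)) \/
    ((forall u, enters e u <-> u = v) /\ (forall u, ~ departs e u)).

Definition shape_ray : Prop :=
  [/\ diagram_connected, ([set: vertex D] #= `I_1)%card,
      ([set: edge D] #= `I_1)%card & forall e, closure_ray e].

Definition three_vertices_two_arcs : Prop :=
  [/\ diagram_connected, ([set: vertex D] #= `I_3)%card,
      ([set: edge D] #= `I_2)%card & forall e, closure_arc e].

Definition shape_depart : Prop :=
  three_vertices_two_arcs /\ exists v, forall e : edge D, departs e v.

Definition shape_enter : Prop :=
  three_vertices_two_arcs /\ exists v, forall e : edge D, enters e v.

Definition shape_through : Prop :=
  three_vertices_two_arcs /\
  exists v (e1 e2 : edge D), [/\ e1 <> e2, departs e1 v & enters e2 v].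

End Shapes.

Section Smooth.
Variable R : realType.

Fixpoint Ck_on (n k : nat) (U : set 'rV[R]_n.+1) (g : 'rV[R]_n.+1 -> R)
    : Prop :=
  match k with
  | 0 => forall x, U x -> {for x, continuous g}
  | k'.+1 => forall i : 'I_n.+1,
      (forall x, U x -> derivable g x (delta_mx 0 i)) /\
      Ck_on k' U (fun x => 'D_(delta_mx 0 i) g x)
  end.

(* Smoothness of a map defined on an arbitrary subset of a Euclidean space:
   locally it extends to a smooth map on an open set. *)
Definition smooth_on (n p : nat) (A : set 'rV[R]_n.+1)
    (F : 'rV[R]_n.+1 -> 'rV[R]_p.+1) : Prop :=
  forall x, A x -> exists (U : set 'rV[R]_n.+1)
                          (H : 'rV[R]_n.+1 -> 'rV[R]_p.+1),
    [/\ open U, U x,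
        (forall (j : 'I_p.+1) k, Ck_on k U (fun z => H z 0 j)) &
        (forall z, A z -> U z -> F z = H z)].

Definition diffeomorphism (n p : nat) (A : set 'rV[R]_n.+1)
    (B : set 'rV[R]_p.+1) (F : 'rV[R]_n.+1 -> 'rV[R]_p.+1) : Prop :=
  smooth_on A F /\ set_fun A B F /\
  exists H : 'rV[R]_p.+1 -> 'rV[R]_n.+1,
    [/\ smooth_on B H, set_fun B A H,
        (forall x, A x -> H (F x) = x) & (forall y, B y -> F (H y) = y)].

Definition smooth_curve (n : nat) (gamma : R -> 'rV[R]_n.+1) : Prop :=
  forall (j : 'I_n.+1) (k : nat) (t : R),
    derivable (derive1n k (fun u => gamma u 0 j)) t 1.

(* Critical points of a smooth function [g] on a submanifold [M] of a Euclidean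
   space: the differential of [g] vanishes on every tangent vector, a tangent
   vector at [p] being the velocity of a smooth curve of [M] through [p]. *)
Definition critical_points (n : nat) (M : set 'rV[R]_n.+1)
    (g : 'rV[R]_n.+1 -> R) : set 'rV[R]_n.+1 :=
  [set p | M p /\
     forall gamma : R -> 'rV[R]_n.+1, smooth_curve gamma -> gamma 0 = p ->
       (\forall t \near (0 : R), M (gamma t)) ->
       derive1 (g \o gamma) 0 = 0].

End Smooth.

Section ZeroSets.
Variable R : realType.

Definition real_analytic (c : R -> R) : Prop :=
  forall x0 : R, exists (a : R^nat) (r : R), 0 < r /\
    forall x, `|x - x0| < r -> pseries a (x - x0) @ \oo --> c x.

Definition domain (c1 c2 : R -> R) : set (R * R) :=
  [set x | c1 x.2 < x.1 < c2 x.2].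

(* The coordinates of [z] are (x_1, x_2, y_1, ..., y_(m-1)), i.e. x_1 and x_2
   have indices 0 and 1; [zero_set m c1 c2] is meant for [1 < m]. *)
Definition coord1 (m : nat) (z : 'rV[R]_m.+1) : R := z 0 0.
Definition coord2 (m : nat) (z : 'rV[R]_m.+1) : R := z 0 (inord 1).

Definition zero_set (m : nat) (c1 c2 : R -> R) : set 'rV[R]_m.+1 :=
  [set z | closure (domain c1 c2) (coord1 z, coord2 z) /\
     (coord1 z - c1 (coord2 z)) * (c2 (coord2 z) - coord1 z)
       - \sum_(j < m.+1 | (1 < j)%N) z 0 j ^+ 2 = 0].
Arguments zero_set : clear implicits.

Definition SAB_at (F : set_system R) (c1 c2 : R -> R) : Prop :=
  [\/ exists l : R, c1 @ F --> l /\ c2 @ F --> l,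
      c1 @ F --> -oo /\ c2 @ F --> -oo |
      c1 @ F --> +oo /\ c2 @ F --> +oo].

Definition SAB_at_infinity_in_top (c1 c2 : R -> R) : Prop :=
  SAB_at -oo c1 c2 /\ SAB_at +oo c1 c2.

Definition sphere (m : nat) : set 'rV[R]_m.+1 :=
  [set z | \sum_(i < m.+1) z 0 i ^+ 2 = 1].
Arguments sphere : clear implicits.

Definition pole_plus (m : nat) : 'rV[R]_m.+1 := delta_mx 0 ord_max.
Definition pole_minus (m : nat) : 'rV[R]_m.+1 := - pole_plus m.

Definition punctured_sphere (m : nat) : set 'rV[R]_m.+1 :=
  sphere m `\` [set pole_plus m; pole_minus m].
Arguments punctured_sphere : clear implicits.

Definition compactifying_diffeo (m : nat) (c1 c2 : R -> R)
    (phi : 'rV[R]_m.+1 -> 'rV[R]_m.+1) : Prop :=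
  [/\ diffeomorphism (punctured_sphere m) (zero_set m c1 c2) phi,
      coord2 (phi z) @[z --> within (punctured_sphere m) (nbhs (pole_minus m))]
        --> -oo &
      coord2 (phi z) @[z --> within (punctured_sphere m) (nbhs (pole_plus m))]
        --> +oo].

(* Only the values on the sphere are relevant. *)
Definition compactified (m : nat) (a1 a2 : R)
    (phi : 'rV[R]_m.+1 -> 'rV[R]_m.+1) (z : 'rV[R]_m.+1) : R :=
  if z == pole_minus m then a1
  else if z == pole_plus m then a2
  else coord1 (phi z).

Definition restr (m : nat) (M : set 'rV[R]_m.+1) (g : 'rV[R]_m.+1 -> R)
    : subsp M -> R := fun z => g (\val z).
Arguments restr {m} M g.

(* The image of [A `&` M] in the Reeb space of the restriction of [g] to [M]. *)
Definition reeb_image (m : nat) (M : set 'rV[R]_m.+1) (g : 'rV[R]_m.+1 -> R)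
    (A : set 'rV[R]_m.+1) : set (reeb_space (restr M g)) :=
  [set reeb_map (restr M g) z | z in [set z : subsp M | A (\val z)]].
Arguments reeb_image {m} M g A.

Definition GDNF_pi (m : nat) (c1 c2 : R -> R) : diagram :=
  let X := zero_set m c1 c2 in
  let pi1 := @coord1 m in
  GDNF (reeb_image X pi1 (critical_points X pi1))
       (reeb_bar (c := restr X pi1)).

Definition GDNF_f (m : nat) (a1 a2 : R) (phi : 'rV[R]_m.+1 -> 'rV[R]_m.+1)
    : diagram :=
  let Sm := sphere m in
  let f := compactified a1 a2 phi in
  GDNF (reeb_image Sm f (critical_points (punctured_sphere m) f)
          `|` reeb_image Sm f [set pole_plus m; pole_minus m])
       (reeb_bar (c := restr Sm f)).

End ZeroSets.

Section EdgesOfPreDigraphs.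
Variables (R : realType) (G : topologicalType).

Let homeomorphic_connected (A : set G) (B : set R) :
  homeomorphic (subsp A) (subsp B) -> connected B -> connected A.
Proof.
move=> [f [g [_ cg fK gK]]] cB.
have [->|/set0P[a Aa]] := eqVneq A set0; first exact: connected0.
pose k : set_type B -> G := fun b => \val (g b).
have ck : continuous k.
  move=> x; apply: (@continuous_comp _ _ _ g); first exact: cg.
  exact: (@initial_continuous (set_type A) G set_val).
have := connected_continuous_connected cB
  ((@subspace_valL_continuousP' _ B _ a k).2 ck).
have kE (b : set_type B) : valL_ a k (\val b) = k b.
  by have := congr1 (@^~ b) (valLK a k).
congr connected; apply/seteqP; split=> [_ [x Bx <-]|x Ax].
  rewrite -[x]/(\val (SigSub (mem_set Bx) : set_type B)) kE.
  exact: set_valP.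
pose y := f (SigSub (mem_set Ax) : set_type A).
exists (\val y); first exact: set_valP.
by rewrite kE /k /y fK.
Qed.

Lemma pre_digraph_edges (S : set G) (c : G -> R) (E : set (set G)) :
  pre_digraph S c E -> E = edges S.
Proof.
move=> [_ _ [hE oE tE cE] _ _].
have neE e : E e -> e !=set0.
  move=> /hE [_ [g _]].
  have h0 : `]-1, 1[%classic (0 : R) by rewrite /= in_itv /= ltrN10 ltr01.
  by exists (\val (g (SigSub (mem_set h0)))); exact: set_valP.
have ctE e : E e -> connected e.
  move=> /hE /homeomorphic_connected; apply.
  by apply/connected_intervalP; exact: interval_is_interval.
have sE e : E e -> e `<=` ~` S by move=> Ee x ex; rewrite -cE; exists e.
have compE e x : E e -> e x -> connected_component (~` S) x = e.
  move=> Ee ex; apply/seteqP; split; last first.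
    by apply: connected_component_max => //; [exact: sE|exact: ctE].
  set K := connected_component _ x.
  have KS : K `<=` ~` S by exact: connected_component_sub.
  suff <- : K `&` e = K by move=> y [].
  apply: (@component_connected _ (~` S) x).
  - exists x; split=> //; apply: connected_component_refl; exact: (sE e).
  - have [V oV eV] := oE _ Ee; exists V => //.
    apply/seteqP; split=> y [Ky]; first by rewrite eV => -[].
    by move=> Vy; split=> //; rewrite eV; split=> //; exact: KS.
  - pose W := \bigcup_(V in [set V | open V /\ V `&` ~` S `<=` ~` e]) V.
    exists (~` W).
      by apply: open_closedC; apply: bigcup_open => V [].
    apply/seteqP; split=> y [Ky]; last first.
      move=> nWy; split=> //; have : (~` S) y by exact: KS.
      rewrite -cE => -[e' Ee' e'y]; have [<- //|ne] := pselect (e' = e).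
      exfalso; apply: nWy; have [V oV eV] := oE _ Ee'.
      exists V; last by move: e'y; rewrite eV => -[].
      split=> //; rewrite -eV => z e'z ez; apply: ne.
      by apply: (tE _ _ Ee' Ee); exists z.
    by move=> ey; split=> // -[V [_ VS] Vy]; apply: (VS y) => //; split=> //;
      exact: KS.
apply/seteqP; split=> [e Ee|_ [x Sx <-]].
  have [x ex] := neE _ Ee; exists x; first exact: (sE e).
  exact: compE.
have [e Ee ex] : (\bigcup_(e in E) e) x by rewrite cE.
by move: (Ee); rewrite -(compE _ _ Ee ex).
Qed.

End EdgesOfPreDigraphs.

(* Main.v *)
(* A level of the first coordinate on the zero-set lies over a level
   [{x | c1 x <= t <= c2 x}] of a planar band. When [t] leaves the interior of the
   band somewhere, the components of the former are those of the latter: the Reeb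
   space is the set of pairs [(t, x)] up to moving [x] inside the level.
   By analyticity a component which is bounded, or at whose infinite ends no
   critical points accumulate, has a star-shaped neighbourhood; so a non-finite
   point is an unbounded component, and there is at most one at each end of the
   line. The Reeb space of the compactification has the same points, with larger
   neighbourhoods around the two ends, which are moreover declared vertices.
   If there are two non-finite points, they are these ends. If there is only one,
   it cannot separate the part above it from the part below it, since there is a
   single class; hence [c1] or [c2] is constant on a half-line, thus everywhere,
   and the two ends coincide with this point, which is critical. In both cases
   an end is either critical or approached by edges both from above and from
   below; these edges would be cut by the component of the end in the complement
   of the vertices, unless this component is a single point. So declaring the
   ends vertices changes neither the other edges nor the non-finite points. *)
Require Import Defs.
From Stdlib Require Import Relation_Operators.
From mathcomp Require Import all_boot all_order all_algebra.
From mathcomp Require Import all_classical all_reals all_analysis.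
From mathcomp Require Import lra ring.
Import Order.TTheory GRing.Theory Num.Theory.
Import numFieldNormedType.Exports.
Local Open Scope classical_set_scope.
Local Open Scope ring_scope.
Set Implicit Arguments.
Unset Strict Implicit.
Unset Printing Implicit Defensive.

(** * Real analytic functions *)

Section RealAnalytic.
Variable R : realType.
Implicit Types (c : R -> R) (x y a b v : R).

(** Each Reeb space enters the comparison only through the record [strip] over one planar band; the
    sphere, the diffeomorphism and the dimension are confined to its instances. The two topologies
    differ in one clause: band-open sets are open, for [f] provided that with an end they contain
    the far part of the band on that side. The obstacle to this description is a level lying inside
    the band over the whole line: for [m = 2] it has two sheets that never meet, and two components
    lie over one pair (t, x). The shapes exclude it. Reflections of the fibre make its points finite
    or non-finite together; a single class is refuted because the parts above and below give two,
    and three classes because those two parts account for all components. The delicate half of the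
    comparison goes from [f] back to the projection. Edges accumulating at an end of the sphere need
    not accumulate at the corresponding point of the other Reeb space, whose neighbourhoods are
    smaller. They do enter every window around its level, which suffices to construct other edges in
    the same component that end there. *)

Let bernoulli_bound (q : R) : 0 < q < 1 ->
  exists C : R, 0 < C /\ forall n, n.+1%:R * q ^+ n <= C.
Proof.
move=> /andP[q0 q1]; pose h := q^-1 - 1.
have h0 : 0 < h by rewrite subr_gt0 invf_gt1.
have hn n : 1 + n%:R * h <= (1 + h) ^+ n.
  elim: n => [|n IH]; first by rewrite mul0r addr0 expr0.
  rewrite exprS; apply: (@le_trans _ _ ((1 + h) * (1 + n%:R * h))); last first.
    by rewrite ler_wpM2l// addr_ge0// ltW.
  have : 0 <= h * (n%:R * h) by rewrite !mulr_ge0 ?ler0n// ltW.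
  by rewrite -[n.+1%:R]natr1; lra.
(* With q = 1/(1+h), Bernoulli's inequality bounds (n+1) q^n by (n+1)/(1+nh), which is at most 1 +
   1/h. *)
exists (1 + h^-1); split; first by rewrite addr_gt0// invr_gt0.
move=> n; have qh : q = (1 + h)^-1 by rewrite /h addrC subrK invrK.
rewrite qh exprVn ler_pdivrMr; last by rewrite exprn_gt0// addr_gt0.
apply: (@le_trans _ _ ((1 + h^-1) * (1 + n%:R * h))); last first.
  by rewrite ler_wpM2l// addr_ge0// invr_ge0 ltW.
have -> : (1 + h^-1) * (1 + n%:R * h) = 1 + n%:R * h + h^-1 + n%:R.
  by field; rewrite gt_eqF.
rewrite -natr1.
have : 0 <= n%:R * h by rewrite mulr_ge0 ?ler0n// ltW.
have : 0 < h^-1 by rewrite invr_gt0.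
lra.
Qed.

(** The factor [n.+1] of the derived series is absorbed by a geometric one: [z'] and [y] divide the
    gap between the two moduli into thirds, and (n+1)(z'/y)^n is bounded. *)
Lemma is_cvg_pseries_diffs (u : R^nat) x z :
  cvgn (pseries u x) -> `|z| < `|x| -> cvgn (pseries (pseries_diffs u) z).
Proof.
move=> ux zx; pose z' : R := (2 * `|z| + `|x|) / 3; pose y : R := (`|z| + 2 * `|x|) / 3.
have z0 := normr_ge0 z.
have zz' : `|z| < z' by rewrite /z'; lra.
have z'y : z' < y by rewrite /z' /y; lra.
have yx : y < `|x| by rewrite /y; lra.
have z'0 : 0 < z' by rewrite (le_lt_trans _ zz').
have y0 : 0 < y by rewrite (lt_trans z'0).
have uy : cvgn (pseries (fun i => `|u i|) y).
  by apply: is_cvg_pseries_inside_norm ux _; rewrite gtr0_norm.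
have [C [C0 hC]] : exists C : R, 0 < C /\
    forall n, n.+1%:R * (z' / y) ^+ n <= C.
  by apply: bernoulli_bound; rewrite divr_gt0//= ltr_pdivrMr ?mul1r.
have uy' : cvgn (series (fun i => `|u i.+1| * y ^+ i.+1)).
  have -> : series (fun i => `|u i.+1| * y ^+ i.+1) =
     (fun n => pseries (fun i => `|u i|) y n.+1 - `|u 0%N|).
    apply/funext => n; rewrite /pseries/= /series/= big_nat_recl//= expr0 mulr1.
    by rewrite addrAC subrr add0r.
  apply: is_cvgB; last exact: is_cvg_cst.
  case/cvg_ex: uy => l ul; apply/cvg_ex; exists l.
  by have := ul; rewrite -(cvg_shiftS (pseries (fun i => `|u i|) y)).
apply: normed_cvg.
apply: (@series_le_cvg _ _ (fun i => (C / y) * (`|u i.+1| * y ^+ i.+1))).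
- by move=> n; exact: normr_ge0.
- by move=> n; rewrite !mulr_ge0 ?invr_ge0 ?exprn_ge0// ltW.
- move=> n /=; rewrite /pseries_diffs !normrM normrX normr_nat.
  apply: (@le_trans _ _ (n.+1%:R * `|u n.+1| * z' ^+ n)).
    apply: ler_wpM2l; first by rewrite mulr_ge0 ?ler0n.
    by apply: lerXn2r; rewrite ?nnegrE ?normr_ge0//; exact: ltW.
  have := hC n; rewrite expr_div_n mulrA ler_pdivrMr ?exprn_gt0// => {}hC.
  have -> : C / y * (`|u n.+1| * y ^+ n.+1) = `|u n.+1| * (C * y ^+ n).
    by rewrite exprS; field; rewrite gt_eqF.
  by rewrite mulrAC mulrC ler_wpM2l.
- have := @is_cvg_seriesZ _ (fun i => `|u i.+1| * y ^+ i.+1) (C / y) uy'.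
  by [].
Qed.

Let is_derive_shift (f : R -> R) x x0 d : is_derive (x - x0) 1 f d ->
  is_derive x 1 (fun y => f (y - x0)) d.
Proof.
move=> df; have dsub : is_derive x (1 : R) (fun y => y - x0) 1.
  by apply: is_derive_eq; rewrite subr0.
by rewrite -[d]mulr1; exact: (@is_derive1_comp R f (fun y => y - x0)).
Qed.

Lemma pseries_disc_derive (u : R^nat) (r h : R) :
  (forall z, `|z| < r -> cvgn (pseries u z)) -> `|h| < r ->
  is_derive h 1 (fun y => limn (pseries u y)) (limn (pseries (pseries_diffs u) h))
  /\ cvgn (pseries (pseries_diffs u) h).
Proof.
move=> hr xr.
(* [pseries_snd_diffs] asks at [k2] for the convergence of the series and of its first two derived
   series. Each derivation costs some radius, hence a chain of intermediate radii. *)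
have [k1 [k2 [k3 [k4 [h1 h2 h3 h4]]]]] : exists k1 k2 k3 k4 : R,
    [/\ `|h| < k1, k1 < k2, k2 < k3 /\ k3 < k4 & k4 < r].
  pose d : R := (r - `|h|) / 5.
  have d0 : 0 < d by rewrite divr_gt0// subr_gt0.
  have dE : r = `|h| + 5 * d by rewrite /d; field.
  exists (`|h| + d), (`|h| + 2 * d), (`|h| + 3 * d), (`|h| + 4 * d).
  by rewrite dE; split; [|..|]; try split; lra.
have [h3' h3''] := h3.
have k10 : 0 < k1 by rewrite (le_lt_trans _ h1).
have k20 := lt_trans k10 h2; have k30 := lt_trans k20 h3'.
have k40 := lt_trans k30 h3''.
have nk (k : R) : 0 < k -> `|k| = k by move=> /gtr0_norm.
have c4 : cvgn (pseries u k4) by apply: hr; rewrite nk.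
have c3 : cvgn (pseries (pseries_diffs u) k3).
  by apply: is_cvg_pseries_diffs c4 _; rewrite !nk.
have c2 : cvgn (pseries (pseries_diffs (pseries_diffs u)) k2).
  by apply: is_cvg_pseries_diffs c3 _; rewrite !nk.
have c1' : cvgn (pseries (pseries_diffs u) k2).
  by apply: is_cvg_pseries_inside c3 _; rewrite !nk.
have c0 : cvgn (pseries u k2).
  by apply: is_cvg_pseries_inside c4 _; rewrite !nk// (lt_trans h3').
split; last first.
  by apply: is_cvg_pseries_inside c3 _; rewrite (nk k3)// (lt_trans h1)// (lt_trans h2).
have := @pseries_snd_diffs R u k2 h c0 c1' c2.
by rewrite (nk k2 k20) => /(_ (lt_trans h1 h2)).
Qed.

Let analytic_at c x0 : real_analytic c -> exists (u : R^nat) (r : R),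
  [/\ 0 < r, forall z, `|z| < r -> cvgn (pseries u z) &
      forall x, `|x - x0| < r -> c x = limn (pseries u (x - x0))].
Proof.
move=> /(_ x0)[u [r [r0 hr]]]; exists u, r; split=> //; last first.
  by move=> x xr; apply/esym/cvg_lim => //; apply: hr.
move=> z zr; apply/cvg_ex; exists (c (x0 + z)).
have -> : z = (x0 + z) - x0 by lra.
have -> : x0 + (x0 + z - x0) = x0 + z by lra.
by apply: hr; rewrite addrAC subrr add0r.
Qed.

Let near_disc x0 x (r : R) : `|x - x0| < r -> \forall y \near x, `|y - x0| < r.
Proof.
move=> xr; apply/nbhs_ballP; exists (r - `|x - x0|); rewrite /= ?subr_gt0// => y.
rewrite /ball/= => yx.
have -> : y - x0 = (x - x0) - (x - y) by lra.
by rewrite (le_lt_trans (ler_normB _ _))//; lra.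
Qed.

Lemma real_analytic_derive c : real_analytic c ->
  (forall x, derivable c x 1) /\ real_analytic (derive1 c).
Proof.
move=> cA.
have key x0 : exists (u : R^nat) (r : R), 0 < r /\ forall x, `|x - x0| < r ->
    is_derive x 1 c (limn (pseries (pseries_diffs u) (x - x0))) /\
    cvgn (pseries (pseries_diffs u) (x - x0)).
  have [u [r [r0 hu hr]]] := analytic_at x0 cA.
  exists u, r; split=> // x xr.
  have [dp cp] := pseries_disc_derive hu xr; split; last exact: cp.
  apply: near_eq_is_derive (@is_derive_shift (fun y => limn (pseries u y)) x x0 _ dp).
  by near=> y; rewrite hr//; near: y; exact: near_disc xr.
split=> [x|x0].
  have [u [r [r0 /(_ x)]]] := key x; rewrite subrr normr0 => /(_ r0)[+ _].
  by move=> ?; exact: ex_derive.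
have [u [r [r0 hr]]] := key x0; exists (pseries_diffs u), r; split=> // x xr.
by have [dc cc] := hr _ xr; rewrite derive1E derive_val.
Unshelve. all: by end_near. Qed.

Lemma real_analytic_derive1n c k : real_analytic c -> real_analytic (derive1n k c).
Proof.
by move=> cA; elim: k => [//|k /real_analytic_derive[]]; rewrite derive1nS.
Qed.

Let pseries_recl (u : R^nat) h n :
  pseries u h n.+1 = u 0%N + \sum_(0 <= i < n) u i.+1 * h ^+ i.+1.
Proof. by rewrite /pseries /series /= big_nat_recl// expr0 mulr1. Qed.

Lemma real_analytic_subr c v : real_analytic c -> real_analytic (fun x => c x - v).
Proof.
move=> cA x0; have [u [r [r0 hr]]] := cA x0.
exists (fun i => u i - v *+ (i == 0%N)), r; split=> // x xr.
apply: (cvg_trans _ (cvgB (hr _ xr) (@cvg_cst _ v _ \oo _))).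
apply: near_eq_cvg; near=> n.
(* The partial sum of index 0 is empty, so the constant term is present from index 1 on only. *)
have /prednK <- : (0 < n)%N by near: n; exists 1%N.
rewrite !fctE !pseries_recl mulr1n addrAC; congr (_ + _); apply: eq_bigr => i _.
by rewrite mulr0n subr0.
Unshelve. all: by end_near. Qed.

Let pseries_shift (u : R^nat) k h n : (forall i, (i < k)%N -> u i = 0) ->
  pseries u h (n + k)%N = h ^+ k * pseries (fun i => u (i + k)%N) h n.
Proof.
move=> uk; rewrite /pseries /series /= (@big_cat_nat _ _ _ k)//=; last exact: leq_addl.
rewrite big_nat_cond big1 ?add0r; last first.
  by move=> i; rewrite andbT => /andP[_ /uk ->]; rewrite mul0r.
rewrite -[X in \sum_(X <= _ < _) _]add0n big_addn addnK mulr_sumr.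
by apply: eq_bigr => i _; rewrite exprD mulrA mulrC.
Qed.

(** Unless all coefficients vanish, [c] is near [x0] the product of (x - x0)^k, where [u k] is the
    first nonzero coefficient, and of a power series that is continuous and nonzero at 0. *)
Lemma real_analytic_zero_near c x0 : real_analytic c ->
  (\forall x \near x0, c x = 0) \/
  (exists2 e, 0 < e & forall x, 0 < `|x - x0| < e -> c x <> 0).
Proof.
move=> cA; have [u [r [r0 hu hr]]] := analytic_at x0 cA.
have [u0|/existsNP[k0 uk0]] := pselect (forall i, u i = 0).
  left; near=> x; rewrite hr; last first.
    by near: x; apply: (@near_disc x0); rewrite subrr normr0.
  have -> : pseries u (x - x0) = cst 0; last exact: lim_cst.
  by apply/funext => n; rewrite /pseries /series /= big1// => i _; rewrite u0 mul0r.
right.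
have hex : exists k, u k != 0 by exists k0; apply/eqP.
pose k := ex_minn hex.
have uk : u k != 0 by rewrite /k; case: ex_minnP.
have ult i : (i < k)%N -> u i = 0.
  rewrite /k; case: ex_minnP => j _ jmin ij; apply/eqP.
  by apply/negPn/negP => /jmin; rewrite leqNgt ij.
pose g i := u (i + k)%N.
have cv h : `|h| < r -> cvgn (pseries g h).
  move=> hr'; have [->|h0] := eqVneq h 0.
    apply/cvg_ex; exists (g 0%N); apply: cvg_near_cst; near=> n.
    have /prednK <- : (0 < n)%N by near: n; exists 1%N.
    rewrite pseries_recl.
    by rewrite big1 ?addr0// => i _; rewrite expr0n mulr0.
  have /cvg_ex[l] := hu _ hr'; rewrite -(cvg_shiftn k) => ul.
  apply/cvg_ex; exists (h ^- k * l).
  have -> : pseries g h = (fun n => h ^- k * pseries u h (n + k)%N).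
    by apply/funext => n; rewrite pseries_shift// mulKf// expf_neq0.
  by apply: cvgZl_tmp.
have r0' : `|0 : R| < r by rewrite normr0.
have [dg _] := pseries_disc_derive cv r0'.
have cg : {for 0, continuous (fun y => limn (pseries g y))}.
  apply: differentiable_continuous; apply/derivable1_diffP.
  exact: ex_derive.
have g0 : limn (pseries g 0) = u k.
  apply: cvg_lim => //; apply: cvg_near_cst; near=> n.
  have /prednK <- : (0 < n)%N by near: n; exists 1%N.
  rewrite pseries_recl.
  by rewrite /g add0n big1 ?addr0// => i _; rewrite expr0n mulr0.
have : \forall y \near (0:R), limn (pseries g y) != 0.
  by apply: (cvgr_neq0 _ cg); rewrite g0.
move=> /nbhs_ballP[e /= e0 he]; exists (Order.min e r).
  by rewrite lt_min e0 r0.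
move=> x /andP[x0x]; rewrite lt_min => /andP[xe xr].
rewrite hr// => /eqP; apply/negP.
have -> : limn (pseries u (x - x0)) = (x - x0) ^+ k * limn (pseries g (x - x0)).
  apply: cvg_lim => //; rewrite -(cvg_shiftn k).
  under eq_fun do rewrite pseries_shift//.
  by apply: cvgZl_tmp; exact: cv.
rewrite mulf_neq0// ?expf_neq0//; first by rewrite -normr_gt0.
by apply: he; rewrite /ball/= sub0r normrN.
Unshelve. all: by end_near. Qed.

(** The points near which [c] vanishes form an open set. It is closed, because at a limit point the
    zeros are not isolated; and the line is connected. *)
Lemma real_analytic_zero c : real_analytic c -> (forall x, c x = 0) \/
  forall x0, exists2 e, 0 < e & forall x, 0 < `|x - x0| < e -> c x <> 0.
Proof.
move=> cA; pose Z := [set x : R | \forall y \near x, c y = 0].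
have [Z0|/nonemptyPn Z0] := pselect (Z !=set0); last first.
  right=> x0; have [zx|//] := real_analytic_zero_near x0 cA.
  by move: Z0 => /seteqP[/(_ x0 zx)].
left; have ZT : Z = setT.
  have cT : connected [set: R] by apply/connected_intervalP => x y _ _ z.
  apply: cT => //.
    by exists Z; rewrite ?setTI//; rewrite openE => x /near_join.
  exists Z; rewrite ?setTI// closedE => x hx.
  have [//|[e e0 he]] := real_analytic_zero_near x cA.
  exfalso; apply: hx; apply/nbhs_ballP; exists e => // y.
  rewrite /ball/= => xy Zy.
  have [yx|yx] := eqVneq y x; last first.
    move/nbhs_singleton: Zy; apply: he.
    by rewrite normr_gt0 subr_eq0 yx/= distrC.
  move: Zy; rewrite yx => /nbhs_ballP[d /= d0 hd].
  have m0 : 0 < Order.min d e / 2 by rewrite divr_gt0// lt_min d0 e0.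
  have md : Order.min d e <= d by rewrite ge_min lexx.
  have me : Order.min d e <= e by rewrite ge_min lexx orbT.
  have : ball x d (x + Order.min d e / 2).
    by rewrite /ball/= opprD addrA subrr sub0r normrN gtr0_norm//; lra.
  move=> /hd; apply: he; rewrite addrAC subrr add0r gtr0_norm// m0/=.
  by lra.
by move=> x; have /nbhs_singleton : Z x by rewrite ZT.
Unshelve. all: by end_near. Qed.

(** An infinite bounded set would have a limit point, at which it is not isolated. *)
Lemma isolated_finite (P : set R) a b :
  (forall x0, exists2 e, 0 < e & forall x, 0 < `|x - x0| < e -> ~ P x) ->
  finite_set [set x | a <= x <= b /\ P x].
Proof.
move=> iso; apply: contrapT => inf.
have [|x lx] := infinite_bounded_limit_point_nonempty inf.
  exists (Num.max `|a| `|b|); split; first exact: num_real.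
  move=> M hM x /= [/andP[ax xb] _]; rewrite ltW//; apply: le_lt_trans hM.
  have := ler_norm b; have := ler_norm (- a); rewrite normrN => a' b'.
  by rewrite le_max; case: (leP 0 x) => x0; apply/orP;
    [right; rewrite ger0_norm|left; rewrite ltr0_norm]; lra.
have [e e0 he] := iso x.
have [y [yx [_ Py] xy]] := lx _ (nbhsx_ballx x e e0).
by apply: (he y) => //; rewrite normr_gt0 subr_eq0 yx/= distrC.
Qed.

(* Only the consequences of analyticity that survive replacing [c] by [- c] or
   reflecting the line are used in the planar arguments. *)
Record tame c : Prop := Tame {
  tame_derivable : forall x, derivable c x 1;
  tame_level : forall v a b,
    (forall x, c x = v) \/ finite_set [set x | a <= x <= b /\ c x = v];
  tame_crit : forall a b, (exists v, forall x, c x = v) \/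
    finite_set [set x | a <= x <= b /\ derive1 c x = 0] }.

Lemma real_analytic_tame c : real_analytic c -> tame c.
Proof.
move=> cA; have [dc dcA] := real_analytic_derive cA; split=> //.
- move=> v a b; have [c0|iso] := real_analytic_zero (real_analytic_subr v cA).
    by left=> x; apply/eqP; rewrite -subr_eq0 c0.
  right; apply: isolated_finite => x0; have [e e0 he] := iso x0.
  by exists e => // x /he cx ?; apply: cx; apply/eqP; rewrite subr_eq0; apply/eqP.
- move=> a b; have [c0|iso] := real_analytic_zero dcA.
    left; exists (c 0) => x; apply: (@is_derive_0_is_cst R c) => y.
    by rewrite -(c0 y) derive1E; exact/derivableP.
  by right; apply: isolated_finite.
Qed.

End RealAnalytic.

(** * Levels of a planar band *)

Section Between.
Variable R : realType.
Implicit Types x y z w : R.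

Definition btw x y z : bool := (x <= z <= y) || (y <= z <= x).

Lemma btwC x y z : btw x y z = btw y x z.
Proof. by rewrite /btw orbC. Qed.

Lemma btwl x y : btw x y x.
Proof. by rewrite /btw lexx; case: (leP x y) => // /ltW ->. Qed.

Lemma btwr x y : btw x y y.
Proof. by rewrite btwC btwl. Qed.

Lemma btw_split x y z w : btw x z w -> btw x y w || btw y z w.
Proof.
rewrite /btw => /orP[] /andP[-> ->]; rewrite ?andbT /=;
  by have [->|->] := orP (le_total y w); rewrite ?orbT.
Qed.

Lemma btw_sub x y z w : btw x y z -> btw x z w -> btw x y w.
Proof.
rewrite /btw => /orP[] /andP[a b] /orP[] /andP[c d]; apply/orP;
  first [by left; apply/andP; split; lra|by right; apply/andP; split; lra].
Qed.

(** Serves to move the endpoint of a segment: the new segment adds only points close to the old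
    endpoint. *)
Lemma btw_near x0 x x' w : btw x0 x' w -> btw x0 x w \/ `|w - x| <= `|x' - x|.
Proof.
move=> h; have [|nb] := boolP (btw x0 x w); [by left|right].
move: h nb; rewrite /btw negb_or !negb_and -!ltNge ler_norml lerNl.
have := ler_norm (x' - x); have := ler_norm (- (x' - x)); rewrite normrN.
move=> h1 h2 /orP[]/andP[h3 h4] /andP[/orP[]h5 /orP[]h6]; lra.
Qed.

Lemma btw_opp x y z : btw (- x) (- y) (- z) = btw x y z.
Proof. by rewrite /btw !lerN2 orbC; congr (_ || _); rewrite andbC. Qed.

(** Connectedness of a segment as an induction principle; [nb] turns the radii of the two hypotheses
    into open sets of the line. *)
Lemma seg_ind (P : R -> Prop) x x' : P x ->
  (forall w, btw x x' w -> P w -> exists2 d, 0 < d &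
     forall w', btw x x' w' -> `|w' - w| < d -> P w') ->
  (forall w, btw x x' w -> ~ P w -> exists2 d, 0 < d &
     forall w', btw x x' w' -> `|w' - w| < d -> ~ P w') -> P x'.
Proof.
move=> Px oP cP; pose I := [set w | btw x x' w].
have cI : connected I.
  apply/connected_intervalP => a b Ia Ib c /andP[ac cb].
  by move: Ia Ib; rewrite /I/= /btw => /orP[]/andP[? ?] /orP[]/andP[? ?];
    apply/orP; first [left; apply/andP; split; lra|right; apply/andP; split; lra].
pose nb (Q : R -> Prop) := \bigcup_(u in [set u : R * R | 0 < u.2 /\
   (forall w', btw x x' w' -> `|w' - u.1| < u.2 -> Q w')]) ball u.1 u.2.
have onb Q : open (nb Q).
  apply: bigcup_open => -[a b] [/= b0 _].
  by rewrite openE => y; rewrite /ball/= => yb; exact: (@ball_open _ R).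
have PE : I `&` P = I `&` nb P.
  apply/seteqP; split=> w [Iw Pw]; split=> //.
    have [d d0 hd] := oP _ Iw Pw; exists (w, d); first by split.
    exact: ballxx.
  by case: Pw => -[a b] [/= b0 hb]; rewrite /ball/= distrC => /hb; exact.
suff : I `&` P = I by move=> /seteqP[_ /(_ x' (btwr _ _))[]].
apply: cI.
- by exists x; split=> //; exact: btwl.
- by exists (nb P).
- exists (~` nb (fun w => ~ P w)); first exact: open_closedC.
  apply/seteqP; split=> w [Iw Pw]; split=> //.
    by case=> -[a b] [/= b0 hb]; rewrite /ball/= distrC => /hb; exact.
  apply: contrapT => nPw; apply: Pw.
  have [d d0 hd] := cP _ Iw nPw; exists (w, d); first by split.
  exact: ballxx.
Qed.

End Between.

(** * Interior extrema and first exit points *)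

Section InteriorExtrema.
Variable R : realType.
Implicit Types (c : R -> R) (x y z w : R).

(** The main tool of the planar arguments: a bump of a boundary curve produces a critical point
    whose height is controlled by the bump. *)
Lemma interior_max c x y w : (forall z, derivable c z 1) -> x < w < y ->
  c x < c w -> c y < c w -> exists z, [/\ x < z < y, derive1 c z = 0 &
    forall u, x <= u <= y -> c u <= c z].
Proof.
move=> dc /andP[xw wy] cxw cyw.
have xy := lt_trans xw wy.
have cc : {within `[x, y], continuous c}.
  apply: continuous_subspaceT => z; apply: differentiable_continuous.
  exact/derivable1_diffP.
have [z] := EVT_max (ltW xy) cc; rewrite in_itv/= => /andP[xz zy] zmax.
have hw : c w <= c z by apply: zmax; rewrite in_itv/= !ltW.
have xz' : x < z by rewrite lt_neqAle xz andbT; apply: contraTneq cxw => ->; rewrite -leNgt.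
have zy' : z < y by rewrite lt_neqAle zy andbT; apply: contraTneq cyw => <-; rewrite -leNgt.
exists z; split; first by rewrite xz'.
  have := @derive1_at_max _ c x y z (ltW xy) (fun t _ => dc t).
  rewrite in_itv/= xz' zy' => /(_ isT) h.
  rewrite derive1E; apply: (@derive_val _ _ _ _ _ _ _ (h _)) => t.
  by rewrite in_itv/= => /andP[xt ty]; apply: zmax; rewrite in_itv/= !ltW.
by move=> u uxy; apply: zmax; rewrite in_itv.
Qed.

Lemma derivableNf c x : derivable c x 1 -> derivable (fun u => - c u) x 1.
Proof. by move=> h; exact: (derivableN h). Qed.

Lemma derive1Nf c x : derivable c x 1 -> derive1 (fun u => - c u) x = - derive1 c x.
Proof. by move=> h; rewrite !derive1E; exact: (deriveN h). Qed.

Lemma interior_min c x y w : (forall z, derivable c z 1) -> x < w < y ->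
  c w < c x -> c w < c y -> exists z, [/\ x < z < y, derive1 c z = 0 &
    forall u, x <= u <= y -> c z <= c u].
Proof.
move=> dc xwy cx cy.
have [z [xzy dz zmax]] : exists z, [/\ x < z < y, derive1 (fun u => - c u) z = 0 &
    forall u, x <= u <= y -> - c u <= - c z].
  have := @interior_max (fun u => - c u) x y w (fun u => derivableNf (dc u)) xwy.
  by rewrite !ltrN2 => /(_ cx cy).
exists z; split=> //; last by move=> u /zmax; rewrite lerN2.
by apply/eqP; rewrite -oppr_eq0 -derive1Nf// dz.
Qed.

(** [z] is the supremum of the points up to which [g] stays nonnegative. Its maximality gives
    negative values arbitrarily close on the right, and continuity then forces [g z = 0]. *)
Lemma exit_point (g : R -> R) x y : continuous g -> x < y -> 0 <= g x -> g y < 0 ->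
  exists z, [/\ x <= z < y, forall u, x <= u <= z -> 0 <= g u, g z = 0 &
    forall e, 0 < e -> exists w, [/\ z < w < z + e, w <= y & g w < 0]].
Proof.
move=> cg xy gx gy.
pose A := [set w | x <= w <= y /\ forall u, x <= u <= w -> 0 <= g u].
have Ax : A x.
  split; first by rewrite lexx ltW.
  by move=> u /andP[? ?]; have -> : u = x by apply/le_anti/andP.
have supA : has_sup A by split; [exists x|exists y => w [/andP[]]].
pose z := sup A.
have xz : x <= z by apply: sup_upper_bound.
have zy : z <= y by apply: ge_sup => // [|w [/andP[]]//]; exists x.
have gz u : x <= u < z -> 0 <= g u.
  move=> /andP[xu uz]; have [w [_ hw] uw] := sup_adherent (ltac:(by rewrite subr_gt0) : 0 < z - u) supA.
  by apply: hw; rewrite xu ltW//; move: uw; rewrite -/z; lra.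
have gzz : 0 <= g z.
  rewrite leNgt; apply/negP => gz0.
  have [|xz'] := eqVneq x z; first by move=> E; move: gz0; rewrite -E ltNge gx.
  have {}xz : x < z by rewrite lt_neqAle xz'.
  have /cvgrPdist_lt/(_ (- g z)) := cg z; rewrite oppr_gt0 => /(_ gz0).
  move=> /nbhs_ballP[d /= d0 hd].
  pose u := Order.max x (z - d / 2).
  have uz : u < z by rewrite gt_max xz/=; lra.
  have xu : x <= u by rewrite le_max lexx.
  have := gz u; rewrite xu uz => /(_ isT) gu.
  have ub : ball z d u.
    rewrite /ball/= gtr0_norm ?subr_gt0//.
    have zdu : z - d / 2 <= u by rewrite le_max lexx orbT.
    by lra.
  have := hd _ ub; have := ler_norm (g u - g z); rewrite distrC; lra.
have zy' : z < y.
  by rewrite lt_neqAle zy andbT; apply: contraTneq gy => <-; rewrite -leNgt.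
have ex e : 0 < e -> exists w, [/\ z < w < z + e, w <= y & g w < 0].
  move=> e0; apply: contrapT => /forallNP hn.
  pose w := Order.min y (z + e / 2).
  have zw : z < w by rewrite lt_min zy'/=; lra.
  have wy : w <= y by rewrite ge_min lexx.
  have we : w <= z + e / 2 by rewrite ge_min lexx orbT.
  have : A w.
    split; first by rewrite wy (le_trans xz (ltW zw)).
    move=> u /andP[xu uw]; have [uz|zu] := ltP u z; first by apply: gz; rewrite xu.
    have [->//|uz] := eqVneq u z.
    rewrite leNgt; apply/negP => gu; apply: (hn u); split=> //; last by lra.
    by rewrite lt_neqAle eq_sym uz zu/=; lra.
  by move=> /(sup_upper_bound supA); rewrite -/z leNgt zw.
exists z; split=> //; first by rewrite xz.
  move=> u /andP[xu uz]; have [->//|nuz] := eqVneq u z.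
  by apply: gz; rewrite xu lt_neqAle nuz.
apply/eqP; rewrite eq_le gzz andbT leNgt; apply/negP => gz0.
have /cvgrPdist_lt/(_ (g z) gz0) := cg z => /nbhs_ballP[d /= d0 hd].
have [w [/andP[zw wd] _ gw]] := ex d d0.
have : ball z d w by rewrite /ball/= distrC gtr0_norm ?subr_gt0//; lra.
by move=> /hd; have := ler_norm (g z - g w); lra.
Qed.

End InteriorExtrema.

(** * Symmetries of tame functions and non-critical heights *)

Section TameSymmetries.
Variable R : realType.
Implicit Types (c : R -> R).

Lemma tame_continuous c : tame c -> continuous c.
Proof.
move=> tc z; apply: differentiable_continuous; apply/derivable1_diffP.
exact: tame_derivable.
Qed.

Lemma tameN c : tame c -> tame (fun x => - c x).
Proof.
move=> tc; split.
- by move=> x; apply: derivableNf; exact: tame_derivable.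
- move=> v a b; case: (tame_level tc (- v) a b) => [h|h].
    by left=> x; rewrite h opprK.
  right; apply: sub_finite_set h => x /= [axb <-]; split=> //.
  by rewrite opprK.
- move=> a b; case: (tame_crit tc a b) => [[v h]|h].
    by left; exists (- v) => x; rewrite h.
  right; apply: sub_finite_set h => x /= [axb dx]; split=> //.
  apply/eqP; rewrite -oppr_eq0 -derive1Nf; last exact: tame_derivable.
  by rewrite dx.
Qed.

Lemma derivable_opp c x : derivable c (- x) 1 -> derivable (fun u => c (- u)) x 1.
Proof.
move=> dc; apply/derivable1_diffP.
apply: (@differentiable_comp _ _ _ _ (fun u : R => - u) c); last exact/derivable1_diffP.
by apply/derivable1_diffP; apply: derivableN; exact: derivable_id.
Qed.

Lemma derive1_opp c x : derivable c (- x) 1 ->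
  derive1 (fun u => c (- u)) x = - derive1 c (- x).
Proof.
move=> dc; have dn : is_derive x (1 : R) (-%R) (-1) by exact: is_deriveN.
have h := @is_derive1_comp R c -%R x _ _ (derivableP dc) dn.
by rewrite [LHS]derive1E (@derive_val _ _ _ _ _ _ _ h) derive1E mulrN1.
Qed.

Lemma tame_opp c : tame c -> tame (fun x => c (- x)).
Proof.
move=> tc; split.
- by move=> x; apply: derivable_opp; exact: tame_derivable.
- move=> v a b; case: (tame_level tc v (- b) (- a)) => [h|h]; first by left.
  right; apply: (@sub_finite_set _ _ (-%R @` [set x | - b <= x <= - a /\ c x = v])).
    by move=> x /= [/andP[ax xb] cx]; exists (- x); rewrite ?opprK// !lerN2 ax xb.
  exact: finite_image.
- move=> a b; case: (tame_crit tc (- b) (- a)) => [[v h]|h].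
    by left; exists v.
  right; apply: (@sub_finite_set _ _ (-%R @` [set x | - b <= x <= - a /\ derive1 c x = 0])).
    move=> x /= [/andP[ax xb] cx]; exists (- x); rewrite ?opprK// !lerN2 ax xb.
    split=> //; apply/eqP; rewrite -oppr_eq0 -derive1_opp ?cx//.
    exact: tame_derivable.
  exact: finite_image.
Qed.

Lemma tame_critical_values_countable c : tame c ->
  countable [set v | exists2 x, derive1 c x = 0 & c x = v].
Proof.
move=> tc.
apply: (@sub_countable _ _ _ (\bigcup_(n : nat) (c @` [set x | - n%:R <= x <= n%:R /\ derive1 c x = 0]))).
  apply: subset_card_le => v [x dx <-]; exists (Num.truncn `|x|).+1 => //.
  exists x => //; split=> //; rewrite -ler_norml ltW//.
  exact: truncnS_gt.
apply: bigcup_countable => // n _; apply: finite_set_countable.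
have [[v cv]|] := tame_crit tc (- n%:R) n%:R; last exact: finite_image.
by apply: (@sub_finite_set _ _ [set v]) => // w [x _ <-]; rewrite cv.
Qed.

(** A one-dimensional Sard argument: on a compact interval a tame function has finitely many
    critical points or is constant. So critical values are countable, whereas an interval has
    positive Lebesgue measure. *)
Lemma exists_noncritical c c' a b : tame c -> tame c' -> a < b ->
  exists t, [/\ a < t < b, forall x, derive1 c x = 0 -> c x <> t &
    forall x, derive1 c' x = 0 -> c' x <> t].
Proof.
move=> tc tc' ab; apply: contrapT => hn.
pose V (f : R -> R) := [set v | exists2 x, derive1 f x = 0 & f x = v].
have : `]a, b[%classic `<=` V c `|` V c'.
  move=> t /=; rewrite in_itv/= => tab; apply: contrapT => /not_orP[h h'].
  by apply: hn; exists t; split=> // x dx cx; [apply: h|apply: h']; exists x.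
move=> /subset_card_le/sub_countable; have cU : countable (V c `|` V c').
  rewrite -bigcup2E; apply: bigcup_countable => // -[|[|i]] _ /=;
    [exact: tame_critical_values_countable..|exact: countable0].
move=> /(_ cU) /countable_lebesgue_measure0.
rewrite lebesgue_measure_itv/= lte_fin ab => /eqP.
by rewrite -EFinB eqe subr_eq0 gt_eqF.
Qed.

End TameSymmetries.

(** * Components of levels and the two sides of a point *)

Section BandDefs.
Variable R : realType.
Implicit Types (c : R -> R) (t x y w : R).

Definition dom c1 c2 t x : bool := c1 x <= t <= c2 x.

(** A level is a subset of the line, so its components are intervals; this is the relation of lying
    in the same one. *)
Definition lev c1 c2 t x y : Prop := forall w, btw x y w -> dom c1 c2 t w.

(* Walking from [x0] to [x] at height [t], one leaves the band through its
   lower boundary ([up]: the band then lies above), resp. its upper one. *)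
Definition up c1 c2 t x0 x : Prop :=
  exists y, [/\ btw x0 x y, t < c1 y & forall w, btw x0 y w -> t <= c2 w].
Definition dn c1 c2 t x0 x : Prop :=
  exists y, [/\ btw x0 x y, c2 y < t & forall w, btw x0 y w -> c1 w <= t].

(** One of the two sides of the point of the Reeb space represented by [(t0, x0)]. Over the
    component of [x0] the heights are compared; past an exit the side is decided by the boundary
    crossed, whatever [t] is. *)
Definition above c1 c2 t0 x0 t x : Prop :=
  up c1 c2 t0 x0 x \/ (lev c1 c2 t0 x0 x /\ t0 < t).
Definition below c1 c2 t0 x0 t x : Prop :=
  dn c1 c2 t0 x0 x \/ (lev c1 c2 t0 x0 x /\ t < t0).

Definition band_open c1 c2 (A : R -> R -> Prop) : Prop :=
  forall t x, dom c1 c2 t x -> A t x -> exists2 d, 0 < d &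
    forall t' x', dom c1 c2 t' x' -> `|t' - t| < d -> `|x' - x| < d -> A t' x'.

Lemma lev_refl c1 c2 t x : dom c1 c2 t x -> lev c1 c2 t x x.
Proof. by move=> h w; rewrite /btw orbb => /le_anti <-. Qed.

Lemma lev_sym c1 c2 t x y : lev c1 c2 t x y -> lev c1 c2 t y x.
Proof. by move=> h w; rewrite btwC => /h. Qed.

Lemma lev_trans c1 c2 t x y z :
  lev c1 c2 t x y -> lev c1 c2 t y z -> lev c1 c2 t x z.
Proof. by move=> h h' w /(btw_split y)/orP[/h|/h']. Qed.

Lemma lev_sub c1 c2 t x y z : lev c1 c2 t x y -> btw x y z -> lev c1 c2 t x z.
Proof. by move=> h xyz w /(btw_sub xyz)/h. Qed.

Lemma lev_doml c1 c2 t x y : lev c1 c2 t x y -> dom c1 c2 t x.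
Proof. by apply; exact: btwl. Qed.

Lemma lev_domr c1 c2 t x y : lev c1 c2 t x y -> dom c1 c2 t y.
Proof. by apply; exact: btwr. Qed.

Lemma dom_flip c1 c2 t x :
  dom (fun x => - c2 x) (fun x => - c1 x) (- t) x = dom c1 c2 t x.
Proof. by rewrite /dom !lerN2 andbC. Qed.

Lemma lev_flip c1 c2 t x y :
  lev (fun x => - c2 x) (fun x => - c1 x) (- t) x y <-> lev c1 c2 t x y.
Proof. by split=> h w /h; rewrite dom_flip. Qed.

Lemma up_flip c1 c2 t x y :
  up (fun x => - c2 x) (fun x => - c1 x) (- t) x y <-> dn c1 c2 t x y.
Proof.
by split=> -[z [h1 h2 h3]]; exists z; split=> //;
  [move: h2; rewrite ltrN2|move=> w /h3; rewrite lerN2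
  |rewrite ltrN2|move=> w /h3; rewrite lerN2].
Qed.

Lemma below_flip c1 c2 t0 x0 t x :
  above (fun x => - c2 x) (fun x => - c1 x) (- t0) x0 (- t) x <->
  below c1 c2 t0 x0 t x.
Proof.
split=> -[h|[h h']].
- by left; exact/up_flip.
- by right; split; [exact/lev_flip|move: h'; rewrite ltrN2].
- by left; exact/up_flip.
- by right; split; [exact/lev_flip|rewrite ltrN2].
Qed.

Lemma lev_opp c1 c2 t x y :
  lev (fun x => c1 (- x)) (fun x => c2 (- x)) t x y <-> lev c1 c2 t (- x) (- y).
Proof.
split=> h w; last by rewrite -btw_opp => /h.
by rewrite -[w]opprK btw_opp => /h; rewrite /dom opprK.
Qed.

Lemma up_opp c1 c2 t x y :
  up (fun x => c1 (- x)) (fun x => c2 (- x)) t x y <-> up c1 c2 t (- x) (- y).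
Proof.
split=> -[z [h1 h2 h3]]; exists (- z).
  split; rewrite ?btw_opp// => w; rewrite -[w]opprK btw_opp => /h3.
  by rewrite opprK.
split; rewrite ?opprK//; first by rewrite -btw_opp opprK.
by move=> w; rewrite -btw_opp opprK => /h3.
Qed.

Lemma dn_opp c1 c2 t x y :
  dn (fun x => c1 (- x)) (fun x => c2 (- x)) t x y <-> dn c1 c2 t (- x) (- y).
Proof.
split=> -[z [h1 h2 h3]]; exists (- z).
  split; rewrite ?btw_opp// => w; rewrite -[w]opprK btw_opp => /h3.
  by rewrite opprK.
split; rewrite ?opprK//; first by rewrite -btw_opp opprK.
by move=> w; rewrite -btw_opp opprK => /h3.
Qed.

Lemma cont_neg c : continuous c -> continuous (fun x => - c x).
Proof. by move=> cc w; apply: cvgN; exact: cc. Qed.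

Lemma cont_opp c : continuous c -> continuous (fun x => c (- x)).
Proof.
move=> cc w; apply: (@continuous_comp _ _ _ (fun x : R => - x) c); last exact: cc.
by apply: cvgN; exact: cvg_id.
Qed.

Lemma cont_gt c x t : continuous c -> t < c x ->
  exists2 d, 0 < d & forall y, `|y - x| < d -> t < c y.
Proof.
move=> cc tc; have /cvgrPdist_lt/(_ (c x - t)) := cc x.
rewrite subr_gt0 => /(_ tc) /nbhs_ballP[d /= d0 hd]; exists d => // y yd.
have /hd : ball x d y by rewrite /ball/= distrC.
by have := ler_norm (c x - c y); lra.
Qed.

Lemma cont_lt c x t : continuous c -> c x < t ->
  exists2 d, 0 < d & forall y, `|y - x| < d -> c y < t.
Proof.
move=> cc tc; have /cvgrPdist_lt/(_ (t - c x)) := cc x.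
rewrite subr_gt0 => /(_ tc) /nbhs_ballP[d /= d0 hd]; exists d => // y yd.
have /hd : ball x d y by rewrite /ball/= distrC.
by have := ler_norm (c y - c x); rewrite distrC; lra.
Qed.

End BandDefs.

Section Band.
Variables (R : realType) (c1 c2 : R -> R).
Hypotheses (cc1 : continuous c1) (cc2 : continuous c2) (c12 : forall x, c1 x < c2 x).
Implicit Types (t x y w : R).

Lemma band_exit t x0 y : x0 < y -> dom c1 c2 t x0 -> ~ lev c1 c2 t x0 y ->
  exists z, [/\ x0 <= z < y, lev c1 c2 t x0 z, c1 z = t \/ c2 z = t &
    forall e, 0 < e -> exists w, [/\ z < w < z + e, w <= y & ~~ dom c1 c2 t w]].
Proof.
(* [g] is the signed vertical distance to the boundary of the band, so that leaving the band is a
   change of sign. *)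
move=> xy dx nl; pose g w := Order.min (t - c1 w) (c2 w - t).
have gE w : (0 <= g w) = dom c1 c2 t w.
  by rewrite /g le_min !subr_ge0.
have cg : continuous g.
  move=> w; apply: (@continuous_min R R (fun w => t - c1 w) (fun w => c2 w - t)).
    by apply: cvgB; [exact: cvg_cst|exact: cc1].
  by apply: cvgB; [exact: cc2|exact: cvg_cst].
have [y' [xy' yy' gy']] : exists y', [/\ x0 < y', y' <= y & g y' < 0].
  move/existsNP: nl => [w /not_implyP[xw /negP ndw]].
  move: xw; rewrite /btw => /orP[]/andP[xw wy]; last lra.
  exists w; split=> //; last by rewrite ltNge gE.
  by rewrite lt_neqAle xw andbT; apply: contraNneq ndw => <-.
have g0 : 0 <= g x0 by rewrite gE.
have [z [/andP[xz zy'] gz gz0 hz]] := exit_point cg xy' g0 gy'.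
exists z; split.
- by rewrite xz (lt_le_trans zy').
- move=> w; rewrite /btw => /orP[]/andP[h1 h2].
    by rewrite -gE gz// h1.
  by rewrite -gE gz// (le_trans xz h1) (le_trans h2 xz).
- move: gz0; rewrite /g; case: (leP (t - c1 z) (c2 z - t)) => _ h.
    by left; lra.
  by right; lra.
- by move=> e /hz [w [? ? gw]]; exists w; split=> //; [lra|rewrite -gE -ltNge].
Qed.

(** Since [c1 < c2], the level touches only one boundary at its exit point. The other boundary stays
    away for a while, so the exit is through the first one. *)
Lemma trichotomy_right t x0 x : x0 < x -> dom c1 c2 t x0 ->
  [\/ lev c1 c2 t x0 x, up c1 c2 t x0 x | dn c1 c2 t x0 x].
Proof.
move=> xx dx; have [?|nl] := pselect (lev c1 c2 t x0 x); first exact: Or31.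
have [z [/andP[xz zx] lz zt hz]] := band_exit xx dx nl.
have seg w w' : btw x0 w w' -> z < w -> `|w' - z| <= `|w - z| \/ btw x0 z w'.
  by move=> /btw_near h _; case: (h z); [right|left].
case: zt => zt.
  have c2z : t < c2 z by rewrite -zt.
  have [d d0 hd] := cont_gt cc2 c2z.
  have [w [/andP[zw wd] wx ndw]] := hz d d0.
  have wz : `|w - z| < d by rewrite gtr0_norm ?subr_gt0//; lra.
  apply: Or32; exists w; split.
  - by rewrite /btw wx (le_trans xz (ltW zw)).
  - by move: ndw; rewrite /dom (ltW (hd _ wz)) andbT -ltNge.
  - move=> w' /seg/(_ zw)[h|/lz/andP[]//].
    by apply/ltW/hd/(le_lt_trans h).
have c1z : c1 z < t by rewrite -zt.
have [d d0 hd] := cont_lt cc1 c1z.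
have [w [/andP[zw wd] wx ndw]] := hz d d0.
have wz : `|w - z| < d by rewrite gtr0_norm ?subr_gt0//; lra.
apply: Or33; exists w; split.
- by rewrite /btw wx (le_trans xz (ltW zw)).
- by move: ndw; rewrite /dom (ltW (hd _ wz)) -ltNge.
- move=> w' /seg/(_ zw)[h|/lz/andP[]//].
  by apply/ltW/hd/(le_lt_trans h).
Qed.

(** The exit that comes first lies on the way to the other one, where the opposite inequality is
    required. *)
Lemma up_dn_excl t x0 x : up c1 c2 t x0 x -> dn c1 c2 t x0 x -> False.
Proof.
move=> [y [xy ty hy]] [z [xz tz hz]].
have [yz|zy] : btw x0 z y \/ btw x0 y z.
  move: xy xz; rewrite /btw => /orP[]/andP[? ?] /orP[]/andP[? ?];
    by case: (leP y z) => ?;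
    first [left; apply/orP; left; apply/andP; split; lra
          |left; apply/orP; right; apply/andP; split; lra
          |right; apply/orP; left; apply/andP; split; lra
          |right; apply/orP; right; apply/andP; split; lra].
  by have := hz _ yz; rewrite leNgt ty.
by have := hy _ zy; rewrite leNgt tz.
Qed.

Lemma lev_up_excl t x0 x : lev c1 c2 t x0 x -> up c1 c2 t x0 x -> False.
Proof. by move=> h [y [/h/andP[+ _] ty _]]; rewrite leNgt ty. Qed.

Lemma lev_dn_excl t x0 x : lev c1 c2 t x0 x -> dn c1 c2 t x0 x -> False.
Proof. by move=> h [y [/h/andP[_ +] ty _]]; rewrite leNgt ty. Qed.

Lemma above_below_excl t0 x0 t x :
  above c1 c2 t0 x0 t x -> below c1 c2 t0 x0 t x -> False.
Proof.
move=> [u|[l h]] [d|[l' h']].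
- exact: up_dn_excl u d.
- exact: lev_up_excl l' u.
- exact: lev_dn_excl l d.
- by move: h h'; lra.
Qed.

End Band.

Section BandSymmetric.
Variables (R : realType) (c1 c2 : R -> R).
Hypotheses (cc1 : continuous c1) (cc2 : continuous c2) (c12 : forall x, c1 x < c2 x).
Implicit Types (t x y w : R).

Lemma trichotomy t x0 x : dom c1 c2 t x0 ->
  [\/ lev c1 c2 t x0 x, up c1 c2 t x0 x | dn c1 c2 t x0 x].
Proof.
move=> dx; have [xx|xx|<-] := ltgtP x0 x; last by apply: Or31; exact: lev_refl.
  exact: trichotomy_right.
have := @trichotomy_right R _ _ (cont_opp cc1) (cont_opp cc2) (fun x => c12 (- x)) t (- x0) (- x).
rewrite ltrN2 /dom opprK => /(_ xx dx).
by move=> [/lev_opp|/up_opp|/dn_opp]; rewrite !opprK;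
  [apply: Or31|apply: Or32|apply: Or33].
Qed.

Lemma above_or_below t0 x0 t x : dom c1 c2 t0 x0 ->
  [\/ above c1 c2 t0 x0 t x, below c1 c2 t0 x0 t x | t = t0 /\ lev c1 c2 t0 x0 x].
Proof.
move=> dx; have [l|u|d] := trichotomy x dx; last 2 first.
- by apply: Or31; left.
- by apply: Or32; left.
by have [tt|tt|->] := ltgtP t t0; [apply: Or32|apply: Or31|apply: Or33];
  rewrite ?/above ?/below; [right|right|].
Qed.

(** An exit before [x] remains an exit for nearby points. Over the component of [x0], an exit
    through the upper boundary is impossible near [x], because [c2] stays above [t0] there. *)
Lemma above_open t0 x0 : dom c1 c2 t0 x0 -> band_open c1 c2 (above c1 c2 t0 x0).
Proof.
move=> d0 t x dx [[y [xy ty hy]]|[l tt]].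
  have [E|yx] := eqVneq y x.
    subst y; have t2 : t0 < c2 x by rewrite (lt_trans ty).
    have [e e0 he] := cont_gt cc1 ty; have [e' e'0 he'] := cont_gt cc2 t2.
    exists (Order.min e e'); first by rewrite lt_min e0.
    move=> t' x' _ _; rewrite lt_min => /andP[xe xe'].
    left; exists x'; split; [exact: btwr|exact: he|].
    move=> w /(@btw_near _ _ x)[/hy//|h].
    by apply/ltW/he'/(le_lt_trans h).
  exists `|x - y|; first by rewrite normr_gt0 subr_eq0 eq_sym.
  move=> t' x' _ _ xx; left; exists y; split=> //.
  move: xy yx xx; rewrite /btw => /orP[]/andP[h1 h2] yx.
    rewrite [`|x - y|]ger0_norm ?subr_ge0// => /ltr_normlP[h3 h4].
    by apply/orP; left; rewrite h1/=; lra.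
  rewrite [`|x - y|]ler0_norm ?subr_le0// => /ltr_normlP[h3 h4].
  by apply/orP; right; rewrite h2 andbT; lra.
have t2 : t0 < c2 x by move: dx => /andP[_]; exact: lt_le_trans.
have [e e0 he] := cont_gt cc2 t2.
exists (Order.min e (t - t0)); first by rewrite lt_min e0 subr_gt0.
move=> t' x' dx'; rewrite !lt_min => /andP[_ ht'] /andP[xe _].
have tt' : t0 < t' by have := ler_norm (- (t' - t)); rewrite normrN; lra.
have [l'|u|[y [xy yt hy]]] := trichotomy x' d0; [by right|by left|].
have [/l/andP[_]|h] := btw_near x xy; first by rewrite leNgt yt.
by have := he _ (le_lt_trans h xe); rewrite ltNge (ltW yt).
Qed.

End BandSymmetric.

Section BandFlip.
Variables (R : realType) (c1 c2 : R -> R).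
Hypotheses (cc1 : continuous c1) (cc2 : continuous c2) (c12 : forall x, c1 x < c2 x).

Lemma below_open t0 x0 : dom c1 c2 t0 x0 -> band_open c1 c2 (below c1 c2 t0 x0).
Proof.
move=> d0 t x dx bx.
have c12' x' : - c2 x' < - c1 x' by rewrite ltrN2.
have := @above_open R _ _ (cont_neg cc2) (cont_neg cc1) c12' (- t0) x0.
rewrite dom_flip => /(_ d0 (- t) x); rewrite dom_flip => /(_ dx).
case; first exact/below_flip.
move=> d dp hd; exists d => // t' x' dx' tt xx; apply/below_flip.
by apply: hd; rewrite ?dom_flip// -opprD normrN.
Qed.

End BandFlip.

(** * Windows around a component of a level *)

Section Windows.
Variable R : realType.
Implicit Types (c : R -> R) (t x y w eta : R) (P : R -> Prop).

(* [P] is a half-line bounded on the right (or the whole line) which no level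
   of height within [eta] of [t] leaves, and beyond [w] it contains no critical
   point of height within [eta] of [t] but different from [t]. *)
Record rwin c1 c2 t w P eta : Prop := RWin {
  rwin_base : P w;
  rwin_down : forall x y, P y -> x <= y -> P x;
  rwin_open : forall x, P x -> exists2 d, 0 < d & forall y, `|y - x| < d -> P y;
  rwin_lev : forall x t', w < x -> P x -> `|t' - t| <= eta -> dom c1 c2 t' x ->
    lev c1 c2 t' w x;
  rwin_barrier : forall x y t', P x -> ~ P y -> `|t' - t| <= eta ->
    ~ lev c1 c2 t' x y;
  rwin_crit1 : forall x, w < x -> P x -> derive1 c1 x = 0 ->
    c1 x = t \/ eta < `|c1 x - t|;
  rwin_crit2 : forall x, w < x -> P x -> derive1 c2 x = 0 ->
    c2 x = t \/ eta < `|c2 x - t|;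
  rwin_end1 : c1 w < t -> c1 w <= t - eta;
  rwin_end2 : t < c2 w -> t + eta <= c2 w }.

Definition lwin c1 c2 t w P eta :=
  rwin (fun x => c1 (- x)) (fun x => c2 (- x)) t (- w) (fun x => P (- x)) eta.

Lemma rwin_le c1 c2 t w P eta eta' : eta' <= eta ->
  rwin c1 c2 t w P eta -> rwin c1 c2 t w P eta'.
Proof.
move=> ee [h1 h2 h3 h4 h5 h6 h7 h8 h9]; split=> //.
- by move=> x t' wx Px tt; apply: h4 => //; exact: le_trans ee.
- by move=> x y t' Px Py tt; apply: h5 => //; exact: le_trans ee.
- by move=> x wx Px /(h6 _ wx Px)[?|?]; [left|right]; lra.
- by move=> x wx Px /(h7 _ wx Px)[?|?]; [left|right]; lra.
- by move=> /h8; lra.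
- by move=> /h9; lra.
Qed.

Lemma lwin_le c1 c2 t w P eta eta' : eta' <= eta ->
  lwin c1 c2 t w P eta -> lwin c1 c2 t w P eta'.
Proof. exact: rwin_le. Qed.

Lemma dist_flip (a b : R) : `|- a - b| = `|a - - b|.
Proof. by rewrite -normrN opprB !opprK addrC. Qed.

Lemma rwin_flip c1 c2 t w P eta :
  (forall x, derivable c1 x 1) -> (forall x, derivable c2 x 1) ->
  rwin c1 c2 t w P eta ->
  rwin (fun x => - c2 x) (fun x => - c1 x) (- t) w P eta.
Proof.
move=> d1 d2 [h1 h2 h3 h4 h5 h6 h7 h8 h9]; split=> //.
- move=> x t' wx Px tt dx; rewrite -[t']opprK; apply/lev_flip; apply: h4 => //.
    by rewrite dist_flip.
  by rewrite -(@dom_flip _ c1 c2) opprK.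
- move=> x y t' Px Py tt; rewrite -[t']opprK => /lev_flip; apply: h5 => //.
  by rewrite dist_flip.
- move=> x wx Px; rewrite derive1Nf// => /eqP; rewrite oppr_eq0 => /eqP/(h7 _ wx Px).
  by case=> [->|h]; [left|right; rewrite dist_flip opprK].
- move=> x wx Px; rewrite derive1Nf// => /eqP; rewrite oppr_eq0 => /eqP/(h6 _ wx Px).
  by case=> [->|h]; [left|right; rewrite dist_flip opprK].
- by move=> h; have /h9 : t < c2 w by [lra]; lra.
- by move=> h; have /h8 : c1 w < t by [lra]; lra.
Qed.

Lemma finite_gap (F : set R) z : finite_set F ->
  exists2 e, 0 < e & forall x, z < x < z + e -> ~ F x.
Proof.
move=> /finite_seqP[s ->]; elim: s => [|a s [e e0 he]].
  by exists 1 => // x _; rewrite /= in_nil.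
have [az|za] := leP a z.
  exists e => // x xe /=; rewrite in_cons => /orP[/eqP xa|]; last exact: he.
  by move: xe; rewrite xa; lra.
exists (Order.min e (a - z)); first by rewrite lt_min e0 subr_gt0.
move=> x; have : Order.min e (a - z) <= e by rewrite ge_min lexx.
have : Order.min e (a - z) <= a - z by rewrite ge_min lexx orbT.
move=> h1 h2 /andP[zx xe] /=; rewrite in_cons => /orP[/eqP xa|]; first by lra.
by apply: he; lra.
Qed.

Lemma finite_eta (F : set R) c t : finite_set F ->
  exists2 eta, 0 < eta & forall x, F x -> c x = t \/ eta < `|c x - t|.
Proof.
move=> /finite_seqP[s ->]; elim: s => [|a s [e e0 he]].
  by exists 1.
have [at'|at'] := eqVneq (c a) t.
  exists e => // x /=; rewrite in_cons => /orP[/eqP ->|]; [by left|exact: he].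
have a0 : 0 < `|c a - t| by rewrite normr_gt0 subr_eq0.
have h1 : Order.min e (`|c a - t| / 2) <= e by rewrite ge_min lexx.
have h2 : Order.min e (`|c a - t| / 2) <= `|c a - t| / 2.
  by rewrite ge_min lexx orbT.
exists (Order.min e (`|c a - t| / 2)); first by rewrite lt_min e0 divr_gt0.
move=> x /=; rewrite in_cons => /orP[/eqP ->|]; first by right; lra.
by case/he => ?; [left|right; lra].
Qed.

Lemma tame_eta c t a b : tame c -> exists2 eta, 0 < eta &
  forall x, a <= x <= b -> derive1 c x = 0 -> c x = t \/ eta < `|c x - t|.
Proof.
move=> tc; case: (tame_crit tc a b) => [[v cv]|fin].
  have [vt|vt] := eqVneq v t; first by exists 1 => // x _ _; left; rewrite cv.
  have v0 : 0 < `|v - t| by rewrite normr_gt0 subr_eq0.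
  exists (`|v - t| / 2); first by rewrite divr_gt0.
  by move=> x _ _; right; rewrite cv; lra.
have [eta eta0 h] := finite_eta c t fin.
by exists eta => // x xab dx; apply: h.
Qed.

Lemma end_eta a b t : exists2 eta, 0 < eta &
  ((a : R) < t -> a <= t - eta) /\ (t < b -> t + eta <= b).
Proof.
pose e := if a < t then t - a else 1; pose e' := if t < b then b - t else 1.
have e0 : 0 < e by rewrite /e; case: ifP => //; lra.
have e'0 : 0 < e' by rewrite /e'; case: ifP => //; lra.
have h1 : Order.min e e' <= e by rewrite ge_min lexx.
have h2 : Order.min e e' <= e' by rewrite ge_min lexx orbT.
exists (Order.min e e'); first by rewrite lt_min e0.
by split=> h; move: h1 h2; rewrite /e /e' h; lra.
Qed.

End Windows.

Section FiniteEnd.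
Variable R : realType.

(** Beyond [z] the lower boundary rises above [t] and, by tameness, has no critical point up to [B].
    It forms a wall of height [c1 B - t], which no level within half of this height of [t] can
    cross. *)
Lemma finite_right_end_lower (c1 c2 : R -> R) (t z : R) : tame c1 -> tame c2 ->
  c1 z = t -> t < c2 z ->
  (forall e, 0 < e -> exists w, [/\ z < w < z + e & ~~ dom c1 c2 t w]) ->
  exists B eta, [/\ z < B, 0 < eta, rwin c1 c2 t z (fun x => x < B) eta &
    forall x, z < x <= B -> t < c1 x].
Proof.
move=> tc1 tc2 zt zt2 hz.
have cc1 := tame_continuous tc1; have cc2 := tame_continuous tc2.
have m2 : (t + c2 z) / 2 < c2 z by lra.
have [e1 e10 he1] := cont_gt cc2 m2.
have out w : z < w < z + e1 -> ~~ dom c1 c2 t w -> t < c1 w.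
  move=> /andP[zw we]; have : (t + c2 z) / 2 < c2 w.
    by apply: he1; rewrite gtr0_norm ?subr_gt0//; lra.
  by move=> h; rewrite /dom negb_and -!ltNge => /orP[//|]; lra.
have nconst v : ~ forall x, c1 x = v.
  move=> h; have [w [zw /(out _ zw)]] := hz _ e10.
  by rewrite h -(h z) zt ltxx.
have [e2 e20 he2] : exists2 e, 0 < e & forall x, z < x < z + e -> c1 x <> t.
  case: (tame_level tc1 t z (z + 1)) => [/nconst//|/(@finite_gap _ _ z)[e e0 he]].
  exists (Order.min e 1); first by rewrite lt_min e0 ltr01.
  have h1 : Order.min e 1 <= e by rewrite ge_min lexx.
  have h2 : Order.min e 1 <= 1 by rewrite ge_min lexx orbT.
  move=> x xz cx; apply: (he x); first by move: xz; lra.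
  by split=> //; move: xz; lra.
have [e3 e30 he3] : exists2 e, 0 < e & forall x, z < x < z + e -> derive1 c1 x <> 0.
  case: (tame_crit tc1 z (z + 1)) => [[v /nconst]//|/(@finite_gap _ _ z)[e e0 he]].
  exists (Order.min e 1); first by rewrite lt_min e0 ltr01.
  have h1 : Order.min e 1 <= e by rewrite ge_min lexx.
  have h2 : Order.min e 1 <= 1 by rewrite ge_min lexx orbT.
  move=> x xz cx; apply: (he x); first by move: xz; lra.
  by split=> //; move: xz; lra.
pose e := Order.min e1 (Order.min e2 e3).
have e0 : 0 < e by rewrite !lt_min e10 e20.
have ee1 : e <= e1 by rewrite ge_min lexx.
have ee2 : e <= e2 by rewrite !ge_min lexx orbT.
have ee3 : e <= e3 by rewrite !ge_min lexx !orbT.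
pose B := z + e / 2.
have zB : z < B by rewrite /B; lra.
have c2B x : z <= x <= B -> (t + c2 z) / 2 < c2 x.
  by move=> /andP[h1 h2]; apply: he1; rewrite ger0_norm ?subr_ge0//; rewrite /B in h2; lra.
have c1B x : z < x <= B -> t < c1 x.
  move=> /andP[zx xB].
  have [w [/andP[zw wx] nw]] := hz (x - z) (ltac:(by rewrite subr_gt0)).
  have ctw : t < c1 w by apply: out nw; rewrite /B in xB; lra.
  rewrite ltNge; apply/negP => cx.
  have cw : {within `[w, x], continuous c1} by apply: continuous_subspaceT.
  have wx' : w <= x by lra.
  have [|v] := IVT wx' cw (v := t).
    by rewrite ge_min le_max cx orbT (ltW ctw).
  by rewrite in_itv/= => /andP[wv vx]; apply: he2; rewrite /B in xB; lra.
have cBt := c1B B (ltac:(by rewrite zB lexx)).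
(* The second bound keeps the upper boundary out of the window: on [[z, B]] it lies above
   [(t + c2 z) / 2]. *)
pose eta := Order.min ((c1 B - t) / 2) ((c2 z - t) / 2).
have eta0 : 0 < eta by rewrite lt_min !divr_gt0// subr_gt0.
have eta1 : eta <= (c1 B - t) / 2 by rewrite ge_min lexx.
have eta2 : eta <= (c2 z - t) / 2 by rewrite ge_min lexx orbT.
exists B, eta; split=> //; split=> //.
- by move=> x y yB xy; exact: le_lt_trans yB.
- move=> x xB; exists (B - x); first by rewrite subr_gt0.
  by move=> y; have := ler_norm (y - x); lra.
- move=> x t' zx xB tt /andP[cx _] w; rewrite /btw => /orP[]/andP[h1 h2]; last lra.
  have tt' : t' <= t + eta by have := ler_norm (t' - t); lra.
  apply/andP; split; last first.
    by have := c2B w; rewrite h1 (le_trans h2 (ltW xB)) => /(_ isT); lra.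
  apply: le_trans cx; rewrite leNgt; apply/negP => cw.
  have zw : z < w.
    rewrite lt_neqAle h1 andbT; apply: contraTneq cw => <-.
    by rewrite -leNgt zt ltW// c1B// zx ltW.
  have wx : w < x.
    by rewrite lt_neqAle h2 andbT; apply: contraTneq cw => ->; rewrite ltxx.
  (* A value of [c1] above [t'] at [w] forces a maximum between [z] and [x], that is, a critical
     point before [B]. *)
  have czw : c1 z < c1 w.
    by rewrite zt c1B// zw ltW// (lt_trans wx).
  have [u [/andP[zu ux] du _]] := interior_max (tame_derivable tc1) (ltac:(by rewrite zw wx) : z < w < x) czw cw.
  by apply: he3 du; rewrite /B in xB; lra.
- move=> x y t' xB /negP; rewrite -leNgt => By tt /(_ B).
  rewrite /btw (ltW xB) By /= => /(_ isT)/andP[cB _].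
  by have := ler_norm (t' - t); lra.
- move=> x zx xB dx; exfalso; apply: he3 dx; rewrite /B in xB; lra.
- move=> x zx xB dx; right; have := c2B x; rewrite (ltW zx) (ltW xB) => /(_ isT) h.
  by have := ler_norm (c2 x - t); lra.
- by lra.
- by lra.
Qed.

Lemma finite_right_end (c1 c2 : R -> R) (t x0 y : R) : tame c1 -> tame c2 ->
  (forall x, c1 x < c2 x) ->
  x0 <= y -> dom c1 c2 t x0 -> ~ lev c1 c2 t x0 y ->
  exists z B eta, [/\ x0 <= z < B, lev c1 c2 t x0 z, 0 < eta,
    rwin c1 c2 t z (fun x => x < B) eta &
    (forall x, z < x <= B -> t < c1 x) \/ (forall x, z < x <= B -> c2 x < t)].
Proof.
move=> tc1 tc2 c12 xy dx nl.
have {}xy : x0 < y.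
  by rewrite lt_neqAle xy andbT; apply/eqP => E; apply: nl; rewrite -E; exact: lev_refl.
have [z [/andP[xz zy] lz zt hz]] :=
  band_exit (tame_continuous tc1) (tame_continuous tc2) xy dx nl.
have hz' e : 0 < e -> exists w, [/\ z < w < z + e & ~~ dom c1 c2 t w].
  by move=> /hz[w [? _ ?]]; exists w.
case: zt => zt.
  have zt2 : t < c2 z by rewrite -zt.
  have [B [eta [zB eta0 wB cB]]] := finite_right_end_lower tc1 tc2 zt zt2 hz'.
  by exists z, B, eta; split=> //; [rewrite xz|left].
have zt1 : - t < - c1 z by rewrite ltrN2 -zt.
have zt' : - c2 z = - t by rewrite zt.
have [|B [eta [zB eta0 wB cB]]] := finite_right_end_lower (tameN tc2) (tameN tc1) zt' zt1.
  by move=> e /hz'[w [? ?]]; exists w; rewrite dom_flip.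
exists z, B, eta; split=> //; first by rewrite xz.
  have := rwin_flip (tame_derivable (tameN tc2)) (tame_derivable (tameN tc1)) wB.
  rewrite opprK; congr rwin; apply/funext => u; exact: opprK.
by right=> x /cB; rewrite ltrN2.
Qed.

(** As [c] tends to its upper bound [t], a decrease has to be made up for later. The minimum in
    between would be critical with a value below [t]. *)
Let eventually_monotone (c : R -> R) (t x0 M : R) : tame c ->
  c x @[x --> +oo] --> t -> (forall x, x0 <= x -> c x <= t) ->
  (forall x, M < x -> derive1 c x = 0 -> c x = t) ->
  forall x y, x0 <= x -> M < x -> x <= y -> c x <= c y.
Proof.
move=> tc ct cx hM x y x0x Mx xy; rewrite leNgt; apply/negP => cyx.
have cyt : c y < t by rewrite (lt_le_trans cyx)// cx.
have [q [yq cyq]] : exists q, y < q /\ c y < c q.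
  have /cvgrPdist_lt/(_ (t - c y)) := ct; rewrite subr_gt0 => /(_ cyt).
  move=> [M' [_ hM']]; pose q := Order.max (M' + 1) (y + 1).
  have q1 : M' + 1 <= q by rewrite le_max lexx.
  have q2 : y + 1 <= q by rewrite le_max lexx orbT.
  exists q; split; first by lra.
  have := hM' q (ltac:(lra)) => /=; have := ler_norm (t - c q); lra.
have xy' : x < y by rewrite lt_neqAle xy andbT; apply: contraTneq cyx => ->; rewrite ltxx.
have [z [/andP[xz zq] dz zmin]] := interior_min (tame_derivable tc)
  (ltac:(by rewrite xy' yq) : x < y < q) cyx cyq.
have := hM z (lt_trans Mx xz) dz; have := zmin y; rewrite xy (ltW yq) => /(_ isT).
by lra.
Qed.

(** Beyond [M] both boundaries are monotone and the band shrinks towards the height [t]; a height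
    inside the band over [x] is then inside it over all points between [w] and [x]. *)
Lemma infinite_right_end (c1 c2 : R -> R) (t x0 M : R) : tame c1 -> tame c2 ->
  c1 x @[x --> +oo] --> t -> c2 x @[x --> +oo] --> t ->
  (forall x, x0 <= x -> dom c1 c2 t x) ->
  (forall x, M < x -> derive1 c1 x = 0 -> c1 x = t) ->
  (forall x, M < x -> derive1 c2 x = 0 -> c2 x = t) ->
  exists w eta, [/\ x0 <= w, 0 < eta & rwin c1 c2 t w (fun _ => True) eta].
Proof.
move=> tc1 tc2 l1 l2 dx h1 h2.
have m1 := eventually_monotone tc1 l1 (fun x xx => proj1 (andP (dx x xx))) h1.
have l2' : - c2 x @[x --> +oo] --> - t by apply: cvgN.
have m2 := eventually_monotone (tameN tc2) l2' (fun x xx => ltac:(by rewrite lerN2; have /andP[] := dx x xx)) (M := M).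
pose w := Order.max x0 (M + 1).
have w1 : x0 <= w by rewrite le_max lexx.
have w2 : M < w by rewrite lt_max; apply/orP; right; lra.
have [eta eta0 [he1 he2]] := end_eta (c1 w) (c2 w) t.
exists w, eta; split=> //; split=> //.
- by move=> x _; exists 1.
- move=> x t' wx _ tt /andP[cx cx2] u; rewrite /btw => /orP[]/andP[ha hb]; last lra.
  apply/andP; split; first by apply: le_trans cx; apply: m1; lra.
  apply: le_trans cx2 _; rewrite -lerN2; apply: m2; try lra.
  move=> v Mv; rewrite derive1Nf; last exact: tame_derivable.
  by move=> /eqP; rewrite oppr_eq0 => /eqP/(h2 _ Mv) ->.
- by move=> x wx _ /h1 ->; [left|lra].
- by move=> x wx _ /h2 ->; [left|lra].
Qed.

End FiniteEnd.

(** * Branches over the compact core of a window *)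

Section Core.
Variables (R : realType) (c1 c2 : R -> R).
Hypotheses (tc1 : tame c1) (tc2 : tame c2).
Implicit Types (t x y w eta : R).

Lemma band_exit_left t x0 y : y < x0 -> dom c1 c2 t x0 -> ~ lev c1 c2 t x0 y ->
  exists z, [/\ y < z <= x0, lev c1 c2 t x0 z & c1 z = t \/ c2 z = t].
Proof.
move=> yx dx nl.
have yx' : - x0 < - y by rewrite ltrN2.
have dx' : dom (fun x => c1 (- x)) (fun x => c2 (- x)) t (- x0) by rewrite /dom opprK.
have nl' : ~ lev (fun x => c1 (- x)) (fun x => c2 (- x)) t (- x0) (- y).
  by move/lev_opp; rewrite !opprK.
have [z [/andP[xz zy] lz zt _]] := band_exit (cont_opp (tame_continuous tc1))
   (cont_opp (tame_continuous tc2)) yx' dx' nl'.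
exists (- z); split=> //; first by rewrite ltrNr lerNl zy.
by move/lev_opp: lz; rewrite opprK.
Qed.

(** Moving left from [x] at height [t + eta], one reaches [al] or a point where [c2 = t + eta]. The
    latter are finitely many, because [c2] cannot be constant at [t + eta], a height where it has no
    critical value. *)
Lemma core_tips t al be eta : al <= be -> 0 < eta -> lev c1 c2 t al be ->
  (forall x, al <= x <= be -> derive1 c2 x = 0 -> c2 x = t \/ eta < `|c2 x - t|) ->
  exists2 F : set R, finite_set F /\ F `<=` [set x | al <= x <= be] &
    forall x, al <= x <= be -> t + eta <= c2 x ->
      exists2 x', F x' & lev c1 c2 (t + eta) x x'.
Proof.
move=> ab eta0 lt crit2.
have lab x : al <= x <= be -> dom c1 c2 t x by move=> xab; apply: lt; rewrite /btw xab.
exists (al |` [set x | al <= x <= be /\ c2 x = t + eta]).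
  split; last by move=> x [->|[]//] /=; rewrite lexx.
  rewrite finite_setU; split; first exact: finite_set1.
  case: (tame_level tc2 (t + eta) al be) => // c2E; exfalso.
  have aab : al <= al <= be by rewrite lexx.
  have d0 : derive1 c2 al = 0.
    by have -> : c2 = cst (t + eta) by [apply/funext]; rewrite derive1E derive_cst.
  have := crit2 al aab d0; rewrite c2E addrAC subrr add0r gtr0_norm// ltxx.
  by case=> //; lra.
move=> x xab cx; have /andP[cx1 _] := lab _ xab.
have [l|nl] := pselect (lev c1 c2 (t + eta) x al).
  by exists al => //; left.
have dx : dom c1 c2 (t + eta) x by rewrite /dom cx andbT; lra.
have ax : al < x.
  have /andP[ax _] := xab; rewrite lt_neqAle ax andbT.
  by apply/eqP => E; apply: nl; rewrite -E; apply: lev_refl; rewrite E.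
have [z [/andP[az zx] lz [cz|cz]]] := band_exit_left ax dx nl; last first.
  exists z => //; right; split=> //.
  by move: xab => /andP[_ xb]; rewrite (ltW az) (le_trans zx).
have /lab/andP[] : al <= z <= be.
  by move: xab => /andP[_ xb]; rewrite (ltW az) (le_trans zx).
by rewrite cz; lra.
Qed.

(** Distinct legs of the star do not merge: otherwise [c2] would dip below [t + eta] between [x] and
    [y] without going below [t'], and its minimum would be a critical value strictly between [t] and
    [t + eta]. *)
Lemma core_merge t al be eta t' x y : lev c1 c2 t al be ->
  (forall x, al <= x <= be -> derive1 c2 x = 0 -> c2 x = t \/ eta < `|c2 x - t|) ->
  al <= x <= be -> al <= y <= be -> t + eta <= c2 x -> t + eta <= c2 y ->
  t < t' <= t + eta -> lev c1 c2 t' x y -> lev c1 c2 (t + eta) x y.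
Proof.
move=> lt crit2; wlog xy : x y / x <= y.
  move=> H xab yab cx cy tt l; have [xy|/ltW yx] := leP x y; first exact: H.
  by apply/lev_sym/H => //; exact/lev_sym.
move=> xab yab cx cy /andP[tt' tt''] l w; rewrite /btw => /orP[]/andP[h1 h2]; last first.
  have wE : w = y by lra.
  have xE : x = y by lra.
  have /andP[cw _] : dom c1 c2 t' w by apply: l; rewrite wE; exact: btwr.
  by rewrite /dom; apply/andP; split; [lra|rewrite wE].
have /andP[cw1 cw2] : dom c1 c2 t' w by apply: l; rewrite /btw h1 h2.
rewrite /dom (le_trans cw1)//= leNgt; apply/negP => cw.
have xw : x < w by rewrite lt_neqAle h1 andbT; apply: contraTneq cw => <-; rewrite -leNgt.
have wy : w < y by rewrite lt_neqAle h2 andbT; apply: contraTneq cw => ->; rewrite -leNgt.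
have [z [/andP[xz zy] dz zmin]] := interior_min (tame_derivable tc2)
  (ltac:(by rewrite xw wy) : x < w < y) (lt_le_trans cw cx) (lt_le_trans cw cy).
have /andP[_ cz] : dom c1 c2 t' z by apply: l; rewrite /btw (ltW xz) (ltW zy).
have := zmin w; rewrite h1 h2 => /(_ isT) czw.
case: (crit2 z _ dz); first by lra.
  by lra.
by rewrite gtr0_norm; lra.
Qed.

End Core.

Section Climb.
Variable R : realType.
Implicit Types (t x y w eta : R).

(** The right half of [core_climb]; the left half is its mirror image. The level [t'] cannot reach
    [be]: if [c2 be] exceeds [t] at all, it is at least [t + eta], so [be] would be a point of the
    kind ruled out. *)
Lemma climb_right (c1 c2 : R -> R) t be eta t' x : tame c1 -> tame c2 ->
  0 < eta -> x <= be -> (forall y, x <= y <= be -> dom c1 c2 t y) ->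
  (t < c2 be -> t + eta <= c2 be) -> t < t' -> t' <= c2 x ->
  (forall y, x <= y <= be -> lev c1 c2 t' x y -> c2 y < t + eta) ->
  exists w, [/\ x < w <= be, c2 w < t' & forall u, x <= u <= w -> c2 u < t + eta].
Proof.
move=> tc1 tc2 eta0 xb dt e2 tt' tx H.
have dx : dom c1 c2 t' x.
  have /andP[h _] := dt x (ltac:(by rewrite lexx xb)).
  by rewrite /dom tx andbT; lra.
have nl : ~ lev c1 c2 t' x be.
  move=> l; have := H be; rewrite xb lexx => /(_ isT l).
  have /andP[_ h] := lev_domr l.
  by have := e2 (lt_le_trans tt' h); lra.
have xb' : x < be.
  rewrite lt_neqAle xb andbT; apply/eqP => E; apply: nl; rewrite -E.
  exact: lev_refl.
have [z [/andP[xz zb] lz _ hz]] :=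
  band_exit (tame_continuous tc1) (tame_continuous tc2) xb' dx nl.
have cz : c2 z < t + eta by apply: H => //; rewrite xz ltW.
have [d d0 hd] := cont_lt (tame_continuous tc2) cz.
have [w [/andP[zw wd] wb nd]] := hz d d0.
have xw : x < w by lra.
exists w; split; first by rewrite xw.
  have /andP[h _] := dt w (ltac:(by rewrite (ltW xw) wb)).
  by move: nd; rewrite /dom negb_and -!ltNge => /orP[|//]; lra.
move=> u /andP[xu uw]; have [uz|zu] := leP u z.
  apply: H; first by rewrite xu; lra.
  by apply: lev_sub lz _; rewrite /btw xu uz.
by apply: hd; rewrite gtr0_norm ?subr_gt0//; lra.
Qed.

(** A component of the level [t'] over which [c2] stays below [t + eta] would lie under a bump of
    [c2], whose top is a critical value strictly between [t] and [t + eta]. *)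
Lemma core_climb (c1 c2 : R -> R) t al be eta t' x : tame c1 -> tame c2 ->
  0 < eta -> lev c1 c2 t al be ->
  (forall x, al <= x <= be -> derive1 c2 x = 0 -> c2 x = t \/ eta < `|c2 x - t|) ->
  (t < c2 al -> t + eta <= c2 al) -> (t < c2 be -> t + eta <= c2 be) ->
  al <= x <= be -> t < t' <= t + eta -> t' <= c2 x ->
  exists y, [/\ al <= y <= be, t + eta <= c2 y & lev c1 c2 t' x y].
Proof.
move=> tc1 tc2 eta0 lt crit2 ea eb /andP[ax xb] /andP[tt' t'e] tx.
apply: contrapT => /forallNP H.
have lab y : al <= y <= be -> dom c1 c2 t y by move=> xab; apply: lt; rewrite /btw xab.
have H' y : al <= y <= be -> lev c1 c2 t' x y -> c2 y < t + eta.
  by move=> yab l; rewrite ltNge; apply/negP => cy; apply: (H y).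
have [w2 [/andP[xw2 w2b] cw2 h2]] :=
  climb_right tc1 tc2 eta0 xb (fun y hy => lab y (ltac:(lra))) eb tt' tx
  (fun y hy => H' y (ltac:(lra))).
have xb' : - x <= - al by rewrite lerN2.
have lab' y : - x <= y <= - al -> dom (fun x => c1 (- x)) (fun x => c2 (- x)) t y.
  by move=> hy; apply: (lab (- y)); lra.
have ea' : t < c2 (- - al) -> t + eta <= c2 (- - al) by rewrite opprK.
have tx' : t' <= c2 (- - x) by rewrite opprK.
have H'' y : - x <= y <= - al ->
    lev (fun x => c1 (- x)) (fun x => c2 (- x)) t' (- x) y -> c2 (- y) < t + eta.
  by move=> hy /lev_opp; rewrite opprK; apply: H'; lra.
have [w1 [/andP[xw1 w1a] cw1 h1]] := climb_right (tame_opp tc1) (tame_opp tc2)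
  eta0 xb' lab' ea' tt' tx' H''.
have [z [/andP[xz zy] dz zmax]] := interior_max (tame_derivable tc2)
  (ltac:(lra) : - w1 < x < w2) (lt_le_trans cw1 tx) (lt_le_trans cw2 tx).
have czx : c2 x <= c2 z by apply: zmax; lra.
have cze : c2 z < t + eta.
  have [xz'|zx] := leP x z; first by apply: h2; lra.
  by have := h1 (- z); rewrite opprK; apply; lra.
case: (crit2 z _ dz); first by lra.
  by lra.
by rewrite gtr0_norm; lra.
Qed.

End Climb.

(** * Star-shaped neighbourhoods *)

Section Subspaces.

Lemma homeomorphic_sub (T U : topologicalType) (A : set T) (B : set U)
    (f : T -> U) (g : U -> T) :
  {within A, continuous f} -> {within B, continuous g} ->
  (forall x, A x -> B (f x)) -> (forall y, B y -> A (g y)) ->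
  (forall x, A x -> g (f x) = x) -> (forall y, B y -> f (g y) = y) ->
  homeomorphic (subsp A) (subsp B).
Proof.
move=> cf cg AB BA gf fg.
pose f' (x : set_type A) : set_type B := SigSub (mem_set (AB _ (set_valP x))).
pose g' (y : set_type B) : set_type A := SigSub (mem_set (BA _ (set_valP y))).
exists f', g'; split.
- apply: (@continuous_comp_initial (set_type B) (set_type A) U set_val f').
  by move/subspace_sigL_continuousP: cf.
- apply: (@continuous_comp_initial (set_type A) (set_type B) T set_val g').
  by move/subspace_sigL_continuousP: cg.
- by move=> x; apply: val_inj => /=; apply: gf; exact: set_valP.
- by move=> y; apply: val_inj => /=; apply: fg; exact: set_valP.
Qed.

Lemma homeomorphic_refl (T : topologicalType) : homeomorphic T T.
Proof. by exists id, id; split=> // x; exact: cvg_id. Qed.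

Lemma homeomorphic_trans (T U V : topologicalType) :
  homeomorphic T U -> homeomorphic U V -> homeomorphic T V.
Proof.
move=> [f [g [cf cg fg gf]]] [f' [g' [cf' cg' fg' gf']]].
exists (f' \o f), (g \o g'); split.
- by move=> x; apply: continuous_comp; [exact: cf|exact: cf'].
- by move=> x; apply: continuous_comp; [exact: cg'|exact: cg].
- by move=> x /=; rewrite fg'.
- by move=> x /=; rewrite gf.
Qed.

End Subspaces.

(** * Finite stars are graphs *)

Section StarGraph.
Variables (R : realType) (T : topologicalType) (s : T) (F : set T).
Variables (gam : T -> R -> T) (h : T -> T -> R).
Local Notation I := (`[(-1 : R), 1]%classic).
Local Notation J := (`](-1 : R), 1[%classic).
Hypotheses (hT : hausdorff_space T) (finF : finite_set F).
Hypothesis gam_cont : forall u, F u -> {within I, continuous (gam u)}.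
Hypothesis h_cont : forall u, F u -> continuous (h u).
Hypothesis hK : forall u r, F u -> I r -> h u (gam u r) = r.
Hypothesis gamN1 : forall u, F u -> gam u (-1) = s.
Hypothesis gam1 : forall u, F u -> gam u 1 = u.
Hypothesis gam_inj : forall u v r r', F u -> F v -> I r -> I r' ->
  gam u r = gam v r' -> -1 < r -> u = v.
Hypothesis gam_cover : forall x, x = s \/ exists u, F u /\ exists2 r, I r & x = gam u r.

Let I1 : I 1. Proof. by rewrite /= in_itv/= lexx andbT; lra. Qed.
Let IN1 : I (-1). Proof. by rewrite /= in_itv/= lexx/=; lra. Qed.
Let JI r : J r -> I r.
Proof. by rewrite /= !in_itv/= => /andP[/ltW-> /ltW->]. Qed.

Let leg u := gam u @` J.

Let leg_closure u : F u -> closure (leg u) = gam u @` I.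
Proof.
move=> Fu; apply/seteqP; split.
  have cI : closed (gam u @` I).
    by apply: compact_closed => //; apply: continuous_compact;
      [exact: gam_cont|exact: segment_compact].
  rewrite [X in _ `<=` X](closure_id _).1//; apply: closureS.
  by move=> _ [r /JI Ir <-]; exists r.
move=> _ [r Ir <-] B nB.
have := @gam_cont u Fu r B nB.
rewrite /= /nbhs /= -nbhs_subspace_in// => /nbhs_ballP[d /= d0 hd].
have [r' [Jr' rr']] : exists r', J r' /\ ball r d r'.
  have m0 : 0 < Order.min (d / 2) 1 by rewrite lt_min ltr01 divr_gt0.
  have m1 : Order.min (d / 2) 1 <= d / 2 by rewrite ge_min lexx.
  have m2 : Order.min (d / 2) 1 <= 1 by rewrite ge_min lexx orbT.
  move: Ir; rewrite /= in_itv/= => /andP[r1 r2].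
  have [r0|r0] := leP r 0.
    exists (r + Order.min (d / 2) 1 / 2); split; first by rewrite in_itv/=; lra.
    by rewrite /ball/= opprD addrA subrr sub0r normrN gtr0_norm; lra.
  exists (r - Order.min (d / 2) 1 / 2); split; first by rewrite in_itv/=; lra.
  by rewrite /ball/= opprB addrCA subrr addr0 gtr0_norm; lra.
exists (gam u r'); split; first by exists r'.
by apply: (hd r' rr'); exact: JI.
Qed.

Let leg_ends u : F u -> closure (leg u) `\` leg u `<=` [set s; u].
Proof.
move=> Fu; rewrite leg_closure// => _ [[r Ir <-] nl].
move: (Ir); rewrite /= in_itv/= => /andP[r1 r2].
have [->|r1'] := eqVneq r (-1); first by left; rewrite gamN1.
have [->|r2'] := eqVneq r 1; first by right; rewrite gam1.
exfalso; apply: nl; exists r => //=; rewrite in_itv/=.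
by rewrite !lt_neqAle r1 r2 r2' eq_sym r1'.
Qed.

Let leg_avoids u x : F u -> leg u x -> ~ (s |` F) x.
Proof.
move=> Fu [r Jr <-]; have Ir := JI Jr.
have rN1 : -1 < r by move: Jr; rewrite /= in_itv/= => /andP[].
have r1 : r < 1 by move: Jr; rewrite /= in_itv/= => /andP[].
case=> [|Fg]; first rewrite -(gamN1 Fu) => E.
  by have := hK Fu Ir; rewrite E hK// => E'; move: rN1; rewrite E' ltxx.
have E : gam u r = gam (gam u r) 1 by rewrite gam1.
have uE := gam_inj Fu Fg Ir I1 E rN1.
have := hK Fu Ir; rewrite -uE => E'; have := hK Fu I1; rewrite gam1// E' => r1'.
by move: r1; rewrite r1' ltxx.
Qed.

Let within_h u A : F u -> {within A, continuous (h u)}.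
Proof. by move=> Fu; apply: continuous_subspaceT; exact: h_cont. Qed.

(** Each leg is one edge, with the centre and its tip as endpoints; [h u] supplies the continuous
    inverse of [gam u]. The weak topology comes for free with finitely many closed legs. *)
Lemma star_graph : is_graph R T.
Proof.
split=> //; exists (s |` F), [set leg u | u in F].
have tE : trivIset [set leg u | u in F] id.
  move=> _ _ [u Fu <-] [v Fv <-] [x [[r Jr <-] [r' Jr' E]]].
  have rN1 : -1 < r by move: Jr; rewrite /= in_itv/= => /andP[].
  by have -> := gam_inj Fu Fv (JI Jr) (JI Jr') (esym E) rN1.
split.
- move=> _ [u Fu <-]; apply: (@homeomorphic_sub _ _ _ _ (h u) (gam u)).
  + exact: within_h.
  + by apply: continuous_subspaceW (gam_cont Fu) => r /JI.
  + by move=> _ [r Jr <-]; rewrite hK//; exact: JI.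
  + by move=> r Jr; exists r.
  + by move=> _ [r Jr <-]; rewrite hK//; exact: JI.
  + by move=> r Jr; rewrite hK//; exact: JI.
- split=> //.
    move=> _ [u Fu <-]; apply/seteqP; split=> // x [/(leg_avoids Fu) h1 h2].
    exact: h1.
  apply/seteqP; split=> // x _; have [->|[u [Fu [r Ir ->]]]] := gam_cover x.
    by left; left.
  have [->|r1'] := eqVneq r (-1); first by left; left; rewrite gamN1.
  have [->|r2'] := eqVneq r 1; first by left; right; rewrite gam1.
  right; exists (leg u); first by exists u.
  exists r => //=; move: Ir; rewrite /= !in_itv/= => /andP[r1 r2].
  by rewrite !lt_neqAle r1 r2 r2' eq_sym r1'.
- by move=> _ [u Fu <-] x /(leg_ends Fu)[->|->]; [left|right].
- split.
  + move=> _ [u Fu <-]; exists (gam u); split=> //.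
    * exact: gam_cont.
    * move=> r r'; rewrite !inE => /JI Ir /JI Ir' E.
      by rewrite -(hK Fu Ir) E hK.
    * by rewrite gamN1//; left.
    * by rewrite gam1//; right.
  + move=> _ [u Fu <-]; apply: sub_finite_set (leg_ends Fu) _.
    exact: finite_set2.
  + move=> A cA.
    have -> : A = (A `&` (s |` F)) `|` \bigcup_(u in F) (A `&` closure (leg u)).
      apply/seteqP; split=> x; last by case=> [[]//|[u _ []]].
      move=> Ax; have [xs|[u [Fu [r Ir xE]]]] := gam_cover x.
        by left; split=> //; left.
      right; exists u => //; split=> //; rewrite leg_closure// xE.
      by exists r.
    apply: closedU.
      apply: (accessible_finite_set_closed.1 (hausdorff_accessible hT)).
      apply: sub_finite_set (@subIsetr _ _ _) _; rewrite finite_setU; split=> //.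
    apply: closed_bigcup => // u Fu; apply: cA; by exists u.
- split.
  + move=> x; exists setT; first exact: filterT.
    split; first by rewrite setIT finite_setU; split.
    apply: sub_finite_set (_ : _ `<=` [set leg u | u in F]) _; first by move=> e [].
    exact: finite_image.
  + move=> _ [u Fu <-]; rewrite leg_closure//.
    apply: (@homeomorphic_sub _ _ _ _ (h u) (gam u)).
    * exact: within_h.
    * exact: gam_cont.
    * by move=> _ [r Jr <-]; rewrite hK.
    * by move=> r Jr; exists r.
    * by move=> _ [r Jr <-]; rewrite hK.
    * by move=> r Jr; rewrite hK.
Qed.

End StarGraph.

Section StarSub.
Variables (R : realType) (G : topologicalType) (U : set G) (s : G) (F : set G).
Variables (gam : G -> R -> G) (h : G -> G -> R).
Local Notation I := (`[(-1 : R), 1]%classic).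

(** Separation is asked of the points of [U] only, since [strip] controls a Reeb space only at its
    good levels. *)
Lemma star_graph_sub :
  (forall x y, U x -> U y -> cluster (nbhs x) y -> x = y) -> finite_set F ->
  U s -> F `<=` U ->
  (forall u r, F u -> I r -> U (gam u r)) ->
  (forall u, F u -> {within I, continuous (gam u)}) ->
  (forall u, F u -> continuous (h u)) ->
  (forall u r, F u -> I r -> h u (gam u r) = r) ->
  (forall u, F u -> gam u (-1) = s) -> (forall u, F u -> gam u 1 = u) ->
  (forall u v r r', F u -> F v -> I r -> I r' ->
     gam u r = gam v r' -> -1 < r -> u = v) ->
  (forall x, U x -> x = s \/ exists u, F u /\ exists2 r, I r & x = gam u r) ->
  is_graph R (subsp U).
Proof.
move=> hU finF Us FU gU gc hc hK g0 g1 gi gcov.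
pose s' : set_type U := SigSub (mem_set Us).
pose F' : set (set_type U) := [set u | F (\val u)].
pose gam' (u : set_type U) (r : R) : set_type U :=
  if pselect (U (gam (\val u) r)) is left Ug then SigSub (mem_set Ug) else s'.
have gE (u : set_type U) r : F' u -> I r -> \val (gam' u r) = gam (\val u) r.
  move=> Fu Ir; rewrite /gam'; case: pselect => // ng.
  by exfalso; apply: ng; exact: gU.
pose h' (u x : set_type U) := h (\val u) (\val x).
have cv : continuous (set_val : set_type U -> G) by exact: initial_continuous.
apply: (@star_graph R (subsp U) s' F' gam' h').
- move=> x y xy; apply: val_inj; apply: hU; [exact: set_valP|exact: set_valP|].
  move=> B C nB nC; have [z [Bz Cz]] := xy _ _ (cv x _ nB) (cv y _ nC).
  by exists (set_val z).
- have -> : F' = set_val @^-1` F by [].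
  by apply: finite_preimage => // x y _ _; exact: val_inj.
- move=> u Fu.
  apply: (@continuous_comp_initial (set_type U) (subspace I) G set_val (gam' u)).
  apply: (@subspace_eq_continuous _ _ _ (gam (\val u))); last exact: gc.
  by move=> r; rewrite inE => Ir; rewrite /= -gE.
- by move=> u Fu x; apply: continuous_comp; [exact: cv|exact: hc].
- by move=> u r Fu Ir; rewrite /h' gE// hK.
- move=> u Fu; apply: val_inj; rewrite gE ?g0//.
  by rewrite /= in_itv/= lexx/=; lra.
- move=> u Fu; apply: val_inj; rewrite gE ?g1//.
  by rewrite /= in_itv/= lexx andbT; lra.
- move=> u v r r' Fu Fv Ir Ir' E r1; apply: val_inj.
  by apply: (gi _ _ r r') => //; rewrite -!gE// E.
- move=> x; have [xs|[u [Fu [r Ir xE]]]] := gcov _ (set_valP x).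
    by left; apply: val_inj.
  right; exists (SigSub (mem_set (FU _ Fu))); split=> //.
  by exists r => //; apply: val_inj; rewrite gE.
Qed.

End StarSub.

(** * Reeb spaces described by a band, and their windows *)

Section Strip.
Variable R : realType.
Implicit Types (c : R -> R) (t x y : R).

(* In a level that is not good, the two sheets of the zero-set over the whole
   line need not be connected to each other when [m = 2]. *)
Definition good c1 c2 t : Prop := exists y, ~~ (c1 y < t < c2 y).

(* [G] is a Reeb space of the projection to the [t]-axis: away from the levels
   that are not good, its points are the components of the levels of the band,
   [Q t x] being the component of the point of height [t] over [x]. *)
Record strip (G : topologicalType) c1 c2 (Q : R -> R -> G) (cb : G -> R) : Prop :=
  Strip {
  strip_surj : forall g, good c1 c2 (cb g) ->
    exists2 x, dom c1 c2 (cb g) x & Q (cb g) x = g;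
  strip_eq : forall t x y, good c1 c2 t -> dom c1 c2 t x -> dom c1 c2 t y ->
    (Q t x = Q t y <-> lev c1 c2 t x y);
  strip_val : forall t x, dom c1 c2 t x -> cb (Q t x) = t;
  strip_band_open : forall O : set G, open O ->
    band_open c1 c2 (fun t x => O (Q t x));
  strip_cont : continuous cb }.

Definition window (G : topologicalType) c1 c2 (Q : R -> R -> G)
    (P1 P2 : R -> Prop) (t eta : R) : set G :=
  [set g | exists t' x, [/\ dom c1 c2 t' x, P1 x /\ P2 x, `|t' - t| <= eta &
                            g = Q t' x]].

Definition owindow (G : topologicalType) c1 c2 (Q : R -> R -> G)
    (P1 P2 : R -> Prop) (t eta : R) : set G :=
  [set g | exists t' x, [/\ dom c1 c2 t' x, P1 x /\ P2 x, `|t' - t| < eta &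
                            g = Q t' x]].

Lemma good_flip c1 c2 t :
  good (fun x => - c2 x) (fun x => - c1 x) (- t) <-> good c1 c2 t.
Proof. by split=> -[y h]; exists y; move: h; rewrite !ltrN2 andbC. Qed.

Lemma band_open_flip c1 c2 (A : R -> R -> Prop) : band_open c1 c2 A ->
  band_open (fun x => - c2 x) (fun x => - c1 x) (fun t x => A (- t) x).
Proof.
move=> oA t x dx Ax; have [|d d0 hd] := oA (- t) x _ Ax.
  by rewrite -(@dom_flip _ c1 c2) opprK.
exists d => // t' x' dx' tt xx; apply: hd => //.
  by rewrite -(@dom_flip _ c1 c2) opprK.
by rewrite dist_flip opprK.
Qed.

Lemma strip_flip (G : topologicalType) c1 c2 (Q : R -> R -> G) cb : strip c1 c2 Q cb ->
  strip (fun x => - c2 x) (fun x => - c1 x) (fun t x => Q (- t) x)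
    (fun g => - cb g).
Proof.
move=> [h1 h2 h3 h4 h5]; split.
- move=> g /good_flip/h1[x dx Qx]; exists x; rewrite ?dom_flip//.
  by rewrite opprK.
- move=> t x y gt dx dy; have := lev_flip c1 c2 (- t) x y; rewrite opprK => ->.
  apply: h2; first by apply/good_flip; rewrite opprK.
  1-2: by rewrite -(@dom_flip _ c1 c2) opprK.
- by move=> t x dx; rewrite h3 ?opprK// -(@dom_flip _ c1 c2) opprK.
- by move=> O oO; exact: (band_open_flip (h4 O oO)).
- by move=> g; apply: (@cvgN _ _ _ _ _ cb); exact: h5.
Qed.

Lemma strip_path (G : topologicalType) c1 c2 (Q : R -> R -> G) cb (f : R -> R) (A : set R) x :
  strip c1 c2 Q cb -> continuous f -> (forall r, A r -> dom c1 c2 (f r) x) ->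
  {within A, continuous (fun r => Q (f r) x)}.
Proof.
move=> st cf dA; apply/subspace_continuousP => r Ar B.
rewrite nbhsE => -[V [oV Vr] VB].
have [d d0 hd] := strip_band_open st oV (dA r Ar) Vr.
have : \forall r' \near r, `|f r' - f r| < d.
  have /cvgrPdist_lt/(_ d d0) := cf r.
  by apply: filterS => r'; rewrite distrC.
move=> hr; rewrite /nbhs/= /within/=; near=> r' => Ar'; apply: VB; apply: hd.
- exact: dA.
- by near: r'.
- by rewrite subrr normr0.
Unshelve. all: by end_near. Qed.

(** The part of [rwin] that makes windows saturated and open. In contrast with [rwin] it exists at
    every point, even where critical points accumulate; see [near_window]. *)
Record hwin c1 c2 t (w : R) (P : R -> Prop) (eta : R) : Prop := HWin {
  hwin_base : P w;
  hwin_down : forall x y, P y -> x <= y -> P x;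
  hwin_open : forall x, P x -> exists2 d, 0 < d & forall y, `|y - x| < d -> P y;
  hwin_barrier : forall x y t', P x -> ~ P y -> `|t' - t| <= eta ->
    ~ lev c1 c2 t' x y }.

Lemma rwin_hwin c1 c2 t w P eta : rwin c1 c2 t w P eta -> hwin c1 c2 t w P eta.
Proof. by case. Qed.

Section OpenWindow.
Variables (c1 c2 : R -> R) (G : topologicalType) (Q : R -> R -> G) (cb : G -> R).
Hypothesis st : strip c1 c2 Q cb.
Variables (t al be eta : R) (P1 P2 : R -> Prop).
Hypothesis goodt : forall t', `|t' - t| <= eta -> good c1 c2 t'.
Hypotheses (lw : hwin (fun x => c1 (- x)) (fun x => c2 (- x)) t (- al)
  (fun x => P1 (- x)) eta) (rw : hwin c1 c2 t be P2 eta).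

Lemma window_barrier x y t' : P1 x -> P2 x -> `|t' - t| <= eta ->
  lev c1 c2 t' x y -> P1 y /\ P2 y.
Proof.
move=> p1 p2 tt l; split; apply: contrapT => np; last first.
  exact: (hwin_barrier rw p2 np tt l).
apply: (@hwin_barrier _ _ _ _ _ _ lw (- x) (- y) t'); rewrite ?opprK//.
by apply/lev_opp; rewrite !opprK.
Qed.

(** The barriers make the window saturated: membership does not depend on the representative
    chosen. *)
Lemma windowP t' x : dom c1 c2 t' x -> window c1 c2 Q P1 P2 t eta (Q t' x) ->
  [/\ P1 x, P2 x & `|t' - t| <= eta].
Proof.
move=> dx [t'' [y [dy [p1 p2] tt E]]].
have tE : t' = t'' by have := congr1 cb E; rewrite !(strip_val st).
subst t''; have /(strip_eq st (goodt tt) dy dx) l := esym E.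
by have [] := window_barrier p1 p2 tt l.
Qed.

Lemma window_owindow : owindow c1 c2 Q P1 P2 t eta `<=` window c1 c2 Q P1 P2 t eta.
Proof. by move=> g [t' [x [h1 h2 h3 h4]]]; exists t', x; split=> //; exact: ltW. Qed.

Lemma owindowP t' x : dom c1 c2 t' x -> owindow c1 c2 Q P1 P2 t eta (Q t' x) ->
  [/\ P1 x, P2 x & `|t' - t| < eta].
Proof.
move=> dx ow; have [p1 p2 _] := windowP dx (window_owindow ow); split=> //.
have [t'' [y [dy _ tt E]]] := ow.
by have := congr1 cb E; rewrite !(strip_val st)// => ->.
Qed.

Lemma owindow_band_open :
  band_open c1 c2 (fun t' x => owindow c1 c2 Q P1 P2 t eta (Q t' x)).
Proof.
move=> t' x dx /(owindowP dx)[p1 p2 tt].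
have p1' : P1 (- - x) by rewrite opprK.
have [d1 d10 h1] := hwin_open lw p1'.
have [d2 d20 h2] := hwin_open rw p2.
exists (Order.min (Order.min d1 d2) (eta - `|t' - t|)).
  by rewrite !lt_min d10 d20 subr_gt0.
move=> t'' y dy; rewrite !lt_min => /andP[_ ht''] /andP[/andP[y1 y2] _].
exists t'', y; split=> //.
  split; last exact: h2.
  have := h1 (- y); rewrite /= !opprK; apply.
  by rewrite addrC distrC.
have -> : t'' - t = (t'' - t') + (t' - t) by lra.
by apply: le_lt_trans (ler_normD _ _) _; lra.
Qed.

End OpenWindow.

Section Star.
Variables (c1 c2 : R -> R) (G : topologicalType) (Q : R -> R -> G) (cb : G -> R).
Hypotheses (tc1 : tame c1) (tc2 : tame c2) (st : strip c1 c2 Q cb).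
Hypothesis hG : forall x y : G, good c1 c2 (cb x) -> good c1 c2 (cb y) ->
  cluster (nbhs x) y -> x = y.
Variables (t al be eta : R) (P1 P2 : R -> Prop).
Hypotheses (ab : al <= be) (eta0 : 0 < eta) (lt : lev c1 c2 t al be).
Hypothesis goodt : forall t', `|t' - t| <= eta -> good c1 c2 t'.
Hypotheses (lw : lwin c1 c2 t al P1 eta) (rw : rwin c1 c2 t be P2 eta).
Hypothesis crit1 : forall x, al <= x <= be -> derive1 c1 x = 0 ->
  c1 x = t \/ eta < `|c1 x - t|.
Hypothesis crit2 : forall x, al <= x <= be -> derive1 c2 x = 0 ->
  c2 x = t \/ eta < `|c2 x - t|.

Let s := Q t al.
Let lab x : al <= x <= be -> dom c1 c2 t x.
Proof. by move=> h; apply: lt; rewrite /btw h. Qed.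

Let P1_be x : al <= x -> P1 x.
Proof.
move=> ax; rewrite -[x]opprK; apply: (rwin_down lw) (rwin_base lw) _.
by rewrite lerN2.
Qed.

Let P2_al x : x <= be -> P2 x.
Proof. by move=> xb; apply: (rwin_down rw) (rwin_base rw) _. Qed.

Let barrier x y t' : P1 x -> P2 x -> `|t' - t| <= eta -> lev c1 c2 t' x y ->
  P1 y /\ P2 y.
Proof. exact: (window_barrier (rwin_hwin lw) (rwin_hwin rw)). Qed.

Let reduce x t' : P1 x -> P2 x -> `|t' - t| <= eta -> dom c1 c2 t' x ->
  exists2 y, al <= y <= be & lev c1 c2 t' x y.
Proof.
move=> p1 p2 tt dx; have [xa|ax] := ltP x al.
  exists al; first by rewrite lexx.
  have := @rwin_lev _ _ _ _ _ _ _ lw (- x) t'; rewrite ltrN2 opprK.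
  rewrite /dom opprK => /(_ xa p1 tt dx) /lev_opp; rewrite !opprK.
  exact: lev_sym.
have [bx|xb] := ltP be x; last by exists x; [rewrite ax|exact: lev_refl].
exists be; first by rewrite lexx andbT.
by apply: lev_sym; apply: (rwin_lev rw).
Qed.

Let st_eq x y t' : `|t' - t| <= eta -> dom c1 c2 t' x -> dom c1 c2 t' y ->
  Q t' x = Q t' y <-> lev c1 c2 t' x y.
Proof. by move=> tt; apply: (strip_eq st); exact: goodt. Qed.

(** Beyond the core, [rwin] and [lwin] exclude critical points at heights near [t] other than [t];
    over the core, the choice of [eta] does. So the centre of the star is the only candidate for a
    critical point. *)
Lemma window_crit t' x y : `|t' - t| <= eta -> dom c1 c2 t' x -> P1 x -> P2 x ->
  lev c1 c2 t' x y ->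
  (derive1 c1 y = 0 /\ c1 y = t') \/ (derive1 c2 y = 0 /\ c2 y = t') -> t' = t.
Proof.
move=> tt dx p1 p2 l cy; have [p1' p2'] := barrier p1 p2 tt l.
have [ya|ay] := ltP y al.
  have c1d : derivable c1 (- - y) 1 by exact: tame_derivable.
  have c2d : derivable c2 (- - y) 1 by exact: tame_derivable.
  case: cy => -[dy cy].
    have := @rwin_crit1 _ _ _ _ _ _ _ lw (- y); rewrite ltrN2 derive1_opp//= opprK.
    by rewrite dy oppr0 cy => /(_ ya p1' erefl)[//|]; lra.
  have := @rwin_crit2 _ _ _ _ _ _ _ lw (- y); rewrite ltrN2 derive1_opp//= opprK.
  by rewrite dy oppr0 cy => /(_ ya p1' erefl)[//|]; lra.
have [by'|yb] := ltP be y.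
  case: cy => -[dy cy].
    by have := rwin_crit1 rw by' p2' dy; rewrite cy => -[//|]; lra.
  by have := rwin_crit2 rw by' p2' dy; rewrite cy => -[//|]; lra.
have yab : al <= y <= be by rewrite ay yb.
case: cy => -[dy cy].
  by have := crit1 yab dy; rewrite cy => -[//|]; lra.
by have := crit2 yab dy; rewrite cy => -[//|]; lra.
Qed.

Lemma window_base x : al <= x <= be -> Q t x = s.
Proof.
move=> xab; have ta : `|t - t| <= eta by rewrite subrr normr0 ltW.
apply/(st_eq ta); rewrite ?lab//; first by rewrite lexx.
by apply: lev_sym; apply: lev_sub lt _; rewrite /btw xab.
Qed.

Lemma window_level x : P1 x -> P2 x -> dom c1 c2 t x -> Q t x = s.
Proof.
move=> p1 p2 dx; have ta : `|t - t| <= eta by rewrite subrr normr0 ltW.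
have [y yab l] := reduce p1 p2 ta dx.
by rewrite -(window_base yab); apply/(st_eq ta) => //; exact: lab.
Qed.

Let te : `|t + eta - t| <= eta.
Proof. by rewrite addrAC subrr add0r gtr0_norm. Qed.
Let te' : `|t - eta - t| <= eta.
Proof. by rewrite addrAC subrr add0r normrN gtr0_norm. Qed.

Let endl2 : t < c2 al -> t + eta <= c2 al.
Proof. by have := rwin_end2 lw; rewrite opprK. Qed.
Let endl1 : c1 al < t -> c1 al <= t - eta.
Proof. by have := rwin_end1 lw; rewrite opprK. Qed.

Let climb_up x t' : al <= x <= be -> t < t' <= t + eta -> dom c1 c2 t' x ->
  exists y, [/\ al <= y <= be, t + eta <= c2 y & lev c1 c2 t' x y].
Proof.
move=> xab tt /andP[_ dx].
exact: (core_climb tc1 tc2 eta0 lt crit2 endl2 (rwin_end2 rw) xab tt dx).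
Qed.

Let N1 := fun x => - c2 x.
Let N2 := fun x => - c1 x.
Let tN1 : tame N1. Proof. exact: tameN. Qed.
Let tN2 : tame N2. Proof. exact: tameN. Qed.
Let ltN : lev N1 N2 (- t) al be. Proof. exact/lev_flip. Qed.
Let critN x : al <= x <= be -> derive1 N2 x = 0 -> N2 x = - t \/ eta < `|N2 x - - t|.
Proof.
move=> xab; rewrite derive1Nf; last exact: tame_derivable.
move=> /eqP; rewrite oppr_eq0 => /eqP/(crit1 xab)[h|h].
  by left; rewrite /N2 h.
by right; rewrite /N2 dist_flip !opprK.
Qed.

Let climb_down x t' : al <= x <= be -> t - eta <= t' < t -> dom c1 c2 t' x ->
  exists y, [/\ al <= y <= be, c1 y <= t - eta & lev c1 c2 t' x y].
Proof.
move=> xab tt /andP[dx _].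
have ea : - t < N2 al -> - t + eta <= N2 al.
  by rewrite /N2 ltrN2 => /endl1; lra.
have eb : - t < N2 be -> - t + eta <= N2 be.
  by rewrite /N2 ltrN2 => /(rwin_end1 rw); lra.
have tt2 : - t < - t' <= - t + eta by lra.
have dx2 : - t' <= N2 x by rewrite /N2 lerN2.
have [y [yab cy /lev_flip l]] := core_climb tN1 tN2 eta0 ltN critN ea eb xab tt2 dx2.
by exists y; split=> //; rewrite /N2 in cy; lra.
Qed.

(** The free ends of the legs, at the two extreme heights of the window. *)
Let tips (u : G) := exists x, [/\ al <= x <= be, dom c1 c2 (cb u) x,
  Q (cb u) x = u & cb u = t + eta \/ cb u = t - eta].

Let finite_tips : finite_set [set u | tips u].
Proof.
have [F [finF FI] hF] := core_tips tc1 tc2 ab eta0 lt crit2.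
have [F' [finF' FI'] hF'] := core_tips tN1 tN2 ab eta0 ltN critN.
apply: (@sub_finite_set _ _ (Q (t + eta) @` F `|` Q (t - eta) @` F')); last first.
  by rewrite finite_setU; split; exact: finite_image.
move=> u [x [xab dx Qx [E|E]]].
  have [|x' Fx' l] := hF x xab; first by move: dx; rewrite E => /andP[].
  left; exists x' => //; rewrite -Qx E; apply/(st_eq te) => //.
  - exact: lev_domr l.
  - by rewrite -E.
  - exact: lev_sym.
have [|x' Fx' l] := hF' x xab; first by move: dx; rewrite E => /andP[]; rewrite /N2; lra.
have {}l : lev c1 c2 (t - eta) x x' by apply/lev_flip; rewrite opprB addrC.
right; exists x' => //; rewrite -Qx E; apply/(st_eq te') => //.
- exact: lev_domr l.
- by rewrite -E.
- exact: lev_sym.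
Qed.

Let rep (u : G) : R := xget 0 [set x | [/\ al <= x <= be, dom c1 c2 (cb u) x &
  Q (cb u) x = u]].

Let repP u : tips u -> [/\ al <= rep u <= be, dom c1 c2 (cb u) (rep u) &
  Q (cb u) (rep u) = u].
Proof.
move=> [x [h1 h2 h3 _]].
exact: (@xgetPex _ 0 [set x | [/\ al <= x <= be, dom c1 c2 (cb u) x &
  Q (cb u) x = u]] (ex_intro _ x (And3 h1 h2 h3))).
Qed.

(** A leg is a vertical segment over [rep u], parametrised affinely by its height: [t] at -1 and
    [cb u] at 1. Its inverse [hh] only reads off a height, which makes it continuous on the whole
    space. *)
Let ht (u : G) (r : R) : R := t + (cb u - t) * (r + 1) / 2.
Let gam (u : G) (r : R) : G := Q (ht u r) (rep u).
Let hh (u g : G) : R := 2 * (cb g - t) / (cb u - t) - 1.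
Local Notation I := (`[(-1 : R), 1]%classic).

Let tips_ne u : tips u -> cb u - t != 0.
Proof. by move=> [x [_ _ _ [->|->]]]; rewrite addrAC subrr add0r ?oppr_eq0 gt_eqF. Qed.

Let ht_dom u r : tips u -> I r -> dom c1 c2 (ht u r) (rep u) /\ `|ht u r - t| <= eta.
Proof.
move=> tu; rewrite /= in_itv/= => /andP[r1 r2].
have [h1 /andP[h2 h3] _] := repP tu.
have /andP[h4 h5] := lab h1.
have E : `|cb u - t| = eta.
  case: tu => x [_ _ _ [->|->]]; rewrite addrAC subrr add0r ?normrN gtr0_norm//.
have k0 : 0 <= (r + 1) / 2 by rewrite divr_ge0//; lra.
have k1 : (r + 1) / 2 <= 1 by lra.
pose k := (r + 1) / 2.
have hE : ht u r = (1 - k) * t + k * cb u by rewrite /ht /k; field.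
split.
  have a1 : (1 - k) * c1 (rep u) <= (1 - k) * t by rewrite ler_wpM2l// subr_ge0.
  have a2 : k * c1 (rep u) <= k * cb u by rewrite ler_wpM2l.
  have a3 : (1 - k) * t <= (1 - k) * c2 (rep u) by rewrite ler_wpM2l// subr_ge0.
  have a4 : k * cb u <= k * c2 (rep u) by rewrite ler_wpM2l.
  by rewrite /dom hE; apply/andP; split; lra.
have -> : ht u r - t = (cb u - t) * k by rewrite /ht /k; field.
by rewrite normrM E (ger0_norm k0) ler_piMr// ltW.
Qed.

(** [core_tips] makes the legs finitely many, [core_merge] keeps them disjoint away from the centre,
    and the two climbs show that they cover the window. *)
Lemma star_window : is_graph R (subsp (window c1 c2 Q P1 P2 t eta)).
Proof.
have winU t' x : dom c1 c2 t' x -> al <= x <= be -> `|t' - t| <= eta ->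
    window c1 c2 Q P1 P2 t eta (Q t' x).
  move=> dx /andP[xa xb] tt; exists t', x; split=> //.
  by split; [exact: P1_be|exact: P2_al].
have good_win g : window c1 c2 Q P1 P2 t eta g -> good c1 c2 (cb g).
  by move=> [t' [x [dx _ tt ->]]]; rewrite (strip_val st)//; exact: goodt.
have cb_gam u r : tips u -> I r -> cb (gam u r) = ht u r.
  by move=> tu Ir; have [d _] := ht_dom tu Ir; rewrite (strip_val st).
have tt0 : `|t - t| <= eta by rewrite subrr normr0 ltW.
apply: (@star_graph_sub _ _ _ s [set u | tips u] gam hh).
- by move=> x y /good_win gx /good_win gy; exact: hG.
- exact: finite_tips.
- by apply: winU => //; [apply: lab|]; rewrite lexx.
- move=> u tu; have [h1 h2 h3] := repP tu; rewrite -h3; apply: winU => //.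
  by case: tu => x [_ _ _ [->|->]].
- move=> u r tu Ir; have [d tt] := ht_dom tu Ir; apply: winU => //.
  by have [] := repP tu.
- move=> u tu; apply: (strip_path st) => [r|r Ir]; last by have [] := ht_dom tu Ir.
  apply: cvgD; first exact: cvg_cst.
  apply: cvgM; last exact: cvg_cst.
  by apply: cvgM; [exact: cvg_cst|apply: cvgD; [exact: cvg_id|exact: cvg_cst]].
- move=> u tu g; apply: cvgB; last exact: cvg_cst.
  apply: cvgM; last exact: cvg_cst.
  apply: cvgM; first exact: cvg_cst.
  by apply: cvgB; [exact: (strip_cont st)|exact: cvg_cst].
- move=> u r tu Ir; rewrite /hh cb_gam// /ht; field.
  exact: tips_ne.
- move=> u tu; rewrite /gam /ht addNr mulr0 mul0r addr0.
  by apply: window_base; have [] := repP tu.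
- move=> u tu; have [h1 h2 h3] := repP tu; rewrite /gam -[RHS]h3; congr Q.
  by rewrite /ht; field.
- move=> u v r r' tu tv Ir Ir' E r1.
  have [du ttu] := ht_dom tu Ir; have [dv ttv] := ht_dom tv Ir'.
  have htE : ht u r = ht v r' by rewrite -cb_gam// E cb_gam.
  have l : lev c1 c2 (ht u r) (rep u) (rep v).
    by apply/(st_eq ttu) => //; [rewrite htE|rewrite [RHS]/gam in E; rewrite htE -E /gam htE].
  have [u1 u2 u3] := repP tu; have [v1 v2 v3] := repP tv.
  have r10 : 0 < (r + 1) / 2 by lra.
  have r1' : 0 <= (r' + 1) / 2 by move: Ir'; rewrite /= in_itv/=; lra.
  have htu : ht u r - t = (cb u - t) * ((r + 1) / 2) by rewrite /ht; field.
  have htv : ht u r - t = (cb v - t) * ((r' + 1) / 2) by rewrite htE /ht; field.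
  (* The common point of the two legs is not at height [t], so both tips are on its side of [t]. *)
  have cbE : cb u = cb v.
    case: (tu) => x [_ _ _ Eu]; case: (tv) => x' [_ _ _ Ev].
    have p : 0 < eta * ((r + 1) / 2) by rewrite mulr_gt0.
    have p' : 0 <= eta * ((r' + 1) / 2) by rewrite mulr_ge0// ltW.
    by case: Eu Ev htu htv => [->|->] [->|->] //;
      rewrite ![_ - t]addrAC !subrr !add0r ?mulNr => -> ?; lra.
  rewrite -u3 -v3 cbE; apply/(st_eq _ _ v2).
  + by case: tv => x [_ _ _ [->|->]].
  + by rewrite -cbE.
  have ttu' := ler_norm (ht u r - t).
  have ttu'' := ler_norm (- (ht u r - t)); rewrite normrN in ttu''.
  case: (tu) => x [_ _ _ [Eu|Eu]].
    have e0 : 0 < ht u r - t.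
      by rewrite htu Eu addrAC subrr add0r mulr_gt0.
    rewrite -cbE Eu; apply: (core_merge tc2 lt crit2 u1 v1 _ _ _ l).
    * by rewrite -Eu; case/andP: u2.
    * by rewrite -Eu cbE; case/andP: v2.
    * by lra.
  have e0 : ht u r - t < 0.
    by rewrite htu Eu addrAC subrr add0r mulNr oppr_lt0 mulr_gt0.
  rewrite -cbE Eu; apply/lev_flip; rewrite opprB addrC.
  apply: (core_merge tN2 ltN critN u1 v1 _ _ _ ((lev_flip _ _ _ _ _).2 l)).
  * by rewrite /N2; case/andP: u2; rewrite Eu; lra.
  * by rewrite /N2; case/andP: v2; rewrite -cbE Eu; lra.
  * by lra.
- move=> g [t' [x [dx [p1 p2] tt ->]]].
  have [y yab l] := reduce p1 p2 tt dx.
  have dy := lev_domr l.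
  have -> : Q t' x = Q t' y by apply/(st_eq tt).
  have n1 := ler_norm (t' - t); have n2 := ler_norm (- (t' - t)).
  rewrite normrN in n2.
  (* If the level of [y] reaches a point [z] over which the band extends to the extreme height [e],
     then [Q t' y] lies on the leg ending at [Q e z]. *)
  have close z : al <= z <= be -> lev c1 c2 t' y z -> t' != t ->
      dom c1 c2 (if t < t' then t + eta else t - eta) z ->
      exists u, tips u /\ exists2 r, I r & Q t' y = gam u r.
    move=> zab lz tne; set e := if _ then _ else _ => dz.
    have tte : `|e - t| <= eta by rewrite /e; case: ifP.
    have cbu : cb (Q e z) = e by rewrite (strip_val st).
    have tu : tips (Q e z).
      exists z; rewrite cbu; split=> //.
      by rewrite /e; case: ifP; [left|right].
    exists (Q e z); split=> //; exists (2 * (t' - t) / (e - t) - 1).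
      rewrite /= in_itv/= /e; case: ltgtP tne => // ht' _.
        rewrite addrAC subrr add0r.
        have a0 : 0 <= (t' - t) / eta by apply: divr_ge0; [rewrite subr_ge0 ltW|exact: ltW].
        have a1 : (t' - t) / eta <= 1 by rewrite ler_pdivrMr// mul1r; lra.
        by apply/andP; split; lra.
      rewrite addrAC subrr add0r invrN mulrN -mulNr.
      have a0 : 0 <= (t - t') / eta by apply: divr_ge0; [rewrite subr_ge0 ltW|exact: ltW].
      have a1 : (t - t') / eta <= 1 by rewrite ler_pdivrMr// mul1r; lra.
      by apply/andP; split; lra.
    have en0 : e - t != 0.
      by rewrite /e; case: ifP; rewrite addrAC subrr add0r ?oppr_eq0 gt_eqF.
    have [u1 u2 u3] := repP tu; rewrite cbu in u2 u3.
    have hE : ht (Q e z) (2 * (t' - t) / (e - t) - 1) = t'.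
      by rewrite /ht cbu; field.
    rewrite /gam hE; move: (rep _) u1 u2 u3 => y' u1 u2 u3.
    apply/(st_eq tt) => //.
      have /andP[q1 q2] := lab u1; move: u2 => /andP[q3 q4].
      by rewrite /dom; move: q3 q4; rewrite /e; case: ltgtP tne => // h _ q3 q4; lra.
    apply: lev_trans lz _ => w wz.
    have /andP[q1 q2] : dom c1 c2 t w.
      apply: lab; move: wz zab u1; rewrite /btw.
      by move=> /orP[]/andP[? ?] /andP[? ?] /andP[? ?]; apply/andP; split; lra.
    have /andP[q3 q4] : dom c1 c2 e w.
      have lzy : lev c1 c2 e z y' by apply/(st_eq tte) => //; rewrite u3.
      exact: lzy.
    by rewrite /dom; move: q3 q4; rewrite /e; case: ltgtP tne => // h _ q3 q4; lra.
  have [tlt|tgt|tE] := ltgtP t t'; last first.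
  - by left; rewrite -tE window_base.
  - right; have tt2 : t - eta <= t' < t by lra.
    have [z [zab cz lz]] := climb_down yab tt2 dy.
    apply: (close z) => //; first by rewrite lt_eqF.
    by rewrite ltNge (ltW tgt)/= /dom cz/=; have /andP[] := lab zab; lra.
  - right; have tt2 : t < t' <= t + eta by lra.
    have [z [zab cz lz]] := climb_up yab tt2 dy.
    apply: (close z) => //; first by rewrite gt_eqF.
    by rewrite tlt /dom cz andbT; have /andP[] := lab zab; lra.
Qed.

Lemma owindow_base : owindow c1 c2 Q P1 P2 t eta s.
Proof.
exists t, al; split=> //; first by apply: lab; rewrite lexx.
  by split; [exact: P1_be|exact: P2_al].
by rewrite subrr normr0.
Qed.

End Star.
End Strip.

(** * Points that separate the Reeb space *)

Section Separation.
Variables (R : realType) (c1 c2 : R -> R) (G : topologicalType).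
Variables (Q : R -> R -> G) (cb : G -> R).
Hypotheses (cc1 : continuous c1) (cc2 : continuous c2) (c12 : forall x, c1 x < c2 x).
Hypotheses (st : strip c1 c2 Q cb) (all_good : forall t, good c1 c2 t).
Hypothesis band_open_open : forall V : set G,
  band_open c1 c2 (fun t x => V (Q t x)) -> open V.
Implicit Types t x : R.

Let eqQ t x y : dom c1 c2 t x -> dom c1 c2 t y ->
  Q t x = Q t y <-> lev c1 c2 t x y.
Proof. exact: (strip_eq st (all_good t)). Qed.

(** By [seg_ind] neither part can give way to the other along a level missing [k], so both are
    saturated. Their images are then open and would disconnect [E]. *)
Lemma separation (k : G) (A B : R -> R -> Prop) (E : set G) t x t' x' :
  (forall t x, dom c1 c2 t x -> [\/ A t x, B t x | Q t x = k]) ->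
  (forall t x, dom c1 c2 t x -> A t x -> B t x -> False) ->
  (forall t x, dom c1 c2 t x -> A t x -> Q t x <> k) ->
  (forall t x, dom c1 c2 t x -> B t x -> Q t x <> k) ->
  band_open c1 c2 A -> band_open c1 c2 B -> connected E -> ~ E k ->
  dom c1 c2 t x -> E (Q t x) -> A t x ->
  dom c1 c2 t' x' -> E (Q t' x') -> B t' x' -> False.
Proof.
move=> cov excl nA nB oA oB cE nk dx Ex Ax dx' Ex' Bx'.
have sat (P P' : R -> R -> Prop) u y z :
    (forall t x, dom c1 c2 t x -> [\/ P t x, P' t x | Q t x = k]) ->
    (forall t x, dom c1 c2 t x -> P t x -> P' t x -> False) ->
    (forall t x, dom c1 c2 t x -> P t x -> Q t x <> k) ->
    band_open c1 c2 P -> band_open c1 c2 P' ->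
    dom c1 c2 u y -> P u y -> lev c1 c2 u y z -> P u z.
  move=> cov' excl' nP oP oP' dy Py l.
  have nQ w : btw y z w -> Q u w <> k.
    move=> yw E0; apply: (nP _ _ dy Py); rewrite -E0; apply/eqQ => //; first exact: l.
    exact: lev_sub l yw.
  apply: (@seg_ind _ (fun w => P u w) y z) => // w yw Pw.
    have [d d0 hd] := oP _ _ (l _ yw) Pw; exists d => // w' yw' ww'.
    by apply: hd => //; [exact: l|rewrite subrr normr0].
  have P'w : P' u w by case: (cov' _ _ (l _ yw)) => // /(nQ _ yw).
  have [d d0 hd] := oP' _ _ (l _ yw) P'w; exists d => // w' yw' ww' Pw'.
  apply: (excl' u w') => //; first exact: l.
  by apply: hd => //; [exact: l|rewrite subrr normr0].
pose sat_set (P : R -> R -> Prop) : set G :=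
  [set g | exists u y, [/\ dom c1 c2 u y, P u y & g = Q u y]].
have opn (P P' : R -> R -> Prop) :
    (forall t x, dom c1 c2 t x -> [\/ P t x, P' t x | Q t x = k]) ->
    (forall t x, dom c1 c2 t x -> P t x -> P' t x -> False) ->
    (forall t x, dom c1 c2 t x -> P t x -> Q t x <> k) ->
    band_open c1 c2 P -> band_open c1 c2 P' ->
    open (sat_set P) /\ forall u y, dom c1 c2 u y -> sat_set P (Q u y) -> P u y.
  move=> h1 h2 h3 h4 h5.
  have inP u y : dom c1 c2 u y -> sat_set P (Q u y) -> P u y.
    move=> dy [v [z [dz Pz E0]]].
    have uv : u = v by have := congr1 cb E0; rewrite !(strip_val st).
    subst v; apply: (sat P P' u z y) => //.
    by apply/eqQ.
  split=> //; apply: band_open_open => u y dy /(inP _ _ dy) Py.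
  have [d d0 hd] := h4 _ _ dy Py; exists d => // u' y' dy' uu yy.
  by exists u', y'; split=> //; exact: hd.
have [oSA inA] := opn A B cov excl nA oA oB.
have cov' u y : dom c1 c2 u y -> [\/ B u y, A u y | Q u y = k].
  by move=> /cov[?|?|?]; [apply: Or32|apply: Or31|apply: Or33].
have excl' u y : dom c1 c2 u y -> B u y -> A u y -> False.
  by move=> dy ? ?; exact: (excl u y dy).
have [oSB inB] := opn B A cov' excl' nB oB oA.
have EAB g : E g -> sat_set A g \/ sat_set B g.
  move=> Eg; have [u dy Qy] := strip_surj st (all_good (cb g)).
  case: (cov _ _ dy) => [Ay|By|Qk].
  - by left; exists (cb g), u.
  - by right; exists (cb g), u.
  - by exfalso; apply: nk; rewrite -Qk Qy.
have : E `&` sat_set A = E.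
  apply: cE.
  - by exists (Q t x); split=> //; exists t, x.
  - by exists (sat_set A).
  - exists (~` sat_set B); first exact: open_closedC.
    apply/seteqP; split=> g [Eg Ag]; split=> //.
      case: Ag => u [y [dy Ay ->]] /(inB _ _ dy); exact: (excl _ _ dy).
    by case: (EAB _ Eg).
move=> /seteqP[_ /(_ _ Ex')[_ /(inA _ _ dx') Ax']].
exact: excl Ax' Bx'.
Qed.

Let above_ne t0 x0 t x : dom c1 c2 t0 x0 -> dom c1 c2 t x ->
  above c1 c2 t0 x0 t x -> Q t x <> Q t0 x0.
Proof.
move=> d0 dx ax E; have tt : t = t0 by have := congr1 cb E; rewrite !(strip_val st).
subst t; have /eqQ l := esym E; case: ax => [u|[_]]; last by rewrite ltxx.
by apply: lev_up_excl u; exact: l.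
Qed.

Let below_ne t0 x0 t x : dom c1 c2 t0 x0 -> dom c1 c2 t x ->
  below c1 c2 t0 x0 t x -> Q t x <> Q t0 x0.
Proof.
move=> d0 dx ax E; have tt : t = t0 by have := congr1 cb E; rewrite !(strip_val st).
subst t; have /eqQ l := esym E; case: ax => [u|[_]]; last by rewrite ltxx.
by apply: lev_dn_excl u; exact: l.
Qed.

Lemma level_separates t0 x0 (E : set G) t x t' x' : dom c1 c2 t0 x0 ->
  connected E -> ~ E (Q t0 x0) ->
  dom c1 c2 t x -> E (Q t x) -> above c1 c2 t0 x0 t x ->
  dom c1 c2 t' x' -> E (Q t' x') -> below c1 c2 t0 x0 t' x' -> False.
Proof.
move=> d0; apply: (@separation (Q t0 x0) (above c1 c2 t0 x0) (below c1 c2 t0 x0)).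
- move=> u y dy; have [?|?|[uE l]] := above_or_below cc1 cc2 c12 u y d0.
  + exact: Or31.
  + exact: Or32.
  + by apply: Or33; subst u; apply/eqQ => //; exact: lev_sym.
- by move=> u y _; exact: above_below_excl.
- by move=> u y; exact: above_ne.
- by move=> u y; exact: below_ne.
- exact: above_open.
- exact: below_open.
Qed.

(** Above a minimum of [c2] the band has two branches, which only meet at the minimum or below it.
    Its image in the Reeb space therefore cuts one branch off. *)
Lemma cusp_separates x0 (E : set G) t x t' x' :
  connected E -> ~ E (Q (c2 x0) x0) ->
  (x < x0 < x' \/ x' < x0 < x) -> (forall w, btw x x' w -> c2 x0 <= c2 w) ->
  dom c1 c2 t x -> E (Q t x) -> c2 x0 < t ->
  dom c1 c2 t' x' -> E (Q t' x') -> c2 x0 < t' -> False.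
Proof.
wlog xx : t x t' x' / x < x0 < x'.
  move=> H cE nE [xx|xx] hc dx Ex tx dx' Ex' tx'.
    by apply: (H t x t' x') => //; left.
  apply: (H t' x' t x) => //; first by left.
  by move=> w; rewrite btwC; exact: hc.
move=> cE nE _ hc dx Ex tx dx' Ex' tx'.
set t0 := c2 x0 in nE hc tx tx' *.
have d0 : dom c1 c2 t0 x0 by rewrite /dom /t0 lexx andbT ltW.
have ab u y : dom c1 c2 u y -> btw x x' y -> t0 < u -> above c1 c2 t0 x0 u y.
  move=> dy xy tu; have [l|?|[z [xz zt _]]] := trichotomy cc1 cc2 c12 y d0.
  - by right.
  - by left.
  - exfalso; have : btw x x' z.
      move: xy xz xx; rewrite /btw => /orP[]/andP[? ?] /orP[]/andP[? ?] /andP[? ?];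
        apply/orP; left; apply/andP; split; lra.
    by move=> /hc; rewrite leNgt zt.
pose A t x := above c1 c2 t0 x0 t x /\ x < x0.
(* What lies below the point is counted with the right branch, so that both parts together exhaust
   its complement. *)
pose B t x := below c1 c2 t0 x0 t x \/ (above c1 c2 t0 x0 t x /\ x0 < x).
move: xx => /andP[xx0 xx0'].
apply: (@separation (Q t0 x0) A B E t x t' x') => //.
- move=> u y dy; have [ay|?|[uE l]] := above_or_below cc1 cc2 c12 u y d0.
  + have [yx|xy|yE] := ltgtP y x0.
    * by apply: Or31.
    * by apply: Or32; right.
    * subst y; exfalso; case: ay => [[z [xz tz _]]|[_ tu]].
        move: xz; rewrite /btw orbb => /le_anti zE.
        by move: tz; rewrite -zE /t0 ltNge ltW.
      by move: dy => /andP[_]; rewrite leNgt tu.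
  + by apply: Or32; left.
  + by apply: Or33; subst u; apply/eqQ => //; exact: lev_sym.
- move=> u y _ [ay yx] [bY|[_]]; first exact: above_below_excl ay bY.
  by rewrite ltNge ltW.
- by move=> u y dy [+ _]; exact: above_ne.
- by move=> u y dy [|[+ _]]; [exact: below_ne|exact: above_ne].
- move=> u y dy [ay yx]; have [d dp hd] := above_open cc1 cc2 c12 d0 dy ay.
  exists (Order.min d (x0 - y)); first by rewrite lt_min dp subr_gt0.
  move=> u' y' dy'; rewrite !lt_min => /andP[uu _] /andP[yy yx'].
  by split; [exact: hd|have := ler_norm (y' - y); lra].
- move=> u y dy [bY|[ay yx]].
    have [d dp hd] := below_open cc1 cc2 c12 d0 dy bY.
    by exists d => // u' y' dy' uu yy; left; exact: hd.
  have [d dp hd] := above_open cc1 cc2 c12 d0 dy ay.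
  exists (Order.min d (y - x0)); first by rewrite lt_min dp subr_gt0.
  move=> u' y' dy'; rewrite !lt_min => /andP[uu _] /andP[yy yx'].
  right; split; [exact: hd|have := ler_norm (- (y' - y)); rewrite normrN; lra].
- split=> //; apply: ab => //; exact: btwl.
- right; split=> //; apply: ab => //; exact: btwr.
Qed.

End Separation.

(** * Star-shaped neighbourhoods of finite points *)

Section Ends.
Variable R : realType.
Implicit Types (c : R -> R) (t x y : R).

Definition finite_end c1 c2 t x0 : Prop := exists y, x0 <= y /\ ~~ dom c1 c2 t y.

Definition tame_end c1 c2 t x0 : Prop :=
  [/\ c1 x @[x --> +oo] --> t, c2 x @[x --> +oo] --> t,
      forall x, x0 <= x -> dom c1 c2 t x &
      exists M, forall x, M < x -> (derive1 c1 x = 0 -> c1 x = t) /\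
                                   (derive1 c2 x = 0 -> c2 x = t)].

Lemma right_window c1 c2 t x0 : tame c1 -> tame c2 -> (forall x, c1 x < c2 x) ->
  dom c1 c2 t x0 -> finite_end c1 c2 t x0 \/ tame_end c1 c2 t x0 ->
  exists w P eta, [/\ x0 <= w, lev c1 c2 t x0 w, 0 < eta, rwin c1 c2 t w P eta &
    finite_end c1 c2 t x0 -> exists B, forall x, P x -> x < B].
Proof.
move=> tc1 tc2 c12 dx; have [fe _|nf] := pselect (finite_end c1 c2 t x0).
  have [y [xy /negP nd]] := fe.
  have nl : ~ lev c1 c2 t x0 y by move/lev_domr.
  have [z [B [eta [/andP[xz zB] lz eta0 rw _]]]] :=
    finite_right_end tc1 tc2 c12 xy dx nl.
  by exists z, (fun x => x < B), eta; split=> // _; exists B.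
case=> // -[l1 l2 hd [M hM]].
have [w [eta [xw eta0 rw]]] := infinite_right_end tc1 tc2 l1 l2 hd
  (fun x h => (hM x h).1) (fun x h => (hM x h).2).
exists w, (fun _ => True), eta; split=> //.
move=> y; rewrite /btw => /orP[]/andP[h1 h2]; apply: hd; lra.
Qed.

End Ends.

Section StarNeighborhood.
Variables (R : realType) (c1 c2 : R -> R) (G : topologicalType).
Variables (Q : R -> R -> G) (cb : G -> R).
Hypotheses (tc1 : tame c1) (tc2 : tame c2) (c12 : forall x, c1 x < c2 x).
Hypothesis st : strip c1 c2 Q cb.
Hypothesis hG : forall x y : G, good c1 c2 (cb x) -> good c1 c2 (cb y) ->
  cluster (nbhs x) y -> x = y.

(** The vertices in planar terms: the critical points of the projection lie over the boundary of the
    band, at the critical points of [c1] and [c2]; see [vertices_zero_set] and [vertices_sphere]. *)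
Definition crit_points : set G := [set g | exists y,
  (derive1 c1 y = 0 /\ g = Q (c1 y) y) \/ (derive1 c2 y = 0 /\ g = Q (c2 y) y)].

Definition bounded_part (V : set G) : Prop :=
  exists A B, forall t x, dom c1 c2 t x -> V (Q t x) -> A < x < B.

(** A switch between two topologies: False for the zero-set, where band-open sets of good heights
    are open, and True for the sphere, where this is used for bounded parts, which stay away from
    the poles. *)
Variable bd : Prop.
Hypothesis band_open_open : forall V : set G, (forall g, V g -> good c1 c2 (cb g)) ->
  band_open c1 c2 (fun t x => V (Q t x)) -> (bd -> bounded_part V) -> open V.

Lemma star_nbhd (t x0 : R) : dom c1 c2 t x0 ->
  (exists2 e, 0 < e & forall t', `|t' - t| <= e -> good c1 c2 t') ->
  let fr := finite_end c1 c2 t x0 in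
  let fl := finite_end (fun x => c1 (- x)) (fun x => c2 (- x)) t (- x0) in
  (bd -> fr /\ fl) ->
  fr \/ tame_end c1 c2 t x0 ->
  fl \/ tame_end (fun x => c1 (- x)) (fun x => c2 (- x)) t (- x0) ->
  exists U, [/\ nbhs (Q t x0) U, is_graph R (subsp U),
    forall g, U g -> crit_points g -> g = Q t x0 & fr /\ fl -> bounded_part U].
Proof.
move=> dx [e e0 he] fr fl hbd hr hl.
have [be [P2 [e2 [xb lb e20 rw hB]]]] := right_window tc1 tc2 c12 dx hr.
have dx' : dom (fun x => c1 (- x)) (fun x => c2 (- x)) t (- x0) by rewrite /dom opprK.
have [al' [P1' [e1 [xa la e10 lw hA]]]] :=
  right_window (tame_opp tc1) (tame_opp tc2) (fun x => c12 (- x)) dx' hl.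
pose al := - al'; pose P1 x := P1' (- x).
have lw1 : lwin c1 c2 t al P1 e1.
  rewrite /lwin /al opprK; congr rwin: lw; apply/funext => x.
  by rewrite /P1 opprK.
have ax : al <= x0 by rewrite /al lerNl.
have la' : lev c1 c2 t x0 al by move/lev_opp: la; rewrite opprK.
have ab : al <= be by apply: le_trans xb.
have lt : lev c1 c2 t al be by apply: lev_trans lb; exact: lev_sym.
have [e3 e30 h3] := tame_eta t al be tc1.
have [e4 e40 h4] := tame_eta t al be tc2.
pose eta := Order.min e (Order.min (Order.min e1 e2) (Order.min e3 e4)).
have eta0 : 0 < eta by rewrite !lt_min e0 e10 e20 e30 e40.
have ee : eta <= e by rewrite !ge_min lexx.
have ee1 : eta <= e1 by rewrite !ge_min lexx ?orbT.
have ee2 : eta <= e2 by rewrite !ge_min lexx ?orbT.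
have ee3 : eta <= e3 by rewrite !ge_min lexx ?orbT.
have ee4 : eta <= e4 by rewrite !ge_min lexx ?orbT.
have gd t' : `|t' - t| <= eta -> good c1 c2 t' by move=> tt; apply: he; lra.
have lw' := lwin_le ee1 lw1; have rw' := rwin_le ee2 rw.
have cr1 x : al <= x <= be -> derive1 c1 x = 0 -> c1 x = t \/ eta < `|c1 x - t|.
  by move=> xab /(h3 _ xab)[?|?]; [left|right; lra].
have cr2 x : al <= x <= be -> derive1 c2 x = 0 -> c2 x = t \/ eta < `|c2 x - t|.
  by move=> xab /(h4 _ xab)[?|?]; [left|right; lra].
have s0 : Q t al = Q t x0.
  have gt : good c1 c2 t by apply: gd; rewrite subrr normr0 ltW.
  apply/(strip_eq st gt) => //; last exact: lev_sym.
  exact: lev_doml lt.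
have wP := windowP st gd (rwin_hwin lw') (rwin_hwin rw').
have wb V : V `<=` window c1 c2 Q P1 P2 t eta -> fr /\ fl -> bounded_part V.
  move=> VU [/hB[B hB'] /hA[A hA']]; exists (- A), B => t' x dt /VU /(wP _ _ dt)[p1 p2 _].
  by rewrite ltrNl hA'//= hB'.
exists (window c1 c2 Q P1 P2 t eta); split.
- rewrite -s0 nbhsE; exists (owindow c1 c2 Q P1 P2 t eta); last exact: window_owindow.
  split; last exact: (owindow_base Q ab eta0 lt lw' rw').
  apply: band_open_open.
  + by move=> g [t' [x [dt _ tt ->]]]; rewrite (strip_val st)//; apply: gd; exact: ltW.
  + exact: (owindow_band_open st gd (rwin_hwin lw') (rwin_hwin rw')).
  + by move=> /hbd; apply: wb; exact: window_owindow.
- exact: (star_window tc1 tc2 st hG ab eta0 lt gd lw' rw').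
- move=> g [t' [x [dt [p1 p2] tt ->]]] [y cy].
  have [E [dy cy']] : Q t' x = Q t' y /\ (dom c1 c2 t' y /\
    ((derive1 c1 y = 0 /\ c1 y = t') \/ (derive1 c2 y = 0 /\ c2 y = t'))).
    have d1 : dom c1 c2 (c1 y) y by rewrite /dom lexx ltW.
    have d2 : dom c1 c2 (c2 y) y by rewrite /dom lexx andbT ltW.
    case: cy => -[dy E]; have tE := congr1 cb E; rewrite !(strip_val st) in tE => //;
      rewrite -tE in E d1 d2; split=> //; split=> //; [by left|by right].
  have l : lev c1 c2 t' x y by apply/(strip_eq st (gd _ tt)).
  have tE := window_crit tc1 tc2 lw' rw' cr1 cr2 tt dt p1 p2 l cy'.
  by rewrite -s0 tE; apply: (window_level st ab eta0 lt gd lw' rw'); rewrite -?tE.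
- exact: wb.
Qed.

End StarNeighborhood.

(** * Edges ending at a non-finite point *)

Section NearWindow.
Variable R : realType.
Implicit Types (c : R -> R) (t x y w eta : R) (P : R -> Prop).

Lemma hwin_le c1 c2 t w P eta eta' : eta' <= eta ->
  hwin c1 c2 t w P eta -> hwin c1 c2 t w P eta'.
Proof.
move=> ee [h1 h2 h3 h4]; split=> //.
by move=> x y t' Px Py tt; apply: h4 => //; exact: le_trans ee.
Qed.

(** A weak form of [right_window] which holds without any assumption at infinity. If the component
    of [x0] is unbounded, the half-line lies in the level [t] and each [x] is its own witness. *)
Lemma right_near c1 c2 t x0 : tame c1 -> tame c2 -> (forall x, c1 x < c2 x) ->
  dom c1 c2 t x0 -> exists P eta, [/\ 0 < eta, hwin c1 c2 t x0 P eta,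
    forall x t', x0 <= x -> P x -> `|t' - t| <= eta -> dom c1 c2 t' x ->
      exists2 y, lev c1 c2 t x0 y & lev c1 c2 t' x y &
    (forall x, x0 <= x -> dom c1 c2 t x) -> forall x, P x].
Proof.
move=> tc1 tc2 c12 dx.
have [all_dom|/existsNP[y /not_implyP[xy nd]]] :=
  pselect (forall x, x0 <= x -> dom c1 c2 t x).
  exists (fun _ => True), 1; split=> //; first by split=> // x _; exists 1.
  move=> x t' xx _ _ dx'; exists x; last exact: lev_refl.
  by move=> w; rewrite /btw => /orP[]/andP[h1 h2]; apply: all_dom; lra.
have nl : ~ lev c1 c2 t x0 y by move/lev_domr.
have [z [B [eta [/andP[xz zB] lz eta0 rw _]]]] :=
  finite_right_end tc1 tc2 c12 xy dx nl.
exists (fun x => x < B), eta; split=> //.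
- split; first by lra.
  + by move=> u v uB vu; exact: le_lt_trans uB.
  + exact: (rwin_open rw).
  + exact: (rwin_barrier rw).
- move=> x t' xx xB tt dx'; have [xz'|zx] := leP x z.
    exists x; last exact: lev_refl.
    by apply: lev_sub lz _; rewrite /btw xx xz'.
  by exists z => //; apply: lev_sym; apply: (rwin_lev rw).
- by move=> /(_ y xy) /nd.
Qed.

(** The bound is uniform because the end of the component is. If it ends at the upper boundary, [c2]
    stays below [t] up to [B]; coming back to [t] thus requires passing over [B], where
    [c2 B < t]. *)
Lemma right_dip c1 c2 t x0 : tame c1 -> tame c2 -> (forall x, c1 x < c2 x) ->
  dom c1 c2 t x0 -> exists2 tau, tau < t & forall x, x0 <= x ->
    dn c1 c2 t x0 x -> t <= c2 x -> exists2 w, x0 <= w <= x & c2 w <= tau.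
Proof.
move=> tc1 tc2 c12 dx.
have [all_dom|/existsNP[y /not_implyP[xy nd]]] :=
  pselect (forall x, x0 <= x -> dom c1 c2 t x).
  (* This case is vacuous, and any height below [t] will do. *)
  exists (t - 1); first by lra.
  move=> x xx [y [xy ty _]] _; exfalso.
  have /andP[_] : dom c1 c2 t y.
    by apply: all_dom; move: xy; rewrite /btw => /orP[]/andP[]; lra.
  by rewrite leNgt ty.
have nl : ~ lev c1 c2 t x0 y by move/lev_domr.
have [z [B [eta [/andP[xz zB] lz eta0 rw side]]]] :=
  finite_right_end tc1 tc2 c12 xy dx nl.
have beyond x' y' : x0 <= x' -> btw x0 x' y' -> c2 y' < t -> z < y' /\ y' <= x'.
  move=> xx' xy' cy'; have /andP[h1 h2] : x0 <= y' <= x'.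
    by move: xy'; rewrite /btw => /orP[//|]/andP[? ?]; apply/andP; split; lra.
  split=> //; rewrite ltNge; apply/negP => yz.
  have /andP[_] : dom c1 c2 t y' by apply: lz; rewrite /btw h1 yz.
  by rewrite leNgt cy'.
case: side => side.
  exists (t - 1); first by lra.
  move=> x' xx' [y' [xy' cy' hy']] _; exfalso.
  have [zy' yx'] := beyond _ _ xx' xy' cy'.
  have h1 : Order.min y' B <= y' by rewrite ge_min lexx.
  have h2 : Order.min y' B <= B by rewrite ge_min lexx orbT.
  have h3 : z < Order.min y' B by rewrite lt_min zy' zB.
  have := side (Order.min y' B); rewrite h3 h2 => /(_ isT).
  rewrite ltNge hy'// /btw h1 andbT (le_trans xz (ltW h3))//.
exists (c2 B); first by apply: side; rewrite zB lexx.
move=> x' xx' [y' [xy' cy' hy']] cx'.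
have [zy' yx'] := beyond _ _ xx' xy' cy'.
exists B => //; rewrite (le_trans xz (ltW zB))/= leNgt; apply/negP => xB.
have := side x'; rewrite (lt_le_trans zy' yx') (ltW xB) => /(_ isT).
by rewrite ltNge cx'.
Qed.

Lemma near_window c1 c2 t x0 e : tame c1 -> tame c2 -> (forall x, c1 x < c2 x) ->
  0 < e -> dom c1 c2 t x0 -> exists P1 P2 eta, [/\ 0 < eta <= e,
    hwin (fun x => c1 (- x)) (fun x => c2 (- x)) t (- x0) (fun x => P1 (- x)) eta
    /\ hwin c1 c2 t x0 P2 eta,
    forall x t', P1 x -> P2 x -> `|t' - t| <= eta -> dom c1 c2 t' x ->
      exists2 y, lev c1 c2 t x0 y & lev c1 c2 t' x y &
    ((forall x, x <= x0 -> dom c1 c2 t x) -> forall x, P1 x) /\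
    ((forall x, x0 <= x -> dom c1 c2 t x) -> forall x, P2 x)].
Proof.
move=> tc1 tc2 c12 e0 dx.
have [P2 [e2 [e20 h2 l2 a2]]] := right_near tc1 tc2 c12 dx.
have dx' : dom (fun x => c1 (- x)) (fun x => c2 (- x)) t (- x0) by rewrite /dom opprK.
have [P1 [e1 [e10 h1 l1 a1]]] :=
  right_near (tame_opp tc1) (tame_opp tc2) (fun x => c12 (- x)) dx'.
pose eta := Order.min e (Order.min e1 e2).
have eta0 : 0 < eta by rewrite !lt_min e0 e10 e20.
have ee : eta <= e by rewrite !ge_min lexx.
have ee1 : eta <= e1 by rewrite !ge_min lexx ?orbT.
have ee2 : eta <= e2 by rewrite !ge_min lexx ?orbT.
exists (fun x => P1 (- x)), P2, eta; split.
- by rewrite eta0.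
- split; last exact: hwin_le h2.
  have -> : (fun x => P1 (- - x)) = P1 by apply/funext => x; rewrite opprK.
  exact: hwin_le h1.
- move=> x t' p1 p2 tt dt; have [xx|xx] := leP x0 x.
    by apply: l2 => //; exact: le_trans ee2.
  have [||||y /lev_opp ly /lev_opp ly'] := l1 (- x) t'.
  + by rewrite lerN2 ltW.
  + by [].
  + exact: le_trans ee1.
  + by rewrite /dom opprK.
  by exists (- y); rewrite !opprK in ly ly'.
- split=> // hd x; apply: a1 => y xy; apply: hd; lra.
Qed.

Lemma dips c1 c2 t x0 : tame c1 -> tame c2 -> (forall x, c1 x < c2 x) ->
  dom c1 c2 t x0 -> exists2 tau, tau < t & forall x,
    dn c1 c2 t x0 x -> t <= c2 x -> exists2 w, btw x0 x w & c2 w <= tau.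
Proof.
move=> tc1 tc2 c12 dx.
have [u ut hu] := right_dip tc1 tc2 c12 dx.
have dx' : dom (fun x => c1 (- x)) (fun x => c2 (- x)) t (- x0) by rewrite /dom opprK.
have [v vt hv] :=
  right_dip (tame_opp tc1) (tame_opp tc2) (fun x => c12 (- x)) dx'.
exists (Order.max u v); first by rewrite gt_max ut.
move=> x dnx cx; have [xx|xx] := leP x0 x.
  have [w xw cw] := hu _ xx dnx cx; exists w; first by rewrite /btw xw.
  by rewrite (le_trans cw)// le_max lexx.
have [|||w xw cw] := hv (- x).
- by rewrite lerN2 ltW.
- by apply/dn_opp; rewrite !opprK.
- by rewrite opprK.
exists (- w); last by rewrite (le_trans cw)// le_max lexx orbT.
by rewrite /btw; apply/orP; right; move: xw => /andP[? ?]; apply/andP; split; lra.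
Qed.

End NearWindow.

(** * Edges below and above an end point *)

Section Approach.
Variables (R : realType) (c1 c2 : R -> R) (G : topologicalType).
Variables (Q : R -> R -> G) (cb : G -> R).
Hypotheses (tc1 : tame c1) (tc2 : tame c2) (c12 : forall x, c1 x < c2 x).
Hypotheses (st : strip c1 c2 Q cb) (all_good : forall t, good c1 c2 t).
Hypothesis band_open_open : forall V : set G,
  band_open c1 c2 (fun t x => V (Q t x)) -> open V.
Implicit Types (t x y : R) (S N C E : set G).

Lemma strip_eqQ t x y : dom c1 c2 t x -> dom c1 c2 t y ->
  Q t x = Q t y <-> lev c1 c2 t x y.
Proof. exact: (strip_eq st (all_good t)). Qed.

Let dom_between t u v y : t <= u <= v -> dom c1 c2 t y -> dom c1 c2 v y -> dom c1 c2 u y.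
Proof.
move=> /andP[tu uv] /andP[h1 _] /andP[_ h2].
by rewrite /dom (le_trans h1 tu) (le_trans uv h2).
Qed.

(* If [C] meets the part of the band just below [s], the edges through
   noncritical heights slightly below [s] are bounded above by [s]: an edge
   climbing back above [s] elsewhere would cross a local minimum of [c2]. *)
Lemma edges_max_at_below S N C a x0 t y :
  S = crit_points c1 c2 Q -> NF R S = N ->
  (forall s, N s -> S s \/ connected_component (~` S) s = [set s]) ->
  NF_components R S C -> dom c1 c2 a x0 -> N (Q a x0) ->
  lev c1 c2 a x0 y -> dom c1 c2 t y -> t < a -> C (Q t y) ->
  (forall u, t <= u < a -> ~ N (Q u y)) ->
  edges_max_at S cb C (Q a x0).
Proof.
move=> SE NE hH NC dx Ns ly dy ta Cy nN.
have day : dom c1 c2 a y := lev_domr ly.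
have Qay : Q a y = Q a x0.
  by apply/strip_eqQ => //; exact: lev_sym.
have du u : t <= u <= a -> dom c1 c2 u y by move=> h; exact: dom_between h dy day.
have CE g : C g -> C = connected_component (~` N) g.
  case: NC => g0; rewrite -/(NF R S) NE => Ng0 <- /same_connected_component ->.
  by [].
have CnN : C `<=` ~` N by rewrite (CE _ Cy); exact: connected_component_sub.
have pathC u : t <= u < a -> C (Q u y).
  move=> /andP[tu ua]; rewrite (CE _ Cy).
  pose I := `[t, u]%classic.
  have cI : connected ((fun r => Q r y) @` I).
    apply: connected_continuous_connected.
      by apply/connected_intervalP; exact: interval_is_interval.
    apply: (strip_path (f := id) st) => [r|r]; first exact: cvg_id.
    by rewrite /I/= in_itv/= => /andP[h1 h2]; apply: du; lra.
  apply: (connected_component_max _ _ cI).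
  - by exists t; rewrite // /I/= in_itv/= lexx.
  - move=> _ [r + <-]; rewrite /I/= in_itv/= => /andP[h1 h2].
    by apply: nN; lra.
  - by exists u; rewrite // /I/= in_itv/= lexx andbT.
have [tau0 tau0a hdip] := dips tc1 tc2 c12 dx.
(* The edges are those through the points over [y] at non-critical heights above [tau0], the height
   down to which every dip reaches. *)
pose nc u := (forall x, derive1 c1 x = 0 -> c1 x <> u) /\
             (forall x, derive1 c2 x = 0 -> c2 x <> u).
pose ok u := [/\ t <= u, tau0 < u, u < a & nc u].
pose Ed u := connected_component (~` S) (Q u y).
have okS u : ok u -> ~ S (Q u y).
  move=> [tu _ ua [n1 n2]]; rewrite SE => -[x cx].
  have d1 : dom c1 c2 (c1 x) x by rewrite /dom lexx ltW.
  have d2 : dom c1 c2 (c2 x) x by rewrite /dom lexx andbT ltW.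
  have dd : dom c1 c2 u y by apply: du; lra.
  case: cx => -[dx' E]; have := congr1 cb E; rewrite !(strip_val st)// => /esym.
    exact: n1.
  exact: n2.
have EdS u : ok u -> Ed u (Q u y) by move=> /okS; exact: connected_component_refl.
(* An edge meeting [N] at [g] is the component of [g], hence reduced to [g] by [hH]; but it also
   contains [Q u y], which [nN] keeps outside [N]. *)
have EdN u : ok u -> Ed u `<=` ~` N.
  move=> ou g Eg Ng; have gS : (~` S) g by apply: connected_component_sub Eg.
  case: (hH g Ng) => // gE.
  have EE : Ed u = connected_component (~` S) g by exact: same_connected_component.
  have := EdS u ou; rewrite EE gE => /= Qg; case: ou => tu _ ua _.
  by apply: (nN u); rewrite ?tu// Qg.
have EdC u : ok u -> Ed u `<=` C.
  move=> ou; have [tu _ ua _] := ou; have Cu := pathC u (ltac:(by rewrite tu)).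
  rewrite (CE _ Cu); apply: connected_component_max.
  - exact: EdS.
  - exact: EdN.
  - exact: component_connected.
(* A point of the edge higher than [a] is not above the end point, by [level_separates], so it lies
   past an exit through the upper boundary. On the way [c2] has a minimum of height at most
   [tau0 < u]; it gives a vertex, and the edge would have to join the two branches over it. *)
have Edlow u g : ok u -> Ed u g -> cb g <= a.
  move=> ou Eg; rewrite leNgt; apply/negP => ga.
  have [tu t0u ua nu] := ou.
  have [x' dx' Qx'] := strip_surj st (all_good (cb g)).
  have cE : connected (Ed u) by exact: component_connected.
  have dud : dom c1 c2 u y by apply: du; lra.
  have nE : ~ Ed u (Q a x0) by move=> /(EdN u ou); exact.
  have bu : below c1 c2 a x0 u y by right.
  have nab : ~ above c1 c2 a x0 (cb g) x'.
    move=> ab; apply: (level_separates (tame_continuous tc1) (tame_continuous tc2)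
      c12 st all_good band_open_open dx cE nE dx' _ ab dud (EdS u ou) bu).
    by rewrite Qx'.
  have dnx' : dn c1 c2 a x0 x'.
    case: (above_or_below (tame_continuous tc1) (tame_continuous tc2) c12 (cb g) x' dx)
      => [/nab//|[//|[_ h]]|[gaE _]].
      by move: ga; rewrite ltNge (ltW h).
    by move: ga; rewrite gaE ltxx.
  have cx' : a < c2 x' by move: dx' => /andP[_]; exact: lt_le_trans.
  have [w xw cw] := hdip x' dnx' (ltW cx').
  have nlw z : btw x0 y z -> a <= c2 z by move=> /ly/andP[].
  have wyx : btw y x' w.
    have /orP[xyw|//] := btw_split y xw.
    by have := nlw _ xyw; lra.
  have cy : a <= c2 y by apply: nlw; exact: btwr.
  have wy : w != y by apply/eqP => E; move: cw; rewrite E; lra.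
  have wx' : w != x' by apply/eqP => E; move: cw; rewrite E; lra.
  have [z [zb dz zmin]] : exists z, [/\ y < z < x' \/ x' < z < y, derive1 c2 z = 0 &
      forall v, btw y x' v -> c2 z <= c2 v].
    have [yx'|x'y|yx'E] := ltgtP y x'.
    - have wyx' : y < w < x'.
        move: wyx; rewrite /btw => /orP[]/andP[h1 h2]; last lra.
        by rewrite !lt_neqAle h1 h2 eq_sym wy wx'.
      have [z [zb dz zm]] := interior_min (tame_derivable tc2) wyx'
        (ltac:(lra)) (ltac:(lra)).
      exists z; split=> //; first by left.
      by move=> v; rewrite /btw => /orP[]/andP[h1 h2]; apply: zm; lra.
    - have wyx' : x' < w < y.
        move: wyx; rewrite /btw => /orP[]/andP[h1 h2]; first lra.
        by rewrite !lt_neqAle h1 h2 eq_sym wx' wy.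
      have [z [zb dz zm]] := interior_min (tame_derivable tc2) wyx'
        (ltac:(lra)) (ltac:(lra)).
      exists z; split=> //; first by right.
      by move=> v; rewrite /btw => /orP[]/andP[h1 h2]; apply: zm; lra.
    - by move: wyx; rewrite yx'E /btw orbb => /le_anti E; move: wx'; rewrite E eqxx.
  have czw : c2 z <= c2 w by exact: zmin.
  have nEz : ~ Ed u (Q (c2 z) z).
    move=> /connected_component_sub; apply; rewrite SE; exists z; right; split=> //.
  apply: (cusp_separates (tame_continuous tc1) (tame_continuous tc2)
      c12 st all_good band_open_open cE nEz zb zmin dud (EdS u ou) _ dx').
  - lra.
  - by rewrite Qx'.
  - lra.
have [u1 ou1] : exists u, ok u.
  have ma : Order.max t tau0 < a by rewrite gt_max ta tau0a.
  have [u [/andP[h1 h2] n1 n2]] := exists_noncritical tc1 tc2 ma.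
  move: h1; rewrite gt_max => /andP[h1 h1'].
  by exists u; split=> //; exact: ltW.
exists [set Ed u | u in ok]; split.
- by exists (Ed u1); exists u1.
- by move=> _ [u ou <-]; exists (Q u y) => //; exact: okS.
- by move=> g [_ [u ou <-] Eg]; exact: EdC Eg.
- move=> B; rewrite nbhsE => -[V [oV Vs] VB].
  have Vay : V (Q a y) by rewrite Qay.
  have [d d0 hd] := strip_band_open st oV day Vay.
  have ma : Order.max (Order.max t tau0) (a - d) < a.
    by rewrite !gt_max ta tau0a; lra.
  have [u [/andP[h1 h2] n1 n2]] := exists_noncritical tc1 tc2 ma.
  move: h1; rewrite !gt_max => /andP[/andP[h1 h1'] h1''].
  have ou : ok u by split=> //; exact: ltW.
  exists (Q u y); split.
    by exists (Ed u); [exists u|exact: EdS].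
  apply: VB; apply: hd; rewrite ?subrr ?normr0//.
    by apply: du; lra.
  by rewrite ltr0_norm; lra.
- move=> g; rewrite (strip_val st)//.
  have clo : closed [set g | cb g <= a].
    have -> : [set g | cb g <= a] = cb @^-1` [set r | r <= a] by [].
    apply: preimage_closed; last exact: closed_le.
    by move=> r _; exact: (strip_cont st).
  move: g; rewrite -[forall g, _]/(_ `<=` [set g | cb g <= a]).
  rewrite [X in _ `<=` X](closure_id _).1//; apply: closureS.
  by move=> g [_ [u ou <-] Eg]; exact: Edlow Eg.
Qed.

(* Below [s], the component of [~` S] through [s] would be the whole trunk
   ending at [s], so that no other edge could accumulate at [s] from below. *)
Lemma no_trunk_below S C a x0 :
  S = crit_points c1 c2 Q -> dom c1 c2 a x0 -> NF R S (Q a x0) ->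
  NF_components R S C -> edges_max_at S cb C (Q a x0) -> ~ S (Q a x0) ->
  forall t y, lev c1 c2 a x0 y -> dom c1 c2 t y -> t < a ->
    ~ connected_component (~` S) (Q a x0) (Q t y).
Proof.
move=> SE dx Ns NC [J [_ JE JC sJ Jle]] nS t y ly dy ta.
set K := connected_component _ _ => Ky.
have Ks : K (Q a x0) by exact: connected_component_refl.
have cK : connected K by exact: component_connected.
have KS : K `<=` ~` S by exact: connected_component_sub.
have day : dom c1 c2 a y := lev_domr ly.
have Qay : Q a y = Q a x0 by apply/strip_eqQ => //; exact: lev_sym.
have du u : t <= u <= a -> dom c1 c2 u y by move=> h; exact: dom_between h dy day.
have trunk u : t < u < a -> K (Q u y).
  move=> /andP[tu ua]; apply: contrapT => nK.
  have duy : dom c1 c2 u y by apply: du; lra.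
  have lu : lev c1 c2 u y y by exact: lev_refl.
  apply: (level_separates (tame_continuous tc1) (tame_continuous tc2)
    c12 st all_good band_open_open duy cK nK day _ _ dy Ky).
  - by rewrite Qay.
  - by right.
  - by right.
have CN : C `<=` ~` NF R S.
  by case: NC => g0 _ <-; exact: connected_component_sub.
have [P1 [P2 [eta [/andP[eta0 etae] [hl hr] red _]]]] :=
  near_window tc1 tc2 c12 (ltac:(by rewrite subr_gt0) : 0 < (a - t)) dx.
have gd t' : `|t' - a| <= eta -> good c1 c2 t' by move=> _; exact: all_good.
have oW := band_open_open (owindow_band_open st gd hl hr).
have Ws : owindow c1 c2 Q P1 P2 a eta (Q a x0).
  exists a, x0; split=> //; last by rewrite subrr normr0.
  by split; [have := hwin_base hl; rewrite opprK|exact: hwin_base hr].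
have [g [[e Je eg] Wg]] := sJ _ (open_nbhs_nbhs (conj oW Ws)).
have Cg : C g by apply: JC; exists e.
have ga : cb g <= a.
  have := Jle g; rewrite (strip_val st)//; apply; apply: subset_closure; by exists e.
have [t' [x [dt' [p1 p2] tt gE]]] := Wg.
have [z lz lz'] := red _ _ p1 p2 (ltW tt) dt'.
have dz := lev_domr lz'.
have gz : g = Q t' z by rewrite gE; apply/strip_eqQ.
have cbg : cb g = t' by rewrite gz (strip_val st).
have daz := lev_domr lz.
have ta' : t' < a.
  rewrite lt_neqAle -{2}cbg ga andbT; apply/eqP => E.
  apply: (CN _ Cg); rewrite gz E.
  suff -> : Q a z = Q a x0 by [].
  by apply/strip_eqQ => //; exact: lev_sym.
have tt' : t < t'.
  by have := ler_norm (- (t' - a)); rewrite normrN; lra.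
have dty : dom c1 c2 t' y by apply: du; lra.
(* Otherwise put, the edge of [g] would be [K] itself and contain the end point, which [C]
   avoids. *)
suff Kg : K g.
  have := JE _ Je; case=> g0 nSg0 eE.
  have eg' : e = connected_component (~` S) g.
    by rewrite -eE; apply: same_connected_component; rewrite eE.
  have Ke : e = K.
    by rewrite eg' /K; apply/esym/same_connected_component.
  have Cs : C (Q a x0) by apply: JC; exists e => //; rewrite Ke.
  exact: (CN _ Cs).
suff -> : g = Q t' y by apply: trunk; rewrite tt'.
(* If the levels differ, [c1] has a bump between [y] and [z]. Its top is critical and represents a
   point of the trunk over [y], or the end point itself. *)
rewrite gz; apply/strip_eqQ => //; apply: contrapT => nl.
have lyz : lev c1 c2 a y z by apply: lev_trans lz; exact: lev_sym.
have [w ywz cw] : exists2 w, btw z y w & t' < c1 w.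
  move/existsNP: nl => [w /not_implyP[zyw /negP]]; rewrite /dom negb_and -!ltNge.
  move=> /orP[?|cw]; first by exists w.
  have /andP[_] : dom c1 c2 a w by apply: lyz; rewrite btwC.
  by lra.
have cz : c1 z <= t' by move: dz => /andP[].
have cy : c1 y <= t by move: dy => /andP[].
have [v [vb dv vmax]] : exists v, [/\ btw y z v, derive1 c1 v = 0 &
    forall u, btw y z u -> c1 u <= c1 v].
  have wz : w != z by apply/eqP => E; move: cw; rewrite E; lra.
  have wy : w != y by apply/eqP => E; move: cw; rewrite E; lra.
  have [yz|zy|yzE] := ltgtP y z.
  - have ywz' : y < w < z.
      move: ywz; rewrite /btw => /orP[]/andP[h1 h2]; first lra.
      by rewrite !lt_neqAle h1 h2 eq_sym wy wz.
    have [v [vb dv vm]] := interior_max (tame_derivable tc1) ywz'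
      (ltac:(lra)) (ltac:(lra)).
    exists v; split=> //; first by move: vb; rewrite /btw => /andP[/ltW -> /ltW ->].
    by move=> u; rewrite /btw => /orP[]/andP[h1 h2]; apply: vm; lra.
  - have ywz' : z < w < y.
      move: ywz; rewrite /btw => /orP[]/andP[h1 h2]; last lra.
      by rewrite !lt_neqAle h1 h2 eq_sym wy wz.
    have [v [vb dv vm]] := interior_max (tame_derivable tc1) ywz'
      (ltac:(lra)) (ltac:(lra)).
    exists v; split=> //.
      by move: vb; rewrite /btw => /andP[/ltW -> /ltW ->]; rewrite orbT.
    by move=> u; rewrite /btw => /orP[]/andP[h1 h2]; apply: vm; lra.
  - by move: ywz; rewrite yzE /btw orbb => /le_anti E; move: wz; rewrite E eqxx.
have cwv : c1 w <= c1 v by apply: vmax; rewrite btwC.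
have dav : dom c1 c2 a v by exact: lyz.
have dv1 : dom c1 c2 (c1 v) v by rewrite /dom lexx ltW.
have cva : c1 v <= a by move: dav => /andP[].
have Sv : S (Q (c1 v) v) by rewrite SE; exists v; left.
have dvy : dom c1 c2 (c1 v) y by apply: du; rewrite cva; lra.
have lvy : lev c1 c2 (c1 v) v y.
  move=> u vyu; have yzu : btw y z u.
    apply: (btw_sub vb); by rewrite btwC.
  rewrite /dom vmax//=.
  by have /andP[_] := lyz _ yzu; lra.
have QE : Q (c1 v) v = Q (c1 v) y by apply/strip_eqQ.
have [cva'|cva'] := ltP (c1 v) a.
  apply: (KS _ (trunk (c1 v) _)); last by rewrite -QE.
  by rewrite cva' andbT; lra.
have cE : c1 v = a by apply/le_anti/andP.
by apply: nS; rewrite -Qay -cE -QE.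
Qed.

End Approach.

Section ApproachFrom.
Variables (R : realType) (c1 c2 : R -> R) (G : topologicalType).
Variables (Q : R -> R -> G) (cb : G -> R).
Hypotheses (tc1 : tame c1) (tc2 : tame c2) (c12 : forall x, c1 x < c2 x).
Hypotheses (st : strip c1 c2 Q cb) (all_good : forall t, good c1 c2 t).
Hypothesis band_open_open : forall V : set G,
  band_open c1 c2 (fun t x => V (Q t x)) -> open V.
Implicit Types (t x y : R) (S N C E : set G).

(** What remains of accumulation at [Q a x0] when edges are transported from the compactification:
    they enter all small windows having the properties provided by [near_window]. *)
Definition meets_windows (c1 c2 : R -> R) (Q : R -> R -> G) (J : set (set G))
    (a x0 e : R) : Prop :=
  forall P1 P2 eta, 0 < eta <= e ->
    hwin (fun x => c1 (- x)) (fun x => c2 (- x)) a (- x0) (fun x => P1 (- x)) eta ->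
    hwin c1 c2 a x0 P2 eta ->
    (forall x t', P1 x -> P2 x -> `|t' - a| <= eta -> dom c1 c2 t' x ->
      exists2 y, lev c1 c2 a x0 y & lev c1 c2 t' x y) ->
    ((forall x, x <= x0 -> dom c1 c2 a x) -> forall x, P1 x) ->
    ((forall x, x0 <= x -> dom c1 c2 a x) -> forall x, P2 x) ->
    exists2 g, (\bigcup_(E in J) E) g & owindow c1 c2 Q P1 P2 a eta g.

(** No other height of [N] is within [e] of [a]. So the vertical segment from a point of the family
    inside the window up to the level [a] meets [N] at most at its top, as [edges_max_at_below]
    requires. *)
Lemma edges_max_at_from S N C a x0 e J :
  S = crit_points c1 c2 Q -> NF R S = N ->
  (forall s, N s -> S s \/ connected_component (~` S) s = [set s]) ->
  NF_components R S C -> dom c1 c2 a x0 -> N (Q a x0) -> 0 < e ->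
  (forall g, N g -> cb g = a \/ e <= `|cb g - a|) ->
  \bigcup_(E in J) E `<=` C -> (forall g, (\bigcup_(E in J) E) g -> cb g <= a) ->
  meets_windows c1 c2 Q J a x0 e -> edges_max_at S cb C (Q a x0).
Proof.
move=> SE NE hH NC dx Ns e0 hN JC Ja hJ.
have [P1 [P2 [eta [eta0 [hl hr] red [a1 a2]]]]] := near_window tc1 tc2 c12 e0 dx.
have [g Jg [t [x [dt [p1 p2] tt gE]]]] := hJ P1 P2 eta eta0 hl hr red a1 a2.
have [y ly ly'] := red _ _ p1 p2 (ltW tt) dt.
have dy := lev_domr ly'; have day := lev_domr ly.
have gy : g = Q t y by rewrite gE; apply/(strip_eqQ st all_good).
have cbg : cb g = t by rewrite gy (strip_val st).
have CN : C `<=` ~` N.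
  by case: NC => g0 _ <-; rewrite -NE; exact: connected_component_sub.
have ta : t < a.
  rewrite lt_neqAle -{2}cbg Ja// andbT; apply/eqP => E.
  apply: (CN _ (JC _ Jg)); rewrite gy E.
  suff -> : Q a y = Q a x0 by [].
  by apply/(strip_eqQ st all_good) => //; exact: lev_sym.
apply: (edges_max_at_below tc1 tc2 c12 st all_good band_open_open SE NE hH NC dx
  Ns ly dy ta); first by rewrite -gy; exact: JC.
move=> u /andP[tu ua] Nu.
have du : dom c1 c2 u y.
  by move: dy day; rewrite /dom => /andP[h1 h2] /andP[h3 h4]; apply/andP; split; lra.
have nu : `|u - a| = a - u by rewrite ltr0_norm ?opprB// subr_lt0.
have nt : `|t - a| = a - t by rewrite ltr0_norm ?opprB// subr_lt0.
have := hN _ Nu; rewrite (strip_val st)// nu => -[|]; first lra.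
by move: eta0 tt; rewrite nt => /andP[? ?]; lra.
Qed.

End ApproachFrom.

(** * Exchange of above and below *)

Section Flips.
Variables (R : realType) (c1 c2 : R -> R) (G : topologicalType).
Variables (Q : R -> R -> G).
Local Notation N1 := (fun x => - c2 x).
Local Notation N2 := (fun x => - c1 x).

Lemma crit_points_flip : (forall x, derivable c1 x 1) -> (forall x, derivable c2 x 1) ->
  crit_points N1 N2 (fun t x => Q (- t) x) = crit_points c1 c2 Q.
Proof.
move=> d1 d2; apply/seteqP; split=> g [y h]; exists y; move: h.
- rewrite !derive1Nf//= !opprK => -[] [/eqP + ->]; rewrite oppr_eq0 => /eqP ->.
    by right.
  by left.
- rewrite !derive1Nf//= !opprK => -[] [-> ->]; rewrite oppr0.
    by right.
  by left.
Qed.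

Lemma owindow_flip (P1 P2 : R -> Prop) (a eta : R) :
  owindow N1 N2 (fun t x => Q (- t) x) P1 P2 (- a) eta = owindow c1 c2 Q P1 P2 a eta.
Proof.
apply/seteqP; split=> g [t [x [dt p tt gE]]]; exists (- t), x.
  split=> //; first by rewrite -(@dom_flip _ c1 c2) opprK.
  by rewrite dist_flip.
split; rewrite ?dom_flip ?opprK//.
by rewrite addrC distrC.
Qed.

Lemma hwin_flip (t w : R) (P : R -> Prop) (eta : R) : hwin N1 N2 (- t) w P eta -> hwin c1 c2 t w P eta.
Proof.
move=> [h1 h2 h3 h4]; split=> // x y t' Px Py tt l.
apply: (h4 x y (- t') Px Py); first by rewrite dist_flip opprK.
exact/lev_flip.
Qed.

Lemma hwin_flip_opp (t w : R) (P : R -> Prop) (eta : R) :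
  hwin (fun x => - c2 (- x)) (fun x => - c1 (- x)) (- t) w P eta ->
  hwin (fun x => c1 (- x)) (fun x => c2 (- x)) t w P eta.
Proof.
move=> [h1 h2 h3 h4]; split=> // x y t' Px Py tt l.
apply: (h4 x y (- t') Px Py); first by rewrite dist_flip opprK.
exact/(@lev_flip _ (fun x => c1 (- x)) (fun x => c2 (- x))).
Qed.

Lemma meets_windows_flip J (a x0 e : R) : meets_windows c1 c2 Q J a x0 e ->
  meets_windows N1 N2 (fun t x => Q (- t) x) J (- a) x0 e.
Proof.
move=> h P1 P2 eta eta0 /hwin_flip_opp w1 /hwin_flip w2 red i1 i2.
rewrite owindow_flip; apply: h => //.
- move=> x t' p1 p2 tt dt; have [||y /lev_flip ly /lev_flip ly'] := red x (- t') p1 p2.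
  + by rewrite dist_flip opprK.
  + by rewrite dom_flip.
  by exists y.
- by move=> hd; apply: i1 => x /hd; rewrite dom_flip.
- by move=> hd; apply: i2 => x /hd; rewrite dom_flip.
Qed.

End Flips.

Section FlippedApproach.
Variables (R : realType) (c1 c2 : R -> R) (G : topologicalType).
Variables (Q : R -> R -> G) (cb : G -> R).
Hypotheses (tc1 : tame c1) (tc2 : tame c2) (c12 : forall x, c1 x < c2 x).
Hypotheses (st : strip c1 c2 Q cb) (all_good : forall t, good c1 c2 t).
Hypothesis band_open_open : forall V : set G,
  band_open c1 c2 (fun t x => V (Q t x)) -> open V.
Implicit Types (t x y : R) (S N C E : set G).
Local Notation N1 := (fun x => - c2 x).
Local Notation N2 := (fun x => - c1 x).

Let N12 x : N1 x < N2 x. Proof. by rewrite ltrN2. Qed.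
Let good_all t : good N1 N2 t.
Proof. by rewrite -[t]opprK; apply/good_flip. Qed.
Let bo (V : set G) : band_open N1 N2 (fun t x => V (Q (- t) x)) -> open V.
Proof.
move=> h; apply: band_open_open.
have := @band_open_flip _ _ _ _ h; congr band_open; apply/funext => x; rewrite ?opprK//.
Qed.

Lemma edges_min_at_opp S C s : edges_min_at S cb C s <->
  edges_max_at S (fun g => - cb g) C s.
Proof.
by split=> -[J [h1 h2 h3 h4 h5]]; exists J; split=> // x /h5; rewrite lerN2.
Qed.

Lemma edges_min_at_from S N C a x0 e J :
  S = crit_points c1 c2 Q -> NF R S = N ->
  (forall s, N s -> S s \/ connected_component (~` S) s = [set s]) ->
  NF_components R S C -> dom c1 c2 a x0 -> N (Q a x0) -> 0 < e ->
  (forall g, N g -> cb g = a \/ e <= `|cb g - a|) ->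
  \bigcup_(E in J) E `<=` C -> (forall g, (\bigcup_(E in J) E) g -> a <= cb g) ->
  meets_windows c1 c2 Q J a x0 e -> edges_min_at S cb C (Q a x0).
Proof.
move=> SE NE hH NC dx Ns e0 hN JC Ja hJ; apply/edges_min_at_opp.
have SE' : S = crit_points N1 N2 (fun t x => Q (- t) x).
  by rewrite crit_points_flip//; exact: tame_derivable.
have dx' : dom N1 N2 (- a) x0 by rewrite dom_flip.
have Ns' : N (Q (- - a) x0) by rewrite opprK.
have hN' g : N g -> - cb g = - a \/ e <= `|- cb g - - a|.
  by move=> /hN[->|h]; [left|right; rewrite dist_flip !opprK].
have Ja' g : (\bigcup_(E in J) E) g -> - cb g <= - a by move=> /Ja; rewrite lerN2.
have := edges_max_at_from (tameN tc2) (tameN tc1) N12 (strip_flip st) good_all bo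
  SE' NE hH NC dx' Ns' e0 hN' JC Ja' (meets_windows_flip hJ).
by rewrite opprK.
Qed.

Lemma no_trunk_above S C a x0 :
  S = crit_points c1 c2 Q -> dom c1 c2 a x0 -> NF R S (Q a x0) ->
  NF_components R S C -> edges_min_at S cb C (Q a x0) -> ~ S (Q a x0) ->
  forall t y, lev c1 c2 a x0 y -> dom c1 c2 t y -> a < t ->
    ~ connected_component (~` S) (Q a x0) (Q t y).
Proof.
move=> SE dx Ns NC /edges_min_at_opp M nS t y ly dy ta.
have SE' : S = crit_points N1 N2 (fun t x => Q (- t) x).
  by rewrite crit_points_flip//; exact: tame_derivable.
have dx' : dom N1 N2 (- a) x0 by rewrite dom_flip.
have := @no_trunk_below _ _ _ _ _ _ (tameN tc2) (tameN tc1) N12 (strip_flip st)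
  good_all bo S C (- a) x0 SE' dx'; rewrite opprK => /(_ Ns NC M nS (- t) y).
rewrite opprK; apply.
- exact/lev_flip.
- by rewrite dom_flip.
- by rewrite ltrN2.
Qed.

(** With no trunk on either side, the component meets a window around the point in this point alone,
    which is then both open and closed in it. *)
Lemma trunk_trivial S C C' a x0 :
  S = crit_points c1 c2 Q -> dom c1 c2 a x0 -> NF R S (Q a x0) ->
  NF_components R S C -> edges_max_at S cb C (Q a x0) ->
  NF_components R S C' -> edges_min_at S cb C' (Q a x0) ->
  S (Q a x0) \/ connected_component (~` S) (Q a x0) = [set Q a x0].
Proof.
move=> SE dx Ns NC M NC' M'; have [?|nS] := pselect (S (Q a x0)); [by left|right].
have lo := no_trunk_below tc1 tc2 c12 st all_good band_open_open SE dx Ns NC M nS.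
have hi := no_trunk_above SE dx Ns NC' M' nS.
set K := connected_component _ _ in lo hi *.
have Ks : K (Q a x0) by exact: connected_component_refl.
have [P1 [P2 [eta [/andP[eta0 _] [hl hr] red _]]]] :=
  near_window tc1 tc2 c12 ltr01 dx.
have gd t' : `|t' - a| <= eta -> good c1 c2 t' by move=> _; exact: all_good.
have oW := band_open_open (owindow_band_open st gd hl hr).
have Ws : owindow c1 c2 Q P1 P2 a eta (Q a x0).
  exists a, x0; split=> //; last by rewrite subrr normr0.
  by split; [have := hwin_base hl; rewrite opprK|exact: hwin_base hr].
have KW g : K g -> owindow c1 c2 Q P1 P2 a eta g -> g = Q a x0.
  move=> Kg [t' [x [dt' [p1 p2] tt gE]]].
  have [z lz lz'] := red _ _ p1 p2 (ltW tt) dt'.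
  have dz := lev_domr lz'; have daz := lev_domr lz.
  have gz : g = Q t' z by rewrite gE; apply/(strip_eqQ st all_good).
  have [tlt|tgt|tE] := ltgtP t' a.
  - by exfalso; apply: (lo t' z) => //; rewrite -gz.
  - by exfalso; apply: (hi t' z) => //; rewrite -gz.
  - by rewrite gz tE; apply/(strip_eqQ st all_good) => //; exact: lev_sym.
have cK : connected K by exact: component_connected.
have cut g : K g -> g = Q a x0.
  move=> Kg; apply: contrapT => gs.
  have : K `&` [set Q a x0] = K.
    apply: cK.
    - by exists (Q a x0).
    - exists (owindow c1 c2 Q P1 P2 a eta) => //; apply/seteqP; split=> h [Kh hW].
        by split=> //; rewrite hW.
      by split=> //; exact: KW.
    - exists [set Q a x0] => //; rewrite -[X in closed X]setCK.
      apply: open_closedC; apply: band_open_open => t x dt /= ns.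
      have [ab|be|[tE l]] := above_or_below (tame_continuous tc1)
          (tame_continuous tc2) c12 t x dx; last first.
      + by exfalso; apply: ns; rewrite tE; apply/(strip_eqQ st all_good) => //;
          [rewrite -tE|exact: lev_sym].
      + have [d d0 hd] := below_open (tame_continuous tc1) (tame_continuous tc2)
          c12 dx dt be.
        exists d => // t' x' dt' tt xx E.
        have tE : t' = a by have := congr1 cb E; rewrite !(strip_val st).
        subst t'; have /(strip_eqQ st all_good) l := esym E.
        case: (hd _ _ dt' tt xx) => [dn'|[_]]; last by rewrite ltxx.
        by apply: lev_dn_excl dn'; exact: l.
      + have [d d0 hd] := above_open (tame_continuous tc1) (tame_continuous tc2)
          c12 dx dt ab.
        exists d => // t' x' dt' tt xx E.
        have tE : t' = a by have := congr1 cb E; rewrite !(strip_val st).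
        subst t'; have /(strip_eqQ st all_good) l := esym E.
        case: (hd _ _ dt' tt xx) => [up'|[_]]; last by rewrite ltxx.
        by apply: lev_up_excl up'; exact: l.
  by move=> /seteqP[_ /(_ _ Kg)[]].
by apply/seteqP; split=> g => [/cut|->].
Qed.

End FlippedApproach.

(** * Comparison of the two diagrams *)

Section EndLevels.
Variable R : realType.
Implicit Types (c : R -> R) (a t x : R).

Lemma right_level c1 c2 a t x0 : c1 x @[x --> +oo] --> a -> c2 x @[x --> +oo] --> a ->
  (forall x, x0 <= x -> dom c1 c2 t x) -> t = a.
Proof.
move=> l1 l2 hd; apply/eqP; rewrite eq_le; apply/andP; split; rewrite leNgt; apply/negP => ta.
  have [M [_ hM]] := cvgr_lt a l2 _ ta.
  pose x := Order.max x0 (M + 1).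
  have h1 : x0 <= x by rewrite le_max lexx.
  have h2 : M < x by rewrite lt_max; apply/orP; right; lra.
  have /andP[_] := hd x h1; have := hM x h2 => /=; lra.
have [M [_ hM]] := cvgr_gt a l1 _ ta.
pose x := Order.max x0 (M + 1).
have h1 : x0 <= x by rewrite le_max lexx.
have h2 : M < x by rewrite lt_max; apply/orP; right; lra.
have /andP[+ _] := hd x h1; have := hM x h2 => /=; lra.
Qed.

Lemma cvg_opp_infty c a : c x @[x --> -oo] --> a -> c (- x) @[x --> +oo] --> a.
Proof.
move=> l B nB; have [M [Mr hM]] := l B nB.
exists (- M); split; first by rewrite realN.
by move=> x Mx; apply: hM; lra.
Qed.

Lemma left_level c1 c2 a t x0 : c1 x @[x --> -oo] --> a -> c2 x @[x --> -oo] --> a ->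
  (forall x, x <= x0 -> dom c1 c2 t x) -> t = a.
Proof.
move=> /cvg_opp_infty l1 /cvg_opp_infty l2 hd.
apply: (right_level (x0 := - x0) l1 l2) => x xx.
by apply: (hd (- x)); lra.
Qed.

Definition crit_acc c1 c2 t : Prop := forall M, exists x, M < x /\
  ((derive1 c1 x = 0 /\ c1 x <> t) \/ (derive1 c2 x = 0 /\ c2 x <> t)).

(** An end of the component is harmless if it is finite, or if the critical points of the boundary
    curves far out have the height of the level. With two harmless ends [star_nbhd] applies. *)
Lemma NF_crit_acc c1 c2 a1 a2 (G : topologicalType) (Q : R -> R -> G) cb t x0 :
  tame c1 -> tame c2 -> (forall x, c1 x < c2 x) ->
  c1 x @[x --> -oo] --> a1 -> c2 x @[x --> -oo] --> a1 ->
  c1 x @[x --> +oo] --> a2 -> c2 x @[x --> +oo] --> a2 ->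
  strip c1 c2 Q cb ->
  (forall x y : G, good c1 c2 (cb x) -> good c1 c2 (cb y) ->
    cluster (nbhs x) y -> x = y) ->
  (forall V : set G, (forall g, V g -> good c1 c2 (cb g)) ->
     band_open c1 c2 (fun t x => V (Q t x)) -> open V) ->
  dom c1 c2 t x0 ->
  (exists2 e, 0 < e & forall t', `|t' - t| <= e -> good c1 c2 t') ->
  NF R (crit_points c1 c2 Q) (Q t x0) ->
  ((forall x, x0 <= x -> dom c1 c2 t x) /\ crit_acc c1 c2 t) \/
  ((forall x, x <= x0 -> dom c1 c2 t x) /\
    crit_acc (fun x => c1 (- x)) (fun x => c2 (- x)) t).
Proof.
move=> tc1 tc2 c12 l1 l2 r1 r2 st hG bo dx gd nf.
apply: contrapT => /not_orP[nr nl].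
have side (d1 d2 : R -> R) a y : d1 x @[x --> +oo] --> a -> d2 x @[x --> +oo] --> a ->
    ~ ((forall x, y <= x -> dom d1 d2 t x) /\ crit_acc d1 d2 t) ->
    finite_end d1 d2 t y \/ tame_end d1 d2 t y.
  move=> k1 k2 h; have [?|nf'] := pselect (finite_end d1 d2 t y); [by left|right].
  have hd x : y <= x -> dom d1 d2 t x.
    by move=> yx; apply/negPn/negP => nd; apply: nf'; exists x.
  have ta := right_level k1 k2 hd; rewrite ta in hd h *; split=> //.
  apply: contrapT => /forallNP hM; apply: h; split=> // M.
  have /existsNP[x /not_implyP[Mx hx]] := hM M; exists x; split=> //.
  by move/not_andP: hx => [/not_implyP[? ?]|/not_implyP[? ?]]; [left|right].
have hr := side _ _ _ _ r1 r2 nr.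
have hl : finite_end (fun x => c1 (- x)) (fun x => c2 (- x)) t (- x0) \/
    tame_end (fun x => c1 (- x)) (fun x => c2 (- x)) t (- x0).
  apply: (side _ _ _ _ (cvg_opp_infty l1) (cvg_opp_infty l2)) => -[h1 h2].
  apply: nl; split=> // x xx; have := h1 (- x); rewrite /dom opprK; apply.
  by rewrite lerN2.
have [U [nU gU cU _]] := @star_nbhd R c1 c2 G Q cb tc1 tc2 c12 st hG False
  (fun V h1 h2 _ => bo V h1 h2) t x0 dx gd (fun f => False_ind _ f) hr hl.
apply: nf; exists U; split=> //.
  by apply/seteqP; split=> // g [Ug [Sg ng]]; apply: ng; exact: cU.
by exists (subsp U); split=> //; exact: homeomorphic_refl.
Qed.

End EndLevels.

(** * Transport of the diagram between the two Reeb spaces *)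

Section Key.
Variables (R : realType) (c1 c2 : R -> R) (a1 a2 xm xp : R).
Hypotheses (tc1 : tame c1) (tc2 : tame c2) (c12 : forall x, c1 x < c2 x).
Hypotheses (c1m : c1 x @[x --> -oo] --> a1) (c2m : c2 x @[x --> -oo] --> a1).
Hypotheses (c1p : c1 x @[x --> +oo] --> a2) (c2p : c2 x @[x --> +oo] --> a2).
Hypothesis all_good : forall t, good c1 c2 t.
Hypotheses (dm : forall x, x <= xm -> dom c1 c2 a1 x)
           (dp : forall x, xp <= x -> dom c1 c2 a2 x).
Variables (G : topologicalType) (Q : R -> R -> G) (cb : G -> R).
Hypotheses (st : strip c1 c2 Q cb) (hG : hausdorff_space G).
Hypothesis bo : forall V : set G,
  band_open c1 c2 (fun t x => V (Q t x)) -> open V.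
Variables (G' : topologicalType) (Q' : R -> R -> G') (cb' : G' -> R).
Hypotheses (st' : strip c1 c2 Q' cb') (hG' : hausdorff_space G').
Local Notation sm := (Q a1 xm).
Local Notation sp := (Q a2 xp).
Local Notation sm' := (Q' a1 xm).
Local Notation sp' := (Q' a2 xp).
(** With [fom] and [fop] this describes the topology of the compactification: a neighbourhood of an
    end contains everything far out on its side, at all heights. *)
Hypothesis bo' : forall V : set G',
  band_open c1 c2 (fun t x => V (Q' t x)) ->
  (V sm' -> exists M, forall t x, x < M -> dom c1 c2 t x -> V (Q' t x)) ->
  (V sp' -> exists M, forall t x, M < x -> dom c1 c2 t x -> V (Q' t x)) ->
  open V.
Hypothesis fom : forall V : set G', open V -> V sm' ->
  exists M, forall t x, x < M -> dom c1 c2 t x -> V (Q' t x).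
Hypothesis fop : forall V : set G', open V -> V sp' ->
  exists M, forall t x, M < x -> dom c1 c2 t x -> V (Q' t x).
Let S := crit_points c1 c2 Q.
Let S' := crit_points c1 c2 Q' `|` [set sm'; sp'].
Let N : set G := [set sm; sp].
Hypothesis NFS : NF R S = N.
Hypothesis trunk : forall s, N s -> S s \/ connected_component (~` S) s = [set s].
Implicit Types (t x y : R).

Let eqQ t x y : dom c1 c2 t x -> dom c1 c2 t y -> Q t x = Q t y <-> lev c1 c2 t x y.
Proof. exact: (strip_eqQ st all_good). Qed.
Let eqQ' t x y : dom c1 c2 t x -> dom c1 c2 t y -> Q' t x = Q' t y <-> lev c1 c2 t x y.
Proof. exact: (strip_eqQ st' all_good). Qed.
Let dxm : dom c1 c2 a1 xm. Proof. exact: dm. Qed.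
Let dxp : dom c1 c2 a2 xp. Proof. exact: dp. Qed.

Let iota (g : G) : G' := Q' (cb g) (xget 0 [set x | dom c1 c2 (cb g) x /\ Q (cb g) x = g]).
Let jota (g : G') : G := Q (cb' g) (xget 0 [set x | dom c1 c2 (cb' g) x /\ Q' (cb' g) x = g]).

Let iotaQ t x : dom c1 c2 t x -> iota (Q t x) = Q' t x.
Proof.
move=> dx; rewrite /iota (strip_val st)//.
have [d E] := @xgetPex _ 0 [set y | dom c1 c2 t y /\ Q t y = Q t x]
  (ex_intro _ x (conj dx erefl)).
exact: (eqQ' d dx).2 ((eqQ d dx).1 E).
Qed.

Let jotaQ t x : dom c1 c2 t x -> jota (Q' t x) = Q t x.
Proof.
move=> dx; rewrite /jota (strip_val st')//.
have [d E] := @xgetPex _ 0 [set y | dom c1 c2 t y /\ Q' t y = Q' t x]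
  (ex_intro _ x (conj dx erefl)).
exact: (eqQ d dx).2 ((eqQ' d dx).1 E).
Qed.

Let repQ (g : G) : exists t x, dom c1 c2 t x /\ g = Q t x.
Proof. by have [x dx E] := strip_surj st (all_good (cb g)); exists (cb g), x. Qed.

Let repQ' (g : G') : exists t x, dom c1 c2 t x /\ g = Q' t x.
Proof. by have [x dx E] := strip_surj st' (all_good (cb' g)); exists (cb' g), x. Qed.

Let iotaK g : jota (iota g) = g.
Proof. by have [t [x [dx ->]]] := repQ g; rewrite iotaQ// jotaQ. Qed.

Let jotaK g : iota (jota g) = g.
Proof. by have [t [x [dx ->]]] := repQ' g; rewrite jotaQ// iotaQ. Qed.

Let cb_iota g : cb' (iota g) = cb g.
Proof. by have [t [x [dx ->]]] := repQ g; rewrite iotaQ// (strip_val st)// (strip_val st'). Qed.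

Let iota_cont : continuous iota.
Proof.
apply/continuousP => V oV; apply: bo => t x dx /=; rewrite iotaQ// => Vx.
have [d d0 hd] := strip_band_open st' oV dx Vx; exists d => // t' x' dx' tt xx.
by rewrite iotaQ//; exact: hd.
Qed.

Let openN (V : set G) : open V -> V `&` N = set0 -> open (jota @^-1` V).
Proof.
move=> oV VN; apply: bo'.
- move=> t x dx /=; rewrite jotaQ// => Vx.
  have [d d0 hd] := strip_band_open st oV dx Vx; exists d => // t' x' dx' tt xx.
  by rewrite jotaQ//; exact: hd.
- move=> /=; rewrite jotaQ// => Vm; exfalso.
  by move/seteqP: VN => [h _]; apply: (h sm); split=> //; left.
- move=> /=; rewrite jotaQ// => Vp; exfalso.
  by move/seteqP: VN => [h _]; apply: (h sp); split=> //; right.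
Qed.

Let closedN : closed N.
Proof.
apply: (accessible_finite_set_closed.1 (hausdorff_accessible hG)).
exact: finite_set2.
Qed.

Let jota_cont (g : G') : ~ N (jota g) -> {for g, continuous jota}.
Proof.
move=> nN B; rewrite nbhsE => -[V [oV Vg] VB].
rewrite nbhs_simpl nbhsE; exists (jota @^-1` (V `&` ~` N)).
  split; last by split.
  apply: openN; first by apply: openI => //; exact: closed_openC.
  by apply/seteqP; split=> // h [[_ +] ?]; exact.
by move=> h [/VB].
Qed.

Let T (A : set G) : set G' := jota @^-1` A.

Let T_image (A : set G) : T A = iota @` A.
Proof.
apply/seteqP; split=> [g Ag|_ [g Ag <-]]; last by rewrite /T/= iotaK.
by exists (jota g); rewrite ?jotaK.
Qed.

Let T_iota (B : set G') : T (iota @^-1` B) = B.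
Proof. by apply/seteqP; split=> g; rewrite /T/= jotaK. Qed.

Let T_connected A : connected A -> connected (T A).
Proof.
move=> cA; rewrite T_image; apply: connected_continuous_connected => //.
exact: continuous_subspaceT.
Qed.

Let iota_connected B : connected B -> B `<=` ~` (T N) -> connected (iota @^-1` B).
Proof.
move=> cB BN; have -> : iota @^-1` B = jota @` B.
  apply/seteqP; split=> [g Bg|_ [g Bg <-]]; last by rewrite /= jotaK.
  by exists (iota g); rewrite ?iotaK.
apply: connected_continuous_connected => //.
apply: continuous_in_subspaceT => g; rewrite inE => Bg.
by apply: jota_cont; exact: BN.
Qed.

(** [iota] carries connected sets one way. For the other way [jota] is continuous on the complement
    of [T Z], since [Z] contains the ends. *)
Let component_T (Z : set G) (g : G') : N `<=` Z -> ~ T Z g ->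
  connected_component (~` T Z) g = T (connected_component (~` Z) (jota g)).
Proof.
move=> NZ nZg; apply/seteqP; split.
  rewrite -[X in X `<=` _]T_iota.
  apply: (@preimage_subset _ _ jota); apply: connected_component_max.
  - by rewrite /= jotaK; exact: connected_component_refl.
  - move=> h /connected_component_sub; rewrite /T/= iotaK; exact.
  - apply: iota_connected; first exact: component_connected.
    by move=> h /connected_component_sub + Nh; apply; exact: NZ.
apply: connected_component_max.
- exact: connected_component_refl.
- by move=> h /connected_component_sub.
- by apply: T_connected; exact: component_connected.
Qed.

Let right_end t x0 : (forall x, x0 <= x -> dom c1 c2 t x) -> t = a2 /\ Q t x0 = sp.
Proof.
move=> hd; have tE := right_level c1p c2p hd; split=> //; subst t.
apply/eqQ => //; first by apply: hd.
move=> w; rewrite /btw => /orP[]/andP[h1 h2]; [exact: hd|exact: dp].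
Qed.

Let left_end t x0 : (forall x, x <= x0 -> dom c1 c2 t x) -> t = a1 /\ Q t x0 = sm.
Proof.
move=> hd; have tE := left_level c1m c2m hd; split=> //; subst t.
apply/eqQ => //; first by apply: hd.
move=> w; rewrite /btw => /orP[]/andP[h1 h2]; [exact: dm|exact: hd].
Qed.

Let d1 y : dom c1 c2 (c1 y) y. Proof. by rewrite /dom lexx ltW. Qed.
Let d2 y : dom c1 c2 (c2 y) y. Proof. by rewrite /dom lexx andbT ltW. Qed.

Let S'E : S' = T (S `|` N).
Proof.
apply/seteqP; split=> g.
- case=> [[y [[dy ->]|[dy ->]]]|[->|->]]; rewrite /T/= jotaQ//.
  + by left; exists y; left.
  + by left; exists y; right.
  + by right; left.
  + by right; right.
- rewrite /T/= => -[[y [[dy E]|[dy E]]]|[E|E]]; rewrite -[g]jotaK E iotaQ//.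
  + by left; exists y; left.
  + by left; exists y; right.
  + by right; left.
  + by right; right.
Qed.

(** A neighbourhood of the end contains the far part of the band, and there critical points at
    heights other than that of the end, which are other vertices. *)
Let NF'_right : crit_acc c1 c2 a2 -> NF R S' sp'.
Proof.
move=> acc [U [nU US _]]; move: nU; rewrite nbhsE => -[V [oV Vs] VU].
have [M hM] := fop oV Vs; have [x [Mx cx]] := acc M.
move/seteqP: US => [h _].
case: cx => -[dx nx].
  apply: (h (Q' (c1 x) x)); split; first by apply: VU; apply: hM.
  split; first by left; exists x; left.
  by move=> E; apply: nx; have := congr1 cb' E; rewrite !(strip_val st').
apply: (h (Q' (c2 x) x)); split; first by apply: VU; apply: hM.
split; first by left; exists x; right.
by move=> E; apply: nx; have := congr1 cb' E; rewrite !(strip_val st').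
Qed.

Let NF'_left : crit_acc (fun x => c1 (- x)) (fun x => c2 (- x)) a1 -> NF R S' sm'.
Proof.
move=> acc [U [nU US _]]; move: nU; rewrite nbhsE => -[V [oV Vs] VU].
have [M hM] := fom oV Vs; have [x [Mx cx]] := acc (- M).
have xM : - x < M by rewrite ltrNl.
move/seteqP: US => [h _].
move: cx; rewrite !derive1_opp; try exact: tame_derivable.
case=> -[/eqP]; rewrite oppr_eq0 => /eqP dx nx.
  apply: (h (Q' (c1 (- x)) (- x))); split; first by apply: VU; apply: hM.
  split; first by left; exists (- x); left.
  by move=> E; apply: nx; have := congr1 cb' E; rewrite !(strip_val st').
apply: (h (Q' (c2 (- x)) (- x))); split; first by apply: VU; apply: hM.
split; first by left; exists (- x); right.
by move=> E; apply: nx; have := congr1 cb' E; rewrite !(strip_val st').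
Qed.

Let hGc (x y : G) : good c1 c2 (cb x) -> good c1 c2 (cb y) ->
  cluster (nbhs x) y -> x = y.
Proof. by move=> _ _; exact: hG. Qed.

Let hGc' (x y : G') : good c1 c2 (cb' x) -> good c1 c2 (cb' y) ->
  cluster (nbhs x) y -> x = y.
Proof. by move=> _ _; exact: hG'. Qed.

Let gd t : exists2 e, 0 < e & forall t', `|t' - t| <= e -> good c1 c2 t'.
Proof. by exists 1. Qed.

Let NF'_base t x0 : dom c1 c2 t x0 -> NF R S (Q t x0) -> NF R S' (Q' t x0).
Proof.
move=> dx nf.
have [[hd acc]|[hd acc]] := NF_crit_acc tc1 tc2 c12 c1m c2m c1p c2p st hGc
    (fun V _ => bo (V := V)) dx (gd t) nf.
- have [tE sE] := right_end hd; subst t.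
  have -> : Q' a2 x0 = sp' by rewrite -[LHS]iotaQ// sE iotaQ.
  exact: NF'_right.
- have [tE sE] := left_end hd; subst t.
  have -> : Q' a1 x0 = sm' by rewrite -[LHS]iotaQ// sE iotaQ.
  exact: NF'_left.
Qed.

(** A bounded part contains no end, as an end is represented by pairs arbitrarily far away; the
    conditions of [bo'] at the ends are then void. *)
Let bo'_bounded (V : set G') : (forall g, V g -> good c1 c2 (cb' g)) ->
  band_open c1 c2 (fun t x => V (Q' t x)) ->
  (True -> bounded_part c1 c2 Q' V) -> open V.
Proof.
move=> _ bV /(_ I)[A [B hAB]]; apply: bo' => // Vs; exfalso.
- have h1 : Order.min xm (A - 1) <= xm by rewrite ge_min lexx.
  have h2 : Order.min xm (A - 1) <= A - 1 by rewrite ge_min lexx orbT.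
  have dz := dm h1.
  have E : Q' a1 (Order.min xm (A - 1)) = sm'.
    apply/eqQ' => // w; rewrite /btw => /orP[]/andP[? ?]; apply: dm; lra.
  by move: (hAB _ _ dz); rewrite E => /(_ Vs); lra.
- have h1 : xp <= Order.max xp (B + 1) by rewrite le_max lexx.
  have h2 : B + 1 <= Order.max xp (B + 1) by rewrite le_max lexx orbT.
  have dz := dp h1.
  have E : Q' a2 (Order.max xp (B + 1)) = sp'.
    apply/eqQ' => // w; rewrite /btw => /orP[]/andP[? ?]; apply: dp; lra.
  by move: (hAB _ _ dz); rewrite E => /(_ Vs); lra.
Qed.

(** A point outside [N] comes from a component that is bounded on both sides, so it has a bounded
    star. The ends, which are the vertices added to the critical points, lie outside of it. *)
Let NF'_sub t x0 : dom c1 c2 t x0 -> NF R S' (Q' t x0) -> N (Q t x0).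
Proof.
move=> dx nf; apply: contrapT => nN.
have fr : finite_end c1 c2 t x0.
  apply: contrapT => h; apply: nN; right.
  suff [] : t = a2 /\ Q t x0 = sp by [].
  apply: right_end => x xx; apply/negPn/negP => nd; apply: h; by exists x.
have fl : finite_end (fun x => c1 (- x)) (fun x => c2 (- x)) t (- x0).
  apply: contrapT => h; apply: nN; left.
  suff [] : t = a1 /\ Q t x0 = sm by [].
  apply: left_end => x xx; apply/negPn/negP => nd; apply: h; exists (- x).
  by rewrite lerN2 xx /dom opprK.
have [U [nU gU cU bU]] := @star_nbhd R c1 c2 G' Q' cb' tc1 tc2 c12 st' hGc' True
  bo'_bounded t x0 dx (gd t) (fun _ => conj fr fl) (or_introl fr) (or_introl fl).
have [A [B hAB]] := bU (conj fr fl).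
apply: nf; exists U; split=> //; last first.
  by exists (subsp U); split=> //; exact: homeomorphic_refl.
apply/seteqP; split=> // g [Ug [Sg ng]].
case: Sg => [cg|[gE|gE]]; first by apply: ng; exact: cU.
- have h1 : Order.min xm (A - 1) <= xm by rewrite ge_min lexx.
  have h2 : Order.min xm (A - 1) <= A - 1 by rewrite ge_min lexx orbT.
  have dz := dm h1.
  have E : Q' a1 (Order.min xm (A - 1)) = sm'.
    apply/eqQ' => // w; rewrite /btw => /orP[]/andP[? ?]; apply: dm; lra.
  by move: (hAB _ _ dz); rewrite E -gE => /(_ Ug); lra.
- have h1 : xp <= Order.max xp (B + 1) by rewrite le_max lexx.
  have h2 : B + 1 <= Order.max xp (B + 1) by rewrite le_max lexx orbT.
  have dz := dp h1.
  have E : Q' a2 (Order.max xp (B + 1)) = sp'.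
    apply/eqQ' => // w; rewrite /btw => /orP[]/andP[? ?]; apply: dp; lra.
  by move: (hAB _ _ dz); rewrite E -gE => /(_ Ug); lra.
Qed.

Let NF'E : NF R S' = T N.
Proof.
apply/seteqP; split=> g; have [t [x [dx ->]]] := repQ' g.
- by move=> /(NF'_sub dx); rewrite /T/= jotaQ.
- by rewrite /T/= jotaQ// -NFS; exact: NF'_base.
Qed.

Let componentsE : NF_components R S' = [set T C | C in NF_components R S].
Proof.
rewrite /NF_components -/(NF R S') -/(NF R S) NF'E NFS; apply/seteqP; split.
- move=> _ [g nN <-]; rewrite component_T//.
  exists (connected_component (~` N) (jota g)) => //.
  by exists (jota g).
- move=> _ [_ [g nN <-] <-]; exists (iota g); first by rewrite /T/= iotaK.
  by rewrite component_T//= ?iotaK// /T/= iotaK.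
Qed.

Let trunk_component g : ~ (S `|` N) g ->
  connected_component (~` (S `|` N)) g = connected_component (~` S) g.
Proof.
move=> /not_orP[nS nN].
have avoid : connected_component (~` S) g `<=` ~` N.
  move=> h Kh Nh; case: (trunk Nh); first exact: (connected_component_sub Kh).
  move=> E; apply: nN; have := same_connected_component Kh.
  rewrite E => E'; have : connected_component (~` S) g g by exact: connected_component_refl.
  by rewrite E' => ->.
apply/seteqP; split; apply: connected_component_max.
- by apply: connected_component_refl => -[].
- by move=> h /connected_component_sub/not_orP[].
- exact: component_connected.
- exact: connected_component_refl.
- by move=> h Kh [/(connected_component_sub Kh)//|]; exact: avoid.
- exact: component_connected.
Qed.

Let edges'P e' : edges S' e' ->
  exists e, [/\ edges S e, e `&` N = set0 & e' = T e].
Proof.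
rewrite /edges S'E => -[g ng <-]; rewrite component_T; [|by right|exact: ng].
exists (connected_component (~` (S `|` N)) (jota g)); split=> //.
  by rewrite trunk_component//; exists (jota g) => //; move/not_orP: ng => [].
by apply/seteqP; split=> // h [/connected_component_sub/not_orP[_ nN] /nN].
Qed.

Let edgesT e : edges S e -> e `&` N = set0 -> edges S' (T e).
Proof.
move=> [g ng <-] eN.
have nN : ~ N g.
  move=> Ng; move/seteqP: eN => [/(_ g) h _]; apply: h; split=> //.
  exact: connected_component_refl.
have nSN : ~ (S `|` N) g by case.
rewrite /edges S'E; exists (iota g); first by rewrite /T/= iotaK.
by rewrite component_T ?iotaK -?trunk_component// /T/= ?iotaK//; right.
Qed.

(** Stated for an arbitrary pair of compatible functions, so that minima follow by a change of
    sign. *)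
Let max_forth (k : G -> R) (k' : G' -> R) C s : continuous k' -> (forall g, k' (iota g) = k g) ->
  C `<=` ~` N -> edges_max_at S k C s -> edges_max_at S' k' (T C) (iota s).
Proof.
move=> ck kE CN [J [[e0 Je0] JE JC sJ Jle]].
have avoid e : J e -> e `&` N = set0.
  by move=> Je; apply/seteqP; split=> // g [eg Ng]; apply: (CN g) => //; apply: JC; exists e.
exists [set T e | e in J]; split.
- by exists (T e0); exists e0.
- by move=> _ [e Je <-]; apply: edgesT; [exact: JE|exact: avoid].
- by move=> g [_ [e Je <-] eg]; apply: JC; exists e.
- move=> B nB; have [g [[e Je eg] Bg]] := sJ _ (iota_cont nB).
  exists (iota g); split=> //; exists (T e); first by exists e.
  by rewrite /T/= iotaK.
- have clo : closed [set g | k' g <= k' (iota s)].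
    have -> : [set g | k' g <= k' (iota s)] = k' @^-1` [set r | r <= k' (iota s)] by [].
    by apply: preimage_closed; [move=> r _; exact: ck|exact: closed_le].
  rewrite -[forall g, _]/(_ `<=` [set g | k' g <= k' (iota s)]).
  rewrite [X in _ `<=` X](closure_id _).1//; apply: closureS.
  move=> g [_ [e Je <-] eg] /=; rewrite -[g]jotaK !kE; apply: Jle.
  by apply: subset_closure; exists e.
Qed.

(** A small window is open in the compactification too. If it contains an end, this end has height
    [a] and the level of [x0] is unbounded on that side; so the window extends to infinity there,
    where the band is squeezed around the height [a]. *)
Let windows (J' : set (set G')) (a x0 : R) : dom c1 c2 a x0 -> N (Q a x0) ->
  closure (\bigcup_(E in J') E) (Q' a x0) ->
  exists2 e, 0 < e & (forall g, N g -> cb g = a \/ e <= `|cb g - a|) /\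
    forall J : set (set G), \bigcup_(E in J') E `<=` T (\bigcup_(E in J) E) ->
      meets_windows c1 c2 Q J a x0 e.
Proof.
move=> dx Ns sJ.
(* An end at height [a] itself imposes no bound; 1 is a default. *)
pose gap b := if b == a then 1 else `|b - a|.
have gap0 b : 0 < gap b.
  by rewrite /gap; case: eqVneq => // ba; rewrite normr_gt0 subr_eq0.
pose e := Order.min (gap a1) (gap a2).
have e1 : e <= gap a1 by rewrite ge_min lexx.
have e2 : e <= gap a2 by rewrite ge_min lexx orbT.
exists e; first by rewrite lt_min !gap0.
split.
  move=> g [->|->]; rewrite (strip_val st)//.
    by move: e1; rewrite /gap; case: eqVneq => [->|_]; [left|right].
  by move: e2; rewrite /gap; case: eqVneq => [->|_]; [left|right].
move=> J JJ P1 P2 eta /andP[eta0 etae] hl hr red i1 i2.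
have gdt t' : `|t' - a| <= eta -> good c1 c2 t' by move=> _; exact: all_good.
have oP := owindowP st' gdt hl hr.
have close b : `|b - a| < eta -> eta <= gap b -> b = a.
  by rewrite /gap; case: eqVneq => // _ h1 h2; lra.
have Ws : owindow c1 c2 Q' P1 P2 a eta (Q' a x0).
  exists a, x0; split=> //; last by rewrite subrr normr0.
  by split; [have := hwin_base hl; rewrite opprK|exact: hwin_base hr].
have oW : open (owindow c1 c2 Q' P1 P2 a eta).
  apply: bo'; first exact: (owindow_band_open st' gdt hl hr).
  - move=> /(oP _ _ dxm)[p1 p2 tt].
    have aE : a1 = a by apply: close => //; exact: le_trans e1.
    have [y ly ly'] := red _ _ p1 p2 (ltW tt) dxm.
    have hd x : x <= x0 -> dom c1 c2 a x.
      move=> xx; have [xxm|xmx] := leP x xm; first by rewrite -aE; exact: dm.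
      rewrite aE in ly'; apply: (lev_trans ly (lev_sym ly')).
      by rewrite /btw xx (ltW xmx) orbT.
    have [M1 [_ h1]] := cvgr_lt a1 c2m (a1 + eta) (ltac:(lra)).
    have [M2 [_ h2]] := cvgr_gt a1 c1m (a1 - eta) (ltac:(lra)).
    exists (Order.min x0 (Order.min M1 M2)) => t x; rewrite !lt_min.
    move=> /andP[xx0 /andP[xM1 xM2]] dt; exists t, x; split=> //.
      split; first exact: i1.
      by apply: (hwin_down hr) (hwin_base hr) _; exact: ltW.
    have /= := h1 x xM1; have /= := h2 x xM2; move: dt => /andP[? ?] ? ?.
    by rewrite ltr_norml -aE; apply/andP; split; lra.
  - move=> /(oP _ _ dxp)[p1 p2 tt].
    have aE : a2 = a by apply: close => //; exact: le_trans e2.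
    have [y ly ly'] := red _ _ p1 p2 (ltW tt) dxp.
    have hd x : x0 <= x -> dom c1 c2 a x.
      move=> xx; have [xxm|xmx] := leP xp x; first by rewrite -aE; exact: dp.
      rewrite aE in ly'; apply: (lev_trans ly (lev_sym ly')).
      by rewrite /btw xx (ltW xmx).
    have [M1 [_ h1]] := cvgr_lt a2 c2p (a2 + eta) (ltac:(lra)).
    have [M2 [_ h2]] := cvgr_gt a2 c1p (a2 - eta) (ltac:(lra)).
    exists (Order.max x0 (Order.max M1 M2)) => t x; rewrite !gt_max.
    move=> /andP[xx0 /andP[xM1 xM2]] dt; exists t, x; split=> //.
      split; last exact: i2.
      have := @hwin_down _ _ _ _ _ _ _ hl (- x) (- x0); rewrite !opprK; apply.
        by have := hwin_base hl; rewrite opprK.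
      by rewrite lerN2 ltW.
    have /= := h1 x xM1; have /= := h2 x xM2; move: dt => /andP[? ?] ? ?.
    by rewrite ltr_norml -aE; apply/andP; split; lra.
have [g [Jg [t [x [dt p tt gE]]]]] := sJ _ (open_nbhs_nbhs (conj oW Ws)).
exists (jota g); first exact: JJ.
by exists t, x; split=> //; rewrite gE jotaQ.
Qed.

Let pull_back (J' : set (set G')) C : J' `<=` edges S' ->
  \bigcup_(E in J') E `<=` T C ->
  exists J : set (set G), [/\ \bigcup_(E in J) E `<=` C,
    \bigcup_(E in J') E `<=` T (\bigcup_(E in J) E) &
    T (\bigcup_(E in J) E) `<=` \bigcup_(E in J') E].
Proof.
move=> JE JC; exists [set e | J' (T e)]; split.
- by move=> g [e Je eg]; have := JC (iota g); rewrite /T/= iotaK; apply;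
    exists (T e) => //; rewrite /T/= iotaK.
- move=> g [e' Je' eg]; have [e [_ _ eE]] := edges'P (JE _ Je').
  by rewrite eE in Je' eg; exists e.
- by move=> g [e Je eg]; exists (T e).
Qed.

Let repN s : N s -> exists a x0, dom c1 c2 a x0 /\ s = Q a x0.
Proof. by case=> ->; [exists a1, xm|exists a2, xp]. Qed.

Let max_back C s : NF_components R S C -> N s ->
  edges_max_at S' cb' (T C) (iota s) -> edges_max_at S cb C s.
Proof.
move=> NC Ns [J' [_ JE JC sJ Jle]].
have [a [x0 [dx sE]]] := repN Ns; rewrite sE iotaQ// in sJ Jle; rewrite sE in Ns *.
have [e e0 [hN hJ]] := windows dx Ns sJ.
have [J [h1 h2 h3]] := pull_back JE JC.
apply: (edges_max_at_from tc1 tc2 c12 st all_good bo erefl NFS trunk NC dx Ns e0 hN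
  h1 _ (hJ J h2)).
move=> g Jg; have := Jle (iota g); rewrite cb_iota (strip_val st')//; apply.
by apply: subset_closure; apply: h3; rewrite /T/= iotaK.
Qed.

Let min_back C s : NF_components R S C -> N s ->
  edges_min_at S' cb' (T C) (iota s) -> edges_min_at S cb C s.
Proof.
move=> NC Ns [J' [_ JE JC sJ Jle]].
have [a [x0 [dx sE]]] := repN Ns; rewrite sE iotaQ// in sJ Jle; rewrite sE in Ns *.
have [e e0 [hN hJ]] := windows dx Ns sJ.
have [J [h1 h2 h3]] := pull_back JE JC.
apply: (edges_min_at_from tc1 tc2 c12 st all_good bo erefl NFS trunk NC dx Ns e0 hN
  h1 _ (hJ J h2)).
move=> g Jg; have := Jle (iota g); rewrite cb_iota (strip_val st')//; apply.
by apply: subset_closure; apply: h3; rewrite /T/= iotaK.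
Qed.

Let comp_avoid C : NF_components R S C -> C `<=` ~` N.
Proof. by case=> g _ <-; rewrite -NFS; exact: connected_component_sub. Qed.

Let maxE C s : NF_components R S C -> N s ->
  edges_max_at S' cb' (T C) (iota s) <-> edges_max_at S cb C s.
Proof.
move=> NC Ns; split; first exact: max_back.
by apply: max_forth; [exact: (strip_cont st')|exact: cb_iota|exact: comp_avoid].
Qed.

Let minE C s : NF_components R S C -> N s ->
  edges_min_at S' cb' (T C) (iota s) <-> edges_min_at S cb C s.
Proof.
move=> NC Ns; split; first exact: min_back.
move=> /edges_min_at_opp M; apply/edges_min_at_opp.
apply: (max_forth _ _ _ M); [|by move=> g; rewrite cb_iota|exact: comp_avoid].
by move=> g; apply: cvgN; exact: (strip_cont st').
Qed.

Let comp_T C : NF_components R S' (T C) <-> NF_components R S C.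
Proof.
rewrite componentsE; split=> [[D ND E]|NC]; last by exists C.
suff -> : C = D by [].
by apply/seteqP; split=> g Cg; have := congr1 (@^~ (iota g)) E;
  rewrite /T/= iotaK => h; [rewrite h|rewrite -h].
Qed.

Let comp_iota C' : NF_components R S' C' -> NF_components R S (iota @^-1` C').
Proof. by move=> NC'; apply/comp_T; rewrite T_iota. Qed.

Let iota_T C : iota @^-1` (T C) = C.
Proof. by apply/seteqP; split=> g; rewrite /T/= iotaK. Qed.

Let step_T C1 C2 : gdnf_step S' cb' (T C1) (T C2) <-> gdnf_step S cb C1 C2.
Proof.
split=> -[N1 N2 [s]].
- rewrite -/(NF R S') NF'E => Ns h; have N1' := (comp_T _).1 N1; have N2' := (comp_T _).1 N2.
  split=> //; exists (jota s); first by rewrite -/(NF R S) NFS.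
  rewrite -[s]jotaK in h; case: h => -[h1 h2]; [left|right].
    by split; apply/maxE.
  by split; apply/minE.
- rewrite -/(NF R S) NFS => Ns h.
  split; [exact/comp_T|exact/comp_T|].
  exists (iota s); first by rewrite -/(NF R S') NF'E /T/= iotaK.
  case: h => -[h1 h2]; [left|right].
    by split; apply/maxE.
  by split; apply/minE.
Qed.

Let rst_T C1 C2 :
  Relation_Operators.clos_refl_sym_trans (set G') (gdnf_step S' cb') (T C1) (T C2) <->
  Relation_Operators.clos_refl_sym_trans (set G) (gdnf_step S cb) C1 C2.
Proof.
split=> h.
- rewrite -[C1]iota_T -[C2]iota_T.
  elim: h => {C1 C2} [A B|A|A B _ IH|A B D _ IH1 _ IH2].
  + rewrite -[A]T_iota -[B]T_iota => /step_T h; rewrite !iota_T; exact: rst_step.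
  + exact: rst_refl.
  + exact: rst_sym.
  + exact: rst_trans IH1 IH2.
- elim: h => {C1 C2} [A B|A|A B _ IH|A B D _ IH1 _ IH2].
  + by move=> /step_T; exact: rst_step.
  + exact: rst_refl.
  + exact: rst_sym.
  + exact: rst_trans IH1 IH2.
Qed.

Let class_T C D : gdnf_class S' cb' (T C) (T D) <-> gdnf_class S cb C D.
Proof. by split=> -[h1 h2]; (split; [exact/comp_T|exact/rst_T]). Qed.

Let VS := [set gdnf_class S cb C | C in NF_components R S].
Let VS' := [set gdnf_class S' cb' C | C in NF_components R S'].

Let down (V' : set (set G')) : set (set G) := [set C | V' (T C)].
Let lift (V : set (set G)) : set (set G') := [set C' | V (iota @^-1` C')].

Let down_VS V' : VS' V' -> VS (down V').
Proof.
move=> [C' NC' <-]; exists (iota @^-1` C'); first exact: comp_iota.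
have CE := T_iota C'; apply/seteqP; split=> D /= h.
  by rewrite /down/= -CE; apply/class_T.
by move: h; rewrite /down/= -{1}CE => /class_T.
Qed.

Let lift_VS V : VS V -> VS' (lift V).
Proof.
move=> [C NC <-]; exists (T C); first exact/comp_T.
apply/seteqP; split=> D' /= h; have DE := T_iota D'.
  by move: h; rewrite /lift/= -{1}DE => /class_T.
by rewrite -DE; apply/class_T.
Qed.

(* [iota] is continuous, and so is its inverse away from the ends. As [trunk]
   says that an end outside [S] bounds no edge, turning the ends into vertices
   only removes the edges reduced to them. *)
Lemma key_iso : diagram_iso (GDNF S' cb') (GDNF S cb).
Proof.
pose fv (v : vertex (GDNF S' cb')) : vertex (GDNF S cb) :=
  SigSub (mem_set (down_VS (set_valP v))).
pose gv (v : vertex (GDNF S cb)) : vertex (GDNF S' cb') :=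
  SigSub (mem_set (lift_VS (set_valP v))).
have inN g : NF R S' g -> N (jota g) by rewrite NF'E.
have inS g : NF R S' g -> NF R S (jota g) by move=> /inN; rewrite -NFS.
have inS' g : NF R S g -> NF R S' (iota g) by rewrite NF'E NFS /T/= iotaK.
have fe_proof (e : edge (GDNF S' cb')) : NF R S (jota (\val e)).
  exact: inS (set_valP e).
have ge_proof (e : edge (GDNF S cb)) : NF R S' (iota (\val e)).
  exact: inS' (set_valP e).
pose fe (e : edge (GDNF S' cb')) : edge (GDNF S cb) := SigSub (mem_set (fe_proof e)).
pose ge (e : edge (GDNF S cb)) : edge (GDNF S' cb') := SigSub (mem_set (ge_proof e)).
have vcomp (v : vertex (GDNF S' cb')) C' : \val v C' -> NF_components R S' C'.
  by have [C0 _ <-] := set_valP v; case.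
have Ne (e : edge (GDNF S' cb')) : N (jota (\val e)).
  exact: inN (set_valP e).
exists fv, fe; split.
- exists gv => v; apply: val_inj; apply/seteqP; split=> C /=.
  + by rewrite /lift/down/= T_iota.
  + by rewrite /lift/down/= T_iota.
  + by rewrite /lift/down/= iota_T.
  + by rewrite /lift/down/= iota_T.
- by exists ge => e; apply: val_inj; rewrite /= ?jotaK ?iotaK.
- move=> e v; split=> -[C vC M].
    have NC := comp_iota (vcomp _ _ vC).
    exists (iota @^-1` C); first by rewrite /= /down/= T_iota.
    by apply/(maxE NC (Ne e)); rewrite T_iota jotaK.
  exists (T C) => //.
  by rewrite -[\val e]jotaK; apply/(maxE _ (Ne e)) => //; apply/comp_T/vcomp; exact: vC.
- move=> e v; split=> -[C vC M].
    have NC := comp_iota (vcomp _ _ vC).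
    exists (iota @^-1` C); first by rewrite /= /down/= T_iota.
    by apply/(minE NC (Ne e)); rewrite T_iota jotaK.
  exists (T C) => //.
  by rewrite -[\val e]jotaK; apply/(minE _ (Ne e)) => //; apply/comp_T/vcomp; exact: vC.
Qed.

End Key.

(** * Consequences of the shapes *)

Section SmallCardinals.
Variable T : Type.

Lemma card_I1 : ([set: T] #= `I_1)%card -> exists x : T, forall y, y = x.
Proof.
move=> /card_set_bijP[f [fS fi fs]]; have [x _ fx] := fs 0 isT.
exists x => y; apply: fi; rewrite ?inE//.
by have := fS y I; rewrite fx /=; case: (f y).
Qed.

Lemma card_I2 : ([set: T] #= `I_2)%card ->
  exists x y : T, x <> y /\ forall z, z = x \/ z = y.
Proof.
move=> /card_set_bijP[f [fS fi fs]]; have [x _ fx] := fs 0 isT; have [y _ fy] := fs 1%N isT.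
exists x, y; split=> [E|z]; first by move: fy; rewrite -E fx.
have := fS z I; case E : (f z) => [|[|]]//= _; [left|right].
  by apply: fi; rewrite ?inE// fx.
by apply: fi; rewrite ?inE// fy.
Qed.

Lemma card_I3 : ([set: T] #= `I_3)%card ->
  exists x y z : T, [/\ x <> y, y <> z & z <> x].
Proof.
move=> /card_set_bijP[f [_ _ fs]].
have [x _ fx] := fs 0 isT; have [y _ fy] := fs 1%N isT; have [z _ fz] := fs 2%N isT.
exists x, y, z; split=> E.
- by move: fy; rewrite -E fx.
- by move: fz; rewrite -E fy.
- by move: fx; rewrite -E fz.
Qed.

End SmallCardinals.

Section Extract.
Variables (R : realType) (G : topologicalType) (S : set G) (cb : G -> R).
Variable K : diagram.
Hypothesis iso : diagram_iso (GDNF S cb) K.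
Local Notation rst := (clos_refl_sym_trans (set G) (gdnf_step S cb)).

Lemma gdnf_class_eq C C' : NF_components R S C' ->
  gdnf_class S cb C = gdnf_class S cb C' -> rst C C'.
Proof.
move=> NC' E; have : gdnf_class S cb C' C' by split=> //; exact: rst_refl.
by rewrite -E => -[].
Qed.

Lemma gdnf_class_rst C C' : rst C C' -> gdnf_class S cb C = gdnf_class S cb C'.
Proof.
move=> h; apply/seteqP; split=> D [ND hD]; split=> //.
  by apply: rst_trans hD; exact: rst_sym.
exact: rst_trans hD.
Qed.

Let class_in C : NF_components R S C ->
  (gdnf_class S cb C) \in [set gdnf_class S cb C | C in NF_components R S].
Proof. by move=> NC; apply/mem_set; exists C. Qed.

Lemma ray_extract : shape_ray K -> exists s, NF R S = [set s] /\
  forall C C', NF_components R S C -> NF_components R S C' -> rst C C'.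
Proof.
have [fv [fe [bv be _ _]]] := iso.
move=> [_ /card_I1[v hv] /card_I1[e he] _]; have [ge feK geK] := be.
exists (\val (ge e)); split.
  apply/seteqP; split=> [s Ns|_ ->]; last exact: set_valP.
  have := bij_inj be (x1 := SigSub (mem_set Ns)) (x2 := ge e).
  by move=> /(_ (etrans (he _) (esym (he _)))) /(congr1 \val).
move=> C C' NC NC'; apply: gdnf_class_eq => //.
have := bij_inj bv (x1 := SigSub (class_in NC)) (x2 := SigSub (class_in NC')).
by move=> /(_ (etrans (hv _) (esym (hv _)))) /(congr1 \val).
Qed.

Lemma arcs_extract : three_vertices_two_arcs K -> exists s1 s2,
  [/\ s1 <> s2, NF R S = [set s1; s2],
    forall s, NF R S s -> (exists2 C, NF_components R S C & edges_max_at S cb C s) /\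
      exists2 C, NF_components R S C & edges_min_at S cb C s &
    exists C1 C2 C3, [/\ NF_components R S C1, NF_components R S C2,
      NF_components R S C3 & [/\ ~ rst C1 C2, ~ rst C2 C3 & ~ rst C3 C1]]].
Proof.
have [fv [fe [bv be hd he]]] := iso.
move=> [_ /card_I3[v1 [v2 [v3 [v12 v23 v31]]]] /card_I2[e1 [e2 [e12 e_all]]] arcs].
have [ge feK geK] := be; have [gv fvK gvK] := bv.
exists (\val (ge e1)), (\val (ge e2)); split.
- by move=> /val_inj E; apply: e12; rewrite -[e1]geK E geK.
- apply/seteqP; split=> [s Ns|_ [->|->]]; try exact: set_valP.
  have gE : ge (fe (SigSub (mem_set Ns))) = SigSub (mem_set Ns) by [].
  by case: (e_all (fe (SigSub (mem_set Ns)))) => E; rewrite E in gE; [left|right];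
    rewrite gE.
- move=> s Ns; have [v [w [_ hv hw]]] := arcs (fe (SigSub (mem_set Ns))).
  have memV (u : vertex (GDNF S cb)) C : \val u C -> NF_components R S C.
    by have [C0 _ <-] := set_valP u; case.
  split.
    have /hv := erefl v; rewrite -[v]gvK => /hd[C uC M]; exists C => //.
    exact: (memV (gv v)).
  have /hw := erefl w; rewrite -[w]gvK => /he[C uC M]; exists C => //.
  exact: (memV (gv w)).
- have rep v : exists C (NC : NF_components R S C), gv v = SigSub (class_in NC).
    have [C NC E] := set_valP (gv v); exists C, NC; apply: val_inj.
    by rewrite /= -E.
  have [C1 [N1 E1]] := rep v1; have [C2 [N2 E2]] := rep v2; have [C3 [N3 E3]] := rep v3.
  exists C1, C2, C3; split=> //; split=> /gdnf_class_rst E.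
  + by apply: v12; rewrite -[v1]gvK -[v2]gvK E1 E2; congr fv; exact: val_inj.
  + by apply: v23; rewrite -[v2]gvK -[v3]gvK E2 E3; congr fv; exact: val_inj.
  + by apply: v31; rewrite -[v3]gvK -[v1]gvK E3 E1; congr fv; exact: val_inj.
Qed.

End Extract.

Lemma shape_cases (K : diagram) :
  (shape_ray K \/ shape_depart K \/ shape_enter K \/ shape_through K) ->
  shape_ray K \/ three_vertices_two_arcs K.
Proof. by move=> [?|[[]|[[]|[]]]]; [left|right|right|right]. Qed.

Section NearBelow.
Variables (R : realType) (c1 c2 : R -> R) (G : topologicalType).
Variables (Q : R -> R -> G) (cb : G -> R).
Hypotheses (tc1 : tame c1) (tc2 : tame c2) (c12 : forall x, c1 x < c2 x).
Hypotheses (st : strip c1 c2 Q cb) (all_good : forall t, good c1 c2 t).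
Hypothesis bo : forall V : set G,
  band_open c1 c2 (fun t x => V (Q t x)) -> open V.

Lemma max_near_below S C a x0 : dom c1 c2 a x0 -> ~ C (Q a x0) ->
  edges_max_at S cb C (Q a x0) ->
  exists t y, [/\ t < a, lev c1 c2 a x0 y, dom c1 c2 t y & C (Q t y)].
Proof.
move=> dx nC [J [_ _ JC sJ Jle]].
have [P1 [P2 [eta [/andP[eta0 etae] [hl hr] red _]]]] := near_window tc1 tc2 c12 ltr01 dx.
have gd t' : `|t' - a| <= eta -> good c1 c2 t' by move=> _; exact: all_good.
have oW := bo (owindow_band_open st gd hl hr).
have Ws : owindow c1 c2 Q P1 P2 a eta (Q a x0).
  exists a, x0; split=> //; last by rewrite subrr normr0.
  by split; [have := hwin_base hl; rewrite opprK|exact: hwin_base hr].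
have [g [Jg Wg]] := sJ _ (open_nbhs_nbhs (conj oW Ws)).
have Cg := JC _ Jg.
have ga := Jle _ (subset_closure Jg); rewrite (strip_val st) in ga => //.
have [t' [x [dt' [p1 p2] tt gE]]] := Wg.
have [z lz lz'] := red _ _ p1 p2 (ltW tt) dt'.
have dz := lev_domr lz'; have daz := lev_domr lz.
have gz : g = Q t' z by rewrite gE; apply/(strip_eqQ st all_good).
exists t', z; split=> //; last by rewrite -gz.
rewrite gz (strip_val st) in ga => //.
rewrite lt_neqAle ga andbT; apply/eqP => E; apply: nC.
suff -> : Q a x0 = g by [].
by rewrite gz E; apply/(strip_eqQ st all_good).
Qed.

End NearBelow.

Section NearAbove.
Variables (R : realType) (c1 c2 : R -> R) (G : topologicalType).
Variables (Q : R -> R -> G) (cb : G -> R).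
Hypotheses (tc1 : tame c1) (tc2 : tame c2) (c12 : forall x, c1 x < c2 x).
Hypotheses (st : strip c1 c2 Q cb) (all_good : forall t, good c1 c2 t).
Hypothesis bo : forall V : set G,
  band_open c1 c2 (fun t x => V (Q t x)) -> open V.

Lemma min_near_above S C a x0 : dom c1 c2 a x0 -> ~ C (Q a x0) ->
  edges_min_at S cb C (Q a x0) ->
  exists t y, [/\ a < t, lev c1 c2 a x0 y, dom c1 c2 t y & C (Q t y)].
Proof.
move=> dx nC /edges_min_at_opp M.
have N12 x : - c2 x < - c1 x by rewrite ltrN2.
have gN t : good (fun x => - c2 x) (fun x => - c1 x) t.
  by rewrite -[t]opprK; apply/good_flip.
have bN (V : set G) : band_open (fun x => - c2 x) (fun x => - c1 x)
    (fun t x => V (Q (- t) x)) -> open V.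
  move=> h; apply: bo.
  have := @band_open_flip _ _ _ _ h; congr band_open; apply/funext => x; rewrite ?opprK//.
have := @max_near_below _ _ _ _ _ _ (tameN tc2) (tameN tc1) N12 (strip_flip st) gN bN
  S C (- a) x0.
rewrite dom_flip opprK => /(_ dx nC M)[t [y [ta /lev_flip ly dy Cy]]].
exists (- t), y; split=> //; first by lra.
by rewrite -(@dom_flip _ c1 c2) opprK.
Qed.

Local Notation rst S := (clos_refl_sym_trans (set G) (gdnf_step S cb)).

(* A non-trivial point of the Reeb space separates what is above it from what
   is below it, and the equivalence relation on components respects this. *)
Lemma two_classes S a x0 t x t' x' : NF R S = [set Q a x0] -> dom c1 c2 a x0 ->
  dom c1 c2 t x -> above c1 c2 a x0 t x -> dom c1 c2 t' x' -> below c1 c2 a x0 t' x' ->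
  exists C C', [/\ NF_components R S C, NF_components R S C' & ~ rst S C C'].
Proof.
move=> NE da dx ab dx' be.
have [cc1 cc2] := (tame_continuous tc1, tame_continuous tc2).
pose hi (C : set G) := exists t x, [/\ dom c1 c2 t x, above c1 c2 a x0 t x & C (Q t x)].
pose lo (C : set G) := exists t x, [/\ dom c1 c2 t x, below c1 c2 a x0 t x & C (Q t x)].
have sep C : NF_components R S C -> hi C -> lo C -> False.
  move=> [g ng <-] [u [y [dy aby Cy]]] [u' [y' [dy' bey Cy']]].
  apply: (level_separates cc1 cc2 c12 st all_good bo da _ _ dy Cy aby dy' Cy' bey).
    exact: component_connected.
  by move=> /connected_component_sub; apply; rewrite NE.
have notN u y : dom c1 c2 u y -> above c1 c2 a x0 u y \/ below c1 c2 a x0 u y ->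
    ~ NF R S (Q u y).
  rewrite NE => dy h E; have ua : u = a by rewrite -(strip_val st dy) E (strip_val st).
  rewrite ua in h dy E; have l : lev c1 c2 a x0 y by apply/(strip_eqQ st all_good).
  case: h => -[h|[_ h]]; rewrite ?ltxx// in h *.
  - exact: lev_up_excl l h.
  - exact: lev_dn_excl l h.
pose comp u y := connected_component (~` NF R S) (Q u y).
have NC u y : dom c1 c2 u y -> above c1 c2 a x0 u y \/ below c1 c2 a x0 u y ->
    NF_components R S (comp u y) /\ comp u y (Q u y).
  move=> dy h; have nN := notN _ _ dy h; split; first by exists (Q u y).
  exact: connected_component_refl.
have [N1 C1] := NC _ _ dx (or_introl ab); have [N2 C2] := NC _ _ dx' (or_intror be).
have nC C : NF_components R S C -> ~ C (Q a x0).
  by move=> [g _ <-] /connected_component_sub; apply; rewrite NE.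
have step_lo C : NF_components R S C -> edges_max_at S cb C (Q a x0) -> lo C.
  move=> NC' /(max_near_below tc1 tc2 c12 st all_good bo da (nC _ NC')).
  by move=> [u [y [ua ly dy Cy]]]; exists u, y; split=> //; right.
have step_hi C : NF_components R S C -> edges_min_at S cb C (Q a x0) -> hi C.
  move=> NC' /(min_near_above da (nC _ NC')).
  by move=> [u [y [ua ly dy Cy]]]; exists u, y; split=> //; right.
have inv D D' : rst S D D' -> (NF_components R S D /\ lo D) <->
    (NF_components R S D' /\ lo D').
  elim=> {D D'} [D D' [ND ND' [s]]|//|D D' _ [h1 h2]|D E D' _ [h1 h2] _ [k1 k2]].
  - rewrite NE => -> [[M M']|[M M']].
      by split=> _; split=> //; apply: step_lo.
    by split=> -[_ /sep] h; exfalso; apply: h => //; apply: step_hi.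
  - by split.
  - by split=> ?; [apply/k1/h1|apply/h2/k2].
exists (comp t x), (comp t' x'); split=> // /inv[_ h].
by apply: (sep _ N1); [exists t, x|apply: (h _).2; split=> //; exists t', x'].
Qed.

End NearAbove.

Section Ends.
Variables (R : realType) (c1 c2 : R -> R) (a1 a2 : R).
Hypotheses (tc1 : tame c1) (tc2 : tame c2) (c12 : forall x, c1 x < c2 x).
Hypotheses (c1m : c1 x @[x --> -oo] --> a1) (c2m : c2 x @[x --> -oo] --> a1).
Hypotheses (c1p : c1 x @[x --> +oo] --> a2) (c2p : c2 x @[x --> +oo] --> a2).
Hypothesis all_good : forall t, good c1 c2 t.
Variables (G : topologicalType) (Q : R -> R -> G) (cb : G -> R).
Hypotheses (st : strip c1 c2 Q cb) (hG : hausdorff_space G).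
Hypothesis bo : forall V : set G,
  band_open c1 c2 (fun t x => V (Q t x)) -> open V.
Let S := crit_points c1 c2 Q.

Lemma tame_const (c : R -> R) (v x0 x1 : R) : tame c -> x0 < x1 -> (forall x, x0 <= x <= x1 -> c x = v) ->
  forall x, c x = v.
Proof.
move=> tc xx h; have [//|] := tame_level tc v x0 x1.
have -> : [set x | x0 <= x <= x1 /\ c x = v] = `[x0, x1]%classic.
  apply/seteqP; split=> x /=; rewrite in_itv/=; first by case.
  by move=> xi; split=> //; exact: h.
move=> /finite_set_countable /(@countable_lebesgue_measure0 R).
rewrite lebesgue_measure_itv/= lte_fin xx -EFinB => -[] /eqP.
by rewrite subr_eq0 gt_eqF.
Qed.

Lemma ends_from_shapes K : diagram_iso (GDNF S cb) K ->
  shape_ray K \/ three_vertices_two_arcs K ->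
  exists xm xp, [/\ forall x, x <= xm -> dom c1 c2 a1 x,
    forall x, xp <= x -> dom c1 c2 a2 x,
    NF R S = [set Q a1 xm; Q a2 xp] &
    forall s, [set Q a1 xm; Q a2 xp] s ->
      S s \/ connected_component (~` S) s = [set s]].
Proof.
move=> iso sh.
have hGc (x y : G) : good c1 c2 (cb x) -> good c1 c2 (cb y) ->
    cluster (nbhs x) y -> x = y by move=> _ _; exact: hG.
have rep s : NF R S s -> exists x0, [/\ dom c1 c2 (cb s) x0, Q (cb s) x0 = s &
    (cb s = a2 /\ forall x, x0 <= x -> dom c1 c2 (cb s) x) \/
    (cb s = a1 /\ forall x, x <= x0 -> dom c1 c2 (cb s) x)].
  move=> Ns; have [x0 dx sE] := strip_surj st (all_good (cb s)).
  exists x0; split=> //; rewrite -sE in Ns.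
  have gd : exists2 e, 0 < e & forall t', `|t' - cb s| <= e -> good c1 c2 t' by exists 1.
  have [[hd _]|[hd _]] := NF_crit_acc tc1 tc2 c12 c1m c2m c1p c2p st hGc
      (fun V _ => bo (V := V)) dx gd Ns; [left|right]; split=> //.
  - exact: right_level c1p c2p hd.
  - exact: left_level c1m c2m hd.
have eqQ := strip_eqQ st all_good.
case: sh => [/(ray_extract iso)[s [NE one]]|/(arcs_extract iso)[s1 [s2 [s12 NE arcs _]]]].
- have Ns : NF R S s by rewrite NE.
  have [x0 [dx sE ends]] := rep s Ns; set a := cb s in dx sE ends *.
  have NE' : NF R S = [set Q a x0] by rewrite sE.
  have noAB x x' : c1 x < a -> lev c1 c2 a x0 x -> a < c2 x' -> lev c1 c2 a x0 x' -> False.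
    move=> xa lx xa' lx'.
    have d1 : dom c1 c2 (c1 x) x by rewrite /dom lexx ltW.
    have d2 : dom c1 c2 (c2 x') x' by rewrite /dom lexx ltW.
    have ab : above c1 c2 a x0 (c2 x') x' by right.
    have be : below c1 c2 a x0 (c1 x) x by right.
    have [C [C' [NC NC']]] := two_classes tc1 tc2 c12 st all_good bo NE' dx d2 ab d1 be.
    by apply; exact: one.
  (* The component is unbounded, so it contains an interval of positive length, on which
     [tame_const] can be applied. *)
  have [u [v [uv huv]]] : exists u v, u < v /\ forall x, u <= x <= v -> lev c1 c2 a x0 x.
    case: ends => -[_ hd].
      exists x0, (x0 + 1); split=> [|x /andP[h _]]; first by lra.
      by move=> w; rewrite /btw => /orP[]/andP[h1 h2]; apply: hd; lra.
    exists (x0 - 1), x0; split=> [|x /andP[_ h]]; first by lra.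
    by move=> w; rewrite /btw => /orP[]/andP[h1 h2]; apply: hd; lra.
  have cst : (forall x, c1 x = a) \/ (forall x, c2 x = a).
    have [h|/existsNP[x /not_implyP[xi h]]] :=
      pselect (forall x, u <= x <= v -> c1 x = a).
      by left; apply: tame_const h.
    right; apply: (tame_const tc2 uv) => x' xi'.
    have lx := huv _ xi; have lx' := huv _ xi'.
    have /andP[h1 _] := lev_domr lx; have /andP[_ h2] := lev_domr lx'.
    apply/eqP; rewrite eq_le h2 andbT leNgt; apply/negP => h3.
    apply: (noAB x x') => //; rewrite lt_neqAle h1 andbT; exact/eqP.
  have da x : dom c1 c2 a x.
    by rewrite /dom; have := c12 x; case: cst => ->; rewrite lexx ?andbT; exact: ltW.
  have aE1 : a = a1 by apply: (left_level (x0 := 0) c1m c2m) => x _; exact: da.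
  have aE2 : a = a2 by apply: (right_level (x0 := 0) c1p c2p) => x _; exact: da.
  have sE' : Q a 0 = s by rewrite -sE; apply/eqQ => // w _; exact: da.
  have Ss : S s.
    have d0 c : (forall x, c x = a) -> derive1 c 0 = 0.
      by move=> h; rewrite (_ : c = fun=> a) ?derive1_cst//; apply/funext.
    by exists 0; case: cst => h; [left|right]; rewrite h sE'; split=> //; exact: d0.
  (* The whole line lies in the level [a], so one base point represents both ends. *)
  exists 0, 0; rewrite -aE1 -aE2 sE'; split=> //; first by rewrite setUid.
  by move=> _ [->|->]; left.
- have right_eq s s' x0 x0' : cb s = a2 -> cb s' = a2 -> Q (cb s) x0 = s -> Q (cb s') x0' = s' ->
      (forall x, x0 <= x -> dom c1 c2 (cb s) x) ->
      (forall x, x0' <= x -> dom c1 c2 (cb s') x) -> s = s'.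
    move=> E E' sE sE' h h'; rewrite E in sE h; rewrite E' in sE' h'; rewrite -sE -sE'.
    apply/eqQ; [by apply: h|by apply: h'|].
    by move=> w; rewrite /btw => /orP[]/andP[h1 h2]; [apply: h|apply: h'].
  have left_eq s s' x0 x0' : cb s = a1 -> cb s' = a1 -> Q (cb s) x0 = s -> Q (cb s') x0' = s' ->
      (forall x, x <= x0 -> dom c1 c2 (cb s) x) ->
      (forall x, x <= x0' -> dom c1 c2 (cb s') x) -> s = s'.
    move=> E E' sE sE' h h'; rewrite E in sE h; rewrite E' in sE' h'; rewrite -sE -sE'.
    apply/eqQ; [by apply: h|by apply: h'|].
    by move=> w; rewrite /btw => /orP[]/andP[h1 h2]; [apply: h'|apply: h].
  have trunk s : NF R S s -> S s \/ connected_component (~` S) s = [set s].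
    move=> Ns; have [[C NC M] [C' NC' M']] := arcs s Ns.
    have [x0 [dx sE _]] := rep s Ns; rewrite -sE in Ns M M' *.
    exact: (trunk_trivial tc1 tc2 c12 st all_good bo erefl dx Ns NC M NC' M').
  have [x1 [dx1 sE1 ends1]] := rep s1 (ltac:(by rewrite NE; left)).
  have [x2 [dx2 sE2 ends2]] := rep s2 (ltac:(by rewrite NE; right)).
  case: ends1 ends2 => -[E1 h1] [] [E2 h2].
  + by exfalso; apply: s12; exact: right_eq h1 h2.
  + exists x2, x1; rewrite E1 E2 in sE1 sE2 h1 h2 *; rewrite sE1 sE2.
    rewrite NE setUC; split=> // s hs; apply: trunk; rewrite NE; case: hs; by [left|right].
  + exists x1, x2; rewrite E1 E2 in sE1 sE2 h1 h2 *; rewrite sE1 sE2.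
    by rewrite NE; split=> // s hs; apply: trunk; rewrite NE.
  + by exfalso; apply: s12; exact: left_eq h1 h2.
Qed.

End Ends.

(** * Exclusion of the levels inside the band *)

Section UpperPart.
Variables (R : realType) (c1 c2 : R -> R) (G : topologicalType).
Variables (Q : R -> R -> G) (cb : G -> R) (a : R).
Hypotheses (cc2 : continuous c2) (c12 : forall x, c1 x < c2 x).
Hypotheses (st : strip c1 c2 Q cb) (ac2 : forall x, a < c2 x).
Hypothesis gd : forall t, t <> a -> good c1 c2 t.

Lemma strip_curve (f : R -> R) : continuous f -> (forall x, dom c1 c2 (f x) x) ->
  continuous (fun x => Q (f x) x).
Proof.
move=> cf df x B; rewrite nbhsE => -[V [oV Vx] VB].
have [d d0 hd] := strip_band_open st oV (df x) Vx.
have /cvgrPdist_lt/(_ d d0) h := cf x.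
have h' : \forall y \near x, `|x - y| < d by exact: nbhsx_ballx.
change (\forall y \near x, B (Q (f y) y)); near=> y; apply: VB; apply: (hd (f y) y); [exact: df| |].
  by rewrite distrC; near: y.
by rewrite distrC; near: y.
Unshelve. all: by end_near. Qed.

(** Every point higher than [a] can be moved up vertically to the image of the graph of [c2], which
    is connected and entirely higher than [a]. *)
Lemma upper_connected : connected [set g | a < cb g].
Proof.
set U := [set g | _].
have dom2 y : dom c1 c2 (c2 y) y by rewrite /dom lexx andbT ltW.
have top y : U (Q (c2 y) y) by rewrite /U/= (strip_val st).
have seg y z : connected_component U (Q (c2 y) y) (Q (c2 z) z).
  wlog yz : y z / y <= z.
    move=> H; have [|/ltW] := leP y z; first exact: H.
    by move=> /H; exact: connected_component_sym.
  apply: (@connected_component_max _ _ ((fun w => Q (c2 w) w) @` `[y, z]%classic)).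
  - by exists y; rewrite //= in_itv/= lexx.
  - by move=> _ [w _ <-].
  - apply: connected_continuous_connected; last first.
      by apply: continuous_subspaceT; exact: strip_curve.
    by apply/connected_intervalP; exact: interval_is_interval.
  by exists z; rewrite //= in_itv/= lexx andbT.
have vert g : U g -> exists y, connected_component U g (Q (c2 y) y).
  move=> Ug; have [y dy gE] := strip_surj st (gd (ltac:(by move=> E; move: Ug; rewrite /U/= E ltxx) : cb g <> a)).
  exists y; set t := cb g in dy gE *; have /andP[h1 h2] := dy.
  have dI r : `[t, c2 y]%classic r -> dom c1 c2 (id r) y.
    by rewrite /= in_itv/= /dom => /andP[h3 ->]; rewrite (le_trans h1 h3).
  apply: (@connected_component_max _ _ ((fun r => Q (id r) y) @` `[t, c2 y]%classic)).
  - by exists t; rewrite //= in_itv/= lexx.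
  - move=> _ [r Ir <-]; rewrite /U/= (strip_val st); last exact: dI.
    by move: Ir; rewrite /= in_itv/= => /andP[h _]; exact: lt_le_trans h.
  - apply: connected_continuous_connected; last first.
      apply: (strip_path st) => // r; exact: cvg_id.
    by apply/connected_intervalP; exact: interval_is_interval.
  by exists (c2 y); rewrite //= in_itv/= lexx andbT.
suff -> : U = connected_component U (Q (c2 0) 0) by exact: component_connected.
apply/seteqP; split; last exact: connected_component_sub.
move=> g /vert[y gy]; apply: connected_component_sym.
exact: connected_component_trans gy (seg _ _).
Qed.

End UpperPart.

Section TwoSheets.
Variables (R : realType) (c1 c2 : R -> R) (a1 a2 a : R).
Hypotheses (tc1 : tame c1) (tc2 : tame c2) (c12 : forall x, c1 x < c2 x).
Hypotheses (c1m : c1 x @[x --> -oo] --> a1) (c2m : c2 x @[x --> -oo] --> a1).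
Hypotheses (c1p : c1 x @[x --> +oo] --> a2) (c2p : c2 x @[x --> +oo] --> a2).
Hypothesis bad : forall x, c1 x < a < c2 x.
Variables (G : topologicalType) (Q : R -> R -> G) (cb : G -> R).
Hypothesis st : strip c1 c2 Q cb.
Hypothesis hG : forall x y : G, good c1 c2 (cb x) -> good c1 c2 (cb y) ->
  cluster (nbhs x) y -> x = y.
Hypothesis bo : forall V : set G, (forall g, V g -> good c1 c2 (cb g)) ->
  band_open c1 c2 (fun t x => V (Q t x)) -> open V.
Let S := crit_points c1 c2 Q.
Let N := NF R S.
(** The level [a] is not good, so [strip] does not describe its points. [attach] joins them to the
    part above, and [symN] expresses the symmetry of the sheets. *)
Hypothesis attach : forall g, cb g = a -> exists K : set G,
  [/\ connected K, K g, forall h, K h -> h = g \/ a < cb h & exists2 h, K h & a < cb h].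
Hypothesis symN : forall s g, cb s = a -> cb g = a -> N s -> N g.

Let bad_level t : (forall x, dom c1 c2 t x) -> t = a1 /\ t = a2.
Proof.
move=> h; split; first by apply: (left_level (x0 := 0) c1m c2m) => x _.
by apply: (right_level (x0 := 0) c1p c2p) => x _.
Qed.

Let aE : a = a1 /\ a = a2.
Proof. by apply: bad_level => x; have /andP[? ?] := bad x; rewrite /dom !ltW. Qed.

Let gd t : t <> a -> good c1 c2 t.
Proof.
move=> ta; apply: contrapT => /forallNP h; apply: ta.
have [-> _] : t = a1 /\ t = a2.
  by apply: bad_level => x; have /negP := h x; rewrite negbK => /andP[? ?]; rewrite /dom !ltW.
by case: aE.
Qed.

Let NFa g : N g -> cb g = a.
Proof.
move=> Ng; apply: contrapT => ga.
have [x0 dx gE] := strip_surj st (gd ga); rewrite -gE in Ng.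
have gn : exists2 e, 0 < e & forall t', `|t' - cb g| <= e -> good c1 c2 t'.
  exists (`|cb g - a| / 2).
    by rewrite divr_gt0// normr_gt0 subr_eq0; exact/eqP.
  move=> t' tt; apply: gd => E; move: tt; rewrite E distrC.
  have : 0 < `|cb g - a| by rewrite normr_gt0 subr_eq0; exact/eqP.
  lra.
have [e1 e2] := aE.
have [[hd _]|[hd _]] := NF_crit_acc tc1 tc2 c12 c1m c2m c1p c2p st hG bo dx gn Ng.
- by apply: ga; rewrite e2; exact: right_level c1p c2p hd.
- by apply: ga; rewrite e1; exact: left_level c1m c2m hd.
Qed.

Let cc1 := tame_continuous tc1.
Let cc2 := tame_continuous tc2.

Let cU : connected [set g | a < cb g].
Proof. by apply: (upper_connected cc2 c12 st _ gd) => x; have /andP[] := bad x. Qed.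

Let cL : connected [set g | cb g < a].
Proof.
have := @upper_connected R _ _ _ _ _ (- a) (cont_neg cc1) _ (strip_flip st).
have -> : [set g | - a < - cb g] = [set g | cb g < a].
  by apply/seteqP; split=> g /=; rewrite ltrN2.
apply=> x.
- by rewrite ltrN2.
- by rewrite ltrN2; have /andP[] := bad x.
- by move=> h; rewrite -[x]opprK; apply/good_flip/gd => E; apply: h; rewrite -E opprK.
Qed.

Let hi (C : set G) := exists2 g, C g & a < cb g.
Let lo (C : set G) := exists2 g, C g & cb g < a.

Let hi_lo C : NF_components R S C -> hi C \/ lo C.
Proof.
move=> [g nNg <-].
have Cg : connected_component (~` N) g g by exact: connected_component_refl.
have [ga|ga|ga] := ltgtP (cb g) a; [by right; exists g|by left; exists g|left].
have [K [cK Kg hK [h Kh ah]]] := attach ga.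
exists h => //; apply: (@connected_component_max _ _ K) => // k /hK[->//|ak].
by move=> /NFa E; move: ak; rewrite E ltxx.
Qed.

Let hi_eq C C' : NF_components R S C -> NF_components R S C' -> hi C -> hi C' -> C = C'.
Proof.
move=> [h nh <-] [h' nh' <-] [g Cg ag] [g' Cg' ag'].
rewrite (same_connected_component Cg) (same_connected_component Cg').
apply: same_connected_component; apply: (@connected_component_max _ _ [set g | a < cb g]) => //.
by move=> k ak /NFa E; move: ak; rewrite /= E ltxx.
Qed.

Let lo_eq C C' : NF_components R S C -> NF_components R S C' -> lo C -> lo C' -> C = C'.
Proof.
move=> [h nh <-] [h' nh' <-] [g Cg ag] [g' Cg' ag'].
rewrite (same_connected_component Cg) (same_connected_component Cg').
apply: same_connected_component; apply: (@connected_component_max _ _ [set g | cb g < a]) => //.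
by move=> k ak /NFa E; move: ak; rewrite /= E ltxx.
Qed.

(* All non-finite points have height [a]. Each component of their complement
   meets the connected part above or below [a], so there are at most two; and if
   there is a single non-finite point, then by symmetry it is the whole level,
   the parts above and below [a] giving two classes. *)
Lemma two_sheets_false K : diagram_iso (GDNF S cb) K ->
  shape_ray K \/ three_vertices_two_arcs K -> False.
Proof.
move=> iso [/(ray_extract iso)[s [NE one]]|/(arcs_extract iso)].
  have Ns : N s by rewrite /N NE.
  have sa := NFa Ns.
  have Na g : cb g = a -> N g by move=> ga; exact: symN Ns.
  (* The heights of a connected set form an interval, and here every point of height [a] is
     non-finite. *)
  have sep C : NF_components R S C -> hi C -> lo C -> False.
    move=> [h _ <-] [g Cg ag] [g' Cg' ga'].
    have : is_interval (cb @` connected_component (~` N) h).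
      apply/connected_intervalP/connected_continuous_connected.
        exact: component_connected.
      by apply: continuous_subspaceT; exact: (strip_cont st).
    move=> /(_ (cb g') (cb g) _ _ a)[||//|k kC ka].
    - by exists g'.
    - by exists g.
    - by rewrite !ltW.
    by have := connected_component_sub kC; apply; exact: Na.
  have memJ (J : set (set G)) : closure (\bigcup_(E in J) E) s ->
      exists g, (\bigcup_(E in J) E) g.
    by move=> /(_ _ (@filterT _ (nbhs s) _))[g [Jg _]]; exists g.
  have avoid C g : NF_components R S C -> C g -> cb g <> a.
    by move=> [h _ <-] /connected_component_sub nN /Na.
  have step_lo C : NF_components R S C -> edges_max_at S cb C s -> lo C.
    move=> NC [J [_ _ JC sJ Jle]]; have [g Jg] := memJ _ sJ.
    have := Jle g (subset_closure Jg); rewrite sa => ga.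
    exists g; first exact: JC.
    by rewrite lt_neqAle ga andbT; apply/eqP/(avoid C) => //; exact: JC.
  have step_hi C : NF_components R S C -> edges_min_at S cb C s -> hi C.
    move=> NC [J [_ _ JC sJ Jle]]; have [g Jg] := memJ _ sJ.
    have := Jle g (subset_closure Jg); rewrite sa => ga.
    exists g; first exact: JC.
    rewrite lt_neqAle ga andbT eq_sym; apply/eqP/(avoid C) => //; exact: JC.
  have inv D D' : clos_refl_sym_trans (set G) (gdnf_step S cb) D D' ->
      (NF_components R S D /\ lo D) <-> (NF_components R S D' /\ lo D').
    elim=> {D D'} [D D' [ND ND' [s']]|//|D D' _ [h1 h2]|D E D' _ [h1 h2] _ [k1 k2]].
    - rewrite -/N /N NE => -> [[M M']|[M M']].
        by split=> _; split=> //; apply: step_lo.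
      by split=> -[_ /sep] h; exfalso; apply: h => //; apply: step_hi.
    - by split.
    - by split=> ?; [apply/k1/h1|apply/h2/k2].
  pose g1 := Q (c1 0) 0; pose g2 := Q (c2 0) 0.
  have /andP[b1 b2] := bad 0.
  have v1 : cb g1 = c1 0 by rewrite (strip_val st)// /dom lexx ltW.
  have v2 : cb g2 = c2 0 by rewrite (strip_val st)// /dom lexx ltW.
  have n1 : ~ N g1 by move=> /NFa; rewrite v1 => E; rewrite E ltxx in b1.
  have n2 : ~ N g2 by move=> /NFa; rewrite v2 => E; rewrite E ltxx in b2.
  have N1 : NF_components R S (connected_component (~` N) g1) by exists g1.
  have N2 : NF_components R S (connected_component (~` N) g2) by exists g2.
  have r1 : connected_component (~` N) g1 g1 by exact: connected_component_refl.
  have r2 : connected_component (~` N) g2 g2 by exact: connected_component_refl.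
  have /inv[h _] := one _ _ N1 N2.
  apply: (sep _ N2); first by exists g2; rewrite ?v2.
  by apply: (h _).2; split=> //; exists g1; rewrite ?v1.
move=> [_ [_ [_ _ _ [C1 [C2 [C3 [N1 N2 N3 [n12 n23 n31]]]]]]]].
have E C C' : NF_components R S C -> NF_components R S C' ->
    (hi C /\ hi C') \/ (lo C /\ lo C') -> 
    clos_refl_sym_trans (set G) (gdnf_step S cb) C C'.
  move=> NC NC' h; have -> : C = C' by case: h => -[]; [exact: hi_eq|exact: lo_eq].
  exact: rst_refl.
(* Pigeonhole: two of the three components are on the same side, hence equal. *)
have [h1|h1] := hi_lo N1; have [h2|h2] := hi_lo N2; have [h3|h3] := hi_lo N3;
  (do ?[by apply: n12; apply: E => //; (left + right)
       |by apply: n23; apply: E => //; (left + right)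
       |by apply: n31; apply: E => //; (left + right)]).
Qed.

End TwoSheets.

(** * Reeb spaces of the zero-set and of the sphere *)

Section ReebTopology.
Variables (R : realType) (T : topologicalType) (f : T -> R).
Local Notation q := (reeb_map f).

Lemma reeb_map_continuous : continuous q.
Proof. exact: pi_continuous. Qed.

Lemma reeb_open (V : set (reeb_space f)) : open V <-> open (q @^-1` V).
Proof. by []. Qed.

Lemma reeb_relE x y : reeb_rel f x y <-> connected_component (f @^-1` [set f x]) x y.
Proof. by split=> [[t [<-]]|h] //; exists (f x). Qed.

Lemma reeb_eq_connected (B : set T) t x y : connected B -> (forall z, B z -> f z = t) ->
  B x -> B y -> q x = q y.
Proof.
move=> cB Bt Bx By; apply/reeb_mapP/reeb_relE.
by apply: (@connected_component_max _ _ B) => // z Bz; rewrite /= (Bt z) // (Bt x).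
Qed.

Lemma reeb_bar_continuous : continuous f -> continuous (reeb_bar (c := f)).
Proof.
move=> cf; apply/continuousP => V oV; apply/reeb_open.
have -> : q @^-1` (reeb_bar (c:=f) @^-1` V) = f @^-1` V.
  by apply/seteqP; split=> x /=; rewrite reeb_barE.
by apply: open_comp.
Qed.

End ReebTopology.

(** * A criterion for a Reeb space to be a strip *)

Section ReebStrip.
Variables (R : realType) (c1 c2 : R -> R) (T : topologicalType) (f : T -> R).
(** [E t x v] is the point over [(t, x)] in the direction [v]; the directions form a sphere in both
    applications, collapsed over the boundary of the band. *)
Variables (U : Type) (v0 : U) (E : R -> R -> U -> T).
Hypotheses (cc1 : continuous c1) (cc2 : continuous c2) (c12 : forall x, c1 x < c2 x).
Local Notation q := (reeb_map f).
Local Notation cb := (reeb_bar (c := f)).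
Definition reeb_strip t x : reeb_space f := q (E t x v0).
Hypothesis cf : continuous f.
Hypothesis fE : forall t x v, dom c1 c2 t x -> f (E t x v) = t.
Hypothesis collapse : forall t x v v', t = c1 x \/ t = c2 x -> E t x v = E t x v'.
Hypothesis E_cont : forall (W : set T) v, open W -> band_open c1 c2 (fun t x => W (E t x v)).
(* The second case is that of the points added by a compactification. *)
Hypothesis E_surj : forall z, (exists x v, dom c1 c2 (f z) x /\ z = E (f z) x v) \/
  (exists x, dom c1 c2 (f z) x /\ q z = reeb_strip (f z) x).
Hypothesis cut : forall w, exists A B : set T,
  [/\ open A, open B, forall z, A z -> B z -> False,
    forall z, ~~ dom c1 c2 (f z) w -> A z \/ B z &
    (forall t x v, dom c1 c2 t x -> x < w -> A (E t x v)) /\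
    (forall t x v, dom c1 c2 t x -> w < x -> B (E t x v))].
Implicit Types (t x y w : R).

Lemma good_touch t x : good c1 c2 t -> dom c1 c2 t x ->
  exists2 y, lev c1 c2 t x y & t = c1 y \/ t = c2 y.
Proof.
move=> [y hy] dx; have [l|nl] := pselect (lev c1 c2 t x y).
  exists y => //; have := lev_domr l; rewrite /dom => /andP[h1 h2].
  move: hy; rewrite negb_and -!leNgt => /orP[h|h]; [left|right]; lra.
have [xy|yx|xy] := ltgtP x y.
- have [z [_ lz ez _]] := band_exit cc1 cc2 xy dx nl.
  by exists z => //; case: ez => <-; [left|right].
- have yx' : - x < - y by rewrite ltrN2.
  have dx' : dom (fun x => c1 (- x)) (fun x => c2 (- x)) t (- x) by rewrite /dom opprK.
  have nl' : ~ lev (fun x => c1 (- x)) (fun x => c2 (- x)) t (- x) (- y).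
    by move=> /lev_opp; rewrite !opprK.
  have [z [_ lz ez _]] := band_exit (cont_opp cc1) (cont_opp cc2) yx' dx' nl'.
  exists (- z); last by case: ez => <-; [left|right].
  by move/lev_opp: lz; rewrite opprK.
- by exfalso; apply: nl; rewrite -xy; exact: lev_refl.
Qed.

Lemma reeb_level t x y v : lev c1 c2 t x y -> q (E t x v) = q (E t y v).
Proof.
wlog xy : x y / x <= y.
  move=> H; have [|/ltW] := leP x y; first exact: H.
  by move=> yx /lev_sym/(H _ _ yx).
move=> l; have bt r : x <= r <= y -> dom c1 c2 t r.
  by move=> h; apply: l; rewrite /btw h.
apply: (@reeb_eq_connected _ _ _ ((fun r => E t r v) @` `[x, y]%classic) t).
- apply: connected_continuous_connected.
    by apply/connected_intervalP; exact: interval_is_interval.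
  apply/subspace_continuousP => r; rewrite /= in_itv/= => Ir B.
  rewrite nbhsE => -[V [oV Vr] VB].
  have [d d0 hd] := E_cont oV (bt _ Ir) Vr.
  have hr : \forall r' \near r, `|r - r'| < d by exact: nbhsx_ballx.
  rewrite /nbhs/= /within/=; near=> r'; rewrite in_itv/= => Ir'; apply: VB.
  apply: (hd t r'); [exact: bt|by rewrite subrr normr0|].
  by rewrite distrC; near: r'.
- by move=> _ [r Ir <-]; rewrite fE //; apply: bt; move: Ir; rewrite /= in_itv.
- by exists x; rewrite //= in_itv/= lexx.
- by exists y; rewrite //= in_itv/= xy lexx.
Unshelve. all: by end_near. Qed.

(** One moves along the level to a point where it touches the boundary, changes the direction there
    at no cost, and returns. *)
Lemma reeb_indep t x v : good c1 c2 t -> dom c1 c2 t x -> q (E t x v) = reeb_strip t x.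
Proof.
move=> gt dx; have [y l ey] := good_touch gt dx.
by rewrite (reeb_level v l) (collapse v v0 ey) /reeb_strip (reeb_level v0 l).
Qed.

Lemma reeb_strip_surj z : good c1 c2 (f z) ->
  exists2 x, dom c1 c2 (f z) x & q z = reeb_strip (f z) x.
Proof.
move=> gz; have [[x [v [dx zE]]]|[x [dx zE]]] := E_surj z; exists x => //.
by rewrite {1}zE reeb_indep.
Qed.

Let cut_component w A B z z' :
  open A -> open B -> (forall z, A z -> B z -> False) ->
  (forall z, ~~ dom c1 c2 (f z) w -> A z \/ B z) ->
  ~~ dom c1 c2 (f z) w -> reeb_rel f z z' -> A z -> B z' -> False.
Proof.
move=> oA oB AB cov nd /reeb_relE[K [Kz Kf cK] Kz'] Az Bz'.
suff KA : K `&` A = K by move: Kz'; rewrite -KA => -[_ Az']; exact: AB Az' Bz'.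
apply: cK; first by exists z.
  by exists A.
exists (~` B); first exact: open_closedC.
apply/seteqP; split=> k [Kk]; first by move=> Ak; split=> // /(AB _ Ak).
move=> nB; split=> //; have [//|//|//] := cov k.
by rewrite (Kf _ Kk).
Qed.

Lemma reeb_strip_lev t x y : dom c1 c2 t x -> dom c1 c2 t y ->
  reeb_strip t x = reeb_strip t y -> lev c1 c2 t x y.
Proof.
wlog xy : x y / x <= y.
  move=> H dx dy e; have [xy|/ltW yx] := leP x y; first exact: H.
  by apply: lev_sym; exact: H.
move=> dx dy /reeb_mapP rel w; rewrite /btw => /orP[]/andP[xw wy]; last first.
  by have -> : w = x by lra.
apply/negPn/negP => nd; have [A [B [oA oB AB cov [hA hB]]]] := cut w.
have [xw'|wE|xw'] := ltgtP x w; last 2 first.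
- by move: xw; rewrite leNgt wE.
- by move: nd; rewrite -xw' dx.
have [wy'|wE|wy'] := ltgtP w y; last 2 first.
- by move: wy; rewrite leNgt wE.
- by move: nd; rewrite wy' dy.
apply: (cut_component oA oB AB cov _ rel); last exact: hB.
  by rewrite fE.
exact: hA.
Qed.

Lemma reeb_strip_strip : strip c1 c2 reeb_strip cb.
Proof.
split.
- move=> g; have [z <-] := reeb_map_surj g; rewrite reeb_barE => gz.
  by have [x dx ->] := reeb_strip_surj gz; exists x.
- move=> t x y gt dx dy; split; first exact: reeb_strip_lev.
  exact: reeb_level.
- by move=> t x dx; rewrite reeb_barE fE.
- move=> V oV; apply: (@E_cont (q @^-1` V)); exact/reeb_open.
- exact: reeb_bar_continuous.
Qed.

Let saturated w A B (I : set R) : open A -> open B -> (forall z, A z -> B z -> False) ->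
  (forall z, ~~ dom c1 c2 (f z) w -> A z \/ B z) -> open I ->
  (forall t, I t -> ~~ dom c1 c2 t w) ->
  exists V : set (reeb_space f), open V /\ forall z, V (q z) <-> (A z /\ I (f z)).
Proof.
move=> oA oB AB cov oI In.
pose V : set (reeb_space f) := [set g | exists z, [/\ q z = g, A z & I (f z)]].
have VE z : V (q z) <-> A z /\ I (f z).
  split=> [[z' [/reeb_mapP rel Az' Iz']]|[Az Iz]]; last by exists z.
  have fz : f z = f z'.
    by move: rel => /reeb_relE /connected_component_sub.
  rewrite fz; split=> //; have [|//|Bz] := cov z; first by rewrite fz; exact: In.
  by exfalso; apply: (cut_component oA oB AB cov (In _ Iz') rel).
exists V; split=> //; apply/reeb_open.
have -> : q @^-1` V = A `&` f @^-1` I.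
  by apply/seteqP; split=> z /= /VE.
by apply: openI => //; apply: open_comp.
Qed.

(** The gap [w] between the two components persists at nearby heights, because those for which [w]
    is outside the band form an open set. Over it both sides of the cut are saturated. *)
Lemma reeb_strip_separated t x y : x < y -> dom c1 c2 t x -> dom c1 c2 t y ->
  ~ lev c1 c2 t x y -> exists V W : set (reeb_space f),
  [/\ open V, open W, V (reeb_strip t x), W (reeb_strip t y) & V `&` W = set0].
Proof.
move=> xy dx dy /existsNP[w /not_implyP[]]; rewrite /btw => /orP[]/andP[xw wy]; last lra.
move=> /negP nd; have [A [B [oA oB AB cov [hA hB]]]] := cut w.
have xw' : x < w.
  by rewrite lt_neqAle xw andbT; apply: contraNneq nd => <-.
have wy' : w < y.
  by rewrite lt_neqAle wy andbT; apply: contraNneq nd => ->.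
pose I := [set t' : R | ~~ dom c1 c2 t' w].
have oI : open I.
  have -> : I = `]-oo, c1 w[%classic `|` `]c2 w, +oo[%classic.
    apply/seteqP; split=> u; rewrite /I/= /dom negb_and -!ltNge !in_itv/= andbT.
      by move/orP.
    by move=> h; apply/orP.
  by apply: openU; exact: interval_open.
have cov' z : ~~ dom c1 c2 (f z) w -> B z \/ A z by move=> /cov[]; [right|left].
have BA z : B z -> A z -> False by move=> /[swap]; exact: AB.
have [V [oV VE]] := saturated oA oB AB cov oI (fun _ => id).
have [W [oW WE]] := saturated oB oA BA cov' oI (fun _ => id).
exists V, W; split=> //.
- by apply/VE; rewrite fE//; split=> //; exact: hA.
- by apply/WE; rewrite fE//; split=> //; exact: hB.
- apply/seteqP; split=> // g []; have [z <-] := reeb_map_surj g.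
  by move=> /VE[Az _] /WE[Bz _]; exact: AB Az Bz.
Qed.

Lemma reeb_strip_hausdorff (g h : reeb_space f) :
  good c1 c2 (cb g) -> good c1 c2 (cb h) -> cluster (nbhs g) h -> g = h.
Proof.
move=> gg gh gch; have cbc := reeb_bar_continuous cf.
have vE : cb g = cb h.
  apply: (@Rhausdorff R) => A B nA nB.
  by have [k [Ak Bk]] := gch _ _ (cbc g _ nA) (cbc h _ nB); exists (cb k).
have st := reeb_strip_strip.
have [x dx gE] := strip_surj st gg; have [y dy hE] := strip_surj st gh.
rewrite -vE in dy hE gh; rewrite -gE -hE.
apply/(strip_eq st gg dx dy); apply: contrapT => nl.
have [xy|yx|xy] := ltgtP x y.
- have [V [W [oV oW Vx Wy VW]]] := reeb_strip_separated xy dx dy nl.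
  have [k] := gch V W (open_nbhs_nbhs (conj oV (eq_rect _ V Vx _ gE)))
    (open_nbhs_nbhs (conj oW (eq_rect _ W Wy _ hE))).
  by rewrite VW.
- have nl' : ~ lev c1 c2 (cb g) y x by move=> /lev_sym.
  have [V [W [oV oW Vy Wx VW]]] := reeb_strip_separated yx dy dx nl'.
  have [k] := gch W V (open_nbhs_nbhs (conj oW (eq_rect _ W Wx _ gE)))
    (open_nbhs_nbhs (conj oV (eq_rect _ V Vy _ hE))).
  by rewrite setIC VW.
- by apply: nl; rewrite -xy; exact: lev_refl.
Qed.

End ReebStrip.

(** * Level-preserving involutions *)

Section Symmetry.

Lemma NF_involution (R : realType) (G : topologicalType) (S : set G) (rho : G -> G) (s : G) :
  continuous rho -> involutive rho -> (forall g, S g -> S (rho g)) ->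
  NF R S s -> NF R S (rho s).
Proof.
move=> crho rhoK Srho Ns [U [nU US [Gam [gGam hU]]]]; apply: Ns.
exists (rho @^-1` U); split; first exact: crho.
  apply/seteqP; split=> // g [Ug [Sg gs]].
  move/seteqP: US => [US _]; apply: (US (rho g)); split=> //; split; first exact: Srho.
  by move=> /= E; apply: gs; rewrite -[g]rhoK E rhoK.
exists Gam; split=> //; apply: homeomorphic_trans hU.
apply: (homeomorphic_sub (f := rho) (g := rho)) => //.
- exact: continuous_subspaceT.
- exact: continuous_subspaceT.
- by move=> g Ug; rewrite /= rhoK.
Qed.

Variables (R : realType) (c1 c2 : R -> R) (T : topologicalType) (f : T -> R).
Variables (U : Type) (v0 : U) (E : R -> R -> U -> T).
Hypotheses (c12 : forall x, c1 x < c2 x).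
Local Notation q := (reeb_map f).
Local Notation cb := (reeb_bar (c := f)).
Hypothesis fE : forall t x v, dom c1 c2 t x -> f (E t x v) = t.
Hypothesis collapse : forall t x v v', t = c1 x \/ t = c2 x -> E t x v = E t x v'.
Hypothesis E_cont : forall (W : set T) v, open W -> band_open c1 c2 (fun t x => W (E t x v)).
Hypothesis E_surj : forall z, exists x v, dom c1 c2 (f z) x /\ z = E (f z) x v.
Local Notation Q := (reeb_strip f v0 E).
Local Notation S := (crit_points c1 c2 Q).

(** [h] induces an involution of the Reeb space. It fixes the vertices, which come from the boundary
    of the band, where all directions coincide. *)
Lemma involution_on_reeb (h : T -> T) (s : reeb_space f) : continuous h -> involutive h ->
  (forall z, f (h z) = f z) -> (forall t x v, dom c1 c2 t x ->
     exists v', h (E t x v) = E t x v') ->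
  forall z, q z = s -> NF R S s -> NF R S (q (h z)).
Proof.
move=> ch hK fh hE z zs Ns.
have qh x y : q x = q y -> q (h x) = q (h y).
  move=> /reeb_mapP/reeb_relE[K [Kx Kf cK] Ky].
  apply: (@reeb_eq_connected _ _ _ (h @` K) (f x)).
  - by apply: connected_continuous_connected => //; exact: continuous_subspaceT.
  - by move=> _ [k /Kf <- <-].
  - by exists x.
  - by exists y.
pose rho (g : reeb_space f) := q (h (sval (cid (reeb_map_surj g)))).
have rhoE x : rho (q x) = q (h x).
  by rewrite /rho; case: cid => y /= yx; exact: qh.
rewrite -rhoE zs; apply: NF_involution Ns.
- apply/continuousP => V oV; apply/reeb_open.
  have -> : q @^-1` (rho @^-1` V) = h @^-1` (q @^-1` V).
    by apply/seteqP; split=> x /=; rewrite rhoE.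
  by apply: open_comp.
- by move=> g; have [x <-] := reeb_map_surj g; rewrite !rhoE hK.
- have key y c : c = c1 \/ c = c2 -> rho (Q (c y) y) = Q (c y) y.
    move=> hc; rewrite /reeb_strip rhoE; have [|v' ->] := hE (c y) y v0.
      by rewrite /dom; case: hc => ->; rewrite lexx ?andbT ltW.
    by rewrite (collapse v' v0)//; case: hc => ->; [left|right].
  move=> g [y [[dy ->]|[dy ->]]]; exists y; [left|right]; split=> //; apply: key.
    by left.
  by right.
Qed.

Lemma attach_curve a g : (forall x, c1 x < a < c2 x) -> cb g = a ->
  exists K : set (reeb_space f),
  [/\ connected K, K g, forall h, K h -> h = g \/ a < cb h & exists2 h, K h & a < cb h].
Proof.
move=> bad; have [z <-] := reeb_map_surj g; rewrite reeb_barE => za.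
have [x [v [dx zE]]] := E_surj z; rewrite za in dx zE.
have /andP[b1 b2] := bad x.
have dt t : a <= t <= c2 x -> dom c1 c2 t x.
  by move=> /andP[h1 h2]; rewrite /dom h2 andbT; lra.
have cbE t : a <= t <= c2 x -> cb (q (E t x v)) = t.
  by move=> h; rewrite reeb_barE fE //; exact: dt.
exists (q @` ((fun t => E t x v) @` `[a, c2 x]%classic)); split.
- apply: connected_continuous_connected; last first.
    by apply: continuous_subspaceT; exact: reeb_map_continuous.
  apply: connected_continuous_connected.
    by apply/connected_intervalP; exact: interval_is_interval.
  apply/subspace_continuousP => r; rewrite /= in_itv/= => Ir B.
  rewrite nbhsE => -[V [oV Vr] VB].
  have [d d0 hd] := E_cont oV (dt _ Ir) Vr.
  have hr : \forall r' \near r, `|r - r'| < d by exact: nbhsx_ballx.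
  rewrite /nbhs/= /within/=; near=> r'; rewrite in_itv/= => Ir'; apply: VB.
  apply: (hd r' x); [exact: dt| |by rewrite subrr normr0].
  by rewrite distrC; near: r'.
- by exists z => //; exists a; rewrite /= ?in_itv/= ?lexx ?ltW// -zE.
- move=> _ [_ [t It <-] <-]; move: (It); rewrite /= in_itv/= => /andP[h1 h2].
  have [ta|at_|ta] := ltgtP a t.
  + by right; rewrite cbE ?h1.
  + by move: h1; rewrite leNgt at_.
  + by left; rewrite zE ta.
- exists (q (E (c2 x) x v)); last by rewrite cbE// lexx ltW.
  by exists (E (c2 x) x v) => //; exists (c2 x); rewrite /= ?in_itv/= ?lexx ?ltW.
Unshelve. all: by end_near. Qed.

End Symmetry.

Section RowVectors.
Variable R : realType.

Lemma row_cvg (n : nat) (T : Type) (F : set_system T) (g : T -> 'rV[R]_n) (l : 'rV[R]_n) :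
  Filter F -> (forall j, g x 0 j @[x --> F] --> l 0 j) -> g @ F --> l.
Proof.
move=> FF h; apply/cvg_ballP => e e0.
have : \forall x \near F, forall j : 'I_n, ball (l 0 j) e (g x 0 j).
  by apply: filter_forall => j; have /cvg_ballP/(_ e e0) := h j.
apply: filterS => x hx; split=> // i j.
by rewrite (ord1 i); exact: hx.
Qed.

Lemma row_coord_continuous (n : nat) (j : 'I_n) : continuous (fun z : 'rV[R]_n => z 0 j).
Proof. exact: coord_continuous. Qed.

End RowVectors.

(** * Reflections of the fibre *)

Section Tail.
Variables (R : realType) (m : nat).
Implicit Types (u v z : 'rV[R]_m.+1).

Definition tdot u v : R := \sum_(j < m.+1 | (1 < j)%N) u 0 j * v 0 j.

Lemma tdotC u v : tdot u v = tdot v u.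
Proof. by apply: eq_bigr => j _; rewrite mulrC. Qed.

Lemma tdotBl u v z (k : R) : tdot (u - k *: v) z = tdot u z - k * tdot v z.
Proof.
rewrite /tdot mulr_sumr -sumrB; apply: eq_bigr => j _.
by rewrite !mxE mulrBl mulrA.
Qed.

Lemma tdotE v : tdot v v = \sum_(j < m.+1 | (1 < j)%N) v 0 j ^+ 2.
Proof. by apply: eq_bigr => j _; rewrite expr2. Qed.

Lemma tdot_ge0 v : 0 <= tdot v v.
Proof. by rewrite tdotE; apply: sumr_ge0 => j _; exact: sqr_ge0. Qed.

Lemma tdot_eq0 v : tdot v v = 0 -> forall j : 'I_m.+1, (1 < j)%N -> v 0 j = 0.
Proof.
rewrite tdotE => /eqP; rewrite psumr_eq0; last by move=> j _; exact: sqr_ge0.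
by move=> /allP h j j1; have := h j (mem_index_enum _); rewrite j1/= sqrf_eq0 => /eqP.
Qed.

(* The reflection of the last coordinates in the hyperplane orthogonal to [u]
   when [u] vanishes in the first two; the identity if it also vanishes in the
   others, as [x / 0 = 0]. *)
Definition refl u z : 'rV[R]_m.+1 := z - (2 * tdot z u / tdot u u) *: u.

Lemma refl_tdot u z : tdot (refl u z) (refl u z) = tdot z z.
Proof.
rewrite /refl; set k := _ / _.
rewrite tdotBl (tdotC z (z - _)) (tdotC u (z - _)) !tdotBl (tdotC u z).
rewrite /k; have [->|nz] := eqVneq (tdot u u) 0; first by rewrite invr0; ring.
by field.
Qed.

Lemma reflK u : involutive (refl u).
Proof.
move=> z; rewrite {1}/refl; have -> : 2 * tdot (refl u z) u / tdot u u =
    - (2 * tdot z u / tdot u u).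
  rewrite /refl tdotBl; have [->|nz] := eqVneq (tdot u u) 0; first by rewrite invr0; ring.
  by field.
by rewrite scaleNr opprK /refl subrK.
Qed.

Lemma tdot_cvg (T : Type) (F : set_system T) (g h : T -> 'rV[R]_m.+1) u v : Filter F ->
  g @ F --> u -> h @ F --> v -> tdot (g x) (h x) @[x --> F] --> tdot u v.
Proof.
move=> FF gu hv; apply: cvg_big => [|j _]; first exact: add_continuous.
apply: cvgM; [apply: (cvg_comp _ (fun z : 'rV[R]_m.+1 => z 0 j) gu)
             |apply: (cvg_comp _ (fun z : 'rV[R]_m.+1 => z 0 j) hv)];
  exact: row_coord_continuous.
Qed.

Lemma refl_continuous u : continuous (refl u).
Proof.
move=> z; apply: (row_cvg (nbhs_filter z)) => j.
have -> : (fun x => refl u x 0 j) = (fun x => x 0 j - 2 * tdot x u / tdot u u * u 0 j).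
  by apply/funext => x; rewrite !mxE.
rewrite [refl u z 0 j](_ : _ = z 0 j - 2 * tdot z u / tdot u u * u 0 j); last by rewrite !mxE.
apply: cvgB; first exact: row_coord_continuous.
apply: cvgMr_tmp; apply: cvgMr_tmp; apply: cvgMl_tmp.
by apply: tdot_cvg; [exact: cvg_id|exact: cvg_cst].
Qed.

End Tail.

(** * The zero-set as a family of spheres over the band *)

Section ZeroSet.
Variables (R : realType) (m : nat) (c1 c2 : R -> R).
Hypotheses (m1 : (1 < m)%N) (c12 : forall x, c1 x < c2 x).
Hypotheses (cc1 : continuous c1) (cc2 : continuous c2).
Implicit Types (z v : 'rV[R]_m.+1) (t x : R).
Local Notation X := (@zero_set R m c1 c2).
Local Notation x1 := (@coord1 R m).
Local Notation x2 := (@coord2 R m).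

Let ord1E : (inord 1 : 'I_m.+1) = 1%N :> nat.
Proof. by rewrite inordK// ltnS ltnW. Qed.

Lemma ord_cases (j : 'I_m.+1) : [\/ j = 0, j = inord 1 | (1 < j)%N].
Proof.
case: j => -[|[|k]] jm; [apply: Or31|apply: Or32|by apply: Or33];
  by apply: val_inj; rewrite /= ?ord1E.
Qed.

(** The equation makes the product nonnegative, which places [x1] between the boundaries.
    Conversely, a point of the closed band is a limit of interior points, obtained by moving it
    towards the middle of the band over the same [x2]. *)
Lemma zero_setP z : X z <->
  dom c1 c2 (x1 z) (x2 z) /\ (x1 z - c1 (x2 z)) * (c2 (x2 z) - x1 z) = tdot z z.
Proof.
rewrite tdotE; split=> [[_ /eqP]|[d E]]; last first.
  split; last by rewrite E subrr.
  move=> B; rewrite -nbhs_ballE => -[e /= e0 eB].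
  pose mid := (c1 (x2 z) + c2 (x2 z)) / 2.
  have cz := c12 (x2 z); move: d; rewrite /dom => /andP[d1 d2].
  (* The first bound keeps the displaced point inside the band, the second one within [e] of the
     original. *)
  pose s := Num.min (1 / 2) (e / (2 * (c2 (x2 z) - c1 (x2 z)))).
  have s0 : 0 < s by rewrite lt_min !divr_gt0// mulr_gt0// subr_gt0.
  have s1 : s <= 1 / 2 by rewrite ge_min lexx.
  have se : s * (c2 (x2 z) - c1 (x2 z)) < e.
    have : s <= e / (2 * (c2 (x2 z) - c1 (x2 z))) by rewrite ge_min lexx orbT.
    rewrite ler_pdivlMr; last by rewrite mulr_gt0// subr_gt0.
    lra.
  exists (x1 z + s * (mid - x1 z), x2 z); split.
    by rewrite /domain/= /mid; apply/andP; split; nra.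
  apply: eB; split; rewrite /ball/=; last by rewrite subrr normr0.
  rewrite opprD addrA subrr add0r normrN normrM gtr0_norm//.
  apply: le_lt_trans se; rewrite ler_pM2l// ler_norml /mid.
  by apply/andP; split; lra.
rewrite subr_eq0 => /eqP E; split=> //.
have := @sumr_ge0 R _ (index_enum 'I_m.+1) (fun j => (1 < j)%N) (fun j => z 0 j ^+ 2)
  (fun j _ => sqr_ge0 _).
by rewrite -E /dom => h; have := c12 (x2 z); apply: contraTT; rewrite negb_and -!ltNge
  => /orP[h'|h']; rewrite -leNgt; nra.
Qed.

(** Only the coordinates of index above 1 matter; they describe the unit sphere of dimension
    [m - 2], which is a pair of points if [m = 2]. *)
Definition unit_tail := {v : 'rV[R]_m.+1 | tdot v v == 1}.

(** The fibre over [(t, x)] is a sphere whose squared radius is given by the equation of the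
    zero-set; it shrinks to a point over the boundary. *)
Definition point t x v : 'rV[R]_m.+1 :=
  \row_j (if j == 0 then t else if j == inord 1 then x
          else Num.sqrt ((t - c1 x) * (c2 x - t)) * v 0 j).

Lemma point1 t x v : x1 (point t x v) = t.
Proof. by rewrite /coord1 mxE eqxx. Qed.

Lemma point2 t x v : x2 (point t x v) = x.
Proof.
rewrite /coord2 mxE eqxx ifN//; apply/eqP => /(congr1 val) /=.
by rewrite ord1E.
Qed.

Lemma point_tail t x v (j : 'I_m.+1) : (1 < j)%N ->
  point t x v 0 j = Num.sqrt ((t - c1 x) * (c2 x - t)) * v 0 j.
Proof.
move=> j1; rewrite mxE ifN ?ifN//.
  by apply/eqP => E; move: j1; rewrite E ord1E.
by apply/eqP => E; move: j1; rewrite E.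
Qed.

Lemma row_eq z z' : x1 z = x1 z' -> x2 z = x2 z' ->
  (forall j : 'I_m.+1, (1 < j)%N -> z 0 j = z' 0 j) -> z = z'.
Proof.
move=> e1 e2 h; apply/rowP => j.
by have [->|->|j1] := ord_cases j; [exact: e1|exact: e2|exact: h].
Qed.

Lemma point_zero t x v : tdot v v = 1 -> dom c1 c2 t x -> X (point t x v).
Proof.
move=> v1 dx; apply/zero_setP; rewrite point1 point2; split=> //.
have w0 : 0 <= (t - c1 x) * (c2 x - t).
  by move: dx => /andP[? ?]; rewrite mulr_ge0// subr_ge0.
rewrite tdotE; under eq_bigr => j j1 do rewrite point_tail// exprMn sqr_sqrtr//.
by rewrite -mulr_sumr -tdotE v1 mulr1.
Qed.

Definition vec0 : 'rV[R]_m.+1 := delta_mx 0 (inord 2).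

Lemma vec0_unit : tdot vec0 vec0 == 1.
Proof.
have o2 : (inord 2 : 'I_m.+1) = 2%N :> nat by rewrite inordK.
rewrite tdotE (bigD1 (inord 2)) ?o2//= mxE !eqxx expr1n big1 ?addr0// => j /andP[_ j2].
by rewrite mxE (negbTE j2) andbF expr0n.
Qed.
Definition v0 : unit_tail := exist _ vec0 vec0_unit.

Let base_zero : X (point (c1 0) 0 vec0).
Proof. by apply: point_zero; [exact/eqP/vec0_unit|rewrite /dom lexx ltW]. Qed.

(** A fixed point of the zero-set is the default value off the band, making the parametrisation
    total. *)
Definition pointX t x (v : unit_tail) : subsp X :=
  if pselect (X (point t x (sval v))) is left h then SigSub (mem_set h)
  else SigSub (mem_set base_zero).

Lemma pointXE t x (v : unit_tail) : dom c1 c2 t x -> \val (pointX t x v) = point t x (sval v).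
Proof.
move=> dx; rewrite /pointX; case: pselect => // n; exfalso; apply: n.
by apply: point_zero => //; exact/eqP/(svalP v).
Qed.

Lemma point_continuous v t x B : nbhs (point t x v) B -> exists2 d, 0 < d &
  forall t' x', `|t' - t| < d -> `|x' - x| < d -> B (point t' x' v).
Proof.
move=> nB; have cp : point p.1 p.2 v @[p --> (t, x)] --> point t x v.
  have f1 : (p : R * R).1 @[p --> (t, x)] --> t by exact: cvg_fst.
  have f2 : (p : R * R).2 @[p --> (t, x)] --> x by exact: cvg_snd.
  apply: (row_cvg (nbhs_filter (t, x))) => j; rewrite mxE.
  under eq_fun do rewrite mxE.
  case: ifP => // _; case: ifP => // _.
  (* [Num.sqrt] is continuous on the whole line, being 0 on negative numbers, so nearby pairs may
     leave the band. *)
  apply: cvgMr_tmp; apply: (cvg_comp _ (@Num.sqrt R)); last exact: sqrt_continuous.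
  apply: cvgM; apply: cvgB => //.
    by apply: (cvg_comp _ c1 f2); exact: cc1.
  by apply: (cvg_comp _ c2 f2); exact: cc2.
have := cp B nB; rewrite /= -nbhs_ballE => -[d /= d0 hd]; exists d => // t' x' tt xx.
by apply: (hd (t', x')); split; rewrite /ball/= distrC.
Qed.

End ZeroSet.

Section ReebOfZeroSet.
Variables (R : realType) (m : nat) (c1 c2 : R -> R).
Hypotheses (m1 : (1 < m)%N) (c12 : forall x, c1 x < c2 x).
Hypotheses (cc1 : continuous c1) (cc2 : continuous c2).
Implicit Types (t x y : R).
Local Notation X := (@zero_set R m c1 c2).
Local Notation x1 := (@coord1 R m).
Local Notation x2 := (@coord2 R m).
Local Notation f := (@restr R m X x1).
Local Notation TX := (subsp X).
Local Notation pX := (pointX m1 c12).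

Definition reebX : R -> R -> reeb_space f := reeb_strip f (v0 R m1) pX.

Let val_cont : continuous (set_val : TX -> 'rV[R]_m.+1).
Proof. exact: initial_continuous. Qed.

Lemma restr_continuous : continuous f.
Proof.
move=> z; apply: (@continuous_comp _ _ _ (set_val : TX -> _) x1); first exact: val_cont.
exact: row_coord_continuous.
Qed.

Lemma pX_height t x v : dom c1 c2 t x -> f (pX t x v) = t.
Proof. by move=> dx; rewrite /restr pointXE// point1. Qed.

Lemma pX_collapse t x v v' : t = c1 x \/ t = c2 x -> pX t x v = pX t x v'.
Proof.
move=> h; have dx : dom c1 c2 t x.
  by case: h => ->; rewrite /dom lexx ?andbT ltW.
apply: val_inj; rewrite !pointXE//; apply: (row_eq m1).
- by rewrite !point1.
- by rewrite !point2.
- by move=> j j1; rewrite !point_tail//; case: h => ->;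
    rewrite subrr ?mul0r ?mulr0 sqrtr0 !mul0r.
Qed.

Let set_valE t x v : dom c1 c2 t x -> set_val (pX t x v : TX) = point c1 c2 t x (sval v).
Proof. exact: pointXE. Qed.

Lemma pX_cont (W : set TX) v : open W -> band_open c1 c2 (fun t x => W (pX t x v)).
Proof.
move=> [W' oW' <-] t x dx; rewrite /= set_valE// => W'x.
have [d d0 hd] := point_continuous cc1 cc2 (open_nbhs_nbhs (conj oW' W'x)).
by exists d => // t' x' dx' tt xx /=; rewrite set_valE//; exact: hd.
Qed.

Lemma pX_surj (z : TX) : exists v, dom c1 c2 (f z) (x2 (\val z)) /\
  z = pX (f z) (x2 (\val z)) v.
Proof.
have Xz : X (\val z) := set_valP z.
have [d E] := (zero_setP c12 _).1 Xz; rewrite -/(@restr R m X x1 z) in d E.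
set t := f z in d E *; set x := x2 (\val z) in d E *.
have [w0|w0] := eqVneq (tdot (\val z) (\val z)) 0.
  exists (v0 R m1); split=> //; apply: val_inj; rewrite pointXE//; apply: (row_eq m1).
  - by rewrite point1.
  - by rewrite point2.
  - by move=> j j1; rewrite point_tail// E w0 sqrtr0 mul0r (tdot_eq0 w0).
pose w := Num.sqrt (tdot (\val z) (\val z)).
have ww : 0 < w by rewrite sqrtr_gt0 lt_neqAle eq_sym w0 tdot_ge0.
pose v : 'rV[R]_m.+1 := w^-1 *: \val z.
have v1 : tdot v v == 1.
  rewrite tdotE; under eq_bigr => j _ do rewrite mxE exprMn.
  by rewrite -mulr_sumr -tdotE -[X in _ * X]sqr_sqrtr ?tdot_ge0// -/w exprVn mulVf//
    expf_eq0/= gt_eqF.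
exists (exist _ v v1); split=> //; apply: val_inj; rewrite pointXE//; apply: (row_eq m1).
- by rewrite point1.
- by rewrite point2.
- by move=> j j1; rewrite point_tail// E -/w mxE mulrA mulfV ?mul1r// gt_eqF.
Qed.

Lemma pX_cut w : exists A B : set TX,
  [/\ open A, open B, forall z, A z -> B z -> False,
    forall z, ~~ dom c1 c2 (f z) w -> A z \/ B z &
    (forall t x v, dom c1 c2 t x -> x < w -> A (pX t x v)) /\
    (forall t x v, dom c1 c2 t x -> w < x -> B (pX t x v))].
Proof.
have cx2 : continuous (fun z : TX => x2 (\val z)).
  move=> z; apply: (@continuous_comp _ _ _ (set_val : TX -> _) x2); first exact: val_cont.
  exact: row_coord_continuous.
exists ((fun z : TX => x2 (\val z)) @^-1` [set x | x < w]).
exists ((fun z : TX => x2 (\val z)) @^-1` [set x | w < x]); split.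
- by apply: open_comp => //; exact: open_lt.
- by apply: open_comp => //; exact: open_gt.
- by move=> z /= h /(lt_trans h); rewrite ltxx.
- move=> z nd; have [v [d _]] := pX_surj z.
  have [h|h|h] := ltgtP (x2 (\val z)) w; [by left|by right|].
  by move: nd; rewrite -h d.
- by split=> t x v dx xw /=; rewrite pointXE// point2.
Qed.

Let surj' z : (exists x v, dom c1 c2 (f z) x /\ z = pX (f z) x v) \/
  (exists x, dom c1 c2 (f z) x /\ reeb_map f z = reebX (f z) x).
Proof. by left; have [v h] := pX_surj z; exists (x2 (\val z)), v. Qed.

Lemma reebX_strip : strip c1 c2 reebX (reeb_bar (c := f)).
Proof.
exact: (reeb_strip_strip cc1 cc2 restr_continuous pX_height pX_collapse pX_cont surj' pX_cut).
Qed.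

Lemma reebX_hausdorff (g h : reeb_space f) :
  good c1 c2 (reeb_bar (c := f) g) -> good c1 c2 (reeb_bar (c := f) h) ->
  cluster (nbhs g) h -> g = h.
Proof.
exact: (reeb_strip_hausdorff cc1 cc2 restr_continuous pX_height pX_collapse pX_cont surj' pX_cut).
Qed.

(** Near a point of good height the direction may vary with the point: by [reeb_indep] the image in
    the Reeb space depends on the pair alone. *)
Lemma reebX_open (V : set (reeb_space f)) :
  (forall g, V g -> good c1 c2 (reeb_bar (c := f) g)) ->
  band_open c1 c2 (fun t x => V (reebX t x)) -> open V.
Proof.
move=> gV bV; apply/reeb_open; rewrite openE => z Vz.
have [v [d zE]] := pX_surj z; set t := f z in d zE; set x := x2 (\val z) in d zE.
have indep := reeb_indep (v0 R m1) cc1 cc2 pX_height pX_collapse pX_cont.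
have gt : good c1 c2 t by move: (gV _ Vz); rewrite reeb_barE.
have Vx : V (reebX t x) by rewrite /reebX -(indep _ _ v)// -zE.
have [e e0 he] := bV _ _ d Vx.
have nx1 : \forall z' \near z, `|f z' - t| < e.
  have cz : f @ z --> f z by exact: restr_continuous.
  by have /cvgrPdist_lt/(_ e e0) := cz; apply: filterS => z'; rewrite distrC.
have nx2 : \forall z' \near z, `|x2 (\val z') - x| < e.
  have cx2 : (fun z : TX => x2 (\val z)) @ z --> x2 (\val z).
    apply: (@continuous_comp _ _ _ (set_val : TX -> _) x2); first exact: val_cont.
    exact: row_coord_continuous.
  by have /cvgrPdist_lt/(_ e e0) := cx2; apply: filterS => z'; rewrite distrC.
have : \forall z' \near z, V (reeb_map f z').
  near=> z'; have [v' [d' zE']] := pX_surj z'.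
  have VQ : V (reebX (f z') (x2 (\val z'))).
    by apply: he => //; [near: z'|near: z'].
  have g' : good c1 c2 (f z').
    by move: (gV _ VQ); rewrite (strip_val reebX_strip).
  by rewrite {1}zE' indep.
by [].
Unshelve. all: by end_near. Qed.

Section Reflect.
Variables v v' : unit_tail R m.

(** The reflection in the hyperplane orthogonal to the difference of two unit vectors exchanges
    them. *)
Let u : 'rV[R]_m.+1 := \row_j (if (1 < j)%N then sval v 0 j - sval v' 0 j else 0).

Let refl_head (j : 'I_m.+1) z : (j <= 1)%N -> refl u z 0 j = z 0 j.
Proof. by move=> j1; rewrite /refl !mxE ltnNge j1/= mulr0 subr0. Qed.

Let refl1 z : x1 (refl u z) = x1 z. Proof. exact: refl_head. Qed.
Let refl2 z : x2 (refl u z) = x2 z.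
Proof. by apply: refl_head; rewrite inordK// ltnS ltnW. Qed.

Let reflX z : X z -> X (refl u z).
Proof.
move=> /(zero_setP c12)[d E]; apply/(zero_setP c12).
by rewrite refl1 refl2 refl_tdot.
Qed.

Definition reflectX (z : TX) : TX := SigSub (mem_set (reflX (set_valP z))).

Lemma reflectX_continuous : continuous reflectX.
Proof.
apply: (@continuous_comp_initial (set_type X) TX _ set_val reflectX) => z.
apply: (@continuous_comp _ _ _ (set_val : TX -> _) (refl u)); first exact: val_cont.
exact: refl_continuous.
Qed.

Lemma reflectXK : involutive reflectX.
Proof. by move=> z; apply: val_inj; rewrite /= reflK. Qed.

Lemma reflectX_height z : f (reflectX z) = f z.
Proof. exact: refl1. Qed.

Lemma reflectX_point t x (w : unit_tail R m) : dom c1 c2 t x ->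
  exists2 w' : unit_tail R m, sval w' = refl u (sval w) & reflectX (pX t x w) = pX t x w'.
Proof.
move=> dx; have w1 : tdot (refl u (sval w)) (refl u (sval w)) == 1.
  by rewrite refl_tdot; exact: svalP w.
exists (exist (fun v => tdot v v == 1) _ w1) => //; apply: val_inj; rewrite /= !pointXE//; apply: (row_eq m1).
- by rewrite refl1 !point1.
- by rewrite refl2 !point2.
- move=> j j1; rewrite [RHS]point_tail// /refl !mxE -/(point c1 c2 t x _).
  have -> : tdot (point c1 c2 t x (sval w)) u =
      Num.sqrt ((t - c1 x) * (c2 x - t)) * tdot (sval w) u.
    by rewrite /tdot mulr_sumr; apply: eq_bigr => k k1; rewrite point_tail// mulrA.
  have := @point_tail _ _ c1 c2 m1 t x (sval w) j j1; rewrite mxE => ->.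
  ring.
Qed.

Lemma reflectX_swap t x : dom c1 c2 t x -> reflectX (pX t x v) = pX t x v'.
Proof.
move=> dx; have [w wE ->] := reflectX_point v dx.
apply: val_inj; rewrite /= !pointXE//; apply: (row_eq m1); rewrite ?point1 ?point2//.
move=> j j1; rewrite !point_tail// wE; congr (_ * _).
have uE z : tdot u z = tdot (sval v) z - tdot (sval v') z.
  rewrite /tdot -sumrB; apply: eq_bigr => k k1.
  by rewrite mxE k1 mulrBl.
have [vv v'v'] : tdot (sval v) (sval v) = 1 /\ tdot (sval v') (sval v') = 1.
  by split; [exact/eqP/(svalP v)|exact/eqP/(svalP v')].
have vu : tdot (sval v) u = 1 - tdot (sval v) (sval v').
  by rewrite tdotC uE vv (tdotC (sval v')).
have uu : tdot u u = 2 - 2 * tdot (sval v) (sval v').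
  by rewrite uE vu (tdotC (sval v') u) uE v'v'; ring.
have uj : u 0 j = sval v 0 j - sval v' 0 j by rewrite mxE j1.
have rE : refl u (sval v) 0 j = sval v 0 j - 2 * tdot (sval v) u / tdot u u * u 0 j.
  by rewrite /refl !mxE.
rewrite rE; have [u0|nz] := eqVneq (tdot u u) 0.
  have := tdot_eq0 u0 j1; rewrite uj => /eqP; rewrite subr_eq0 => /eqP ->.
  by rewrite subrr mulr0 subr0.
have -> : 2 * tdot (sval v) u / tdot u u = 1.
  have -> : 2 * tdot (sval v) u = tdot u u by rewrite uu vu; ring.
  by rewrite mulfV.
by rewrite mul1r uj; ring.
Qed.

End Reflect.

(** The level [a] fills the line, so any of its points can be moved over any [x]; a reflection then
    adjusts the direction. Hence symmetries of the Reeb space act transitively on the points of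
    height [a]. *)
Lemma no_bad_level (a1 a2 a : R) (K : diagram) : tame c1 -> tame c2 ->
  c1 x @[x --> -oo] --> a1 -> c2 x @[x --> -oo] --> a1 ->
  c1 x @[x --> +oo] --> a2 -> c2 x @[x --> +oo] --> a2 ->
  (forall x, c1 x < a < c2 x) ->
  diagram_iso (GDNF (crit_points c1 c2 reebX) (reeb_bar (c := f))) K ->
  shape_ray K \/ three_vertices_two_arcs K -> False.
Proof.
move=> tc1 tc2 c1m c2m c1p c2p bad.
have surj z : exists x v, dom c1 c2 (f z) x /\ z = pX (f z) x v.
  by have [v h] := pX_surj z; exists (x2 (\val z)), v.
apply: (two_sheets_false tc1 tc2 c12 c1m c2m c1p c2p bad reebX_strip reebX_hausdorff
  reebX_open).
  move=> g ga; exact: (attach_curve pX_height pX_cont surj bad ga).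
move=> s g sa ga Ns; have [z zs] := reeb_map_surj s; have [z' zg] := reeb_map_surj g.
have [x [v [dx zE]]] := surj z; have [x' [v' [dx' zE']]] := surj z'.
have za : f z = a by rewrite -reeb_barE zs.
have za' : f z' = a by rewrite -reeb_barE zg.
rewrite za in dx zE; rewrite za' in dx' zE'.
have l : lev c1 c2 a x' x.
  by move=> w _; have /andP[? ?] := bad w; rewrite /dom !ltW.
rewrite -zg zE' (reeb_level pX_height pX_cont v' l) -(reflectX_swap v v' dx) -zE.
have := (involution_on_reeb (v0 := v0 R m1) c12 pX_collapse
  (@reflectX_continuous v v') (@reflectXK v v') (reflectX_height v v') _ zs Ns).
apply.
by move=> t y w dy; have [w' _ ->] := reflectX_point v v' w dy; exists w'.
Qed.

End ReebOfZeroSet.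

(** * The compactification and its poles *)

Section SphereEnds.
Variables (R : realType) (m : nat).
Implicit Types z w : 'rV[R]_m.+1.
Local Notation Sm := (@sphere R m).
Local Notation Pm := (@punctured_sphere R m).
Local Notation pp := (pole_plus R m).
Local Notation pm := (pole_minus R m).

Lemma sphere_compact : compact Sm.
Proof.
apply: bounded_closed_compact.
  exists 1; split=> [|M M1 z Sz]; first exact: num_real.
  change (mx_norm z <= M); rewrite mx_normrE; apply: bigmax_le; first exact/ltW/(lt_trans ltr01).
  move=> [i j] _ /=; rewrite (ord1 i); apply: le_trans (ltW M1).
  rewrite -(@expr_le1 _ 2)// real_normK ?num_real// -Sz (bigD1 j)//= lerDl.
  by apply: sumr_ge0 => k _; exact: sqr_ge0.
have -> : Sm = (fun z => \sum_(i < m.+1) z 0 i ^+ 2) @^-1` [set 1] by [].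
apply: preimage_closed; last exact: closed_eq.
move=> z _; have FF := nbhs_filter z; apply: cvg_big => [|j _]; first exact: add_continuous.
by apply: cvgM; exact: row_coord_continuous.
Qed.

Lemma poles_neq : pp <> pm.
Proof.
move=> /(congr1 (fun z : 'rV[R]_m.+1 => z 0 ord_max)) /=.
have e : pp 0 ord_max = 1 :> R by rewrite /pole_plus mxE !eqxx.
have e' : pm 0 ord_max = - 1 :> R by rewrite /pole_minus mxE e.
by rewrite e e' => h; lra.
Qed.

Lemma pole_plus_sphere : Sm pp.
Proof.
rewrite /sphere/= (bigD1 ord_max)//= /pole_plus mxE !eqxx expr1n big1 ?addr0// => j jm.
by rewrite mxE (negbTE jm) andbF expr0n.
Qed.

Lemma pole_minus_sphere : Sm pm.
Proof.
rewrite /sphere/= -[RHS]pole_plus_sphere; apply: eq_bigr => j _.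
by rewrite /pole_minus mxE sqrrN.
Qed.

(* [h] is bounded below on the compact set of the points outside [W]. *)
Lemma pole_end (p p' : 'rV[R]_m.+1) (h : 'rV[R]_m.+1 -> R) (W : set 'rV[R]_m.+1) :
  [set pp; pm] = [set p; p'] ->
  (forall z, Pm z -> h @ within Pm (nbhs z) --> h z) ->
  h @ within Pm (nbhs p') --> +oo -> open W -> W p ->
  exists M, forall z, Pm z -> h z < M -> W z.
Proof.
move=> pE hc hp oW Wp.
have cK : compact (Sm `&` ~` W).
  by apply: compact_closedI; [exact: sphere_compact|exact: open_closedC].
have /compact_near_coveringP/(_ R -oo (fun M z => Pm z -> M <= h z) _) := cK.
case.
- move=> z [Sz nWz]; have zp : z <> p by move=> E; apply: nWz; rewrite E.
  have [zp'|zp'] := pselect (z = p').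
    have /cvgryPge/(_ 0) h0 := hp.
    exists ([set w | Pm w -> 0 <= h w], [set M | M < 0]).
      split; first by rewrite /= zp'; exact: h0.
      by exists 0; split=> //; exact: num_real.
    by move=> [w M] [/= hw M0] Pw; apply: le_trans (ltW M0) (hw Pw).
  have Pz : Pm z.
    by split=> //; rewrite pE => -[].
  have /cvgr_gt/(_ (h z - 1)) h0 := hc z Pz.
  have hz : h z - 1 < h z by rewrite gtrBl.
  exists ([set w | Pm w -> h z - 1 < h w], [set M | M < h z - 1]).
    split; first exact: (h0 hz).
    by exists (h z - 1); split=> //; exact: num_real.
  by move=> [w M] [/= hw M0] Pw; apply: le_trans (ltW M0) (ltW (hw Pw)).
- move=> M [_ hM]; exists (M - 1) => z Pz hz; apply: contrapT => nWz.
  have := hM (M - 1) _ z (conj (proj1 Pz) nWz) Pz; rewrite gtrBl ltr01 => /(_ isT).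
  by rewrite leNgt hz.
Qed.

End SphereEnds.

Lemma smooth_on_continuous (R : realType) (n p : nat) (A : set 'rV[R]_n.+1)
    (F : 'rV[R]_n.+1 -> 'rV[R]_p.+1) z :
  smooth_on A F -> A z -> F @ within A (nbhs z) --> F z.
Proof.
move=> sF Az; have [V [H [oV Vz cH FH]]] := sF z Az.
have FF : Filter (within A (nbhs z)) by exact: within_filter.
have HF : H @ within A (nbhs z) --> F z.
  apply: row_cvg => j; rewrite (FH _ Az Vz).
  by apply: cvg_within_filter; exact: (cH j 0 z Vz).
apply: cvg_trans HF; apply: near_eq_cvg.
have nV : nbhs z V by apply: open_nbhs_nbhs.
near=> w; symmetry; apply: FH.
  by near: w; exact: withinT.
by near: w; apply: cvg_within.
Unshelve. all: by end_near. Qed.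

Section SphereReeb.
Variables (R : realType) (m : nat) (c1 c2 : R -> R) (a1 a2 xm xp : R).
Hypotheses (m1 : (1 < m)%N) (c12 : forall x, c1 x < c2 x).
Hypotheses (cc1 : continuous c1) (cc2 : continuous c2).
Hypotheses (c1m : c1 x @[x --> -oo] --> a1) (c2m : c2 x @[x --> -oo] --> a1).
Hypotheses (c1p : c1 x @[x --> +oo] --> a2) (c2p : c2 x @[x --> +oo] --> a2).
Hypothesis all_good : forall t, good c1 c2 t.
Hypotheses (dm : forall x, x <= xm -> dom c1 c2 a1 x)
           (dp : forall x, xp <= x -> dom c1 c2 a2 x).
Local Notation X := (@zero_set R m c1 c2).
Local Notation x1 := (@coord1 R m).
Local Notation x2 := (@coord2 R m).
Local Notation Sm := (@sphere R m).
Local Notation Pm := (@punctured_sphere R m).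
Local Notation pp := (pole_plus R m).
Local Notation pm := (pole_minus R m).
Variables phi psi : 'rV[R]_m.+1 -> 'rV[R]_m.+1.
Hypotheses (phX : forall z, Pm z -> X (phi z)) (psP : forall y, X y -> Pm (psi y)).
Hypotheses (phK : forall z, Pm z -> psi (phi z) = z) (psK : forall y, X y -> phi (psi y) = y).
Hypothesis phc : forall z, Pm z -> phi @ within Pm (nbhs z) --> phi z.
Hypothesis psc : forall y, X y -> psi @ within X (nbhs y) --> psi y.
Hypothesis hm : x2 (phi z) @[z --> within Pm (nbhs pm)] --> -oo.
Hypothesis hp : x2 (phi z) @[z --> within Pm (nbhs pp)] --> +oo.
Local Notation F := (compactified a1 a2 phi).
Local Notation f := (@restr R m Sm F).
Local Notation TS := (subsp Sm).
Implicit Types (t x y : R).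

Let val_cont : continuous (set_val : TS -> 'rV[R]_m.+1).
Proof. exact: initial_continuous. Qed.

Let pmS : TS := SigSub (mem_set (@pole_minus_sphere R m)).
Let ppS : TS := SigSub (mem_set (@pole_plus_sphere R m)).

Let pole_cases (z : TS) : [\/ z = pmS, z = ppS | Pm (set_val z)].
Proof.
have [E|n1] := pselect (set_val z = pm); first by apply: Or31; exact: val_inj.
have [E|n2] := pselect (set_val z = pp); first by apply: Or32; exact: val_inj.
by apply: Or33; split; [exact: set_valP|case].
Qed.

Let fm : f pmS = a1.
Proof. by rewrite /restr /compactified /= eqxx. Qed.

Let fp : f ppS = a2.
Proof.
rewrite /restr /compactified /= eqxx ifN//.
by apply/eqP; exact: poles_neq.
Qed.

Lemma compactifiedE z : Pm z -> F z = x1 (phi z).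
Proof.
move=> [_ /not_orP[/eqP n1 /eqP n2]].
by rewrite /compactified (negbTE n2) (negbTE n1).
Qed.

Let near_neq (w p : 'rV[R]_m.+1) : w <> p -> \forall u \near w, u <> p.
Proof.
move=> wp; apply: (@open_nbhs_nbhs _ w (~` [set p])); split=> //.
have hV : hausdorff_space 'rV[R]_m.+1 by exact: norm_hausdorff.
by apply: closed_openC; exact: (accessible_closed_set1 (hausdorff_accessible hV)).
Qed.

Let near_pole (P : 'rV[R]_m.+1 -> Prop) p p' (z : TS) : [set pp; pm] = [set p; p'] -> p <> p' ->
  set_val z = p -> (\forall w \near within Pm (nbhs p), P w) ->
  \forall z' \near z, z' = z \/ (Pm (set_val z') /\ P (set_val z')).
Proof.
move=> pE pp' zp nP; have nn : \forall w \near set_val z, w <> p' /\ (Pm w -> P w).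
  by rewrite zp; apply: filterI => //; exact: near_neq.
have : \forall z' \near z, set_val z' <> p' /\ (Pm (set_val z') -> P (set_val z')).
  exact: val_cont nn.
apply: filterS => z' [zp' hP].
have [E|n] := pselect (set_val z' = p); [left|right].
  by apply: val_inj; change (set_val z' = set_val z); rewrite E zp.
have Pz : Pm (set_val z') by split; [exact: set_valP|rewrite pE; case].
by split=> //; exact: hP.
Qed.

Let near_minus (P : 'rV[R]_m.+1 -> Prop) : (\forall w \near within Pm (nbhs pm), P w) ->
  \forall z \near pmS, z = pmS \/ (Pm (set_val z) /\ P (set_val z)).
Proof. by apply: (@near_pole P pm pp) => //; [rewrite setUC|exact/nesym/poles_neq]. Qed.

Let near_plus (P : 'rV[R]_m.+1 -> Prop) : (\forall w \near within Pm (nbhs pp), P w) ->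
  \forall z \near ppS, z = ppS \/ (Pm (set_val z) /\ P (set_val z)).
Proof. by apply: (@near_pole P pp pm) => //; exact: poles_neq. Qed.

Let near_mid (B : set 'rV[R]_m.+1) (z : TS) : Pm (set_val z) -> nbhs (phi (set_val z)) B ->
  \forall z' \near z, Pm (set_val z') /\ B (phi (set_val z')).
Proof.
move=> Pz nB; have nn : \forall w \near set_val z, (w <> pp /\ w <> pm) /\ (Pm w -> B (phi w)).
  apply: filterI; last exact: (phc Pz nB).
  by apply: filterI; apply: near_neq => E; apply: Pz.2; [left|right].
have : \forall z' \near z, (set_val z' <> pp /\ set_val z' <> pm) /\
    (Pm (set_val z') -> B (phi (set_val z'))) by exact: val_cont nn.
apply: filterS => z' [[n1 n2] hB].
have Pz' : Pm (set_val z') by split; [exact: set_valP|case].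
by split=> //; exact: hB.
Qed.

(** Near a pole the value is squeezed between [c1] and [c2] at an [x2] far out, and both tend to the
    value at the pole. *)
Lemma compactified_continuous : continuous f.
Proof.
have bound z : Pm z -> c1 (x2 (phi z)) <= F z <= c2 (x2 (phi z)).
  by move=> Pz; rewrite compactifiedE//; have [d _] := (zero_setP c12 _).1 (phX Pz).
move=> z; have FF : Filter (nbhs z) by exact: nbhs_filter.
apply/cvgrPdist_lt => e e0; have [->|->|Pz] := pole_cases z.
- rewrite fm; have [M1 [_ h1]] := cvgr_lt a1 c2m (a1 + e) (ltac:(lra)).
  have [M2 [_ h2]] := cvgr_gt a1 c1m (a1 - e) (ltac:(lra)).
  have : \forall w \near pmS, w = pmS \/
      (Pm (set_val w) /\ x2 (phi (set_val w)) < Num.min M1 M2).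
    by apply: (@near_minus (fun w => x2 (phi w) < Num.min M1 M2)); exact: (cvgrNy_lt hm).
  apply: filterS => w [->|[Pw]]; first by rewrite fm subrr normr0.
  rewrite lt_min => /andP[w1 w2]; have /andP[b1 b2] := bound _ Pw.
  have /= b3 := h1 _ w1; have /= b4 := h2 _ w2; rewrite /restr.
  by rewrite ltr_norml; apply/andP; split; lra.
- rewrite fp; have [M1 [_ h1]] := cvgr_lt a2 c2p (a2 + e) (ltac:(lra)).
  have [M2 [_ h2]] := cvgr_gt a2 c1p (a2 - e) (ltac:(lra)).
  have : \forall w \near ppS, w = ppS \/
      (Pm (set_val w) /\ Num.max M1 M2 < x2 (phi (set_val w))).
    by apply: (@near_plus (fun w => Num.max M1 M2 < x2 (phi w))); exact: (cvgry_gt hp).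
  apply: filterS => w [->|[Pw]]; first by rewrite fp subrr normr0.
  rewrite gt_max => /andP[w1 w2]; have /andP[b1 b2] := bound _ Pw.
  have /= b3 := h1 _ w1; have /= b4 := h2 _ w2; rewrite /restr.
  by rewrite ltr_norml; apply/andP; split; lra.
- have := @row_coord_continuous R m.+1 0 (phi (set_val z)).
  move=> /cvgrPdist_lt/(_ e e0)/(near_mid Pz); apply: filterS => w [Pw].
  by rewrite /restr !compactifiedE.
Qed.

Definition pS t x (v : unit_tail R m) : TS :=
  if pselect (X (point c1 c2 t x (sval v))) is left h
  then SigSub (mem_set (psP h).1) else pmS.

Let pSE t x v : dom c1 c2 t x -> set_val (pS t x v) = psi (point c1 c2 t x (sval v)).
Proof.
move=> dx; rewrite /pS; case: pselect => // n; exfalso; apply: n.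
by apply: point_zero => //; exact/eqP/(svalP v).
Qed.

Let pointX' t x (v : unit_tail R m) : dom c1 c2 t x -> X (point c1 c2 t x (sval v)).
Proof. by move=> dx; apply: point_zero => //; exact/eqP/(svalP v). Qed.

Lemma phi_pS t x v : dom c1 c2 t x -> Pm (set_val (pS t x v)) /\
  phi (set_val (pS t x v)) = point c1 c2 t x (sval v).
Proof.
by move=> dx; rewrite pSE//; split; [exact/psP/pointX'|rewrite psK//; exact: pointX'].
Qed.

Lemma pS_height t x v : dom c1 c2 t x -> f (pS t x v) = t.
Proof.
by move=> /(phi_pS v)[Pz E]; rewrite /restr compactifiedE// -[\val _]/(set_val _) E point1.
Qed.

Lemma pS_collapse t x v v' : t = c1 x \/ t = c2 x -> pS t x v = pS t x v'.
Proof.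
move=> h; have dx : dom c1 c2 t x.
  by case: h => ->; rewrite /dom lexx ?andbT ltW.
apply: val_inj; change (set_val (pS t x v) = set_val (pS t x v')).
rewrite !pSE//; congr psi.
by have /(congr1 \val) := pX_collapse m1 c12 v v' h; rewrite !pointXE.
Qed.

Lemma pS_cont (W : set TS) v : open W -> band_open c1 c2 (fun t x => W (pS t x v)).
Proof.
move=> [W' oW' <-] t x dx; rewrite /= pSE// => W'x.
have nW : nbhs (point c1 c2 t x (sval v)) [set y | X y -> W' (psi y)].
  exact: (psc (pointX' v dx) (open_nbhs_nbhs (conj oW' W'x))).
have [d d0 hd] := point_continuous cc1 cc2 nW.
exists d => // t' x' dx' tt xx /=; rewrite pSE//; apply: hd => //; exact: pointX'.
Qed.

Lemma pS_surj (z : TS) : Pm (set_val z) -> exists v,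
  dom c1 c2 (f z) (x2 (phi (set_val z))) /\ z = pS (f z) (x2 (phi (set_val z))) v.
Proof.
move=> Pz; have Xz := phX Pz.
have [v [d E]] := pX_surj m1 c12 (SigSub (mem_set Xz) : subsp X).
have fE : f z = x1 (phi (set_val z)) by rewrite /restr compactifiedE.
exists v; rewrite fE; split=> //; apply: val_inj.
change (set_val z = set_val (pS (x1 (phi (set_val z))) (x2 (phi (set_val z))) v)).
rewrite pSE//; have := congr1 \val E; rewrite pointXE//= => <-.
by rewrite phK.
Qed.

Definition reebS : R -> R -> reeb_space f := reeb_strip f (v0 R m1) pS.

Let x2c z : Pm z -> (fun w => x2 (phi w)) @ within Pm (nbhs z) --> x2 (phi z).
Proof.
move=> Pz; apply: (cvg_comp phi x2 (phc Pz)); exact: row_coord_continuous.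
Qed.

(** The hypotheses say how [x2] behaves near the poles; the converse, that points far out are near
    the pole, is where [pole_end] and thus the compactness of the sphere come in. *)
Let minus_end (W : set TS) : open W -> W pmS -> exists M, forall t x v, x < M ->
  dom c1 c2 t x -> W (pS t x v).
Proof.
move=> [W' oW' <-] Wp; have [M hM] := pole_end (setUC _ _) x2c hp oW' Wp.
exists M => t x v xM dx; have [Pz E] := phi_pS v dx.
by apply: hM => //; rewrite E point2.
Qed.

Let plus_end (W : set TS) : open W -> W ppS -> exists M, forall t x v, M < x ->
  dom c1 c2 t x -> W (pS t x v).
Proof.
move=> [W' oW' <-] Wp.
have nc z : Pm z -> (fun w => - x2 (phi w)) @ within Pm (nbhs z) --> - x2 (phi z).
  by move=> Pz; apply: cvgN; exact: x2c.
have np : (fun w => - x2 (phi w)) @ within Pm (nbhs pm) --> +oo by exact/cvgNry.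
have [M hM] := pole_end erefl nc np oW' Wp.
exists (- M) => t x v xM dx; have [Pz E] := phi_pS v dx.
by apply: hM => //; rewrite E point2//; lra.
Qed.

Let closure_level (K : set TS) t : (forall z, K z -> f z = t) ->
  forall z, closure K z -> f z = t.
Proof.
move=> hK; have cl : closed (f @^-1` [set t]).
  by apply: preimage_closed; [move=> z _; exact: compactified_continuous|exact: closed_eq].
by have := closureS hK; rewrite -((closure_id _).1 cl).
Qed.

(** The half-line of the level [a1] gives a connected set on the sphere whose closure contains the
    pole; the closure is still connected and at height [a1]. *)
Lemma pole_reeb_minus : reeb_map f pmS = reebS a1 xm.
Proof.
pose K : set TS := (fun x => pS a1 x (v0 R m1)) @` `]-oo, xm]%classic.
have dK x : `]-oo, xm]%classic x -> dom c1 c2 a1 x by rewrite /= in_itv/=; exact: dm.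
have cK : connected K.
  apply: connected_continuous_connected.
    by apply/connected_intervalP; exact: interval_is_interval.
  apply/subspace_continuousP => r Ir B; rewrite nbhsE => -[V [oV Vr] VB].
  have [d d0 hd] := pS_cont oV (dK _ Ir) Vr.
  have hr : \forall r' \near r, `|r - r'| < d by exact: nbhsx_ballx.
  rewrite /nbhs/= /within/=; near=> r' => Ir'; apply: VB.
  apply: (hd a1 r'); [exact: dK|by rewrite subrr normr0|].
  by rewrite distrC; near: r'.
apply: (@reeb_eq_connected _ _ _ (closure K) a1).
- exact: connected_closure.
- by apply: closure_level => _ [x Ix <-]; rewrite pS_height//; exact: dK.
- move=> W; rewrite nbhsE => -[V [oV Vp] VW].
  have [M hM] := minus_end oV Vp.
  have h1 : Num.min xm (M - 1) <= xm by rewrite ge_min lexx.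
  have h2 : Num.min xm (M - 1) <= M - 1 by rewrite ge_min lexx orbT.
  exists (pS a1 (Num.min xm (M - 1)) (v0 R m1)); split.
    by exists (Num.min xm (M - 1)); rewrite //= in_itv.
  by apply: VW; apply: hM; [lra|exact: dm].
- by apply: subset_closure; exists xm; rewrite //= in_itv/= lexx.
Unshelve. all: by end_near. Qed.

Lemma pole_reeb_plus : reeb_map f ppS = reebS a2 xp.
Proof.
pose K : set TS := (fun x => pS a2 x (v0 R m1)) @` `[xp, +oo[%classic.
have dK x : `[xp, +oo[%classic x -> dom c1 c2 a2 x.
  by rewrite /= in_itv/= andbT; exact: dp.
have cK : connected K.
  apply: connected_continuous_connected.
    by apply/connected_intervalP; exact: interval_is_interval.
  apply/subspace_continuousP => r Ir B; rewrite nbhsE => -[V [oV Vr] VB].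
  have [d d0 hd] := pS_cont oV (dK _ Ir) Vr.
  have hr : \forall r' \near r, `|r - r'| < d by exact: nbhsx_ballx.
  rewrite /nbhs/= /within/=; near=> r' => Ir'; apply: VB.
  apply: (hd a2 r'); [exact: dK|by rewrite subrr normr0|].
  by rewrite distrC; near: r'.
apply: (@reeb_eq_connected _ _ _ (closure K) a2).
- exact: connected_closure.
- by apply: closure_level => _ [x Ix <-]; rewrite pS_height//; exact: dK.
- move=> W; rewrite nbhsE => -[V [oV Vp] VW].
  have [M hM] := plus_end oV Vp.
  have h1 : xp <= Num.max xp (M + 1) by rewrite le_max lexx.
  have h2 : M + 1 <= Num.max xp (M + 1) by rewrite le_max lexx orbT.
  exists (pS a2 (Num.max xp (M + 1)) (v0 R m1)); split.
    by exists (Num.max xp (M + 1)); rewrite //= in_itv/= andbT.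
  by apply: VW; apply: hM; [lra|exact: dp].
- by apply: subset_closure; exists xp; rewrite //= in_itv/= lexx.
Unshelve. all: by end_near. Qed.

Let surj' z : (exists x v, dom c1 c2 (f z) x /\ z = pS (f z) x v) \/
  (exists x, dom c1 c2 (f z) x /\ reeb_map f z = reebS (f z) x).
Proof.
have [->|->|Pz] := pole_cases z.
- by right; exists xm; rewrite fm; split; [exact: dm|exact: pole_reeb_minus].
- by right; exists xp; rewrite fp; split; [exact: dp|exact: pole_reeb_plus].
- by left; have [v h] := pS_surj Pz; exists (x2 (phi (set_val z))), v.
Qed.

Let not_pole_minus : ~ Pm (set_val pmS). Proof. by move=> [_]; apply; right. Qed.
Let not_pole_plus : ~ Pm (set_val ppS). Proof. by move=> [_]; apply; left. Qed.

Let side_open (p : TS) (P : R -> Prop) : open P -> (\forall z \near p, z = p \/ (Pm (set_val z) /\ P (x2 (phi (set_val z))))) ->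
  open [set z | z = p \/ (Pm (set_val z) /\ P (x2 (phi (set_val z))))].
Proof.
move=> oP np; rewrite openE => z [->|[Pz hz]]; first exact: np.
have nB : nbhs (phi (set_val z)) [set y | P (x2 y)].
  have := @row_coord_continuous R m.+1 (inord 1) (phi (set_val z)).
  by apply; apply: open_nbhs_nbhs.
have := near_mid Pz nB; apply: filterS => w [Pw hw]; by right.
Qed.

(** Each pole is added to the side on which it is a limit, so that the two sides cover its level as
    well. *)
Lemma pS_cut w : exists A B : set TS,
  [/\ open A, open B, forall z, A z -> B z -> False,
    forall z, ~~ dom c1 c2 (f z) w -> A z \/ B z &
    (forall t x v, dom c1 c2 t x -> x < w -> A (pS t x v)) /\
    (forall t x v, dom c1 c2 t x -> w < x -> B (pS t x v))].
Proof.
exists [set z | z = pmS \/ (Pm (set_val z) /\ x2 (phi (set_val z)) < w)].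
exists [set z | z = ppS \/ (Pm (set_val z) /\ w < x2 (phi (set_val z)))]; split.
- apply: (@side_open pmS [set u | u < w]); first exact: open_lt.
  by apply: (@near_minus (fun z => x2 (phi z) < w)); exact: (cvgrNy_lt hm).
- apply: (@side_open ppS [set u | w < u]); first exact: open_gt.
  by apply: (@near_plus (fun z => w < x2 (phi z))); exact: (cvgry_gt hp).
- move=> z [->|[Pz zw]] [E|[Pz' zw']].
  + by have := congr1 set_val E => /esym/poles_neq.
  + exact: not_pole_minus.
  + by rewrite E in Pz; exact: not_pole_plus.
  + by have := lt_trans zw zw'; rewrite ltxx.
- move=> z nd; have [->|->|Pz] := pole_cases z; [by left; left|by right; left|].
  have [v [d _]] := pS_surj Pz.
  have [h|h|h] := ltgtP (x2 (phi (set_val z))) w; [by left; right|by right; right|].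
  by move: nd; rewrite -h d.
- by split=> t x v dx xw; right; have [Pz ->] := phi_pS v dx; rewrite point2.
Qed.

Lemma reebS_strip : strip c1 c2 reebS (reeb_bar (c := f)).
Proof.
exact: (reeb_strip_strip cc1 cc2 compactified_continuous pS_height pS_collapse pS_cont
  surj' pS_cut).
Qed.

Lemma reebS_hausdorff : hausdorff_space (reeb_space f).
Proof.
move=> g h; apply: (reeb_strip_hausdorff cc1 cc2 compactified_continuous pS_height
  pS_collapse pS_cont surj' pS_cut); exact: all_good.
Qed.

Lemma reebS_minus (V : set (reeb_space f)) : open V -> V (reebS a1 xm) ->
  exists M, forall t x, x < M -> dom c1 c2 t x -> V (reebS t x).
Proof.
rewrite -pole_reeb_minus => /reeb_open oV Vp; have [M hM] := minus_end oV Vp.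
by exists M => t x xM dx; exact: hM.
Qed.

Lemma reebS_plus (V : set (reeb_space f)) : open V -> V (reebS a2 xp) ->
  exists M, forall t x, M < x -> dom c1 c2 t x -> V (reebS t x).
Proof.
rewrite -pole_reeb_plus => /reeb_open oV Vp; have [M hM] := plus_end oV Vp.
by exists M => t x xM dx; exact: hM.
Qed.

Lemma reebS_open (V : set (reeb_space f)) :
  band_open c1 c2 (fun t x => V (reebS t x)) ->
  (V (reebS a1 xm) -> exists M, forall t x, x < M -> dom c1 c2 t x -> V (reebS t x)) ->
  (V (reebS a2 xp) -> exists M, forall t x, M < x -> dom c1 c2 t x -> V (reebS t x)) ->
  open V.
Proof.
move=> bV Vm Vp; apply/reeb_open; rewrite openE => z Vz.
have indep := reeb_indep (v0 R m1) cc1 cc2 pS_height pS_collapse pS_cont.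
have rep w : Pm (set_val w) -> dom c1 c2 (f w) (x2 (phi (set_val w))) /\
    reeb_map f w = reebS (f w) (x2 (phi (set_val w))).
  by move=> Pw; have [v [d E]] := pS_surj Pw; split=> //; rewrite {1}E indep.
suff : \forall w \near z, V (reeb_map f w) by [].
have [zE|zE|Pz] := pole_cases z.
- move: Vz; rewrite zE /= pole_reeb_minus => Vz; have [M hM] := Vm Vz.
  have : \forall w \near pmS, w = pmS \/ (Pm (set_val w) /\ x2 (phi (set_val w)) < M).
    by apply: (@near_minus (fun w => x2 (phi w) < M)); exact: (cvgrNy_lt hm).
  apply: filterS => w [->|[Pw wM]]; first by rewrite pole_reeb_minus.
  by have [d ->] := rep w Pw; exact: hM.
- move: Vz; rewrite zE /= pole_reeb_plus => Vz; have [M hM] := Vp Vz.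
  have : \forall w \near ppS, w = ppS \/ (Pm (set_val w) /\ M < x2 (phi (set_val w))).
    by apply: (@near_plus (fun w => M < x2 (phi w))); exact: (cvgry_gt hp).
  apply: filterS => w [->|[Pw wM]]; first by rewrite pole_reeb_plus.
  by have [d ->] := rep w Pw; exact: hM.
- have [d E] := rep z Pz; move: Vz; rewrite /= E => Vz.
  have [e e0 he] := bV _ _ d Vz.
  have n1 : \forall w \near z, Pm (set_val w) /\
      `|x2 (phi (set_val z)) - x2 (phi (set_val w))| < e.
    apply: (near_mid Pz (B := [set y | `|x2 (phi (set_val z)) - x2 y| < e])).
    have := @row_coord_continuous R m.+1 (inord 1) (phi (set_val z)).
    by move=> /cvgrPdist_lt/(_ e e0).
  have n2 : \forall w \near z, `|f z - f w| < e.
    have cz : f @ z --> f z by exact: compactified_continuous.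
    by have /cvgrPdist_lt/(_ e e0) := cz.
  have FF : Filter (nbhs z) by exact: nbhs_filter.
  apply: filterS2 n1 n2 => w [Pw w2] w1.
  have [d' ->] := rep w Pw; apply: he => //; by rewrite distrC.
Qed.

End SphereReeb.

(** * Critical points *)

Section Partials.
Variables (R : realType) (n : nat).
Implicit Types (G : 'rV[R]_n.+1 -> R) (p q e : 'rV[R]_n.+1) (s tau u : R).

Lemma is_derive0P (f : R -> R) (L : R) :
  is_derive (0 : R) 1 f L <-> (fun h => h^-1 * (f h - f 0)) @ (0 : R)^' --> L.
Proof.
have E : (fun h : R => h^-1 *: ((f \o shift 0) (h *: 1) - f 0)) =
    (fun h : R => h^-1 * (f h - f 0)).
  by apply/funext => h; rewrite /= addr0 /GRing.scale/= mulr1.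
split=> [[d <-]|h].
  by rewrite -E; exact: d.
by apply: DeriveDef; [apply/cvg_ex; exists L; rewrite E|apply: cvg_lim => //; rewrite E].
Qed.

Lemma is_derive_line G q e tau : derivable G (q + tau *: e) e ->
  is_derive tau (1 : R) (fun t => G (q + t *: e)) ('D_e G (q + tau *: e)).
Proof.
move=> d; have E : (fun h : R => h^-1 *: (((fun t => G (q + t *: e)) \o shift tau) (h *: (1 : R))
    - G (q + tau *: e))) =
  (fun h : R => h^-1 *: ((G \o shift (q + tau *: e)) (h *: e) - G (q + tau *: e))).
  apply/funext => h; congr (_ *: (G _ - _)).
  have h1 : h *: (1 : R) = h by rewrite /GRing.scale/= mulr1.
  by rewrite /= h1 scalerDl addrCA.
by apply: DeriveDef; [rewrite /derivable E|rewrite /derive E].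
Qed.

Lemma mvt_direction G q e s :
  (forall tau, `|tau| <= `|s| -> derivable G (q + tau *: e) e) ->
  exists2 tau, `|tau| <= `|s| & G (q + s *: e) - G q = 'D_e G (q + tau *: e) * s.
Proof.
move=> dG; pose g t := G (q + t *: e).
have dg t : `|t| <= `|s| -> is_derive t (1 : R) g ('D_e G (q + t *: e)).
  by move=> /dG; exact: is_derive_line.
have g0 : G q = g 0 by rewrite /g scale0r addr0.
have cg a b : (forall t, a <= t <= b -> `|t| <= `|s|) -> {within `[a, b], continuous g}.
  move=> h; apply: continuous_in_subspaceT => t; rewrite inE /= in_itv/= => /h/dg[d _].
  exact/differentiable_continuous/derivable1_diffP.
have [s0|/ltW s0] := leP 0 s.
  have i t : 0 <= t <= s -> `|t| <= `|s|.
    by move=> /andP[t0 ts]; rewrite !ger0_norm.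
  have [|t] := @MVT_segment R g (fun t => 'D_e G (q + t *: e)) _ _ s0 _ (cg _ _ i).
    by move=> x; rewrite in_itv/= => /andP[x0 xs]; apply/dg/i; rewrite !ltW.
  by rewrite in_itv/= => /i ti; rewrite subr0 g0 => E; exists t.
have i t : s <= t <= 0 -> `|t| <= `|s|.
  by move=> /andP[t0 ts]; rewrite !ler0_norm ?lerN2.
have [|t] := @MVT_segment R g (fun t => 'D_e G (q + t *: e)) _ _ s0 _ (cg _ _ i).
  by move=> x; rewrite in_itv/= => /andP[x0 xs]; apply/dg/i; rewrite !ltW.
rewrite in_itv/= => /i ti; rewrite sub0r g0 => E; exists t => //.
by rewrite -/(g s) -opprB E mulrN opprK.
Qed.

(** The base point [P u] moves with [u]; continuity of the partial derivative at [p] is what lets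
    the slopes between [P u] and its translate converge. *)
Lemma partial_increment G (U : set 'rV[R]_n.+1) p (i : 'I_n.+1) (P : R -> 'rV[R]_n.+1)
    (s : R -> R) (L : R) :
  open U -> U p -> (forall x, U x -> derivable G x (delta_mx 0 i)) ->
  {for p, continuous (fun x => 'D_(delta_mx 0 i) G x)} ->
  P @ (0 : R)^' --> p -> s @ (0 : R)^' --> (0 : R) -> (fun u => u^-1 * s u) @ (0 : R)^' --> L ->
  (fun u => u^-1 * (G (P u + s u *: delta_mx 0 i) - G (P u))) @ (0 : R)^'
    --> 'D_(delta_mx 0 i) G p * L.
Proof.
move=> oU Up dU cD Pp s0 sL; set e := delta_mx 0 i in dU cD *.
pose D x := 'D_e G x.
(* The error of the slope, with value 0 where there is no increment to divide by. *)
pose eta u := if s u == 0 then 0 else (G (P u + s u *: e) - G (P u)) / s u - D p.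
have E u : G (P u + s u *: e) - G (P u) = (D p + eta u) * s u.
  rewrite /eta; have [->|nz] := eqVneq (s u) 0; first by rewrite scale0r addr0 subrr mulr0.
  by rewrite (addrC (D p)) subrK mulfVK.
have eta0 : eta @ (0 : R)^' --> (0 : R).
  apply/cvgrPdist_lt => eps eps0.
  have nV : nbhs p (U `&` [set x | `|D p - D x| < eps]).
    apply: filterI; first exact: open_nbhs_nbhs.
    by have /cvgrPdist_lt/(_ _ eps0) := cD.
  have /nbhs_ballP[d /= d0 hd] := nV.
  have d20 : 0 < d / 2 by rewrite divr_gt0.
  have /cvg_ballP/(_ _ d20) n1 := Pp.
  have /cvgrPdist_lt/(_ _ d20) n2 := s0.
  apply: filterS2 n1 n2 => u [_ hP]; rewrite sub0r normrN => su.
  have hin tau : `|tau| <= `|s u| -> (U `&` [set x | `|D p - D x| < eps]) (P u + tau *: e).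
    move=> ts; apply: hd; split=> // i' j; have := hP i' j; rewrite /ball/= !mxE.
    set del := (_ && _); have : `|tau * del%:R| <= `|tau|.
      by case: del; rewrite ?mulr1// mulr0 normr0.
    move=> h1 h2; rewrite opprD addrA; apply: le_lt_trans (ler_normB _ _) _.
    lra.
  rewrite sub0r normrN /eta; have [_|nz] := eqVneq (s u) 0; first by rewrite normr0.
  have [|tau ts ->] := @mvt_direction G (P u) e (s u).
    by move=> tau /hin[/dU].
  by rewrite mulfK// -/(D _) distrC; have [] := hin _ ts.
have -> : (fun u => u^-1 * (G (P u + s u *: e) - G (P u))) =
    (fun u => (D p + eta u) * (u^-1 * s u)).
  by apply/funext => u; rewrite E mulrCA.
apply: cvgM => //; rewrite -[X in _ --> X]addr0.
by apply: cvgD => //; exact: cvg_cst.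
Qed.

(* The increment of [G] is split along the coordinates, and the mean value
   theorem is applied to each part. *)
Lemma C1_chain G (U : set 'rV[R]_n.+1) (gamma : R -> 'rV[R]_n.+1) : open U -> U (gamma 0) ->
  Ck_on 1 U G -> (forall j, derivable (fun u => gamma u 0 j) 0 1) ->
  is_derive (0 : R) 1 (G \o gamma)
    (\sum_j 'D_(delta_mx 0 j) G (gamma 0) * derive1 (fun u => gamma u 0 j) 0).
Proof.
move=> oU Up C1 dg; set p := gamma 0 in Up *.
have isd j : is_derive (0 : R) 1 (fun u => gamma u 0 j) (derive1 (fun u => gamma u 0 j) 0).
  by rewrite derive1E; exact: derivableP.
(* The first [k] coordinates are on the curve and the others at [p], so consecutive points differ in
   one coordinate. *)
pose P (k : nat) u : 'rV[R]_n.+1 := \row_j (if (j < k)%N then gamma u 0 j else p 0 j).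
have PE (k : 'I_n.+1) u :
    P k.+1 u = P k u + (gamma u 0 k - p 0 k) *: delta_mx 0 k.
  apply/rowP => j; rewrite !mxE eqxx/= ltnS.
  have [->|jk] := eqVneq j k; first by rewrite leqnn ltnn mulr1 addrC subrK.
  by rewrite mulr0 addr0 leq_eqVlt (negbTE jk : (j == k :> nat) = false).
have P0 u : P 0%N u = p by apply/rowP => j; rewrite mxE.
have Pn u : P n.+1 u = gamma u by apply/rowP => j; rewrite mxE ltn_ord.
have cg j : (fun u => gamma u 0 j) @ (0 : R)^' --> p 0 j.
  have c0 : {for (0 : R), continuous (fun u => gamma u 0 j)}.
    exact/differentiable_continuous/derivable1_diffP.
  exact: cvg_within_filter c0.
have cP k : P k @ (0 : R)^' --> p.
  apply: row_cvg => j; rewrite (_ : (fun x => P k x 0 j) =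
    (fun u => if (j < k)%N then gamma u 0 j else p 0 j)); last by apply/funext => u; rewrite mxE.
  by case: (j < k)%N; [exact: cg|exact: cvg_cst].
apply/is_derive0P.
have -> : (fun h => h^-1 * ((G \o gamma) h - (G \o gamma) 0)) =
    (fun h => \sum_(k < n.+1) h^-1 * (G (P k.+1 h) - G (P k h))).
  apply/funext => h; rewrite -mulr_sumr; congr (_ * _).
  rewrite -(big_mkord xpredT (fun k => G (P k.+1 h) - G (P k h))).
  by rewrite (@telescope_sumr _ _ _ (fun k => G (P k h)))// Pn P0.
apply: cvg_big => [|k _]; first exact: add_continuous.
under eq_fun do rewrite PE.
have [dU cU] := C1 k.
apply: (partial_increment (U := U)) => //.
- exact: cU.
- have := cvgB (cg k) (cvg_cst (p 0 k)); rewrite subrr; exact.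
- by have /is_derive0P := isd k.
Qed.

End Partials.

(** * Test curves and tangency *)

Section SmoothCurves.
Variable R : realType.
Implicit Types (f g b c h : R -> R) (x t u A B C : R).

Definition smooth1 f := forall k t, derivable (derive1n k f) t 1.

Lemma smooth1_cst A : smooth1 (fun=> A).
Proof.
move=> k t; have [B ->] : exists B, derive1n k (fun=> A) = (fun=> B).
  elim: k => [|k [B E]]; first by exists A.
  exists 0; rewrite derive1nS E; apply/funext => u; exact: derive1_cst.
exact: derivable_cst.
Qed.

Lemma smooth1_step f : (forall t, derivable f t 1) -> smooth1 (derive1 f) -> smooth1 f.
Proof. by move=> d s [|k] t //; rewrite derive1Sn; exact: s. Qed.

Lemma smooth1_affine A : smooth1 (fun u => A + u).
Proof.
have d t : is_derive t (1 : R) (fun u => A + u) 1.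
  have := @is_deriveD R R R (fun=> A) id t 1 0 1 _ _; rewrite add0r; exact.
apply: smooth1_step => [t|]; first by have [] := d t.
have -> : derive1 (fun u => A + u) = (fun=> 1).
  by apply/funext => t; rewrite derive1E; have [_] := d t.
exact: smooth1_cst.
Qed.

(** This family is stable under derivation, which gives the derivatives of all orders by
    induction. *)
Let trig A B C u := A + B * cos u + C * sin u.

Lemma is_derive_trig A B C u : is_derive u (1 : R) (trig A B C) (trig 0 C (- B) u).
Proof.
have d1 : is_derive u (1 : R) (fun u => B * cos u) (B * - sin u).
  exact: (@is_deriveZ R R R cos B u 1 _ (is_derive_cos u)).
have d2 : is_derive u (1 : R) (fun u => C * sin u) (C * cos u).
  exact: (@is_deriveZ R R R sin C u 1 _ (is_derive_sin u)).
have := @is_deriveD R R R (fun u => A + B * cos u) (fun u => C * sin u) u 1 _ _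
  (@is_deriveD R R R (fun=> A) (fun u => B * cos u) u 1 0 _ (is_derive_cst A u 1) d1) d2.
move=> h; apply: (is_derive_eq h); rewrite /trig; ring.
Qed.

Lemma smooth1_trig A B C : smooth1 (fun u => A + B * cos u + C * sin u).
Proof.
rewrite -/(trig A B C) => k; elim: k A B C => [|k IH] A B C t.
  by have [] := is_derive_trig A B C t.
rewrite derive1Sn; have -> : derive1 (trig A B C) = trig 0 C (- B).
  by apply/funext => u; rewrite derive1E; have [_] := is_derive_trig A B C u.
exact: IH.
Qed.

Lemma smooth1_analytic c A : real_analytic c -> smooth1 (fun u => c (A + u)).
Proof.
move=> cA; suff sA : real_analytic (fun u => c (A + u)).
  move=> k t; have [d _] := real_analytic_derive (real_analytic_derive1n k sA).
  exact: d.
move=> x0; have [a [r [r0 h]]] := cA (A + x0); exists a, r; split=> // x xr.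
have E : A + x - (A + x0) = x - x0 by ring.
by have := h (A + x); rewrite E; exact.
Qed.

Lemma derive_at_min h L : is_derive (0 : R) 1 h L -> (\forall u \near (0 : R), h 0 <= h u) ->
  L = 0.
Proof.
move=> /is_derive0P qL /nbhs_ballP[d /= d0 hd].
have hd' u : `|u| < d -> h 0 <= h u.
  by move=> ud; apply: hd; rewrite /ball/= sub0r normrN.
apply/eqP; rewrite eq_le; apply/andP; split; rewrite leNgt; apply/negP => Ln.
  have /nbhs_ballP[e /= e0 he] : nbhs (0 : R) [set u | u != 0 -> 0 < u^-1 * (h u - h 0)].
    exact: (cvgr_gt L qL _ Ln).
  pose u := - (Num.min d e / 2).
  have m0 : 0 < Num.min d e by rewrite lt_min d0.
  have [u1 u2] : Num.min d e <= d /\ Num.min d e <= e by rewrite !ge_min !lexx orbT.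
  have uu : `|u| = Num.min d e / 2 by rewrite /u normrN gtr0_norm// divr_gt0.
  have u0 : u < 0 by rewrite /u; lra.
  have := hd' u (ltac:(rewrite uu; lra)); rewrite leNgt => /negP; apply.
  have := he u; rewrite /ball/= sub0r normrN uu => /(_ (ltac:(lra)) (ltac:(by rewrite lt_eqF))).
  by rewrite mulrC ltr_ndivlMr // mul0r subr_lt0.
have /nbhs_ballP[e /= e0 he] : nbhs (0 : R) [set u | u != 0 -> u^-1 * (h u - h 0) < 0].
  exact: (cvgr_lt L qL _ Ln).
pose u := Num.min d e / 2.
have m0 : 0 < Num.min d e by rewrite lt_min d0.
have [u1 u2] : Num.min d e <= d /\ Num.min d e <= e by rewrite !ge_min !lexx orbT.
have u0 : 0 < u by rewrite /u; lra.
have uu : `|u| = Num.min d e / 2 by rewrite gtr0_norm.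
have := hd' u (ltac:(rewrite uu; lra)); rewrite leNgt => /negP; apply.
have := he u; rewrite /ball/= sub0r normrN uu => /(_ (ltac:(lra)) (ltac:(by rewrite gt_eqF))).
by rewrite mulrC ltr_pdivrMr // mul0r subr_lt0.
Qed.

(** [g - c \o b] has a minimum at 0, and the derivative of [c \o b] vanishes there. *)
Lemma derive_lower_touch c g b dg db : derivable c (b 0) 1 ->
  is_derive (0 : R) 1 g dg -> is_derive (0 : R) 1 b db ->
  (\forall u \near (0 : R), c (b u) <= g u) -> g 0 = c (b 0) -> derive1 c (b 0) = 0 ->
  dg = 0.
Proof.
move=> dc dG dB le g0 c0.
have dcb : is_derive (0 : R) 1 (c \o b) 0.
  have h := derivableP dc; rewrite -derive1E c0 in h.
  have := @is_derive1_comp R c b 0 0 db h dB.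
  by rewrite mul0r.
have dh := @is_deriveB R R R g (c \o b) 0 1 _ _ dG dcb.
rewrite subr0 in dh; apply: (derive_at_min dh).
apply: filterS le => u; rewrite /= -[g - _]/(fun u => g u - c (b u)) /= g0 subrr.
by rewrite subr_ge0.
Qed.

Lemma derive_upper_touch c g b dg db : derivable c (b 0) 1 ->
  is_derive (0 : R) 1 g dg -> is_derive (0 : R) 1 b db ->
  (\forall u \near (0 : R), g u <= c (b u)) -> g 0 = c (b 0) -> derive1 c (b 0) = 0 ->
  dg = 0.
Proof.
move=> dc dG dB le g0 c0; apply: oppr_inj; rewrite oppr0.
have H := @derive_lower_touch (fun x => - c x) (fun u => - g u) b (- dg) db.
apply: H.
- exact: derivableNf.
- by apply: filterS le => u; rewrite lerN2.
- by rewrite g0.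
- by rewrite derive1Nf// c0 oppr0.
Qed.

End SmoothCurves.

(** * Critical points of the zero-set *)

Section CriticalZeroSet.
Variables (R : realType) (m : nat) (c1 c2 : R -> R).
Hypotheses (m1 : (1 < m)%N) (c12 : forall x, c1 x < c2 x).
Hypotheses (an1 : real_analytic c1) (an2 : real_analytic c2).
Local Notation X := (@zero_set R m c1 c2).
Local Notation x1 := (@coord1 R m).
Local Notation x2 := (@coord2 R m).
Implicit Types (z : 'rV[R]_m.+1) (u t x : R).

Let dc1 : forall x, derivable c1 x 1 := tame_derivable (real_analytic_tame an1).
Let dc2 : forall x, derivable c2 x 1 := tame_derivable (real_analytic_tame an2).

Definition critX z : Prop :=
  (x1 z = c1 (x2 z) /\ derive1 c1 (x2 z) = 0) \/
  (x1 z = c2 (x2 z) /\ derive1 c2 (x2 z) = 0).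

Lemma critX_flat z (g b : R -> R) dg db : critX z ->
  is_derive (0 : R) 1 g dg -> is_derive (0 : R) 1 b db -> g 0 = x1 z -> b 0 = x2 z ->
  (\forall u \near (0 : R), dom c1 c2 (g u) (b u)) -> dg = 0.
Proof.
move=> cz dG dB g0 b0 dn; case: cz; rewrite -g0 -b0 => -[e1 e2].
  apply: (derive_lower_touch (@dc1 (b 0)) dG dB _ e1 e2).
  by apply: filterS dn => u /andP[].
apply: (derive_upper_touch (@dc2 (b 0)) dG dB _ e1 e2).
by apply: filterS dn => u /andP[].
Qed.

Lemma dom_of_prod t x : 0 <= (t - c1 x) * (c2 x - t) -> dom c1 c2 t x.
Proof.
rewrite /dom => h; have := c12 x; apply: contraTT; rewrite negb_and -!ltNge.
by move=> /orP[h'|h']; rewrite -leNgt; nra.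
Qed.

(** Over the boundary of the band the fibre is a point, so the graph of [c] itself runs in the
    zero-set. *)
Let boundary_curve z c : (c = c1 \/ c = c2) -> X z -> x1 z = c (x2 z) -> tdot z z = 0 ->
  exists delta : R -> 'rV[R]_m.+1, [/\ smooth_curve delta, delta 0 = z, forall u, X (delta u) &
    derive1 (fun u => x1 (delta u)) 0 = derive1 c (x2 z)].
Proof.
move=> hc Xz zc z0; have dx x : dom c1 c2 (c x) x.
  by rewrite /dom; case: hc => ->; rewrite lexx ?andbT ltW.
have ca : real_analytic c by case: hc => ->.
pose b := x2 z; exists (fun u => point c1 c2 (c (b + u)) (b + u) (vec0 R m)); split.
- move=> j; have [->|->|j1] := ord_cases m1 j.
  + rewrite (_ : (fun u => _) = (fun u => c (b + u))); first exact: smooth1_analytic.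
    by apply/funext => u; rewrite -[LHS]/(x1 _) point1.
  + rewrite (_ : (fun u => _) = (fun u => b + u)); first exact: smooth1_affine.
    by apply/funext => u; rewrite -[LHS]/(x2 _) point2.
  + rewrite (_ : (fun u => _) = (fun=> 0)); first exact: smooth1_cst.
    by apply/funext => u; rewrite point_tail//; case: hc => ->;
      rewrite subrr ?mul0r ?mulr0 sqrtr0 !mul0r.
- rewrite addr0; apply: (row_eq m1); rewrite ?point1 ?point2// => j j1.
  rewrite point_tail// (tdot_eq0 z0 j1).
  by case: hc => ->; rewrite subrr ?mul0r ?mulr0 sqrtr0 !mul0r.
- by move=> u; apply: point_zero => //; exact/eqP/vec0_unit.
- under eq_fun do rewrite point1.
  have dC : derivable c (b + 0) 1 by rewrite addr0; case: hc => ->; [exact: dc1|exact: dc2].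
  have d1 : is_derive (0 : R) (1 : R) (fun u => b + u) 1.
    have := @is_deriveD R R R (fun=> b) id 0 1 0 1 _ _; rewrite add0r; exact.
  have := @is_derive1_comp R c (fun u => b + u) 0 _ _ (derivableP dC) d1.
  by move=> [_]; rewrite -derive1E mulr1 -derive1E addr0.
Qed.

(** The slice of fixed [x2] is a round sphere in the other coordinates, with centre [x1 = h]. The
    great circle through [z] chosen here has speed [- rho] in the direction of [x1]. *)
Let circle_curve z : X z -> 0 < tdot z z ->
  exists delta : R -> 'rV[R]_m.+1, [/\ smooth_curve delta, delta 0 = z, forall u, X (delta u) &
    derive1 (fun u => x1 (delta u)) 0 <> 0].
Proof.
move=> Xz z0; have [d E] := (zero_setP c12 z).1 Xz.
pose rho := Num.sqrt (tdot z z).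
have rho0 : 0 < rho by rewrite sqrtr_gt0.
have rr : rho ^+ 2 = tdot z z by rewrite sqr_sqrtr// ltW.
pose h := (c1 (x2 z) + c2 (x2 z)) / 2; pose a := x1 z - h.
pose delta u : 'rV[R]_m.+1 := \row_j (if j == 0 then h + a * cos u + (- rho) * sin u
  else if j == inord 1 then x2 z
  else 0 + z 0 j * cos u + (a / rho * z 0 j) * sin u).
have o1 : (inord 1 : 'I_m.+1) = 1%N :> nat by rewrite inordK// ltnS ltnW.
have e1 u : x1 (delta u) = h + a * cos u + (- rho) * sin u.
  by rewrite /coord1 mxE eqxx.
have e2 u : x2 (delta u) = x2 z.
  by rewrite /coord2 mxE eqxx ifN//; apply/eqP => /(congr1 val); rewrite /= o1.
have e3 u (j : 'I_m.+1) : (1 < j)%N ->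
    delta u 0 j = 0 + z 0 j * cos u + (a / rho * z 0 j) * sin u.
  move=> j1; rewrite mxE ifN ?ifN//.
    by apply/eqP => jE; move: j1; rewrite jE o1.
  by apply/eqP => jE; move: j1; rewrite jE.
have dX u : X (delta u).
  have tE : tdot (delta u) (delta u) = (rho * cos u + a * sin u) ^+ 2.
    transitivity ((cos u + a / rho * sin u) ^+ 2 * tdot z z).
      rewrite !tdotE mulr_sumr; apply: eq_bigr => j j1; rewrite e3//; ring.
    rewrite -rr; field; exact: lt0r_neq0.
  have pE : (x1 (delta u) - c1 (x2 (delta u))) * (c2 (x2 (delta u)) - x1 (delta u)) =
      tdot (delta u) (delta u).
    have ra : rho ^+ 2 = ((c2 (x2 z) - c1 (x2 z)) / 2) ^+ 2 - a ^+ 2.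
      by rewrite rr -E /a /h; field.
    rewrite tE e1 e2; apply/eqP; rewrite -subr_eq0; apply/eqP.
    have cs := cos2Dsin2 u.
    transitivity (((c2 (x2 z) - c1 (x2 z)) / 2) ^+ 2 -
        (a ^+ 2 + rho ^+ 2) * (cos u ^+ 2 + sin u ^+ 2)).
      by rewrite /h; field.
    by rewrite cs mulr1 ra; ring.
  apply/(zero_setP c12); split=> //.
  by apply: dom_of_prod; rewrite pE; exact: tdot_ge0.
exists delta; split=> //.
- move=> j; have [->|->|j1] := ord_cases m1 j.
  + rewrite (_ : (fun u => _) = (fun u => h + a * cos u + (- rho) * sin u)).
      exact: smooth1_trig.
    by apply/funext => u; exact: e1.
  + rewrite (_ : (fun u => _) = (fun=> x2 z)); first exact: smooth1_cst.
    by apply/funext => u; exact: e2.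
  + rewrite (_ : (fun u => _) = (fun u => 0 + z 0 j * cos u + (a / rho * z 0 j) * sin u)).
      exact: smooth1_trig.
    by apply/funext => u; exact: e3.
- apply: (row_eq m1); rewrite ?e1 ?e2//.
    by rewrite cos0 sin0 /a; ring.
  by move=> j j1; rewrite e3// cos0 sin0; ring.
- rewrite (_ : (fun u => _) = (fun u => h + a * cos u + (- rho) * sin u)); last first.
    by apply/funext => u; exact: e1.
  rewrite derive1E; have [_ ->] := is_derive_trig h a (- rho) 0.
  by rewrite cos0 sin0 => k; move: rho0; lra.
Qed.

Lemma noncrit_curve z : X z -> ~ critX z ->
  exists delta : R -> 'rV[R]_m.+1, [/\ smooth_curve delta, delta 0 = z, forall u, X (delta u) &
    derive1 (fun u => x1 (delta u)) 0 <> 0].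
Proof.
move=> Xz nc; have [z0|nz] := eqVneq (tdot z z) 0; last first.
  by apply: circle_curve => //; rewrite lt_neqAle eq_sym nz tdot_ge0.
have [d E] := (zero_setP c12 z).1 Xz.
have [e|e] : x1 z = c1 (x2 z) \/ x1 z = c2 (x2 z).
  move: E; rewrite z0 => /eqP; rewrite mulf_eq0 !subr_eq0 => /orP[/eqP ->|/eqP ->]; [by left|by right].
- have [delta [h1 h2 h3 h4]] := boundary_curve (or_introl erefl) Xz e z0.
  exists delta; split=> //; by rewrite h4 => k; apply: nc; left.
- have [delta [h1 h2 h3 h4]] := boundary_curve (or_intror erefl) Xz e z0.
  exists delta; split=> //; by rewrite h4 => k; apply: nc; right.
Qed.

Lemma critical_zero_set z : critical_points X x1 z <-> X z /\ critX z.
Proof.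
split=> [[Xz h]|[Xz cz]]; split=> //.
  apply: contrapT => /(noncrit_curve Xz)[delta [sm d0 dX ne]]; apply: ne.
  have nX : \forall t \near (0 : R), X (delta t).
    by apply/nbhs_ballP; exists 1 => //= u _; exact: dX.
  by have := h delta sm d0 nX.
move=> gamma sm g0 gX; rewrite derive1E.
have d0 : derivable (fun u => gamma u 0 0) 0 1 by exact: (sm 0 0%N 0).
have d1 : derivable (fun u => gamma u 0 (inord 1)) 0 1 by exact: (sm (inord 1) 0%N 0).
apply: (@critX_flat z (fun u => gamma u 0 0) (fun u => gamma u 0 (inord 1)) _ _ cz).
- exact: derivableP d0.
- exact: derivableP d1.
- by rewrite g0.
- by rewrite g0.
- by apply: filterS gX => u /(zero_setP c12)[].
Qed.

End CriticalZeroSet.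

(** * Critical points of the punctured sphere *)

Section CriticalSphere.
Variables (R : realType) (m : nat) (c1 c2 : R -> R) (a1 a2 : R).
Hypotheses (m1 : (1 < m)%N) (c12 : forall x, c1 x < c2 x).
Hypotheses (an1 : real_analytic c1) (an2 : real_analytic c2).
Local Notation X := (@zero_set R m c1 c2).
Local Notation x1 := (@coord1 R m).
Local Notation x2 := (@coord2 R m).
Local Notation Sm := (@sphere R m).
Local Notation Pm := (@punctured_sphere R m).
Local Notation pp := (pole_plus R m).
Local Notation pm := (pole_minus R m).
Variables phi psi : 'rV[R]_m.+1 -> 'rV[R]_m.+1.
Hypotheses (phX : forall z, Pm z -> X (phi z)) (psP : forall y, X y -> Pm (psi y)).
Hypotheses (phK : forall z, Pm z -> psi (phi z) = z) (psK : forall y, X y -> phi (psi y) = y).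
Hypotheses (phs : smooth_on Pm phi) (pss : smooth_on X psi).
Local Notation F := (compactified a1 a2 phi).
Implicit Types (z w : 'rV[R]_m.+1) (u t x : R).

Let curve_cont (gamma : R -> 'rV[R]_m.+1) :
  (forall j, derivable (fun u => gamma u 0 j) 0 1) -> gamma @ (0 : R) --> gamma 0.
Proof.
move=> d; apply: (row_cvg (nbhs_filter (0 : R))) => j.
exact/differentiable_continuous/derivable1_diffP.
Qed.

(** [critX_flat] asks only for derivatives at 0, so the first-order chain rule, applied to a local
    extension of [phi], is enough to transport a curve. *)
Lemma critical_sphere_from w : Pm w -> critX c1 c2 (phi w) -> critical_points Pm F w.
Proof.
move=> Pw cw; split=> // gamma sm g0 gP.
have [U [H [oU Uw CH HE]]] := phs Pw.
have dg j : derivable (fun u => gamma u 0 j) 0 1 by exact: (sm j 0%N 0).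
have Ug : U (gamma 0) by rewrite g0.
have dH j := C1_chain oU Ug (CH j 1%N) dg.
have nU : \forall u \near (0 : R), U (gamma u).
  by apply: (curve_cont dg); apply: open_nbhs_nbhs.
have FF : Filter (nbhs (0 : R)) by exact: nbhs_filter.
have nE : \forall u \near (0 : R), phi (gamma u) = H (gamma u) /\ Pm (gamma u).
  by apply: filterS2 gP nU => u Pu Uu; split=> //; exact: HE.
have nF : \forall u \near (0 : R), (fun u => H (gamma u) 0 0) u = (F \o gamma) u.
  by apply: filterS nE => u [E Pu]; rewrite /= compactifiedE// /coord1 E.
have E0 : H w = phi w by rewrite HE.
have flat := critX_flat an1 an2 cw (dH 0) (dH (inord 1)).
have d0 := near_eq_is_derive nF (dH 0).
rewrite derive1E; have [_ ->] := d0; apply: flat.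
- by rewrite /= g0 E0.
- by rewrite /= g0 E0.
- by apply: filterS nE => u [E Pu]; have [d _] := (zero_setP c12 _).1 (phX Pu);
    rewrite /= -E.
Qed.

Let dot z w : R := \sum_j z 0 j * w 0 j.

(* A great circle with the direction of the velocity of [psi \o delta] at [0]
   replaces this curve, whose higher derivatives are thus not needed. *)
Lemma critical_sphere_to w : critical_points Pm F w -> critX c1 c2 (phi w).
Proof.
move=> [Pw hcrit]; apply: contrapT => nc.
have Xw := phX Pw.
have [delta [smd d0 dX dne]] := noncrit_curve m1 c12 an1 an2 Xw nc.
have [U [H [oU Uw CH HE]]] := phs Pw.
have [U' [H' [oU' Uw' CH' HE']]] := pss Xw.
have FF : Filter (nbhs (0 : R)) by exact: nbhs_filter.
have dd j : derivable (fun u => delta u 0 j) 0 1 by exact: (smd j 0%N 0).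
have Ud : U' (delta 0) by rewrite d0.
pose sigma u := H' (delta u).
have s0 : sigma 0 = w by rewrite /sigma d0 -HE'// phK.
have ds j := C1_chain oU' Ud (CH' j 1%N) dd.
have [v dsv] : exists v : 'rV[R]_m.+1, forall j,
    is_derive (0 : R) 1 (fun u => sigma u 0 j) (v 0 j).
  exists (\row_j (\sum_i 'D_(delta_mx 0 i) (fun z => H' z 0 j) (delta 0) *
  derive1 (fun u => delta u 0 i) 0)) => j.
  by rewrite mxE; exact: ds.
have nU' : \forall u \near (0 : R), U' (delta u).
  by apply: (curve_cont dd); apply: open_nbhs_nbhs.
have nS : \forall u \near (0 : R), sigma u = psi (delta u).
  by apply: filterS nU' => u Uu; rewrite /sigma HE'.
have dsd j : derivable (fun u => sigma u 0 j) 0 1 by have [] := dsv j.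
have Us : U (sigma 0) by rewrite s0.
have nU : \forall u \near (0 : R), U (sigma u).
  by apply: (curve_cont dsd); apply: open_nbhs_nbhs.
pose G z := H z 0 0; pose L (e : 'rV[R]_m.+1) := \sum_j 'D_(delta_mx 0 j) G w * e 0 j.
have chain (gamma : R -> 'rV[R]_m.+1) (e : 'rV[R]_m.+1) : gamma 0 = w ->
    (forall j, is_derive (0 : R) 1 (fun u => gamma u 0 j) (e 0 j)) ->
    is_derive (0 : R) 1 (G \o gamma) (L e).
  move=> g0 dg; have Ug : U (gamma 0) by rewrite g0.
  have := C1_chain oU Ug (CH 0 1%N) (fun j => @ex_derive _ _ _ _ _ _ _ (dg j)).
  rewrite g0; move=> h; apply: (is_derive_eq h); apply: eq_bigr => j _.
  by rewrite derive1E; have [_ ->] := dg j.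
have Lv : L v = derive1 (fun u => x1 (delta u)) 0.
  have nG : \forall u \near (0 : R), (G \o sigma) u = (fun u => x1 (delta u)) u.
    apply: filterS2 nS nU => u su Uu /=.
    by rewrite /G -HE// su ?psK//; exact: psP.
  have [_] := near_eq_is_derive nG (chain sigma v s0 dsv).
  by rewrite derive1E => ->.
have Lv0 : L v <> 0 by rewrite Lv.
have sw : dot w w = 1.
  by have := Pw.1; rewrite /sphere/= => <-; apply: eq_bigr => j _; rewrite expr2.
have vw : dot w v = 0.
  have dq : is_derive (0 : R) 1 (fun u => dot (sigma u) (sigma u)) (\sum_j (2 * w 0 j * v 0 j)).
    have h j : is_derive (0 : R) 1 (fun u => sigma u 0 j * sigma u 0 j) (2 * w 0 j * v 0 j).
      have := @is_deriveM R R (fun u => sigma u 0 j) (fun u => sigma u 0 j) 0 1 _ _ (dsv j) (dsv j).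
      by move=> k; apply: (is_derive_eq k); rewrite s0 /GRing.scale/=; ring.
    have := @is_derive_sum R R R m.+1 (fun j u => sigma u 0 j * sigma u 0 j) 0 1
      (fun j => 2 * w 0 j * v 0 j) h.
    by congr is_derive; apply/funext => u; rewrite fct_sumE.
  have n1 : \forall u \near (0 : R), (fun u => dot (sigma u) (sigma u)) u = (fun=> 1) u.
    apply: filterS nS => u /= ->; have := (psP (dX u)).1; rewrite /sphere/= => <-.
    by apply: eq_bigr => j _; rewrite expr2.
  have [_ E1] := near_eq_is_derive n1 dq.
  have E2 : \sum_j (2 * w 0 j * v 0 j) = 0 by rewrite -E1 derive_cst.
  have E3 : \sum_j (2 * w 0 j * v 0 j) = 2 * dot w v.
    by rewrite /dot mulr_sumr; apply: eq_bigr => j _; rewrite mulrA.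
  by move: E2; rewrite E3 => /eqP; rewrite mulf_eq0 pnatr_eq0/= => /eqP.
(* The great circle is run at unit speed; its velocity is [v] divided by [r], which does not affect
   whether [L] vanishes on it. *)
pose r := Num.sqrt (dot v v).
have vv0 : 0 < dot v v.
  have vge : 0 <= dot v v by apply: sumr_ge0 => j _; rewrite -expr2 sqr_ge0.
  rewrite lt_neqAle vge andbT eq_sym; apply/eqP => v0; apply: Lv0.
  apply: big1 => j _; suff -> : v 0 j = 0 by rewrite mulr0.
  move/eqP: v0; rewrite psumr_eq0; last by move=> i _; rewrite -expr2 sqr_ge0.
  by move=> /allP/(_ j (mem_index_enum _)); rewrite /= mulf_eq0 orbb => /eqP.
have r0 : 0 < r by rewrite sqrtr_gt0.
have rr : r ^+ 2 = dot v v by rewrite sqr_sqrtr// ltW.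
pose gamma u : 'rV[R]_m.+1 := \row_j (0 + w 0 j * cos u + (v 0 j / r) * sin u).
have gE j : (fun u => gamma u 0 j) = (fun u => 0 + w 0 j * cos u + (v 0 j / r) * sin u).
  by apply/funext => u; rewrite mxE.
have smg : smooth_curve gamma by move=> j; rewrite gE; exact: smooth1_trig.
have g0 : gamma 0 = w by apply/rowP => j; rewrite mxE cos0 sin0; ring.
have dgj j : is_derive (0 : R) 1 (fun u => gamma u 0 j) ((r^-1 *: v) 0 j).
  rewrite gE; apply: (is_derive_eq (is_derive_trig _ _ _ 0)).
  by rewrite /= cos0 sin0 mxE; ring.
have gS u : Sm (gamma u).
  rewrite /sphere/=; transitivity (cos u ^+ 2 * dot w w +
      2 * (cos u * sin u / r) * dot w v + (sin u / r) ^+ 2 * dot v v).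
    rewrite /dot !mulr_sumr -!big_split/=; apply: eq_bigr => j _; rewrite mxE; ring.
  rewrite sw vw -rr mulr0 addr0 mulr1.
  rewrite -[RHS](cos2Dsin2 u); congr (_ + _).
  by field; exact: lt0r_neq0.
have cg : gamma @ (0 : R) --> gamma 0.
  by apply: curve_cont => j; have [] := dgj j.
have avoid p : w <> p -> \forall u \near (0 : R), gamma u <> p.
  move=> wp; apply: (cg (~` [set p])); rewrite g0; apply: open_nbhs_nbhs; split=> //.
  have hV : hausdorff_space 'rV[R]_m.+1 by exact: norm_hausdorff.
  by apply: closed_openC; exact: (accessible_closed_set1 (hausdorff_accessible hV)).
have nP : \forall u \near (0 : R), Pm (gamma u).
  have h1 := avoid pp (fun E => Pw.2 (or_introl E)).
  have h2 := avoid pm (fun E => Pw.2 (or_intror E)).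
  by apply: filterS2 h1 h2 => u n1 n2; split=> // -[].
have nUg : \forall u \near (0 : R), U (gamma u).
  by apply: cg; rewrite g0; apply: open_nbhs_nbhs.
have nF : \forall u \near (0 : R), (G \o gamma) u = (F \o gamma) u.
  by apply: filterS2 nP nUg => u Pu Uu; rewrite /= compactifiedE// /G -HE.
have [_ E1] := near_eq_is_derive nF (chain gamma _ g0 dgj).
have := hcrit gamma smg g0 nP; rewrite derive1E E1.
have -> : L (r^-1 *: v) = r^-1 * L v.
  by rewrite /L mulr_sumr; apply: eq_bigr => j _; rewrite mxE mulrCA.
by move/eqP; rewrite mulf_eq0 invr_eq0 (gt_eqF r0)/= => /eqP.
Qed.

End CriticalSphere.

Section Vertices.
Variables (R : realType) (m : nat) (c1 c2 : R -> R).
Hypotheses (m1 : (1 < m)%N) (c12 : forall x, c1 x < c2 x).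
Hypotheses (an1 : real_analytic c1) (an2 : real_analytic c2).
Local Notation X := (@zero_set R m c1 c2).
Local Notation x1 := (@coord1 R m).
Local Notation x2 := (@coord2 R m).
Local Notation Sm := (@sphere R m).
Local Notation Pm := (@punctured_sphere R m).
Local Notation pp := (pole_plus R m).
Local Notation pm := (pole_minus R m).

Let cc1 : continuous c1 := tame_continuous (real_analytic_tame an1).
Let cc2 : continuous c2 := tame_continuous (real_analytic_tame an2).

Let dom_bd y c : c = c1 \/ c = c2 -> dom c1 c2 (c y) y.
Proof. by rewrite /dom => -[] ->; rewrite lexx ?andbT ltW. Qed.

Lemma vertices_zero_set :
  @reeb_image R m X x1 (critical_points X x1) = crit_points c1 c2 (reebX m1 c12).
Proof.
have down (z : subsp X) c : c = c1 \/ c = c2 -> x1 (\val z) = c (x2 (\val z)) ->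
    reeb_map (@restr R m X x1) z = reebX m1 c12 (c (x2 (\val z))) (x2 (\val z)).
  move=> hc zc; have [v [_ zE]] := pX_surj m1 c12 z.
  have fz : restr x1 z = c (x2 (\val z)) by [].
  rewrite fz in zE; rewrite {1}zE /reebX /reeb_strip (pX_collapse m1 c12 v (v0 R m1))//.
  by case: hc => ->; [left|right].
have up y c : c = c1 \/ c = c2 -> derive1 c y = 0 ->
    @reeb_image R m X x1 (critical_points X x1) (reebX m1 c12 (c y) y).
  move=> hc dc; exists (pointX m1 c12 (c y) y (v0 R m1)) => //.
  rewrite /= ; apply/(critical_zero_set m1 c12 an1 an2); split; first exact: set_valP.
  rewrite pointXE; last exact: dom_bd.
  by rewrite /critX point1 point2//; case: hc dc => ->; [left|right].
apply/seteqP; split=> [_ [z /(critical_zero_set m1 c12 an1 an2)[_ cz] <-]|g [y]].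
  exists (x2 (\val z)); case: cz => -[zc dc]; [left|right]; split=> //.
    by apply: (down z c1) => //; left.
  by apply: (down z c2) => //; right.
by move=> [[dc ->]|[dc ->]]; apply: up => //; [left|right].
Qed.

Variables (a1 a2 xm xp : R).
Hypotheses (c1m : c1 x @[x --> -oo] --> a1) (c2m : c2 x @[x --> -oo] --> a1).
Hypotheses (c1p : c1 x @[x --> +oo] --> a2) (c2p : c2 x @[x --> +oo] --> a2).
Hypotheses (dm : forall x, x <= xm -> dom c1 c2 a1 x)
           (dp : forall x, xp <= x -> dom c1 c2 a2 x).
Variables phi psi : 'rV[R]_m.+1 -> 'rV[R]_m.+1.
Hypotheses (phX : forall z, Pm z -> X (phi z)) (psP : forall y, X y -> Pm (psi y)).
Hypotheses (phK : forall z, Pm z -> psi (phi z) = z) (psK : forall y, X y -> phi (psi y) = y).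
Hypotheses (phs : smooth_on Pm phi) (pss : smooth_on X psi).
Hypothesis hm : x2 (phi z) @[z --> within Pm (nbhs pm)] --> -oo.
Hypothesis hp : x2 (phi z) @[z --> within Pm (nbhs pp)] --> +oo.
Local Notation F := (compactified a1 a2 phi).
Local Notation Q' := (reebS a1 a2 m1 phi psP).

Let phc z : Pm z -> phi @ within Pm (nbhs z) --> phi z.
Proof. exact: smooth_on_continuous. Qed.

Let psc y : X y -> psi @ within X (nbhs y) --> psi y.
Proof. exact: smooth_on_continuous. Qed.

Lemma vertices_sphere :
  @reeb_image R m Sm F (critical_points Pm F) `|` @reeb_image R m Sm F [set pp; pm] =
  crit_points c1 c2 Q' `|` [set Q' a1 xm; Q' a2 xp].
Proof.
have qm := pole_reeb_minus m1 c12 cc1 cc2 c1m c2m c1p c2p dm phX psP psK phc psc hm hp.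
have qp := pole_reeb_plus m1 c12 cc1 cc2 c1m c2m c1p c2p dp phX psP psK phc psc hm hp.
congr (_ `|` _); last first.
  rewrite -qm -qp; apply/seteqP; split=> [_ [z zp <-]|g [->|->]].
  - by case: zp => zp; [right|left]; congr reeb_map; exact: val_inj.
  - by exists (SigSub (mem_set (@pole_minus_sphere R m))) => //; right.
  - by exists (SigSub (mem_set (@pole_plus_sphere R m))) => //; left.
have down (z : subsp Sm) c : c = c1 \/ c = c2 -> Pm (set_val z) ->
    x1 (phi (set_val z)) = c (x2 (phi (set_val z))) ->
    reeb_map (@restr R m Sm F) z = Q' (c (x2 (phi (set_val z)))) (x2 (phi (set_val z))).
  move=> hc Pz zc; have [v [_ zE]] := pS_surj a1 a2 m1 c12 phX psP phK Pz.
  have fz : restr F z = c (x2 (phi (set_val z))) by rewrite /restr compactifiedE.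
  rewrite fz in zE; rewrite {1}zE /reebS /reeb_strip (pS_collapse m1 c12 psP v (v0 R m1))//.
  by case: hc => ->; [left|right].
have up y c : c = c1 \/ c = c2 -> derive1 c y = 0 ->
    @reeb_image R m Sm F (critical_points Pm F) (Q' (c y) y).
  move=> hc dc; exists (pS psP (c y) y (v0 R m1)) => //.
  have [Pz E] := phi_pS m1 c12 psP psK (v0 R m1) (dom_bd y hc).
  apply: (critical_sphere_from a1 a2 c12 an1 an2 phX phs Pz).
  by rewrite E /critX point1 point2//; case: hc dc => ->; [left|right].
apply/seteqP; split=> [_ [z hz <-]|g [y]].
  have Pz : Pm (set_val z) by case: hz.
  have cz := critical_sphere_to m1 c12 an1 an2 phX psP phK psK phs pss hz.
  exists (x2 (phi (set_val z))); case: cz => -[zc dc]; [left|right]; split=> //.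
    by apply: (down z c1) => //; left.
  by apply: (down z c2) => //; right.
by move=> [[dc ->]|[dc ->]]; apply: up => //; [left|right].
Qed.

End Vertices.

Theorem theorem4 (R : realType) (m : nat) (c1 c2 : R -> R) (a1 a2 : R)
    (phi : 'rV[R]_m.+1 -> 'rV[R]_m.+1) :
  (1 < m)%N ->
  real_analytic c1 -> real_analytic c2 -> (forall x, c1 x < c2 x) ->
  SAB_at_infinity_in_top c1 c2 ->
  c1 x @[x --> -oo] --> a1 -> c2 x @[x --> -oo] --> a1 ->
  c1 x @[x --> +oo] --> a2 -> c2 x @[x --> +oo] --> a2 ->
  compactifying_diffeo c1 c2 phi ->
  (exists K : diagram,
     diagram_iso (GDNF_pi m c1 c2) K /\
     (shape_ray K \/ shape_depart K \/ shape_enter K \/ shape_through K)) ->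
  diagram_iso (GDNF_f a1 a2 phi) (GDNF_pi m c1 c2).
Proof.
move=> m1 an1 an2 c12 _ c1m c2m c1p c2p [[phs [phX [psi [pss psP phK psK]]]] hm hp].
have [tc1 tc2] := (real_analytic_tame an1, real_analytic_tame an2).
have cc1 := tame_continuous tc1; have cc2 := tame_continuous tc2.
move=> [K [iso /shape_cases sh]].
move: iso; rewrite /GDNF_pi /GDNF_f (vertices_zero_set m1 c12 an1 an2) => iso.
have all_good t : good c1 c2 t.
  apply: contrapT => /forallNP bad.
  have bad' x : c1 x < t < c2 x by have /negP := bad x; rewrite negbK.
  exact: (no_bad_level cc1 cc2 tc1 tc2 c1m c2m c1p c2p bad' iso sh).
have st := reebX_strip m1 c12 cc1 cc2.
have hG : hausdorff_space (reeb_space (@restr R m (@zero_set R m c1 c2) (@coord1 R m))).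
  by move=> g h; apply: (reebX_hausdorff m1 c12 cc1 cc2).
have bo (V : set _) : band_open c1 c2 (fun t x => V (reebX m1 c12 t x)) -> open V.
  by apply: (reebX_open cc1 cc2) => g _.
have [xm [xp [dm dp NFS trunk]]] :=
  ends_from_shapes tc1 tc2 c12 c1m c2m c1p c2p all_good st hG bo iso sh.
have phc z : punctured_sphere z ->
    phi @ within (@punctured_sphere R m) (nbhs z) --> phi z.
  exact: smooth_on_continuous.
have psc y : @zero_set R m c1 c2 y -> psi @ within (@zero_set R m c1 c2) (nbhs y) --> psi y.
  exact: smooth_on_continuous.
rewrite (vertices_sphere m1 c12 an1 an2 c1m c2m c1p c2p dm dp phX psP phK psK phs pss hm hp).
apply: (key_iso tc1 tc2 c12 c1m c2m c1p c2p all_good dm dp st hG bo) => //.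
- exact: (reebS_strip m1 c12 cc1 cc2 c1m c2m c1p c2p dm dp phX psP phK psK phc psc hm hp).
- exact: (reebS_hausdorff m1 c12 cc1 cc2 c1m c2m c1p c2p all_good dm dp phX psP phK psK phc psc hm hp).
- exact: (reebS_open c12 cc1 cc2 c1m c2m c1p c2p all_good dm dp phX phK psK phc psc hm hp).
- exact: (reebS_minus c12 cc1 cc2 c1m c2m c1p c2p dm phX psK phc psc hm hp).
- exact: (reebS_plus c12 cc1 cc2 c1m c2m c1p c2p dp phX psK phc psc hm hp).
Qed.
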